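(* Let $X$ be a normal domain of finite type over a field $k$ of characteristic zero and suppose that its tangent sheaf $\mathscr{T}_{X/k}$ is locally free. Then, if $X$ has at worst terminal singularities, $X$ is regular.
   Context: ''Normal domain of finite type over $k$'' means an integral normal scheme of finite type over $k$. $\mathscr{T}_{X/k}$ is the sheaf of $k$-derivations of $\mathscr{O}_X$. Terminal singularities are in the usual sense of the Minimal Model Program: $K_X$ is $\mathbb{Q}$-Cartier (automatic here, since $\mathscr{T}_{X/k}$ is locally free) and, for every proper birational morphism $\pi:\tilde X\to X$ with $\tilde X$ normal, every $\pi$-exceptional prime divisor has positive coefficient (discrepancy) in $K_{\tilde X}-\pi^*K_X$. *)

(* Defs.v *)
From HB Require Import structures.
From mathcomp Require Import all_boot all_order all_algebra.
From mathcomp Require Import boolp classical_sets functions topology.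
Set Implicit Arguments.
Unset Strict Implicit.
Unset Printing Implicit Defensive.
Import Order.TTheory GRing.Theory Num.Theory.
Local Open Scope classical_set_scope.
Local Open Scope ring_scope.

Definition prime_ideal (R : comPzRingType) (P : set R) : Prop :=
  [/\ P 0 /\ (forall a b, P a -> P b -> P (a + b)),
      forall a b, P b -> P (a * b),
      ~ P 1
    & forall a b, P (a * b) -> P a \/ P b].

Definition prime_chain (R : comPzRingType) (n : nat) : Prop :=
  exists P : nat -> set R,
    (forall i, (i <= n)%N -> prime_ideal (P i)) /\
    (forall i, (i < n)%N -> P i `<` P i.+1).

Definition krull_dim (R : comPzRingType) (n : nat) : Prop :=
  prime_chain R n /\ ~ prime_chain R n.+1.

Definition ideal_gen (R : comPzRingType) (n : nat) (a : 'I_n -> R) : set R :=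
  [set z | exists c : 'I_n -> R, z = \sum_i c i * a i].

Definition noetherian (R : comPzRingType) : Prop :=
  forall I : set R,
    I 0 -> (forall a b, I a -> I b -> I (a + b)) ->
    (forall a b, I b -> I (a * b)) ->
    exists n (a : 'I_n -> R), I = ideal_gen a.

(* The maximal ideal, when [R] is local. *)
Definition nonunits (R : comUnitRingType) : set R :=
  [set a | a \isn't a GRing.unit].
Arguments nonunits : clear implicits.

(* To be used for a ring [R] that is known to be local. *)
Definition regular_local (R : comUnitRingType) : Prop :=
  noetherian R /\
  exists n, krull_dim R n /\ exists a : 'I_n -> R, nonunits R = ideal_gen a.

Definition is_fraction_field (R : comUnitRingType) (K : fieldType)
    (i : {rmorphism R -> K}) : Prop :=
  injective i /\ forall z, exists a b, i b != 0 /\ z = i a / i b.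

Definition integrally_closed_domain (R : comUnitRingType) : Prop :=
  exists (K : fieldType) (i : {rmorphism R -> K}),
    is_fraction_field i /\ forall z, integralOver i z -> range i z.

Definition finitely_generated_algebra (A B : comPzRingType)
    (h : {rmorphism A -> B}) : Prop :=
  exists d (b : 'I_d -> B), forall S : set B,
    range h `<=` S -> (forall i, S (b i)) ->
    (forall x y, S x -> S y -> S (x - y)) ->
    (forall x y, S x -> S y -> S (x * y)) ->
    S = setT.

Definition is_derivation (k R : pzRingType) (c : {rmorphism k -> R})
    (M : lmodType R) (D : R -> M) : Prop :=
  [/\ forall a b, D (a + b) = D a + D b,
      forall a b, D (a * b) = a *: D b + b *: D a
    & forall z, D (c z) = 0].

Definition is_self_derivation (k R : pzRingType) (c : {rmorphism k -> R})
    (D : R -> R) : Prop :=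
  @is_derivation k R c R^o D.

(* The differentials of the [f i] form a basis of the [R]-module
   Omega_{R/k}; since Hom_R (Omega_{R/k}, M) = Der_k (R, M), this says that
   a derivation into any [M] can be prescribed freely on the [f i]. *)
Definition differential_basis (k R : pzRingType) (c : {rmorphism k -> R})
    (n : nat) (f : 'I_n -> R) : Prop :=
  forall (M : lmodType R) (m : 'I_n -> M),
    exists! D : R -> M, is_derivation c D /\ forall i, D (f i) = m i.

(* A sheaf of rings is represented by its stalks: a section over [U] is a
   family of germs, and [reg U s] says that the restriction to [U] of the
   (total) family [s] is a section of the structure sheaf.  Every sheaf is of
   this form, U |-> O(U) being embedded in the product of the stalks over U.
   Values of [s] outside [U] are irrelevant, by [reg_glue], and [reg U] is only
   meaningful for open [U]. *)
Record lrspace := LRSpace {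
  points :> topologicalType;
  stalk : points -> comUnitRingType;
  reg : set points -> (forall x, stalk x) -> Prop;
  reg_sub : forall U V s, open U -> open V -> V `<=` U -> reg U s -> reg V s;
  reg_glue : forall U s, open U ->
    (forall x, U x -> exists V t, [/\ open V, V x, reg V t
       & forall y, (U `&` V) y -> s y = t y]) ->
    reg U s;
  reg1 : forall U, open U -> reg U (fun=> 1);
  regB : forall U s t, open U -> reg U s -> reg U t ->
    reg U (fun x => s x - t x);
  regM : forall U s t, open U -> reg U s -> reg U t ->
    reg U (fun x => s x * t x);
  germ_surj : forall x (a : stalk x),
    exists U s, [/\ open U, U x, reg U s & s x = a];
  germ_inj : forall U s t x, open U -> U x -> reg U s -> reg U t ->
    s x = t x -> exists V, [/\ open V, V x & forall y, V y -> s y = t y];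
  stalk_local : forall x (a b : stalk x),
    a \isn't a GRing.unit -> b \isn't a GRing.unit ->
    a + b \isn't a GRing.unit }.

Record lrhom (X Y : lrspace) := LRHom {
  fn :> X -> Y;
  pull : forall x, {rmorphism stalk (fn x) -> stalk x};
  hom_continuous : continuous fn;
  hom_reg : forall U s, open U -> reg U s ->
    reg (fn @^-1` U) (fun x => pull x (s (fn x)));
  hom_local : forall x a, pull x a \is a GRing.unit -> a \is a GRing.unit }.

Definition hom_id (X : lrspace) : lrhom X X.
Proof.
refine (@LRHom X X id (fun x => idfun) _ _ _).
- by move=> x; exact: cvg_id.
- by [].
- by [].
Defined.

Definition hom_comp (X Y Z : lrspace) (g : lrhom Y Z) (f : lrhom X Y) : lrhom X Z.
Proof.
refine (@LRHom X Z (g \o f) (fun x => pull f x \o pull g (f x)) _ _ _).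
- by move=> x; apply: continuous_comp; exact: hom_continuous.
- move=> U s oU rs.
  apply: (@hom_reg _ _ f (g @^-1` U) (fun y => pull g y (s (g y)))).
    by apply: open_comp => // y _; exact: hom_continuous.
  exact: hom_reg.
- by move=> x a /= /hom_local /hom_local.
Defined.

Definition spec_field (k : fieldType) : lrspace.
Proof.
refine (@LRSpace (discrete_topology unit) (fun=> k) (fun _ _ => True)
          _ _ _ _ _ _ _ _) => //.
- by move=> [] a; exists setT, (fun=> a); split => //; exact: openT.
- by move=> U s t [] oU Ux _ _ e; exists U; split => // -[].
- by move=> _ a b; rewrite !unitfE !negbK => /eqP-> /eqP->; rewrite addr0.
Defined.

Definition is_rmorphism (A B : pzRingType) (h : A -> B) : Prop :=
  (forall a b, h (a - b) = h a - h b) /\ monoid_morphism h.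

(* [phi] identifies the open subspace [U] with Spec [A]: the points of [U]
   are the primes of [A], the sets where some [a] does not vanish are a base
   of open sets, the stalks are the localizations of [A] and the sections are
   the functions that are locally fractions.  [phi a] is the global section
   attached to [a]; its values outside [U] are irrelevant. *)
Record affine_chart (X : lrspace) (U : set X) (A : comPzRingType)
    (phi : A -> forall x : X, stalk x) : Prop := AffineChart {
  chart_open : open U;
  chart_rmorphism : forall x, U x -> is_rmorphism (phi^~ x);
  chart_prime : forall P : set A, prime_ideal P ->
    exists! x, U x /\ P = [set a | phi a x \isn't a GRing.unit];
  chart_topology : forall W : set X, W `<=` U ->
    (open W <-> forall x, W x -> exists a, phi a x \is a GRing.unit /\
       forall y, U y -> phi a y \is a GRing.unit -> W y);
  chart_fraction : forall x, U x -> forall b : stalk x,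
    exists a s, phi s x \is a GRing.unit /\ b = phi a x / phi s x;
  chart_kernel : forall x, U x -> forall a, phi a x = 0 ->
    exists s, phi s x \is a GRing.unit /\ s * a = 0;
  chart_reg : forall W s, open W -> W `<=` U ->
    (reg W s <-> forall x, W x -> exists V a b, [/\ open V, V x, V `<=` W
       & forall y, V y -> phi b y \is a GRing.unit /\
                          s y = phi a y / phi b y]) }.

Definition scheme (X : lrspace) : Prop :=
  forall x : X, exists (U : set X) (A : comPzRingType)
    (phi : A -> forall y : X, stalk y), U x /\ affine_chart U phi.

Definition integral_scheme (X : lrspace) : Prop :=
  (exists x : X, True) /\
  forall (U : set X) s t, open U -> U !=set0 -> reg U s -> reg U t ->
    (forall x, U x -> s x * t x = 0) ->
    (forall x, U x -> s x = 0) \/ (forall x, U x -> t x = 0).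

Definition normal_scheme (X : lrspace) : Prop :=
  forall x : X, integrally_closed_domain (stalk x).

Definition regular_scheme (X : lrspace) : Prop :=
  forall x : X, regular_local (stalk x).

Definition finite_type (X Y : lrspace) (f : lrhom X Y) : Prop :=
  forall y : Y, exists (V : set Y) (A : comPzRingType)
      (phi : A -> forall z : Y, stalk z),
    [/\ V y, affine_chart V phi
      & exists m (U : 'I_m -> set X), f @^-1` V = \bigcup_i U i /\
        forall i, exists (B : comPzRingType)
            (psi : B -> forall x : X, stalk x) (h : {rmorphism A -> B}),
          [/\ affine_chart (U i) psi,
              forall a x, U i x -> psi (h a) x = pull f x (phi a (f x))
            & finitely_generated_algebra h]].

Definition is_pullback (X Y S P : lrspace) (f : lrhom X S) (g : lrhom Y S)
    (p : lrhom P X) (q : lrhom P Y) : Prop :=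
  [/\ scheme P, hom_comp f p = hom_comp g q
    & forall (Z : lrspace) (a : lrhom Z X) (b : lrhom Z Y), scheme Z ->
        hom_comp f a = hom_comp g b ->
        exists! h : lrhom Z P, hom_comp p h = a /\ hom_comp q h = b].

Definition closed_immersion (X Y : lrspace) (f : lrhom X Y) : Prop :=
  [/\ closed (range f), injective f,
      forall U : set X, open U -> exists2 V, open V & U = f @^-1` V
    & forall x (b : stalk x), range (pull f x) b].

Definition separated (X Y : lrspace) (f : lrhom X Y) : Prop :=
  forall (P : lrspace) (p q : lrhom P X) (d : lrhom X P),
    is_pullback f f p q -> hom_comp p d = hom_id X ->
    hom_comp q d = hom_id X -> closed_immersion d.

Definition universally_closed (X Y : lrspace) (f : lrhom X Y) : Prop :=
  forall (Y' P : lrspace) (g : lrhom Y' Y) (p : lrhom P X) (q : lrhom P Y'),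
    scheme Y' -> is_pullback f g p q ->
    forall C : set P, closed C -> closed (q @` C).

Definition proper_morphism (X Y : lrspace) (f : lrhom X Y) : Prop :=
  [/\ separated f, finite_type f & universally_closed f].

(* [f] restricts to an isomorphism between dense open subspaces. *)
Definition birational (X Y : lrspace) (f : lrhom X Y) : Prop :=
  exists (U : set X) (V : set Y),
    [/\ open U /\ dense U, open V /\ dense V, set_bij U V f,
        forall W, open W -> W `<=` U -> open (f @` W)
      & forall x, U x -> bijective (pull f x)].

(* [D] restricts over [U] to a [k]-derivation of sheaves O_U -> O_U. *)
Definition tangent_section (k : fieldType) (X : lrspace)
    (s : lrhom X (spec_field k)) (U : set X)
    (D : forall x : X, stalk x -> stalk x) : Prop :=
  (forall x, U x -> is_self_derivation (pull s x) (D x)) /\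
  (forall V f, open V -> V `<=` U -> reg V f -> reg V (fun x => D x (f x))).

Definition tangent_locally_free (k : fieldType) (X : lrspace)
    (s : lrhom X (spec_field k)) : Prop :=
  forall x : X, exists (U : set X) (n : nat)
      (D : 'I_n -> forall y : X, stalk y -> stalk y),
    [/\ open U, U x, forall i, tangent_section s U (D i)
      & forall V, open V -> V `<=` U ->
        (forall E, tangent_section s V E ->
           exists a : 'I_n -> forall y : X, stalk y,
             (forall i, reg V (a i)) /\
             forall y, V y -> forall z, E y z = \sum_i a i y * D i y z) /\
        (forall a : 'I_n -> forall y : X, stalk y,
           (forall i, reg V (a i)) ->
           (forall y, V y -> forall z, \sum_i a i y * D i y z = 0) ->
           forall i y, V y -> a i y = 0)].

(* [K] with the maps [g x] is the function field of the integral scheme [X]: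
   the common fraction field of the stalks, [g x] being the passage from the
   germ at [x] to the germ at the generic point. *)
Definition is_function_field (X : lrspace) (K : fieldType)
    (g : forall x : X, {rmorphism stalk x -> K}) : Prop :=
  (forall x, is_fraction_field (g x)) /\
  forall U s x y, open U -> reg U s -> U x -> U y -> g x (s x) = g y (s y).

(* Prime divisors correspond to their generic points. *)
Definition codim1 (X : lrspace) (e : X) : Prop := krull_dim (stalk e) 1.

(* The valuation of [phi] at a point [e] of codimension 1 of a normal scheme,
   where the local ring is a discrete valuation ring, is [m]. *)
Definition ord_at (X : lrspace) (K : fieldType)
    (g : forall x : X, {rmorphism stalk x -> K}) (e : X) (phi : K) (m : int)
    : Prop :=
  exists t u : stalk e, [/\ nonunits (stalk e) = [set z | exists c, z = c * t],
    u \is a GRing.unit & phi = g e u * g e t ^ m].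

(* Rational n-forms of [K] over [k] are represented as functions of
   [n] derivations of [K]; this is the form df_1 /\ ... /\ df_n. *)
Definition wedge (K : fieldType) (n : nat) (f : 'I_n -> K)
    (D : 'I_n -> K -> K) : K :=
  \det (\matrix_(i, j) D i (f j)).

(* [w] = h dx_1 /\ ... /\ dx_n *)
Definition form_eq (k K : fieldType) (c : {rmorphism k -> K}) (n : nat)
    (w : ('I_n -> K -> K) -> K) (h : K) (x : 'I_n -> K) : Prop :=
  forall D, (forall i, is_self_derivation c (D i)) -> w D = h * wedge x D.

(* [w] is a nonzero rational form of top degree. *)
Definition rational_top_form (k K : fieldType) (c : {rmorphism k -> K})
    (n : nat) (w : ('I_n -> K -> K) -> K) : Prop :=
  exists h x, [/\ h != 0, differential_basis c x & form_eq c w h x].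

Section Divisors.
Variables (k : fieldType) (K : fieldType) (c : {rmorphism k -> K}).
Variables (n : nat) (w : ('I_n -> K -> K) -> K).

(* The canonical divisor K_X = div(w) has coefficient [m] at [e]: comparison of
   [w] with a generator of the top exterior power of Omega at [e], which is free
   of rank n because char k = 0 and the local ring at [e] is regular. *)
Definition ord_form (X : lrspace) (s : lrhom X (spec_field k))
    (g : forall x : X, {rmorphism stalk x -> K}) (e : X) (m : int) : Prop :=
  exists (f : 'I_n -> stalk e) (h : K),
    [/\ differential_basis (pull s e) f, ord_at g e h m
      & form_eq c w h (fun i => g e (f i))].

(* r K_X = div(phi) on [U]. *)
Definition local_equation (X : lrspace) (s : lrhom X (spec_field k))
    (g : forall x : X, {rmorphism stalk x -> K}) (r : nat) (U : set X)
    (phi : K) : Prop :=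
  phi != 0 /\ forall e, U e -> codim1 e ->
    exists2 m, ord_form s g e m & ord_at g e phi (r%:Z * m).

Definition Q_Cartier (X : lrspace) (s : lrhom X (spec_field k))
    (g : forall x : X, {rmorphism stalk x -> K}) : Prop :=
  exists2 r, (0 < r)%N & forall x : X, exists U phi,
    [/\ open U, U x & local_equation s g r U phi].

(* [a] is the coefficient at [e] of K_{X'} - p^* K_X, both canonical divisors
   being those of the same rational form [w]; [g] and [g'] identify the function
   fields of X and X' with K. *)
Definition discrepancy (X X' : lrspace) (s : lrhom X (spec_field k))
    (p : lrhom X' X) (g : forall x : X, {rmorphism stalk x -> K})
    (g' : forall x : X', {rmorphism stalk x -> K}) (e : X') (a : rat) : Prop :=
  exists (r : nat) (U : set X) (phi : K) (m v : int),
    [/\ (0 < r)%N, [/\ open U, U (p e) & local_equation s g r U phi],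
        ord_form (hom_comp s p) g' e m, ord_at g' e phi v
      & a = m%:~R - v%:~R / r%:R].

End Divisors.

(* The prime divisor with generic point [e] is contracted by [p]: its image has
   codimension at least 2. *)
Definition exceptional (X X' : lrspace) (p : lrhom X' X) (e : X') : Prop :=
  codim1 e /\ prime_chain (stalk (p e)) 2.

(* The function field is unique up to unique isomorphism and two nonzero top
   forms differ by a rational function, so that the condition does not depend
   on [K], [g] and [w]. *)
Definition terminal (k : fieldType) (X : lrspace) (s : lrhom X (spec_field k))
    : Prop :=
  forall (K : fieldType) (c : {rmorphism k -> K})
      (g : forall x : X, {rmorphism stalk x -> K})
      (n : nat) (w : ('I_n -> K -> K) -> K),
    is_function_field g -> (forall x z, g x (pull s x z) = c z) ->
    rational_top_form c w ->
    Q_Cartier c w s g /\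
    forall (X' : lrspace) (p : lrhom X' X)
        (g' : forall x : X', {rmorphism stalk x -> K}),
      scheme X' -> integral_scheme X' -> normal_scheme X' ->
      proper_morphism p -> birational p ->
      is_function_field g' ->
      (forall x a, g' x (pull p x a) = g (p x) a) ->
      forall e a, exceptional p e -> discrepancy c w s p g g' e a -> 0 < a.

(* Main.v *)
Require Import Defs.
From HB Require Import structures.
From mathcomp Require Import all_boot all_order all_algebra all_field.
From mathcomp Require Import boolp classical_sets functions topology.
From mathcomp Require Import ring zify.
Set Implicit Arguments.
Unset Strict Implicit.
Unset Printing Implicit Defensive.
Import GRing.Theory.
Local Open Scope classical_set_scope.
Local Open Scope ring_scope.

(* Let the derivations E_i be a frame of the tangent sheaf near x, viewed as derivations of the
   function field K.  In characteristic zero the largest ideal of O_x stable under the E_i inside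
   the maximal ideal is prime.  If it is zero, then O_x is regular (the ideal of the a such that
   a * delta is a combination of the E_i for every derivation delta is stable, hence trivial, and a
   system of elements of m with dual derivations generates m).  Otherwise it is the generic point z
   of a subscheme such that the E_i preserve m_z.  O_z is not a discrete valuation ring, since
   some derivation of a discrete valuation ring maps the uniformizer to a unit.  So dim O_z > 1, and
   the normalized blowup of the closure of z has an exceptional divisor e above z.  The E_i
   extend to O_e: they extend to the blowup, and in characteristic zero to the discrete valuation
   ring by Leibniz.  Hence the pullback of the generator dual to the frame is the product of a
   generator of the top forms at e and of a determinant in O_e, so that the discrepancy of e is not
   positive.  The blowup is modelled as a space of local subrings of K, and X is
   studied through the subrings of K given by its stalks. *)

(** * Subrings of a field *)

(** [terminal] tests proper birational morphisms from normal schemes, so one such morphism has to be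
    built and shown proper. Fibre products are known only by their universal property; their points
    are therefore reached by mapping test schemes into them: spectra of fields, of a valuation ring,
    and of a product of residue fields. That the normalized blowup is of finite type is the
    finiteness of integral closure, for which Noether normalization and the conductor are developed.
    Stalks and coordinate rings are subrings of one field [K], so that localization maps become
    inclusions and a derivation is a single map of [K] that preserves some subrings. Differentials
    are treated through derivations into arbitrary modules, as in [differential_basis]. The last
    step is a comparison at [e]. The order of a form there refers to a differential basis of O_e,
    while the frame, which merely preserves O_e, may degenerate: its determinant against that basis
    has some order q >= 0, and the discrepancy is -q. The bound dim O_z > 1 is what makes [e]
    exceptional. *)

Record subr (K : fieldType) := Subr {
  subr_fun :> K -> Prop;
  sr1 : subr_fun 1;
  srB : forall u v, subr_fun u -> subr_fun v -> subr_fun (u - v);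
  srM : forall u v, subr_fun u -> subr_fun v -> subr_fun (u * v) }.

Coercion subr_set (K : fieldType) (A : subr K) : set K := A.

Section Subring.
Variables (K : fieldType) (A : subr K).

Lemma sr0 : A 0. Proof. by rewrite -(subrr 1); apply: srB; exact: sr1. Qed.
Lemma srN u : A u -> A (- u).
Proof. by move=> Au; rewrite -sub0r; apply: srB => //; exact: sr0. Qed.
Lemma srD u v : A u -> A v -> A (u + v).
Proof. by move=> Au Av; rewrite -[v]opprK; apply: srB => //; exact: srN. Qed.
Lemma srX u n : A u -> A (u ^+ n).
Proof.
by move=> Au; elim: n => [|n IH]; rewrite ?expr0 ?exprS; [exact: sr1|exact: srM].
Qed.
Lemma sr_sum I (r : seq I) (P : pred I) (F : I -> K) :
  (forall i, P i -> A (F i)) -> A (\sum_(i <- r | P i) F i).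
Proof. by move=> h; elim/big_ind: _ => //; [exact: sr0|exact: srD]. Qed.
Lemma sr_prod I (r : seq I) (P : pred I) (F : I -> K) :
  (forall i, P i -> A (F i)) -> A (\prod_(i <- r | P i) F i).
Proof. by move=> h; elim/big_ind: _ => //; [exact: sr1|exact: srM]. Qed.
Lemma sr_muln u n : A u -> A (u *+ n).
Proof. by move=> Au; elim: n => [|n IH]; rewrite ?mulr0n ?mulrS; [exact: sr0|exact: srD]. Qed.
Lemma sr_nat n : A n%:R. Proof. by apply: sr_muln; exact: sr1. Qed.

Definition subr_pred : {pred K} := fun u => `[< A u >].
Lemma subr_predP u : reflect (A u) (u \in subr_pred). Proof. exact: asboolP. Qed.
Lemma subr_pred_closed : subring_closed subr_pred.
Proof.
split=> [|u v /subr_predP Au /subr_predP Av|u v /subr_predP Au /subr_predP Av]; apply/subr_predP.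
- exact: sr1. - exact: srB. - exact: srM.
Qed.
HB.instance Definition _ := GRing.isSubringClosed.Build K subr_pred subr_pred_closed.

Record sub_of := SubOf { sub_val : K; _ : sub_val \in subr_pred }.
HB.instance Definition _ := [isSub of sub_of for sub_val].
HB.instance Definition _ := [Choice of sub_of by <:].
HB.instance Definition _ := [SubChoice_isSubComNzRing of sub_of by <:].

Lemma sub_valP (a : sub_of) : A (val a). Proof. by apply/subr_predP; case: a. Qed.

Definition mk_sub (u : K) (Au : A u) : sub_of := SubOf (introT (subr_predP u) Au).
Lemma val_mk_sub u (Au : A u) : val (mk_sub Au) = u. Proof. by []. Qed.

Lemma sub_valM (a b : sub_of) : val (a * b) = val a * val b. Proof. by []. Qed.
Lemma sub_valD (a b : sub_of) : val (a + b) = val a + val b. Proof. by []. Qed.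
Lemma sub_valB (a b : sub_of) : val (a - b) = val a - val b. Proof. by []. Qed.
Lemma sub_val1 : val (1 : sub_of) = 1. Proof. by []. Qed.
Lemma sub_val0 : val (0 : sub_of) = 0. Proof. by []. Qed.

Definition sub_unit : pred sub_of := fun a => (val a != 0) && `[< A (val a)^-1 >].
Definition sub_inv (a : sub_of) : sub_of :=
  if pselect (val a != 0 /\ A (val a)^-1) is left h then mk_sub h.2 else a.

Fact sub_mulVr : {in sub_unit, left_inverse 1 sub_inv *%R}.
Proof.
move=> a /andP[a0 /asboolP Aa]; apply: val_inj; rewrite /sub_inv.
case: pselect => [h|[]//]; by rewrite sub_valM sub_val1 /= mulVf.
Qed.
Fact sub_unitPl a b : b * a = 1 -> sub_unit a.
Proof.
move=> /(congr1 val); rewrite sub_valM sub_val1 => e.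
have a0 : val a != 0.
  by apply/eqP => a0; move: e; rewrite a0 mulr0 => /eqP; rewrite eq_sym oner_eq0.
rewrite /sub_unit a0; apply/asboolP.
by rewrite -(mul1r (val a)^-1) -e mulfK //; exact: sub_valP.
Qed.
Fact sub_inv0id : {in [predC sub_unit], sub_inv =1 id}.
Proof.
move=> a; rewrite inE /sub_inv => h; case: pselect => // h'.
by case/negP: h; rewrite /in_mem /= /sub_unit h'.1; apply/asboolP; exact: h'.2.
Qed.
HB.instance Definition _ := GRing.ComNzRing_hasMulInverse.Build sub_of
  sub_mulVr sub_unitPl sub_inv0id.

Fact sub_integral : GRing.integral_domain_axiom sub_of.
Proof.
move=> a b /(congr1 val); rewrite sub_valM sub_val0 => /eqP.
by rewrite mulf_eq0 => /orP[] /eqP e; apply/orP; [left|right]; apply/eqP/val_inj; rewrite e sub_val0.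
Qed.
HB.instance Definition _ := GRing.ComUnitRing_isIntegral.Build sub_of sub_integral.

Lemma sub_unitE (a : sub_of) : a \is a GRing.unit = (val a != 0) && `[< A (val a)^-1 >].
Proof. by []. Qed.

Lemma sub_unitP (a : sub_of) :
  (a \is a GRing.unit) <-> (val a != 0 /\ A (val a)^-1).
Proof.
rewrite sub_unitE; split=> [/andP[a0 /asboolP Aa]|[a0 Aa]]; first by split.
by apply/andP; split=> //; apply/asboolP.
Qed.

End Subring.
Arguments sub_of {K} A.

Definition pcoef (K : fieldType) (A : K -> Prop) (p : {poly K}) := forall i, A p`_i.

Section Pcoef.
Variables (K : fieldType) (A : subr K).

Lemma pcoefC c : A c -> pcoef A c%:P.
Proof. by move=> Ac i; rewrite coefC; case: ifP => // _; exact: sr0. Qed.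
Lemma pcoefX : pcoef A 'X.
Proof. by move=> i; rewrite coefX; exact: sr_nat. Qed.
Lemma pcoef0 : pcoef A 0. Proof. by move=> i; rewrite coef0; exact: sr0. Qed.
Lemma pcoef1 : pcoef A 1. Proof. by apply: pcoefC; exact: sr1. Qed.
Lemma pcoefB p q : pcoef A p -> pcoef A q -> pcoef A (p - q).
Proof. by move=> hp hq i; rewrite coefB; exact: srB. Qed.
Lemma pcoefD p q : pcoef A p -> pcoef A q -> pcoef A (p + q).
Proof. by move=> hp hq i; rewrite coefD; exact: srD. Qed.
Lemma pcoefM p q : pcoef A p -> pcoef A q -> pcoef A (p * q).
Proof. by move=> hp hq i; rewrite coefM; apply: sr_sum => j _; exact: srM. Qed.
Lemma pcoefXn p n : pcoef A p -> pcoef A (p ^+ n).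
Proof.
by move=> hp; elim: n => [|n IH]; rewrite ?expr0 ?exprS; [exact: pcoef1|exact: pcoefM].
Qed.
Lemma pcoefZ c p : A c -> pcoef A p -> pcoef A (c *: p).
Proof. by move=> Ac hp i; rewrite coefZ; exact: srM. Qed.
Lemma pcoef_sum I (r : seq I) (P : pred I) (F : I -> {poly K}) :
  (forall i, P i -> pcoef A (F i)) -> pcoef A (\sum_(i <- r | P i) F i).
Proof. by move=> h; elim/big_ind: _ => //; [exact: pcoef0|exact: pcoefD]. Qed.
Lemma pcoef_deriv p : pcoef A p -> pcoef A p^`().
Proof. by move=> hp i; rewrite coef_deriv; exact: sr_muln. Qed.
Lemma pcoef_horner p u : pcoef A p -> A u -> A p.[u].
Proof.
by move=> hp Au; rewrite horner_coef; apply: sr_sum => i _; apply: srM => //; exact: srX.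
Qed.

Lemma pcoef_lift p : pcoef A p -> exists q : {poly sub_of A}, p = map_poly val q.
Proof.
move=> hp; exists (\poly_(i < size p) mk_sub (hp i)); apply/polyP => i.
rewrite coef_map /= coef_poly; case: ltnP => //= h; by rewrite nth_default.
Qed.
Lemma pcoef_map (q : {poly sub_of A}) : pcoef A (map_poly val q).
Proof. by move=> i; rewrite coef_map; exact: sub_valP. Qed.

End Pcoef.

Definition subr_full (K : fieldType) : subr K.
Proof. by exists setT. Defined.

Definition adj1 (K : fieldType) (A : subr K) (b : K) : subr K.
Proof.
exists [set u | exists2 p, pcoef A p & u = p.[b]].
- by exists 1; [exact: pcoef1|rewrite hornerC].
- by move=> _ _ [p hp ->] [q hq ->]; exists (p - q); [exact: pcoefB|rewrite hornerD hornerN].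
- by move=> _ _ [p hp ->] [q hq ->]; exists (p * q); [exact: pcoefM|rewrite hornerM].
Defined.

(** Generators are adjoined one at a time, the head of the list last, so that statements on finitely
    generated algebras reduce to [adj1] by induction. *)
Fixpoint adj (K : fieldType) (A : subr K) (s : seq K) : subr K :=
  if s is b :: s' then adj1 (adj A s') b else A.

Section Adj.
Variables (K : fieldType).
Implicit Types (A B : subr K) (s : seq K).

Lemma adj1_sub A b : A `<=` adj1 A b.
Proof. by move=> a Aa; exists a%:P; [exact: pcoefC|rewrite hornerC]. Qed.
Lemma adj1_mem A b : adj1 A b b.
Proof. by exists 'X; [exact: pcoefX|rewrite hornerX]. Qed.
Lemma adj1_min A B b : A `<=` B -> B b -> adj1 A b `<=` B.
Proof. move=> AB Bb _ [p hp ->]; by apply: pcoef_horner => // i; apply: AB; exact: hp. Qed.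
Lemma adj_sub A s : A `<=` adj A s.
Proof. by elim: s => [//|b s IH] a Aa /=; apply: adj1_sub; exact: IH. Qed.
Lemma adj_mem A s b : b \in s -> adj A s b.
Proof.
elim: s => [//|c s IH]; rewrite inE => /orP[/eqP->|/IH h]; first exact: adj1_mem.
exact: adj1_sub.
Qed.
Lemma adj_min A B s : A `<=` B -> (forall b, b \in s -> B b) -> adj A s `<=` B.
Proof.
move=> AB; elim: s => [//|c s IH] h; apply: adj1_min; last by apply: h; rewrite mem_head.
by apply: IH => b bs; apply: h; rewrite inE bs orbT.
Qed.
End Adj.

Definition ideal_of (K : fieldType) (A : K -> Prop) (I : set K) :=
  [/\ forall u, I u -> A u, I 0, forall u v, I u -> I v -> I (u + v) & forall a u, A a -> I u -> I (a * u)].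

Definition prime_of (K : fieldType) (A : K -> Prop) (P : set K) :=
  [/\ ideal_of A P, ~ P 1 & forall a b, A a -> A b -> P (a * b) -> P a \/ P b].

Fixpoint span (K : fieldType) (A : K -> Prop) (s : seq K) : set K :=
  if s is x :: s' then [set u | exists a v, [/\ A a, span A s' v & u = a * x + v]] else [set 0].

Definition noeth (K : fieldType) (A : K -> Prop) :=
  forall I, ideal_of A I -> exists s, I = span A s.

Section Span.
Variables (K : fieldType) (A : subr K).
Implicit Types (I : set K) (s : seq K).

Lemma span0 s : span A s 0.
Proof.
elim: s => [//|x s IH] /=; exists 0, 0; split; [exact: sr0|exact: IH|by rewrite mul0r addr0].
Qed.
Lemma spanD s u v : span A s u -> span A s v -> span A s (u + v).
Proof.
elim: s u v => [|x s IH] u v /=; first by move=> -> ->; rewrite addr0.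
move=> [a [u' [Aa su ->]]] [b [v' [Ab sv ->]]]; exists (a + b), (u' + v'); split.
- exact: srD. - exact: IH. - by ring.
Qed.
Lemma spanZ s a u : A a -> span A s u -> span A s (a * u).
Proof.
move=> Aa; elim: s u => [|x s IH] u /=; first by move=> ->; rewrite mulr0.
move=> [b [v [Ab sv ->]]]; exists (a * b), (a * v); split; [exact: srM|exact: IH|by ring].
Qed.
Lemma span_mem s u : u \in s -> span A s u.
Proof.
elim: s => [//|x s IH]; rewrite inE => /orP[/eqP->|/IH h] /=.
  by exists 1, 0; split; [exact: sr1|exact: span0|rewrite mul1r addr0].
by exists 0, u; split; [exact: sr0| |rewrite mul0r add0r].
Qed.
Lemma span_min I s : ideal_of A I -> (forall u, u \in s -> I u) -> span A s `<=` I.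
Proof.
move=> [IA I0 ID IM]; elim: s => [|x s IH] h u /=; first by move=> ->.
move=> [a [v [Aa sv ->]]]; apply: ID; first by apply: IM => //; apply: h; rewrite mem_head.
by apply: IH => // w ws; apply: h; rewrite inE ws orbT.
Qed.
(* The span of a sequence outside A is a fractional ideal. *)
Lemma span_closed (S : set K) s : S 0 -> (forall u v, S u -> S v -> S (u + v)) ->
  (forall a u, A a -> S u -> S (a * u)) ->
  (forall u, u \in s -> S u) -> span A s `<=` S.
Proof.
move=> I0 ID IM; elim: s => [|x s IH] h u /=; first by move=> ->.
move=> [a [v [Aa sv ->]]]; apply: ID; first by apply: IM => //; apply: h; rewrite mem_head.
by apply: IH => // w ws; apply: h; rewrite inE ws orbT.
Qed.
Lemma span_sumP s u : span A s u <->
  exists2 c : nat -> K, forall i, A (c i) & u = \sum_(i < size s) c i * s`_i.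
Proof.
split.
  elim: s u => [|x s IH] u /=; first by move=> ->; exists (fun=> 0); [move=> _; exact: sr0|rewrite big_ord0].
  move=> [a [v [Aa /IH[c hc ->] ->]]]; exists (fun i => if i is j.+1 then c j else a).
    by case.
  by rewrite big_ord_recl.
move=> [c hc ->]; elim/big_ind: _ => [||i _]; [exact: span0|exact: spanD|].
by apply: spanZ => //; apply: span_mem; exact: mem_nth.
Qed.
Lemma ideal0 : ideal_of A [set 0].
Proof.
split=> //; first by move=> _ ->; exact: sr0.
- by move=> u v -> ->; rewrite addr0.
- by move=> a u _ ->; rewrite mulr0.
Qed.
Lemma noeth_chain (I : nat -> set K) : noeth A -> (forall n, ideal_of A (I n)) ->
  (forall n, I n `<=` I n.+1) -> exists N, forall n, I n `<=` I N.
Proof.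
move=> nA iI sI.
have mono m n : (m <= n)%N -> I m `<=` I n.
  move=> /subnK <-; elim: (n - m)%N => [//|d IH]; rewrite addSn; exact: subset_trans IH _.
pose U := [set u | exists n, I n u].
have iU : ideal_of A U.
  split.
  - by move=> u [n]; case: (iI n) => h _ _ _; exact: h.
  - by exists 0%N; case: (iI 0%N).
  - move=> u v [m Iu] [n Iv]; exists (maxn m n); case: (iI (maxn m n)) => _ _ h _; apply: h.
      by apply: mono Iu; rewrite leq_maxl.
    by apply: mono Iv; rewrite leq_maxr.
  - by move=> a u Aa [n Iu]; exists n; case: (iI n) => _ _ _ h; exact: h.
have [s Us] := nA _ iU.
have [N hN] : exists N, forall u, u \in s -> I N u.
  have: forall u, u \in s -> U u by move=> u us; rewrite Us; exact: span_mem.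
  elim: (s) => [|x s' IH] h; first by exists 0%N.
  have [N hN] := IH (fun u us => h u (mem_behead (s := x :: s') us)).
  have [n hn] := h x (mem_head _ _).
  exists (maxn n N) => u; rewrite inE => /orP[/eqP->|/hN].
    by apply: mono hn; rewrite leq_maxl.
  by apply: mono; rewrite leq_maxr.
exists N => n u Iu; have : U u by exists n.
by rewrite Us; apply: span_min.
Qed.
End Span.

(** * Hilbert's basis theorem *)

Section Hilbert.
Variables (K : fieldType).

Lemma noeth_field (A : subr K) : (forall u, A u -> u != 0 -> A u^-1) -> noeth A.
Proof.
move=> fA I iI; case: (pselect (exists2 u, I u & u != 0)) => [[u Iu u0]|h].
  exists [:: 1]; apply/seteqP; split.
    move=> v Iv /=; exists v, 0; split=> //; last by rewrite mulr1 addr0.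
    by case: iI => h _ _ _; exact: h.
  apply: span_min => // v; rewrite inE => /eqP->; rewrite -(mulVf u0).
  by case: iI => h _ _ h'; apply: h' => //; apply: fA => //; exact: h.
exists [::]; apply/seteqP; split=> [v Iv|v ->]; last by case: iI.
by apply: contrapT => v0; apply: h; exists v => //; apply/eqP.
Qed.

(** Since [b] may be algebraic over [A], leading coefficients make sense only in [A[X]]: the
    argument runs on the preimage [J] of [I] under evaluation at [b]. *)
Lemma hilbert_basis1 (A : subr K) b : noeth A -> noeth (adj1 A b).
Proof.
move=> nA I iI.
pose J p := pcoef A p /\ I p.[b].
have [IB I0 ID IM] := iI.
(* The coefficient in degree n may vanish here, which makes [L n] an ideal; multiplication by X
   shows that these ideals increase. *)
pose L n : set K := [set a | exists p, [/\ J p, (size p <= n.+1)%N & a = p`_n]].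
have JD p q : J p -> J q -> J (p + q).
  by move=> [hp Ip] [hq Iq]; split; [exact: pcoefD|rewrite hornerD; exact: ID].
have JM r p : pcoef A r -> J p -> J (r * p).
  by move=> hr [hp Ip]; split; [exact: pcoefM|rewrite hornerM; apply: IM => //; exists r].
have iL n : ideal_of A (L n).
  split.
  - by move=> _ [p [[hp _] _ ->]].
  - exists 0; split; rewrite ?coef0 ?size_poly0 //; split; [exact: pcoef0|by rewrite horner0].
  - move=> _ _ [p [Jp sp ->]] [q [Jq sq ->]]; exists (p + q); rewrite coefD; split=> //; first exact: JD.
    by apply: leq_trans (size_polyD _ _) _; rewrite geq_max sp.
  - move=> a _ Aa [p [Jp sp ->]]; exists (a%:P * p); split; [|by apply: leq_trans sp; rewrite mul_polyC size_scale_leq|by rewrite mul_polyC coefZ].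
    by apply: JM => //; exact: pcoefC.
have sL n : L n `<=` L n.+1.
  move=> _ [p [Jp sp ->]]; exists ('X * p); split; last by rewrite coefXM.
    by apply: JM => //; exact: pcoefX.
  by apply: leq_trans (size_polyMleq _ _) _; rewrite size_polyX.
have [N hN] := noeth_chain nA iL sL.
pose B := adj1 A b.
(* Subtracting a combination of lifts of the generators of [L n] cancels the coefficient in degree
   n. *)
have key n : exists2 s, (forall u, u \in s -> I u) &
    forall p, J p -> (size p <= n.+1)%N -> exists q,
      [/\ J q, (size q <= n)%N & exists2 v, span B s v & p.[b] = v + q.[b]].
  have [s Ls] := nA _ (iL n).
  have : forall a, a \in s -> L n a by move=> a sa; rewrite Ls; exact: span_mem.
  have : forall a, L n a -> span A s a by rewrite Ls.
  move=> h1 h2.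
  have /choice [P hP] : forall a, exists p, a \in s -> [/\ J p, (size p <= n.+1)%N & a = p`_n].
    by move=> a; case: (pselect (a \in s)) => [/h2[p hp]|h]; [exists p|exists 0].
  exists [seq (P a).[b] | a <- s].
    by move=> u /mapP[a /hP[[_ h] _ _] ->].
  move=> p Jp sp.
  have : span A s p`_n by apply: h1; exists p.
  have : exists2 v, span B [seq (P a).[b] | a <- [::]] v & p.[b] = v + p.[b].
    by exists 0 => //; rewrite add0r.
  clear h1 Ls.
  suff H : forall s', {subset s' <= s} -> forall a, span A s' a -> exists r,
      [/\ J r, (size r <= n.+1)%N, r`_n = a & span B [seq (P a).[b] | a <- s'] r.[b]].
    move=> _ sa; have [r [Jr sr er spr]] := H s (fun _ => id) _ sa.
    exists (p - r); split.
    - have -> : p - r = p + (-1)%:P * r by rewrite polyCN mulN1r.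
      by apply: JD => //; apply: JM => //; apply: pcoefC; apply: srN; exact: sr1.
    - apply/leq_sizeP => j; rewrite leq_eqVlt => /orP[/eqP<-|h]; first by rewrite coefB er subrr.
      by rewrite coefB (nth_default _ (leq_trans sp h)) (nth_default _ (leq_trans sr h)) subr0.
    - by exists r.[b] => //; rewrite hornerD hornerN addrC subrK.
  elim=> [|x s' IH] ss a /=.
    move=> ->; exists 0; rewrite coef0 size_poly0 horner0; split=> //.
    by split; [exact: pcoef0|rewrite horner0].
  move=> [c [v [Ac sv ->]]].
  have [r [Jr sr er spr]] := IH (fun y ys => ss y (mem_behead (s := x :: s') ys)) _ sv.
  have [JP sP eP] := hP x (ss x (mem_head _ _)).
  exists (c *: P x + r); split.
  - by apply: JD => //; rewrite -mul_polyC; apply: JM => //; exact: pcoefC.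
  - by apply: leq_trans (size_polyD _ _) _; rewrite geq_max sr (leq_trans (size_scale_leq _ _) sP).
  - by rewrite coefD coefZ -eP er.
  - exists c, r.[b]; split=> //; first exact: adj1_sub.
    by rewrite hornerD hornerZ.
have /choice [G hG] : forall n, exists s, (forall u, u \in s -> I u) /\
    forall p, J p -> (size p <= n.+1)%N -> exists q,
      [/\ J q, (size q <= n)%N & exists2 v, span B s v & p.[b] = v + q.[b]].
  by move=> n; have [s h1 h2] := key n; exists s.
pose S := flatten [seq G i | i <- iota 0 N.+1].
exists S; apply/seteqP; split; last first.
  apply: span_min => // u /flattenP[s /mapP[i _ ->]]; exact: (hG i).1.
have spS n : (n <= N)%N -> span B (G n) `<=` span B S.
  move=> nN; apply: span_closed; [exact: span0|exact: spanD|by move=> *; exact: spanZ|].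
  move=> u us; apply: span_mem; apply/flattenP; exists (G n) => //.
  by apply: map_f; rewrite mem_iota.
have main n : forall p, J p -> (size p <= n)%N -> span B S p.[b].
  elim: n => [p _|n IH p Jp sp].
    by rewrite leqn0 size_poly_eq0 => /eqP->; rewrite horner0; exact: span0.
  case: (leqP n N) => nN.
    have [q [Jq sq [v sv ->]]] := (hG n).2 p Jp sp.
    by apply: spanD; [exact: spS sv|exact: IH].
  (* the leading coefficient already occurs in degree N *)
  have [p' [Jp' sp' e]] : L N p`_n by apply: (hN n); exists p.
  have Jr : J ('X^(n - N) * p') by apply: JM => //; apply: pcoefXn; exact: pcoefX.
  have -> : p.[b] = (p - 'X^(n - N) * p').[b] + b ^+ (n - N) * p'.[b].
    by rewrite hornerD hornerN hornerM hornerXn subrK.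
  apply: spanD; last first.
    apply: spanZ; first by apply: srX; exact: adj1_mem.
    have [q [Jq sq [v sv ->]]] := (hG N).2 p' Jp' sp'.
    by apply: spanD; [exact: spS sv|apply: IH => //; exact: leq_trans sq (ltnW nN)].
  apply: IH.
    have -> : p - 'X^(n - N) * p' = p + (-1)%:P * ('X^(n - N) * p') by rewrite polyCN mulN1r.
    by apply: JD => //; apply: JM => //; apply: pcoefC; apply: srN; exact: sr1.
  apply/leq_sizeP => j; rewrite leq_eqVlt => /orP[/eqP<-|h].
    by rewrite coefB coefXnM ltnNge leq_subr /= subKn 1?ltnW // -e subrr.
  rewrite coefB coefXnM (nth_default _ (leq_trans sp h)) sub0r.
  case: ifP => _; first by rewrite oppr0.
  rewrite nth_default ?oppr0 //; apply: leq_trans sp' _.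
  by rewrite ltn_subRL subnK // ltnW.
move=> u Iu; have [p hp e] := IB _ Iu; rewrite e.
by apply: (main (size p)) => //; split=> //; rewrite -e.
Qed.

Lemma hilbert_basis (A : subr K) s : noeth A -> noeth (adj A s).
Proof. by move=> nA; elim: s => [//|b s IH]; exact: hilbert_basis1. Qed.
End Hilbert.

(** * Integral elements, normality and fraction fields inside K *)

Definition integ (K : fieldType) (A : K -> Prop) (u : K) :=
  exists p : {poly K}, [/\ p \is monic, pcoef A p & root p u].

Section Integ.
Variables (K : fieldType).
Implicit Types (A B : subr K) (u v : K).

Lemma map_val_monic A (q : {poly sub_of A}) : (map_poly val q \is monic) = (q \is monic).
Proof.
rewrite !monicE lead_coef_map_inj; [|exact: val_inj|by []].
by rewrite -(sub_val1 A) (inj_eq val_inj).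
Qed.

Lemma integ_over A u : integ A u <-> integralOver (val : sub_of A -> K) u.
Proof.
split=> [[p [mp /pcoef_lift[q e] rp]]|[q mq rq]].
  by exists q; [rewrite e map_val_monic in mp|rewrite -e].
by exists (map_poly val q); split; [rewrite map_val_monic|exact: pcoef_map|].
Qed.

Lemma integ_mem A u : A u -> integ A u.
Proof.
move=> Au; exists ('X - u%:P); split; [exact: monicXsubC| |by rewrite root_XsubC].
by apply: pcoefB; [exact: pcoefX|exact: pcoefC].
Qed.

Lemma integ_sub A B : (forall x, A x -> B x) -> forall u, integ A u -> integ B u.
Proof. by move=> AB u [p [mp hp rp]]; exists p; split=> // i; exact: AB. Qed.

Definition intcl A : subr K.
Proof.
exists (integ A).
- by apply: integ_mem; exact: sr1.
- by move=> u v /integ_over hu /integ_over hv; apply/integ_over; exact: integral_sub.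
- by move=> u v /integ_over hu /integ_over hv; apply/integ_over; exact: integral_mul.
Defined.

Lemma integ_trans A u : integ (integ A) u -> integ A u.
Proof.
move=> [p [mp hp rp]]; apply/integ_over; apply: (integral_root_monic mp rp).
by move=> c /(nthP 0)[i _ <-]; apply/integ_over; exact: hp.
Qed.

Lemma adj_integ A s : (forall b, b \in s -> integ A b) -> forall u, adj A s u -> integ A u.
Proof.
by move=> h; apply: (@adj_min _ A (intcl A) s) => // u; exact: integ_mem.
Qed.

(** [K] may be larger than the fraction field of [A], so only quotients of elements of [A] are
    tested. *)
Definition normalS (A : K -> Prop) :=
  forall a s, A a -> A s -> s != 0 -> integ A (a / s) -> A (a / s).

Definition fracf A : subr K.
Proof.
exists [set u | exists a s, [/\ A a, A s, s != 0 & u = a / s]].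
- exists 1, 1; split; rewrite ?oner_neq0 ?divr1 //; exact: sr1.
- move=> _ _ [a [s [Aa As s0 ->]]] [b [t [Ab At t0 ->]]].
  exists (a * t - b * s), (s * t); split; [|exact: srM|by rewrite mulf_neq0|by field; rewrite s0 t0].
  by apply: srB; exact: srM.
- move=> _ _ [a [s [Aa As s0 ->]]] [b [t [Ab At t0 ->]]].
  exists (a * b), (s * t); split; [exact: srM|exact: srM|by rewrite mulf_neq0|by field; rewrite s0 t0].
Defined.

Lemma fracf_sub A u : A u -> fracf A u.
Proof. by move=> Au; exists u, 1; split; rewrite ?oner_neq0 ?divr1 //; exact: sr1. Qed.

Lemma fracf_div A u v : fracf A u -> fracf A v -> fracf A (u / v).
Proof.
move=> [a [s [Aa As s0 ->]]] [b [t [Ab At t0 ->]]].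
have [->|b0] := eqVneq b 0; first by rewrite mul0r invr0 mulr0; exact: sr0.
exists (a * t), (s * b); split; [exact: srM|exact: srM|by rewrite mulf_neq0|by field; rewrite s0 t0 b0].
Qed.

Lemma fracf_inv A u : fracf A u -> fracf A u^-1.
Proof. by move=> hu; rewrite -(mul1r u^-1); apply: fracf_div => //; exact: sr1. Qed.

Lemma fracf_mono A B : (forall u, A u -> B u) -> forall u, fracf A u -> fracf B u.
Proof. by move=> AB u [a [s [Aa As s0 ->]]]; exists a, s; split; auto. Qed.

Lemma fracf_min A (L : subr K) : (forall u, A u -> L u) -> (forall u, L u -> L u^-1) ->
  forall u, fracf A u -> L u.
Proof. by move=> AL Li _ [a [s [Aa As s0 ->]]]; apply: srM; [exact: AL|apply: Li; exact: AL]. Qed.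

Lemma normal_mem A u : normalS A -> fracf A u -> integ A u -> A u.
Proof. by move=> nA [a [s [Aa As s0 ->]]]; exact: nA. Qed.

(** An integral element is almost integral: if u = a/s satisfies a monic equation of degree N, then
    s^N clears the powers up to N, and the equation reduces the higher ones to these. *)
Lemma integ_denom A u : fracf A u -> integ A u ->
  exists d, [/\ A d, d != 0 & forall m, A (d * u ^+ m)].
Proof.
move=> [a [s [Aa As s0 eu]]] [p [mp hp rp]].
pose N := (size p).-1.
have sp : size p = N.+1 by rewrite prednK // lt0n size_poly_eq0 monic_neq0.
have eN : u ^+ N = - \sum_(i < N) p`_i * u ^+ i.
  have := rp; rewrite /root horner_coef sp big_ord_recr /=.
  by rewrite -[N]/(size p).-1 (eqP mp : p`_(size p).-1 = 1) mul1r addrC addr_eq0 => /eqP.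
exists (s ^+ N); split; [exact: srX|by rewrite expf_neq0|].
elim/ltn_ind=> m IH; case: (leqP m N) => hm.
  have -> : s ^+ N * u ^+ m = s ^+ (N - m) * a ^+ m.
    have e : s * u = a by rewrite eu mulrC divfK.
    by rewrite -{1}(subnK hm) exprD -mulrA -exprMn e.
  by apply: srM; exact: srX.
have -> : s ^+ N * u ^+ m = - \sum_(i < N) p`_i * (s ^+ N * u ^+ (i + (m - N))).
  rewrite -{1}(subnKC (ltnW hm)) exprD eN mulNr mulrN; congr (- _).
  rewrite big_distrl big_distrr /=; apply: eq_bigr => i _; rewrite exprD; ring.
apply: srN; apply: sr_sum => i _; apply: srM; first exact: hp.
by apply: IH; have := ltn_ord i; lia.
Qed.

(** Once a relation for [e] is divided by a power of X, its constant coefficient is nonzero, and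
    solving for that coefficient expresses the inverse of [e] as a polynomial in [e]. *)
Lemma integ_field_inv (L : subr K) e : (forall u, L u -> L u^-1) -> integ L e ->
  adj1 L e e^-1.
Proof.
move=> Li he; have [->|e0] := eqVneq e 0; first by rewrite invr0; exact: sr0.
have [p [pm hp rp]] := he.
suff : forall n (q : {poly K}), (size q <= n)%N -> q != 0 -> pcoef L q -> root q e -> adj1 L e e^-1.
  by move/(_ _ p (leqnn _)); apply=> //; exact: monic_neq0.
elim=> [q|n IH q sq q0 hq rq].
  by rewrite leqn0 size_poly_eq0 => /eqP->; rewrite eqxx.
have [q' eq] : exists q', q = q' * 'X + (q`_0)%:P.
  exists (\poly_(i < size q) q`_i.+1); apply/polyP => -[|i].
    by rewrite coefD coefMX coefC /= add0r.
  rewrite coefD coefMX coefC /= addr0 coef_poly; case: ltnP => // h.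
  by rewrite nth_default // (leq_trans h).
have hq' : pcoef L q' by move=> i; have := hq i.+1; rewrite {1}eq coefD coefMX coefC /= addr0.
have [c0|c0] := eqVneq q`_0 0.
  have q'0 : q' != 0 by apply: contraNneq q0 => z; rewrite eq z c0 mul0r addr0.
  apply: (IH q') => //.
    by rewrite -ltnS -(size_mulX q'0); move: sq; rewrite {1}eq c0 addr0.
  by have := rq; rewrite {1}/root {1}eq c0 addr0 hornerMX mulf_eq0 (negPf e0) orbF.
exists (- (q`_0)^-1 *: q'); first by apply: pcoefZ => //; apply: srN; apply: Li.
rewrite hornerZ; move: rq; rewrite /root {1}eq hornerD hornerMX hornerC addr_eq0 => /eqP h.
have -> : q'.[e] = - q`_0 / e by rewrite -h mulfK.
by field; rewrite e0 c0.
Qed.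

(* By Cayley-Hamilton. *)
Lemma integ_mult A s u : (exists2 x, x \in s & x != 0) ->
  (forall x, x \in s -> span A s (u * x)) -> integ A u.
Proof.
move=> [x0 xs x00] h.
pose n := size s.
have /choice [c hc] : forall i : 'I_n, exists c : nat -> K,
    (forall j, A (c j)) /\ u * s`_i = \sum_(j < n) c j * s`_j.
  move=> i; have /span_sumP[c hc e] := h _ (mem_nth 0 (ltn_ord i)).
  by exists c.
pose M : 'M[sub_of A]_n := \matrix_(i, j) mk_sub ((hc j).1 i).
have hM : map_mx val M = \matrix_(i, j) c j i.
  by apply/matrixP => i j; rewrite !mxE val_mk_sub.
have eig : eigenvalue (map_mx val M) u.
  apply/eigenvalueP; exists (\row_i s`_i).
    apply/rowP => i; rewrite hM !mxE (hc i).2; apply: eq_bigr => j _.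
    by rewrite !mxE mulrC.
  apply/eqP => /rowP e0; move: x00; rewrite -(nth_index 0 xs).
  have hi : (index x0 s < n)%N by rewrite index_mem.
  by have := e0 (Ordinal hi); rewrite !mxE /= => ->; rewrite eqxx.
rewrite eigenvalue_root_char in eig; rewrite -map_char_poly in eig.
exists (map_poly val (char_poly M)); split=> //; last exact: pcoef_map.
by rewrite map_val_monic char_poly_monic.
Qed.

End Integ.

(** * Localization at a prime *)

Section Loc.
Variables (K : fieldType).
Implicit Types (A B : subr K) (P : set K).

Lemma prime_neq0 A P s : prime_of A P -> ~ P s -> s != 0.
Proof. by move=> [[_ P0 _ _] _ _] nPs; apply: contra_notN nPs => /eqP->. Qed.
Lemma primeM A P s t : prime_of A P -> A s -> A t -> ~ P s -> ~ P t -> ~ P (s * t).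
Proof. by move=> [_ _ h] As At ns nt /h[]. Qed.
Definition loc_set (A : K -> Prop) P : set K :=
  [set u | exists a s, [/\ A a, A s, ~ P s & u = a / s]].

Definition loc A P (pP : prime_of A P) : subr K.
Proof.
exists (loc_set A P).
- by exists 1, 1; split; rewrite ?divr1 //; [exact: sr1|exact: sr1|case: pP].
- move=> _ _ [a [s [Aa As s0 ->]]] [b [t [Ab At t0 ->]]].
  exists (a * t - b * s), (s * t); split; [|exact: srM|exact: (primeM pP)|by field; rewrite !(prime_neq0 pP)].
  by apply: srB; exact: srM.
- move=> _ _ [a [s [Aa As s0 ->]]] [b [t [Ab At t0 ->]]].
  exists (a * b), (s * t); split; [exact: srM|exact: srM|exact: (primeM pP)|by field; rewrite !(prime_neq0 pP)].
Defined.

Lemma loc_sub A P (pP : prime_of A P) u : A u -> loc pP u.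
Proof. by move=> Au; exists u, 1; split; rewrite ?divr1 //; [exact: sr1|case: pP]. Qed.

Lemma loc_unit A P (pP : prime_of A P) u : A u -> ~ P u -> loc pP u^-1.
Proof. by move=> Au nu; exists 1, u; split=> //; [exact: sr1|rewrite div1r]. Qed.

Lemma loc_unitP A P (pP : prime_of A P) u : A u -> u != 0 -> (loc pP u^-1 <-> ~ P u).
Proof.
move=> Au u0; split; last exact: loc_unit.
move=> [a [s [Aa As ns e]]] Pu; have s0 := prime_neq0 pP ns; apply: ns.
have -> : s = a * u by rewrite -[a](divfK s0) -e -mulrA [s * u]mulrC mulKf.
by case: pP => [[_ _ _ h] _ _]; exact: h.
Qed.

End Loc.

(** * Noether normalization and finiteness of integral closure *)

(* Integral closedness of R in its fraction field, stated inside R. *)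
Definition nrm (R : idomainType) := forall (a b : R) N (r : nat -> R), b != 0 ->
  a ^+ N = \sum_(j < N) r j * a ^+ j * b ^+ (N - j) -> exists c, a = b * c.

Section NormalPoly.
Variables (R : idomainType).
Hypothesis unit_nat : forall n, n.+1%:R \is a @GRing.unit R.

(** Newton's divided differences: the quotient of Z - Z(M) by X - M again takes values in [R] at the
    integers beyond M, because the differences c - M are units of [R]. *)
Lemma interpolation (F : fieldType) (i : {rmorphism R -> F}) (Z : {poly F}) M :
  (forall c, (M <= c)%N -> exists e, Z.[c%:R] = i e) -> exists z, Z = map_poly i z.
Proof.
have [n] := ubnP (size Z); elim: n Z M => // n IH Z M sZ hZ.
have [e he] := hZ M (leqnn _).
have : root (Z - (i e)%:P) M%:R by rewrite /root hornerD hornerN hornerC he subrr.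
case/factor_theorem => Q eQ.
have [Q0|Q0] := eqVneq Q 0.
  exists e%:P; rewrite map_polyC /=; apply/eqP; by rewrite -subr_eq0 eQ Q0 mul0r.
have sQ : (size Q < n)%N.
  have := size_polyD Z (- (i e)%:P); rewrite eQ size_Mmonic ?monicXsubC // size_XsubC addn2 /=.
  have Qp : (0 < size Q)%N by rewrite lt0n size_poly_eq0.
  have : (size (- (i e)%:P) <= 1)%N by rewrite size_polyN size_polyC; case: (_ != _).
  move=> h1; rewrite leq_max => /orP[h2|h2]; first exact: leq_trans h2 (sZ : (size Z <= n)%N).
  by have := leq_trans h2 h1; rewrite ltnS leqn0 => /eqP z; rewrite z in Qp.
have [q eq] : exists q, Q = map_poly i q.
  apply: (IH Q M.+1) => // c hc.
  have [ec hec] := hZ c (ltnW hc).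
  exists ((ec - e) / (c - M)%:R).
  have u : (c - M)%:R \is a @GRing.unit R.
    by rewrite -(subnSK hc); exact: unit_nat.
  rewrite rmorphM rmorphV // rmorph_nat rmorphB -hec.
  have := congr1 (fun p => p.[c%:R]) eQ.
  rewrite hornerD hornerN hornerC hornerM hornerXsubC -natrB 1?ltnW // => ->.
  by rewrite mulfK // -(rmorph_nat i) -unitfE; exact: rmorph_unit.
exists (q * ('X - M%:R%:P) + e%:P).
rewrite rmorphD rmorphM rmorphB /= map_polyX !map_polyC /= rmorph_nat -eq -eQ.
by rewrite subrK.
Qed.

Lemma nat_roots_bounded (b : {poly R}) : b != 0 -> exists M, forall c, (M <= c)%N -> b.[c%:R] != 0.
Proof.
have [n] := ubnP (size b); elim: n b => // n IH b sb b0.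
case: (pselect (exists c, root b c%:R)) => [[c]|h]; last first.
  by exists 0%N => c _; apply/negP => hc; apply: h; exists c.
case/factor_theorem => q eq.
have q0 : q != 0 by apply: contraNneq b0 => z; rewrite eq z mul0r.
have [|//|M hM] := IH q.
  by move: sb; rewrite eq size_Mmonic ?monicXsubC // size_XsubC addn2.
exists (maxn M c.+1) => d; rewrite geq_max => /andP[Md cd].
rewrite eq hornerM mulf_neq0 ?hM // hornerXsubC -natrB 1?ltnW //.
by apply: contraTneq (unit_nat (d - c).-1) => /eqP; rewrite prednK ?subn_gt0 // => /eqP->; rewrite unitr0.
Qed.

(** The quotient a/b is a polynomial over the fraction field. At every large integer c its value
    a(c)/b(c) is integral over [R], hence in [R], and interpolation puts its coefficients in [R]. *)
Lemma nrm_poly : nrm R -> nrm {poly R}.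
Proof.
move=> nR a b N r b0 e.
pose F := {fraction R}; pose i : {rmorphism R -> F} := @FracField.tofrac R.
have ii : injective i by move=> x y /eqP; rewrite tofrac_eq => /eqP.
pose f := map_poly i.
have fi : injective f by exact: map_inj_poly.
have fb0 : f b != 0 by rewrite -(rmorph0 f) (inj_eq fi).
have N0 : (0 < N)%N.
  by case: N e => // /eqP; rewrite expr0 big_ord0 oner_eq0.
(* In lowest terms A'/B', the integral equation makes B' divide a power of A', so B' is constant. *)
have dv : f b %| f a.
  set A := f a; set B := f b.
  have [D [A' [B' [cop eA eB D0]]]] : exists D A' B',
      [/\ coprimep A' B', A = A' * D, B = B' * D & D != 0].
    exists (gcdp A B), (A %/ gcdp A B), (B %/ gcdp A B); split.
    - by apply: coprimep_div_gcd; rewrite fb0 orbT.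
    - by rewrite divpK // dvdp_gcdl.
    - by rewrite divpK // dvdp_gcdr.
    - by rewrite gcdp_eq0 negb_and fb0 orbT.
  have eN : A' ^+ N = B' * \sum_(j < N) f (r j) * A' ^+ j * B' ^+ (N - j.+1).
    apply: (mulIf (expf_neq0 N D0)); rewrite -exprMn -eA.
    rewrite /A -rmorphXn e rmorph_sum -mulrA big_distrl big_distrr /=; apply: eq_bigr => j _.
    transitivity (f (r j) * A ^+ j * B ^+ (N - j)); first by rewrite /A /B /f !rmorphM !rmorphXn.
    rewrite eA eB !exprMn.
    have -> : D ^+ N = D ^+ j * D ^+ (N - j) by rewrite -exprD subnKC // ltnW.
    rewrite (_ : B' ^+ (N - j) = B' * B' ^+ (N - j.+1)); first by ring.
    by rewrite -exprS subnSK.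
  have : B' %| A' ^+ N by rewrite eN dvdp_mulr.
  have copN : coprimep B' (A' ^+ N) by rewrite coprimep_sym coprimep_expl.
  move=> dB; have : coprimep B' B' by apply: coprimep_dvdl dB copN.
  rewrite coprimepp => sB; rewrite eA eB dvdp_mul2r //.
  by rewrite (eqp_dvdl _ (_ : B' %= 1)) ?dvd1p // -size_poly_eq1.
have /dvdpP[Z eZ] := dv.
have [M hM] := nat_roots_bounded b0.
have [z ez] : exists z, Z = map_poly i z.
  apply: (interpolation (M := M)) => c Mc.
  have bc := hM _ Mc.
  have [|d ed] := nR a.[c%:R] b.[c%:R] N (fun j => (r j).[c%:R]) bc.
    have := congr1 (fun p => p.[c%:R]) e; rewrite hornerXn_comm || rewrite horner_exp => ->.
    rewrite horner_sum; apply: eq_bigr => j _.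
    by rewrite !hornerM !horner_exp.
  exists d.
  have hc (p : {poly R}) : (f p).[c%:R] = i p.[c%:R].
    by rewrite -(rmorph_nat i) horner_map.
  have := congr1 (fun p => p.[c%:R]) eZ; rewrite hornerM !hc ed rmorphM mulrC.
  by move/mulIf => -> //; rewrite -(rmorph0 i) (inj_eq ii).
exists z; apply: fi; rewrite eZ ez mulrC; exact/esym/(rmorphM (map_poly i)).
Qed.
End NormalPoly.

Section NoetherNormalization.
Variables (K : fieldType) (k0 : subr K).
Hypothesis k0V : forall u, k0 u -> k0 u^-1.
Hypothesis char0 : forall n, n.+1%:R != 0 :> K.

(** Nagata's change of variables, the new generators that accompany [y]. *)
Definition nagata (zs : seq K) (ws : seq nat) (y : K) := [seq p.1 - y ^+ p.2 | p <- zip zs ws].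

Lemma nagata_adj zs ws y u : size ws = size zs ->
  adj k0 (zs ++ [:: y]) u -> exists2 g, pcoef (adj k0 (nagata zs ws y)) g & u = g.[y].
Proof.
move=> sw; apply: (@adj_min _ k0 (adj1 (adj k0 (nagata zs ws y)) y)).
  by move=> x kx; apply: adj1_sub; exact: adj_sub.
move=> b; rewrite mem_cat inE => /orP[|/eqP->]; last exact: adj1_mem.
move/(nthP 0) => [i iz <-].
have -> : zs`_i = (zs`_i - y ^+ nth 0%N ws i) + y ^+ nth 0%N ws i by rewrite subrK.
apply: srD; last by apply: srX; exact: adj1_mem.
apply: adj1_sub; apply: adj_mem; apply/(nthP 0).
exists i; first by rewrite size_map size_zip sw minnn.
by rewrite (nth_map (0, 0%N)) ?size_zip ?sw ?minnn // nth_zip.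
Qed.

(** [R] is the polynomial ring over [k0] in as many variables as there are generators and [i] is
    evaluation. The last clause is Nagata's trick: with suitable exponents, every nonzero [F]
    becomes a polynomial in [y] over the new generators with leading coefficient in [k0]. *)
Lemma poly_model zs y : exists (R : idomainType) (i : {rmorphism R -> K}),
  [/\ forall n, n.+1%:R \is a @GRing.unit R, nrm R,
      forall u, adj k0 (zs ++ [:: y]) u <-> exists r, u = i r
    & forall F, F != 0 -> exists2 ws, size ws = size zs & exists g,
        [/\ pcoef (adj k0 (nagata zs ws y)) g, k0 (lead_coef g), g != 0 & g.[y] = i F]].
Proof.
elim: zs => [|z zs [R [i [uR nR rR hR]]]].
  pose k := sub_of k0.
  have uk n : n.+1%:R \is a @GRing.unit k.
    by apply/sub_unitP; rewrite rmorph_nat; split=> //; apply: k0V; exact: sr_nat.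
  have nk : nrm k.
    move=> a b N r b0 _; exists (b^-1 * a); rewrite mulrA divrr ?mul1r //.
    apply/sub_unitP; split; last by apply: k0V; exact: sub_valP.
    by rewrite -(sub_val0 k0) (inj_eq val_inj).
  exists {poly k}, (horner_eval y \o map_poly (val : k -> K)); split.
  - by move=> n; rewrite -(rmorph_nat (@polyC k)); apply: rmorph_unit; exact: uk.
  - exact: nrm_poly.
  - move=> u; split=> [[p /pcoef_lift[q eq] ->]|[r ->]].
      by exists q; rewrite /= /horner_eval -eq.
    by exists (map_poly val r) => //; exact: pcoef_map.
  - move=> F F0; exists [::] => //; exists (map_poly val F); split=> //.
    + exact: pcoef_map.
    + by rewrite lead_coef_map_inj; [exact: sub_valP|exact: val_inj|].
    + by rewrite -(rmorph0 (map_poly (val : k -> K))) (inj_eq (map_inj_poly val_inj _)).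
exists {poly R}, (horner_eval z \o map_poly i); split.
- by move=> n; rewrite -(rmorph_nat (@polyC R)); apply: rmorph_unit; exact: uR.
- exact: nrm_poly.
- move=> u; split=> [[p hp ->]|[r ->]].
    have /choice[c hc] : forall j, exists c, p`_j = i c by move=> j; apply/rR; exact: hp.
    exists (\poly_(j < size p) c j); rewrite /= /horner_eval; congr (_.[_]).
    apply/polyP => j; rewrite coef_map coef_poly; case: ltnP => h; first exact: hc.
      by rewrite nth_default //; exact/esym/rmorph0.
  exists (map_poly i r) => // j; rewrite coef_map /=; apply/rR; by exists r`_j.
move=> F F0.
have ld0 : lead_coef F != 0 by rewrite lead_coef_eq0.
have [ws sw [gd [hgd kgd gd0 egd]]] := hR _ ld0.
have /choice[G0 hG0] : forall j, exists g, pcoef (adj k0 (nagata zs ws y)) g /\ i F`_j = g.[y].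
  move=> j; have [|g h1 h2] := @nagata_adj zs ws y (i F`_j) sw; first by apply/rR; exists F`_j.
  by exists g.
pose d := (size F).-1.
have sF : size F = d.+1 by rewrite prednK // lt0n size_poly_eq0.
pose G j := if j == d then gd else G0 j.
have hG j : pcoef (adj k0 (nagata zs ws y)) (G j) /\ i F`_j = (G j).[y].
  rewrite /G; case: eqP => [->|_]; last exact: hG0.
  by split=> //; rewrite egd.
(* With [w] at least the size of each lower [G j], the term in M^d, of degree at least w d,
   outweighs each G_j M^j with j < d. *)
pose w := (\sum_(j < d) size (G j)).+1.
pose c := z - y ^+ w.
pose M := 'X^w + c%:P.
have mM : M \is monic by apply: monicXnaddC.
have sM : size M = w.+1 by rewrite size_XnaddC.
have sMj j : size (M ^+ j) = (w * j).+1.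
  have := size_exp M j; rewrite sM /= => <-.
  by rewrite prednK // lt0n size_poly_eq0 expf_neq0 // monic_neq0.
exists (w :: ws); first by rewrite /= sw.
pose L := \sum_(j < d) G j * M ^+ j.
exists (G d * M ^+ d + L).
have Gd : G d = gd by rewrite /G eqxx.
have sT : size (G d * M ^+ d) = (size gd + w * d)%N.
  by rewrite size_Mmonic ?monic_exp // Gd // sMj addnS.
have sgd : (0 < size gd)%N by rewrite lt0n size_poly_eq0.
have sL : (size L < size (G d * M ^+ d)%R)%N.
  rewrite sT; apply: leq_trans (_ : (w * d).+1 <= _)%N; last by lia.
  rewrite ltnS; apply: leq_trans (size_sum _ _ _) _; apply/bigmax_leqP => j _.
  apply: leq_trans (size_polyMleq _ _) _; rewrite sMj addnS /=.
  have : (size (G j) <= w)%N.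
    by rewrite /w (bigD1 j) //=; apply: leq_trans (leqnSn _); exact: leq_addr.
  have jd := ltn_ord j; have : (w * j + w <= w * d)%N by rewrite -mulnSr leq_mul2l jd orbT.
  by move=> h1 h2; apply: leq_trans h1; rewrite addnC leq_add2l.
have lT : lead_coef (G d * M ^+ d + L) = lead_coef gd.
  by rewrite lead_coefDl // Gd lead_coef_Mmonic // monic_exp.
split.
- change (pcoef (adj1 (adj k0 (nagata zs ws y)) c) (G d * M ^+ d + L)).
  have hM : pcoef (adj1 (adj k0 (nagata zs ws y)) c) M.
    apply: pcoefD; first by apply: pcoefXn; exact: pcoefX.
    by apply: pcoefC; exact: adj1_mem.
  have hGM j : pcoef (adj1 (adj k0 (nagata zs ws y)) c) (G j * M ^+ j).
    apply: pcoefM; last exact: pcoefXn.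
    by move=> l; apply: adj1_sub; exact: (hG j).1.
  by apply: pcoefD => //; apply: pcoef_sum => j _; exact: hGM.
- by rewrite lT.
- by rewrite -lead_coef_eq0 lT lead_coef_eq0.
- have hM : M.[y] = z by rewrite hornerD hornerXn hornerC /c addrC subrK.
  have hj j : (G j * M ^+ j).[y] = i F`_j * z ^+ j by rewrite hornerM horner_exp hM (hG j).2.
  rewrite /= /horner_eval /map_poly horner_poly sF big_ord_recr /= hornerD hj addrC.
  by congr (_ + _); rewrite horner_sum; apply: eq_bigr => j _; exact: hj.
Qed.

(** Only normality of [S] is needed, not a presentation by independent variables. Either evaluation
    on the polynomial ring is injective and the algebra is itself normal, or a relation makes [y]
    integral over the Nagata generators, one fewer in number. *)
Theorem noether_normalization s : exists S : subr K,
  [/\ forall u, k0 u -> S u, forall u, S u -> adj k0 s u, normalS S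
    & forall u, adj k0 s u -> integ S u].
Proof.
have [n] := ubnP (size s); elim: n s => // n IH s.
case/lastP: s => [_|zs y sn].
  exists k0; split=> //; last by move=> u; exact: integ_mem.
  by move=> a b ka kb _ _; apply: srM => //; exact: k0V.
rewrite -cats1.
have [R [i [uR nR rR hR]]] := poly_model zs y.
case: (pselect (injective i)) => [ii|ni].
  exists (adj k0 (zs ++ [:: y])); split=> //; last by move=> u; exact: integ_mem.
    by move=> u; exact: adj_sub.
  move=> _ _ /rR[a ->] /rR[b ->] b0 [p [mp hp rp]].
  have b0' : b != 0 by apply: contraNneq b0 => ->; rewrite rmorph0.
  pose N := (size p).-1.
  have sp : size p = N.+1 by rewrite prednK // lt0n size_poly_eq0 monic_neq0.
  have /choice[r hr] : forall j, exists r, - p`_j = i r.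
    by move=> j; apply/rR; apply: srN; exact: hp.
  have [|c ->] := nR a b N r b0'; last first.
    by apply/rR; exists c; rewrite rmorphM mulrC mulKf.
  apply: ii; rewrite rmorph_sum rmorphXn.
  move: rp; rewrite /root horner_coef sp big_ord_recr /=.
  rewrite -[N]/(size p).-1 (eqP mp : p`_(size p).-1 = 1) mul1r -/N addrC addr_eq0 => /eqP e.
  rewrite -(divfK b0 (i a)) exprMn e mulNr big_distrl -sumrN /=.
  apply: eq_bigr => j _; rewrite !rmorphM !rmorphXn -hr.
  have -> : i b ^+ N = i b ^+ j * i b ^+ (N - j) by rewrite -exprD subnKC // ltnW.
  have e1 : (i a / i b) ^+ j * i b ^+ j = i a ^+ j by rewrite -exprMn divfK.
  by rewrite -e1; ring.
have [F F0 iF] : exists2 F, F != 0 & i F = 0.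
  apply: contrapT => h; apply: ni => x y' e; apply/eqP; rewrite -subr_eq0; apply/eqP.
  by apply: contrapT => /eqP d; apply: h; exists (x - y') => //; rewrite rmorphB e subrr.
have [ws sw [g [hg kg g0 eg]]] := hR _ F0.
set zs' := nagata zs ws y in hg.
have lg : lead_coef g != 0 by rewrite lead_coef_eq0.
have [|S [kS SA nS AS]] := IH zs'.
  by move: sn; rewrite size_rcons /zs' size_map size_zip sw minnn ltnS.
have yi : integ (adj k0 zs') y.
  exists ((lead_coef g)^-1 *: g); split.
  - by rewrite monicE lead_coefZ mulVf.
  - by apply: pcoefZ => //; apply: adj_sub; exact: k0V.
  - by rewrite /root hornerZ eg iF mulr0.
exists S; split=> // u.
  move/SA; apply: (@adj_min _ k0 (adj k0 (zs ++ [:: y]))) => [x|b /(nthP (0 : K))[j]].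
    exact: adj_sub.
  rewrite /zs' size_map size_zip sw minnn => jz <-.
  rewrite (nth_map (0, 0%N)) ?size_zip ?sw ?minnn // nth_zip //=.
  apply: srB; last by apply: srX; apply: adj_mem; rewrite mem_cat mem_head orbT.
  by apply: adj_mem; rewrite mem_cat mem_nth.
have hu : adj k0 (zs ++ [:: y]) u -> integ (adj k0 zs') u.
  apply: (@adj_min _ k0 (intcl (adj k0 zs'))) => [x kx|b].
    by apply: integ_mem; exact: adj_sub.
  rewrite mem_cat inE => /orP[|/eqP-> //] /(nthP 0)[j jz <-].
  have -> : zs`_j = (zs`_j - y ^+ nth 0%N ws j) + y ^+ nth 0%N ws j by rewrite subrK.
  apply: (@srD _ (intcl _)); last exact: (@srX _ (intcl _)).
  apply: integ_mem; apply: adj_mem; apply/(nthP 0).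
  exists j; first by rewrite size_map size_zip sw minnn.
  by rewrite (nth_map (0, 0%N)) ?size_zip ?sw ?minnn // nth_zip.
by move/hu/(@integ_sub _ _ (intcl S) AS); exact: integ_trans.
Qed.

End NoetherNormalization.

(** * Splitting fields, minimal polynomials and the conductor *)

Lemma splitting_field (K : fieldType) (P : {poly K}) : P \is monic ->
  exists (E : fieldType) (h : {rmorphism K -> E}) (s : seq E),
    map_poly h P = \prod_(a <- s) ('X - a%:P).
Proof.
have [n] := ubnP (size P); elim: n K P => // n IH K P sP mP.
have [s1|s1] := leqP (size P) 1.
  exists K, idfun, [::]; rewrite big_nil map_poly_id //.
  by have e := size1_polyC s1; move: mP; rewrite monicE e lead_coefC => /eqP ->.
(* A nonconstant divisor of least degree is irreducible; one of its roots is adjoined. *)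
have [q [qP sq hq]] : exists q, [/\ q %| P, (1 < size q)%N &
    forall q', q' %| P -> (1 < size q')%N -> (size q <= size q')%N].
  have ex : exists m, `[< exists q, [/\ q %| P, (1 < size q)%N & size q = m] >].
    by exists (size P); apply/asboolP; exists P.
  case: (ex_minnP ex) => m /asboolP[q [qP sq <-]] h; exists q; split=> // q' q'P sq'.
  by apply: h; apply/asboolP; exists q'.
have P0 : P != 0 by exact: monic_neq0.
have irr : irreducible_poly q.
  split=> // q' s' dq; rewrite -dvdp_size_eqp // eqn_leq (dvdp_leq _ dq) /=; last first.
    by rewrite -size_poly_gt0 ltnW.
  apply: hq; first exact: dvdp_trans dq qP.
  rewrite ltn_neqAle eq_sym s' size_poly_gt0; apply: contraTneq dq => ->.
  by rewrite dvd0p -size_poly_gt0 ltnW.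
have [L _ [z rz _]] := irredp_FAdjoin irr.
pose i : {rmorphism K -> L} := in_alg L.
have : root (map_poly i P) z.
  by apply: dvdp_trans_root rz _ || (have /dvdpP[r ->] := qP; rewrite rmorphM rootM rz orbT).
case/factor_theorem => Q eQ.
have mQ : Q \is monic by rewrite -(monicMr _ (monicXsubC z)) -eQ map_monic.
have [|E [h [s es]]] := IH L Q _ mQ.
  by rewrite -ltnS; apply: leq_trans sP; rewrite -(size_map_poly i) eQ size_Mmonic ?monicXsubC ?monic_neq0 // size_XsubC addn2.
exists E, (h \o i), (rcons s (h z)).
rewrite map_poly_comp eQ rmorphM /= es rmorphB /= map_polyX map_polyC /=.
by rewrite -cats1 big_cat big_seq1.
Qed.

Section MinPoly.
Variables (E : fieldType).

Lemma pcoef_div (L : subr E) (P : {poly E}) : P \is monic -> pcoef L P ->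
  forall g, pcoef L g -> exists q r, [/\ pcoef L q, pcoef L r, g = q * P + r & (size r < size P)%N].
Proof.
move=> mP hP g; have [n] := ubnP (size g); elim: n g => // n IH g sg hg.
have [h|h] := ltnP (size g) (size P).
  by exists 0, g; rewrite mul0r add0r; split=> //; exact: pcoef0.
have P0 : P != 0 by exact: monic_neq0.
have g0 : g != 0 by rewrite -size_poly_gt0 (leq_trans _ h) // size_poly_gt0.
pose m := lead_coef g *: 'X^(size g - size P).
have hm : pcoef L m.
  by apply: pcoefZ; [exact: hg|apply: pcoefXn; exact: pcoefX].
have sm : size (m * P) = size g.
  rewrite -scalerAl size_scale ?lead_coef_eq0 // size_Mmonic ?monicXn ?monic_neq0 ?monicXn //.
  by rewrite size_polyXn addSn /= subnK.
have [||q [r [hq hr e sr]]] := IH (g - m * P).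
- rewrite -ltnS; apply: leq_trans sg; rewrite ltnS.
  have : (size (g - m * P)%R <= size g)%N.
    by apply: leq_trans (size_polyD _ _) _; rewrite size_polyN sm maxnn.
  rewrite leq_eqVlt => /orP[/eqP es|//].
  have gs : (0 < size g)%N by rewrite size_poly_gt0.
  have : (g - m * P)`_(size g).-1 = 0.
    rewrite coefB -{2}sm -[(m * P)`__]/(lead_coef (m * P)) lead_coef_Mmonic //.
    by rewrite lead_coefZ lead_coefXn mulr1 -/(lead_coef g) subrr.
  by rewrite -{1}es -/(lead_coef _) => /eqP; rewrite lead_coef_eq0 -size_poly_eq0 es; case: (size g) gs.
- by apply: pcoefB => //; exact: pcoefM.
exists (m + q), r; split=> //; first exact: pcoefD.
by rewrite mulrDl -addrA -e addrC subrK.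
Qed.

Definition minpoly (L : subr E) (b : E) (P : {poly E}) :=
  [/\ P \is monic, pcoef L P, root P b
    & forall q, pcoef L q -> root q b -> exists2 q', pcoef L q' & q = q' * P].

Lemma minpoly_exists (L : subr E) b q : (forall u, L u -> L u^-1) ->
  q != 0 -> pcoef L q -> root q b -> exists P, minpoly L b P.
Proof.
move=> LV q0 hq rq.
have ex : exists m, `[< exists q, [/\ q != 0, pcoef L q, root q b & size q = m] >].
  by exists (size q); apply/asboolP; exists q.
case: (ex_minnP ex) => m /asboolP[p [p0 hp rp sp]] hm.
have lp : lead_coef p != 0 by rewrite lead_coef_eq0.
exists ((lead_coef p)^-1 *: p).
have mP : (lead_coef p)^-1 *: p \is monic by rewrite monicE lead_coefZ mulVf.
have hP : pcoef L ((lead_coef p)^-1 *: p) by apply: pcoefZ => //; apply: LV; exact: hp.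
split=> //; first by rewrite /root hornerZ (eqP rp) mulr0.
move=> f hf rf; have [d [r [hd hr e sr]]] := pcoef_div mP hP hf.
exists d => //; rewrite e; suff -> : r = 0 by rewrite addr0.
apply/eqP; apply: contraTT sr => r0; rewrite -leqNgt size_scale ?invr_eq0 // sp.
apply: hm; apply/asboolP; exists r; split=> //.
move: rf; rewrite /root e hornerD hornerM hornerZ (eqP rp) mulr0 mulr0 add0r //.
Qed.

Lemma minpoly_deriv (L : subr E) b P : (forall n, n.+1%:R != 0 :> E) -> minpoly L b P ->
  P^`() != 0 /\ ~~ root P^`() b.
Proof.
move=> char0 [mon hP rP hm].
have P0 : P != 0 by exact: monic_neq0.
have s1 : (1 < size P)%N.
  by rewrite (root_size_gt1 P0 rP).
have d0 : P^`() != 0.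
  apply/eqP => /polyP/(_ (size P).-2); rewrite coef_deriv coef0 prednK -?subn1 ?subn_gt0 //.
  rewrite subn1 (eqP mon : P`_(size P).-1 = 1) => /eqP; apply/negP.
  by rewrite -(prednK (_ : 0 < (size P).-1)%N) ?char0 // -ltnS prednK // ltnW.
split=> //; apply/negP => rd.
have [q' hq' e] := hm _ (pcoef_deriv hP) rd.
have := lt_size_deriv P0; rewrite e size_Mmonic //; last by apply: contraNneq d0; rewrite e => ->; rewrite mul0r.
have : (0 < size q')%N by rewrite size_poly_gt0; apply: contraNneq d0; rewrite e => ->; rewrite mul0r.
by case: (size q') => // m _; rewrite addSn /= ltnNge leq_addl.
Qed.

End MinPoly.

Lemma uniq_rem (T : eqType) (s : seq T) : (forall a, a \in s -> a \notin rem a s) -> uniq s.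
Proof.
elim: s => //= x s IH h.
have xs : x \notin s by have := h x (mem_head _ _); rewrite eqxx.
rewrite xs; apply: IH => a as_.
have := h a; rewrite inE as_ orbT => /(_ isT).
case: eqP => [e|_]; first by rewrite -e (negPf xs) in as_.
by rewrite inE negb_or => /andP[].
Qed.

Section ConductorSplit.
Variables (E : fieldType) (A : subr E) (b : E) (P : {poly E}) (s : seq E).
Hypothesis char0 : forall n, n.+1%:R != 0 :> E.
Hypothesis nA : normalS A.
Hypothesis ib : integ A b.
Hypothesis mP : minpoly (fracf A) b P.
Hypothesis eP : P = \prod_(a <- s) ('X - a%:P).

Let L := fracf A.

(** [P] divides [F], so a relation over [L] passes from [b] to its conjugates. *)
Lemma split_conj F a : pcoef L F -> root F b -> a \in s -> root F a.
Proof.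
move=> hF rF as_; have [_ _ _ /(_ F hF rF)[q _ ->]] := mP.
by rewrite rootM eP root_prod_XsubC as_ orbT.
Qed.

Lemma pcoefA_L F : pcoef A F -> pcoef L F.
Proof. by move=> h i; apply: fracf_sub; exact: h. Qed.

Lemma split_integ a : a \in s -> integ A a.
Proof.
move=> as_; have [F [mF hF rF]] := ib.
by exists F; split=> //; apply: split_conj => //; exact: pcoefA_L.
Qed.

Lemma split_intcl (t : seq E) : {subset t <= s} -> pcoef (intcl A) (\prod_(a <- t) ('X - a%:P)).
Proof.
elim: t => [|a t IH] h; first by rewrite big_nil; exact: pcoef1.
rewrite big_cons; apply: pcoefM; last by apply: IH => x xt; apply: h; rewrite inE xt orbT.
by apply: pcoefB; [exact: pcoefX|apply: pcoefC; apply: split_integ; apply: h; rewrite mem_head].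
Qed.

Lemma normal_pcoef F : pcoef L F -> pcoef (intcl A) F -> pcoef A F.
Proof. by move=> h1 h2 i; apply: (normal_mem nA); [exact: h1|exact: h2]. Qed.

Lemma split_rem a : a \in s -> P = ('X - a%:P) * \prod_(x <- rem a s) ('X - x%:P).
Proof. by move=> as_; rewrite eP (perm_big _ (perm_to_rem as_)) big_cons. Qed.

Lemma split_deriv a : a \in s -> P^`().[a] = (\prod_(x <- rem a s) ('X - x%:P)).[a].
Proof.
move=> /split_rem ->; rewrite derivM derivXsubC hornerD !hornerM hornerXsubC subrr mul0r addr0.
by rewrite hornerC mul1r.
Qed.

(** The minimal polynomial of a double root divides both [P] and its derivative. By minimality of
    [P] it vanishes at [b], and then so does the derivative, which is excluded in characteristic
    zero. *)
Lemma split_uniq : uniq s.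
Proof.
apply: uniq_rem => a as_; apply/negP => ar.
have [mon hP rP hm] := mP.
have P0 : P != 0 by exact: monic_neq0.
have da : root P^`() a by rewrite /root split_deriv // -/(root _ a) root_prod_XsubC.
have Pa : root P a by rewrite eP root_prod_XsubC.
have [M [mM hM rM hMm]] := minpoly_exists (@fracf_inv _ A) P0 hP Pa.
have [q1 hq1 e1] := hMm _ hP Pa.
have [q2 hq2 e2] := hMm _ (pcoef_deriv hP) da.
have [d0 nd] := minpoly_deriv char0 mP.
move: rP; rewrite e1 rootM => /orP[r1|rMb].
  have [q4 hq4 e4] := hm _ hq1 r1.
  have e5 : q4 * M = 1.
    by apply: (mulfI P0); rewrite mulr1 {2}e1 {1}e4; ring.
  have := congr1 (fun p => p.[a]) e5; rewrite hornerM (eqP rM) mulr0 hornerC => /eqP.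
  by rewrite eq_sym oner_eq0.
by case/negP: nd; rewrite e2 rootM rMb orbT.
Qed.

(** Euler's formula: P'(b) g(b) is the value at [b] of the Lagrange sum over the roots a of g(a)
    times the product of the X - x, x a root other than a. Its coefficients are integral over [A],
    and they lie in [L] because the sum is also the remainder of g P' modulo [P]; by normality they
    are in [A]. *)
Lemma conductor_split : pcoef A P /\ forall g, pcoef L g -> integ A g.[b] ->
  exists2 G, pcoef A G & G.[b] = P^`().[b] * g.[b].
Proof.
have [mon hP rP hm] := mP.
split; first by apply: normal_pcoef => //; rewrite eP; exact: split_intcl.
move=> g hg ig.
have ga a : a \in s -> integ A g.[a].
  have [F [mF hF rF]] := ig => as_; exists F; split=> //.
  rewrite /root -horner_comp; apply: split_conj => //; last by rewrite /root horner_comp.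
  rewrite /comp_poly horner_coef; apply: pcoef_sum => i _; apply: pcoefM; last exact: pcoefXn.
  by rewrite coef_map; apply: pcoefC; apply: fracf_sub; exact: hF.
have [Q [G [hQ hG eG sG]]] := pcoef_div mon hP (pcoefM hg (pcoef_deriv hP)).
pose R a := \prod_(x <- rem a s) ('X - x%:P).
pose H : {poly E} := \sum_(a <- s) (g.[a])%:P * R a.
have sP : size P = (size s).+1 by rewrite eP size_prod_XsubC.
have sH : (size H <= size s)%N.
  rewrite /H big_seq; elim/big_ind: _ => [|p q hp hq|a as_]; first by rewrite size_poly0.
    by apply: leq_trans (size_polyD _ _) _; rewrite geq_max hp.
  rewrite mul_polyC; apply: leq_trans (size_scale_leq _ _) _; rewrite size_prod_XsubC size_rem //.
  by rewrite prednK //; case: (s) as_.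
have ev a : a \in s -> G.[a] = H.[a].
  move=> as_; have Pa : P.[a] = 0 by apply/eqP; rewrite -/(root P a) eP root_prod_XsubC.
  have := congr1 (fun p => p.[a]) eG; rewrite hornerD !hornerM Pa mulr0 add0r => <-.
  rewrite split_deriv // -/(R a) /H horner_sum (bigD1_seq a) ?split_uniq //.
  rewrite [X in _ = _ X _]hornerM hornerC big_seq_cond big1; first exact/esym/addr0.
  move=> x /andP[xs xa]; rewrite hornerM (_ : (R x).[a] = 0) ?mulr0 //.
  by apply/eqP; rewrite -/(root _ a) root_prod_XsubC mem_rem_uniq ?split_uniq // inE eq_sym xa.
have GH : G = H.
  apply/eqP; rewrite -subr_eq0; apply/eqP.
  apply: (@roots_geq_poly_eq0 _ _ s); last 1 first.
  - apply: leq_trans (size_polyD _ _) _; rewrite geq_max size_polyN sH andbT.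
    by rewrite -ltnS -sP.
  - by apply/allP => a as_; rewrite /root hornerD hornerN ev // subrr.
  - exact: split_uniq.
exists G.
  apply: normal_pcoef => //; rewrite GH /H big_seq; apply: pcoef_sum => a as_.
  apply: pcoefM; first by apply: pcoefC; exact: ga.
  by apply: split_intcl => x /mem_rem.
have := congr1 (fun p => p.[b]) eG; rewrite hornerD !hornerM (eqP rP) mulr0 add0r => <-.
by rewrite mulrC.
Qed.
End ConductorSplit.

Section Image.
Variables (K E : fieldType) (h : {rmorphism K -> E}).

Definition imS (A : subr K) : subr E.
Proof.
exists (h @` A).
- by exists 1; [exact: sr1|exact: rmorph1].
- by move=> _ _ [u Au <-] [v Av <-]; exists (u - v); [exact: srB|exact: rmorphB].
- by move=> _ _ [u Au <-] [v Av <-]; exists (u * v); [exact: srM|exact: rmorphM].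
Defined.

Lemma pcoef_imS A q : pcoef (imS A) q <-> exists2 p, pcoef A p & q = map_poly h p.
Proof.
split=> [hq|[p hp ->] i]; last by exists p`_i; [exact: hp|rewrite coef_map].
have /choice[c hc] : forall i, exists c, A c /\ h c = q`_i by move=> i; have [c Ac e] := hq i; exists c.
exists (\poly_(i < size q) c i).
  by move=> i; rewrite coef_poly; case: ifP => _; [exact: (hc i).1|exact: sr0].
apply/polyP => i; rewrite coef_map coef_poly; case: ltnP => hi; first by rewrite /= (hc i).2.
by rewrite nth_default //=; exact/esym/rmorph0.
Qed.

Lemma integ_imS A u : integ (imS A) (h u) <-> integ A u.
Proof.
split=> [[q [mq /pcoef_imS[p hp eq] rq]]|[p [mp hp rp]]].
  exists p; split=> //; first by rewrite -(map_monic h) -eq.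
  by move: rq; rewrite eq /root horner_map fmorph_eq0.
exists (map_poly h p); split; [by rewrite map_monic|by apply/pcoef_imS; exists p|].
by rewrite /root horner_map fmorph_eq0.
Qed.

Lemma fracf_imS A u : fracf (imS A) u <-> imS (fracf A) u.
Proof.
split=> [[_ [_ [[a Aa <-] [t At <-] t0 ->]]]|[_ [a [t [Aa At t0 ->]] <-]]].
  exists (a / t); last exact: fmorph_div.
  by exists a, t; split=> //; apply: contraNneq t0 => ->; rewrite rmorph0.
exists (h a), (h t); split; [by exists a|by exists t|by rewrite fmorph_eq0|exact: fmorph_div].
Qed.

Lemma normal_imS (A : subr K) : normalS A -> normalS (imS A).
Proof.
move=> nA _ _ [a Aa <-] [t At <-] t0; rewrite -fmorph_div => /integ_imS hi.
by exists (a / t) => //; apply: nA => //; apply: contraNneq t0 => ->; rewrite rmorph0.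
Qed.

End Image.

Section Conductor.
Variables (K : fieldType).
Hypothesis char0 : forall n, n.+1%:R != 0 :> K.

(** [conductor_split] is applied to the images in a splitting field of the minimal polynomial;
    integrality and membership descend along the injective map [h]. *)
Lemma conductor_step (A : subr K) b : normalS A -> integ A b ->
  exists c, [/\ c != 0, adj1 A b c
    & forall z, adj1 (fracf A) b z -> integ A z -> adj1 A b (c * z)].
Proof.
move=> nA ib; have [F [mF hF rF]] := ib.
have [P mP] : exists P, minpoly (fracf A) b P.
  apply: (minpoly_exists (@fracf_inv _ A) (monic_neq0 mF)) rF.
  by move=> i; apply: fracf_sub; exact: hF.
have [mon hP rP hm] := mP.
have [E [h [s es]]] := splitting_field mon.
have char0E n : n.+1%:R != 0 :> E by rewrite -(rmorph_nat h) fmorph_eq0.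
have L1 p : pcoef (fracf (imS h A)) p <-> exists2 q, pcoef (fracf A) q & p = map_poly h q.
  rewrite -pcoef_imS; split=> hp i; by apply/fracf_imS; exact: hp.
have mPh : minpoly (fracf (imS h A)) (h b) (map_poly h P).
  split; [by rewrite map_monic|by apply/L1; exists P|by rewrite /root horner_map fmorph_eq0|].
  move=> q /L1[q0 hq0 ->]; rewrite /root horner_map fmorph_eq0 => rq.
  have [q' hq' ->] := hm _ hq0 rq.
  by exists (map_poly h q'); [apply/L1; exists q'|rewrite rmorphM].
have ibh : integ (imS h A) (h b) by apply/integ_imS.
have [/pcoef_imS[P1 hP1 eP1] hc] := conductor_split char0E (normal_imS nA) ibh mPh es.
have hPA : pcoef A P by rewrite (map_poly_inj h eP1).
have [_ nd] := minpoly_deriv char0E mPh.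
exists P^`().[b]; split.
- by move: nd; rewrite deriv_map /root horner_map fmorph_eq0.
- by exists P^`() => //; exact: pcoef_deriv.
- move=> _ [g hg ->] ig.
  have [||G /pcoef_imS[G0 hG0 ->]] := hc (map_poly h g).
  + by apply/L1; exists g.
  + by rewrite horner_map; apply/integ_imS.
  rewrite deriv_map !horner_map -rmorphM => /fmorph_inj <-.
  by exists G0.
Qed.

Lemma fracf_adj1 (A : subr K) b : integ A b ->
  forall u, fracf (adj1 A b) u -> adj1 (fracf A) b u.
Proof.
move=> ib; apply: fracf_min.
  by move=> u [p hp ->]; exists p => // i; apply: fracf_sub; exact: hp.
move=> u hu; have iu : integ (fracf A) u.
  apply: (adj_integ (s := [:: b])) hu => x; rewrite inE => /eqP->.
  by apply: integ_sub ib => y; exact: fracf_sub.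
apply: (adj1_min _ hu); last exact: integ_field_inv (@fracf_inv _ A) iu.
by move=> x; exact: adj1_sub.
Qed.

Definition nclos (S L : subr K) : subr K.
Proof.
exists [set u | L u /\ integ S u].
- by split; [exact: sr1|apply: integ_mem; exact: sr1].
- by move=> u v [Lu Su] [Lv Sv]; split; [exact: srB|exact: (@srB _ (intcl S))].
- by move=> u v [Lu Su] [Lv Sv]; split; [exact: srM|exact: (@srM _ (intcl S))].
Defined.

(** [conductor_step] requires a normal base, so each generator [b] is adjoined to the normalization
    [T] of the previous ring rather than to that ring. The previous conductor [c1] carries [T] back
    into the ring, and the conductors multiply. *)
Theorem conductor_tower (S : subr K) s : normalS S -> (forall b, b \in s -> integ S b) ->
  exists c, [/\ c != 0, adj S s c
    & forall z, fracf (adj S s) z -> integ S z -> adj S s (c * z)].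
Proof.
move=> nS; elim: s => [|b s IH] hs.
  exists 1; split; [exact: oner_neq0|exact: sr1|move=> z [a [t [Aa At t0 ->]]] hz].
  by rewrite mul1r; exact: nS.
have [|c1 [c10 Sc1 hc1]] := IH; first by move=> x xs; apply: hs; rewrite inE xs orbT.
pose T := nclos S (fracf (adj S s)).
have ST u : S u -> T u.
  by move=> Su; split; [apply: fracf_sub; exact: adj_sub|exact: integ_mem].
have iT u : integ T u -> integ S u.
  move=> h; apply: integ_trans; apply: (integ_sub (B := intcl S)) h => x; by case.
have adjT u : adj S s u -> T u.
  move=> hu; split; first exact: fracf_sub.
  by apply: adj_integ hu => x xs; apply: hs; rewrite inE xs orbT.
have nT : normalS T.
  move=> a t [La _] [Lt _] t0 h; split; last exact: iT.
  exact: fracf_div.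
have ibT : integ T b by apply: integ_sub ST _ _; apply: hs; rewrite mem_head.
have [c2 [c20 Tc2 hc2]] := conductor_step nT ibT.
have main u : adj1 T b u -> adj S (b :: s) (c1 * u).
  move=> [p hp ->] /=; exists (c1 *: p); last by rewrite hornerZ.
  by move=> i; rewrite coefZ; case: (hp i); exact: hc1.
exists (c1 * c2); split; [by rewrite mulf_neq0|exact: main|].
move=> z fz iz; rewrite -mulrA; apply: main; apply: hc2; last exact: integ_sub ST _ iz.
apply: (@fracf_adj1 T b ibT); apply: fracf_mono fz => u.
apply: (@adj1_min _ (adj S s) (adj1 T b) b); last exact: adj1_mem.
by move=> x /adjT; exact: adj1_sub.
Qed.

Theorem conductor (k0 : subr K) s : (forall u, k0 u -> k0 u^-1) ->
  exists c, [/\ c != 0, adj k0 s c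
    & forall z, fracf (adj k0 s) z -> integ (adj k0 s) z -> adj k0 s (c * z)].
Proof.
move=> k0V; have [S [kS SA nS AS]] := noether_normalization k0V char0 s.
have [|c [c0 hc1 hc2]] := @conductor_tower S s nS.
  by move=> b bs; apply: AS; exact: adj_mem.
have e1 u : adj S s u -> adj k0 s u by apply: adj_min => // b; exact: adj_mem.
have e2 u : adj k0 s u -> adj S s u.
  by apply: adj_min => [x /kS|b]; [exact: adj_sub|exact: adj_mem].
exists c; split=> //; first exact: e1.
move=> z fz iz; apply: e1; apply: hc2; first exact: fracf_mono fz.
apply: integ_trans; exact: (integ_sub (B := intcl S) AS) iz.
Qed.

End Conductor.

(** * Valuation rings and localizations *)

Lemma zorn_sets (T : Type) (P : set (set T)) (A0 : set T) : P A0 ->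
  (forall F : set (set T), F !=set0 -> F `<=` P -> total_on F subset -> P (\bigcup_(X in F) X)) ->
  exists A, P A /\ forall B, A `<=` B -> P B -> B `<=` A.
Proof.
move=> PA0 hP; pose P' S := S = set0 \/ P S.
have [F FP tF|A [PA hA]] := @Zorn_bigcup T P'.
  pose F' := [set S | F S /\ S <> set0].
  case: (pselect (F' !=set0)) => h; last first.
    left; rewrite -subset0 => x [S FS Sx]; apply: h; exists S; split=> // S0.
    by rewrite S0 in Sx.
  right; have -> : \bigcup_(X in F) X = \bigcup_(X in F') X.
    apply/seteqP; split=> x [S FS Sx]; exists S => //; last by case: FS.
    by split=> // S0; rewrite S0 in Sx.
  apply: hP => //; first by move=> S [/FP[->|]].
  by move=> S S' [FS _] [FS' _]; exact: tF.
have PA' : P A.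
  case: PA => // A0e; rewrite A0e in hA *.
  case: (pselect (A0 = set0)) => [<- //|h].
  case: (hA A0); last by right.
  by split; [exact: sub0set|move=> h'; apply: h; rewrite -subset0].
exists A; split=> // B AB PB; apply: contrapT => nBA.
by apply: (hA B); [split|right].
Qed.

Lemma exprB_split (K : fieldType) (x : K) i n : (i <= n)%N -> x ^+ n = x ^+ (n - i) * x ^+ i.
Proof. by move=> h; rewrite -exprD subnK. Qed.

(** * Domination of a local ring by a valuation ring *)

Section Chevalley.
Variables (K : fieldType) (R : subr K) (P : set K).
Hypothesis pP : prime_of R P.

Inductive pext (S : K -> Prop) : K -> Prop :=
| pext0 : pext S 0
| pextD a s u : P a -> S s -> pext S u -> pext S (a * s + u).

Lemma pext_add S u v : pext S u -> pext S v -> pext S (u + v).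
Proof.
move=> hu hv; elim: hu => [|a s w Pa Ss _ IH]; first by rewrite add0r.
by rewrite -addrA; exact: pextD.
Qed.
Lemma pext_mul (S : subr K) s u : S s -> pext S u -> pext S (s * u).
Proof.
move=> hs; elim=> [|a t w Pa St _ IH]; first by rewrite mulr0; exact: pext0.
rewrite mulrDr mulrCA; apply: pextD => //; exact: srM.
Qed.
Lemma pext_sub (S S' : K -> Prop) u : (forall x, S x -> S' x) -> pext S u -> pext S' u.
Proof. by move=> SS; elim=> [|a s w Pa Ss _ IH]; [exact: pext0|apply: pextD => //; exact: SS]. Qed.
Lemma pext_mem (S : subr K) a : P a -> pext S a.
Proof. by move=> Pa; rewrite -(addr0 a) -(mulr1 a); apply: pextD => //; [exact: sr1|exact: pext0]. Qed.
Lemma pext_sum (S : subr K) I (r : seq I) (Q : pred I) (F : I -> K) :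
  (forall i, Q i -> pext S (F i)) -> pext S (\sum_(i <- r | Q i) F i).
Proof. by move=> h; elim/big_ind: _ => //; [exact: pext0|exact: pext_add]. Qed.
Lemma pext_in (S : subr K) u : (forall x, R x -> S x) -> pext S u -> S u.
Proof.
move=> RS; elim=> [|a s w Pa Ss _ IH]; first exact: sr0.
by apply: srD => //; apply: srM => //; apply: RS; case: pP => [[h _ _ _] _ _]; exact: h.
Qed.

Let R' := loc pP.

(** The rings above the localization in which the extension of [P] is still a proper ideal; a
    maximal one is the valuation ring sought. *)
Definition chev (S : set K) := [/\ R' `<=` S, S 1, forall u v, S u -> S v -> S (u - v),
  forall u v, S u -> S v -> S (u * v) & ~ pext S 1].

Lemma pext_loc u : pext R' u -> exists a s, [/\ P a, R s, ~ P s & u = a / s].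
Proof.
have [[PR P0 PD PM] P1 Pp] := pP.
elim=> [|a s w Pa [b [t [Rb Rt nt ->]]] _ [c [x [Pc Rx nx ->]]]].
  by exists 0, 1; split; rewrite ?divr1 //; exact: sr1.
exists (a * b * x + c * t), (t * x); split.
- have -> : a * b * x + c * t = (b * x) * a + t * c by ring.
  by apply: PD; apply: (PM) => //; exact: srM.
- exact: srM. - exact: (primeM pP).
- by field; rewrite (prime_neq0 pP nt) (prime_neq0 pP nx).
Qed.

Theorem chevalley : exists V : subr K, [/\ forall u, R u -> V u,
  forall t, t != 0 -> V t \/ V t^-1
  & forall a, R a -> (P a <-> ~ (a != 0 /\ V a^-1))].
Proof.
have [[PR P0 PD PM] P1 Pp] := pP.
have [|F [S0 FS0] FP tF|V0 [[RV V1 VB VM nV] maxV]] := @zorn_sets K chev R'.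
- split=> //; [exact: sr1|exact: srB|exact: srM|].
  move=> /pext_loc[a [s [Pa Rs ns e]]]; have s0 := prime_neq0 pP ns.
  by apply: ns; rewrite -[s]mul1r e divfK.
- have two S S' : F S -> F S' -> exists2 S'', F S'' & S `<=` S'' /\ S' `<=` S''.
    by move=> FS FS'; case: (tF _ _ FS FS') => h; [exists S'|exists S] => //; split.
  split.
  - by move=> x Rx; exists S0 => //; case: (FP _ FS0) => h _ _ _ _; exact: h.
  - by exists S0 => //; case: (FP _ FS0).
  - move=> u v [S FS Su] [S' FS' Sv]; have [S'' FS'' [h1 h2]] := two _ _ FS FS'.
    by exists S'' => //; case: (FP _ FS'') => _ _ h _ _; apply: h; [exact: h1|exact: h2].
  - move=> u v [S FS Su] [S' FS' Sv]; have [S'' FS'' [h1 h2]] := two _ _ FS FS'.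
    by exists S'' => //; case: (FP _ FS'') => _ _ _ h _; apply: h; [exact: h1|exact: h2].
  - suff H u : pext (\bigcup_(X in F) X) u -> exists2 S, F S & pext S u.
      by move=> /H[S FS h]; case: (FP _ FS).
    elim=> [|a s w Pa [S FS Ss] _ [S' FS' h]]; first by exists S0 => //; exact: pext0.
    have [S'' FS'' [h1 h2]] := two _ _ FS FS'; exists S'' => //.
    by apply: pextD => //; [exact: h1|exact: pext_sub h2 h].
pose V := Subr V1 VB VM.
have RV' u : R u -> V u by move=> Ru; apply: RV; exact: loc_sub.
(* By maximality the extension of [P] to V[t] contains 1. *)
have big t : ~ V t -> exists p : {poly K}, (forall i, pext V p`_i) /\ p.[t] = 1.
  move=> nt; have h1 : pext (adj1 V t) 1.
    apply: contrapT => h; apply: nt.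
    apply: (maxV (adj1 V t)); [exact: (@adj1_sub _ V t)| |exact: adj1_mem].
    split=> //; [by move=> x /RV; exact: (@adj1_sub _ V t)|exact: sr1|exact: srB|exact: srM].
  suff H u : pext (adj1 V t) u -> exists p : {poly K}, (forall i, pext V p`_i) /\ p.[t] = u.
    exact: H.
  elim=> [|a s w Pa [q hq ->] _ [p [hp <-]]].
    by exists 0; split=> [i|]; [rewrite coef0; exact: pext0|rewrite horner0].
  exists (a *: q + p); split=> [i|]; last by rewrite hornerD hornerZ.
  by rewrite coefD coefZ; apply: pextD => //; exact: hq.
have MV u : pext V u -> V u by exact: pext_in.
(* Otherwise [big] applies to the inverse of y = 1 - b. Multiplying that relation by a power of y,
   which is congruent to 1 modulo the extension of [P], gives 1 in this extension. *)
have unit1 b : pext V b -> b != 1 /\ V (1 - b)^-1.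
  move=> hb; have b1 : b != 1 by apply: contra_notN nV => /eqP <-.
  split=> //; apply: contrapT => /big[p [hp e]]; apply: nV.
  set y := 1 - b in e *; have y0 : y != 0 by rewrite subr_eq0 eq_sym.
  have hy n : pext V (1 - y ^+ n).
    elim: n => [|n IH]; first by rewrite expr0 subrr; exact: pext0.
    have -> : 1 - y ^+ n.+1 = (1 - y ^+ n) + y ^+ n * b by rewrite exprSr /y; ring.
    apply: pext_add => //; apply: pext_mul => //; apply: srX; apply: srB; [exact: sr1|exact: MV].
  have -> : 1 = (1 - y ^+ size p) + \sum_(i < size p) y ^+ (size p - i) * p`_i.
    rewrite (_ : \sum_(i < _) _ = y ^+ size p * p.[y^-1]); first by rewrite e mulr1 subrK.
    rewrite horner_coef big_distrr /=; apply: eq_bigr => i _.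
    rewrite exprVn (exprB_split y (ltnW (ltn_ord i))); field; exact: expf_neq0.
  apply: (@pext_add V) => //; apply: (@pext_sum V) => i _; apply: (@pext_mul V) => //.
  by apply: srX; apply: srB; [exact: sr1|exact: MV].
pose good t n := exists p : {poly K}, [/\ (size p <= n)%N, forall i, pext V p`_i & p.[t] = 1].
(* Given relations for [t] and for its inverse, the longer one is shortened: the shorter one,
   divided by the unit 1 - q_0, rewrites the top power in lower ones. The total length therefore
   descends. *)
have nogood N : forall n m t, (n + m <= N)%N -> t != 0 -> good t n -> good t^-1 m -> False.
  elim: N => [|N IH] n m t.
    rewrite leqn0 addn_eq0 => /andP[/eqP-> _] _ [p [sp _ e]] _.
    move: sp e; rewrite leqn0 size_poly_eq0 => /eqP->; rewrite horner0 => /eqP.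
    by rewrite eq_sym oner_eq0.
  have core n' m' t' : (n' + m' <= N.+1)%N -> (m' <= n')%N -> t' != 0 ->
      good t' n' -> good t'^-1 m' -> False.
    case: n' => [|n'].
      move=> _ _ _ [p [sp _ e]] _.
      move: sp e; rewrite leqn0 size_poly_eq0 => /eqP->; rewrite horner0 => /eqP.
      by rewrite eq_sym oner_eq0.
    move=> hN hm t0 [p [sp hp ep]] [q [sq hq eq]].
    have [q1 Vq] := unit1 _ (hq 0%N).
    have d0 : 1 - q`_0 != 0 by rewrite subr_eq0 eq_sym.
    case: m' hN hm sq => [|m'] hN hm sq.
      move: sq eq; rewrite leqn0 size_poly_eq0 => /eqP->; rewrite horner0 => /eqP.
      by rewrite eq_sym oner_eq0.
    apply: (IH n' m'.+1 t') => //; last by exists q.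
    pose Q : {poly K} := \sum_(j < m') (q`_j.+1 / (1 - q`_0)) *: 'X^(n' - j.+1).
    have eQ : Q.[t'] = t' ^+ n'.
      have := eq; rewrite (horner_coef_wide _ sq) big_ord_recl expr0 mulr1.
      move/(congr1 (fun x => x - q`_0)); rewrite addrAC subrr add0r => /esym e.
      have -> : t' ^+ n' = t' ^+ n' / (1 - q`_0) * (1 - q`_0) by rewrite divfK.
      rewrite {2}e horner_sum big_distrr /=; apply: eq_bigr => j _.
      rewrite hornerZ hornerXn exprVn /bump leq0n add1n.
      have hj : (j.+1 <= n')%N by have := ltn_ord j; lia.
      by rewrite (exprB_split t' hj); field; rewrite expf_neq0.
    exists (\poly_(i < n') p`_i + p`_n' *: Q); split.
    - apply: leq_trans (size_polyD _ _) _; rewrite geq_max size_poly /=.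
      apply: leq_trans (size_scale_leq _ _) _; apply: leq_trans (size_sum _ _ _) _.
      apply/bigmax_leqP => j _; apply: leq_trans (size_scale_leq _ _) _.
      by rewrite size_polyXn; have := ltn_ord j; lia.
    - move=> i; rewrite coefD coef_poly coefZ; apply: pext_add.
        by case: ifP => _ //; exact: pext0.
      rewrite mulrC; apply: pext_mul => //; rewrite coef_sum; apply: sr_sum => j _.
      rewrite coefZ coefXn; apply: srM; last exact: sr_nat.
      by apply: srM => //; exact: MV.
    - rewrite hornerD hornerZ eQ horner_poly -[RHS]ep (horner_coef_wide _ sp) big_ord_recr //.
  move=> hN t0 gt gt'; have [h|h] := leqP m n; first exact: (core n m t).
  apply: (core m n t^-1) => //; [by rewrite addnC|exact: ltnW|by rewrite invr_neq0|by rewrite invrK].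
exists V; split=> //.
- move=> t t0; case: (pselect (V t)) => [|nt]; [by left|right].
  apply: contrapT => /big[q [hq eq]]; have [p [hp ep]] := big _ nt.
  by apply: (nogood _ (size p) (size q) t (leqnn _) t0); [exists p|exists q].
- move=> a Ra; split=> [Pa [a0 Va]|na].
    by apply: nV; rewrite -(mulVf a0); apply: (@pext_mul V) => //; exact: (@pext_mem V).
  apply: contrapT => nPa; apply: na; split; first exact: prime_neq0 pP nPa.
  by apply: RV; exact: loc_unit.
Qed.

End Chevalley.

Definition inu (K : fieldType) (V : K -> Prop) (a : K) := a != 0 /\ V a^-1.

Definition valring (K : fieldType) (V : K -> Prop) := forall t : K, t != 0 -> V t \/ V t^-1.

Lemma valring_integ (K : fieldType) (V : subr K) u : valring V -> integ V u -> V u.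
Proof.
move=> vV [p [mp hp rp]]; have [->|u0] := eqVneq u 0; first exact: sr0.
have [//|Vu] := vV _ u0.
pose N := (size p).-1.
have sp : size p = N.+1 by rewrite prednK // lt0n size_poly_eq0 monic_neq0.
have := rp; rewrite /root horner_coef sp big_ord_recr /=.
rewrite -[N]/(size p).-1 (eqP mp : p`_(size p).-1 = 1) mul1r -/N addrC addr_eq0 => /eqP e.
case: N sp e => [|n] sp e; first by move: e; rewrite expr0 big_ord0 oppr0 => /eqP; rewrite oner_eq0.
have -> : u = - \sum_(i < n.+1) p`_i * u^-1 ^+ (n - i).
  apply: (mulIf (expf_neq0 n u0)); rewrite -exprS e mulNr; congr (- _).
  rewrite big_distrl /=; apply: eq_bigr => i _; rewrite exprVn.
  have hi : (i <= n)%N by rewrite -ltnS.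
  by rewrite (exprB_split u hi); field; exact: expf_neq0.
by apply: srN; apply: sr_sum => i _; apply: srM; [exact: hp|exact: srX].
Qed.

Lemma valring_min (K : fieldType) (V : subr K) (s : seq K) : valring V ->
  (exists2 x, x \in s & x != 0) ->
  exists2 x, x \in s & x != 0 /\ forall y, y \in s -> V (y / x).
Proof.
move=> vV; elim: s => [[x]//|x s IH] [y0 ys y00].
case: (pselect (exists2 x, x \in s & x != 0)) => h; last first.
  have s0 y : y \in s -> y = 0.
    by move=> hy; apply/eqP; apply: contrapT => /negP y1; apply: h; exists y.
  have x0 : x != 0.
    by move: ys; rewrite inE => /orP[/eqP<-//|/s0 e]; rewrite e eqxx in y00.
  exists x; rewrite ?mem_head //; split=> // y; rewrite inE => /orP[/eqP->|/s0->].
    by rewrite divff //; exact: sr1.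
  by rewrite mul0r; exact: sr0.
have [z zs [z0 hz]] := IH h.
have [->|x0] := eqVneq x 0.
  exists z; first by rewrite inE zs orbT.
  split=> // y; rewrite inE => /orP[/eqP->|]; [by rewrite mul0r; exact: sr0|exact: hz].
have [h1|h1] := vV (x / z) (mulf_neq0 x0 (invr_neq0 z0)).
  exists z; first by rewrite inE zs orbT.
  by split=> // y; rewrite inE => /orP[/eqP->|]; [|exact: hz].
exists x; first exact: mem_head.
split=> // y; rewrite inE => /orP[/eqP->|ys']; first by rewrite divff //; exact: sr1.
by have := srM (hz _ ys') h1; congr (V _); field; rewrite x0 z0.
Qed.

Section LocNoeth.
Variables (K : fieldType) (A : subr K) (P : set K).
Hypothesis pP : prime_of A P.

Lemma loc_noeth : noeth A -> noeth (loc pP).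
Proof.
move=> nA I iI; have [IA I0 ID IM] := iI.
have [|s es] := nA [set u | A u /\ I u].
  split.
  - by move=> u [].
  - by split=> //; exact: sr0.
  - by move=> u v [Au Iu] [Av Iv]; split; [exact: srD|exact: ID].
  - by move=> a u Aa [Au Iu]; split; [exact: srM|apply: IM => //; exact: loc_sub].
have sI u : u \in s -> A u /\ I u.
  by move=> us; have : [set u | A u /\ I u] u by rewrite es; exact: span_mem.
exists s; apply/seteqP; split=> [u Iu|]; last by apply: span_min => // u /sI[].
have [a [t [Aa At nt e]]] := IA _ Iu; have t0 := prime_neq0 pP nt.
have : span A s a.
  rewrite -es; split=> //; rewrite (_ : a = t * u); last by rewrite e mulrC divfK.
  by apply: IM => //; exact: loc_sub.
move=> h; rewrite e mulrC; apply: spanZ; first exact: loc_unit.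
apply: span_closed h => //; [exact: span0|exact: spanD| |by move=> x; exact: span_mem].
by move=> x y Ax; apply: spanZ; exact: loc_sub.
Qed.

Lemma common_denom_seq (s : seq K) : (forall x, x \in s -> loc pP x) ->
  exists d, [/\ A d, ~ P d & forall x, x \in s -> A (d * x)].
Proof.
elim: s => [_|x s IH h]; first by exists 1; split=> //; [exact: sr1|case: pP].
have [|d [Ad nd hd]] := IH; first by move=> y ys; apply: h; rewrite inE ys orbT.
have [a [t [Aa At nt e]]] := h x (mem_head _ _); have t0 := prime_neq0 pP nt.
exists (d * t); split; [exact: srM|exact: (primeM pP)|].
move=> y; rewrite inE => /orP[/eqP->|ys].
  have -> : d * t * x = d * a by rewrite e; field.
  exact: srM.
by rewrite mulrAC; apply: srM => //; exact: hd.
Qed.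

Lemma common_denom_poly p : pcoef (loc pP) p ->
  exists d, [/\ A d, ~ P d & forall i, A (d * p`_i)].
Proof.
move=> hp; have [|d [Ad nd hd]] := @common_denom_seq p.
  by move=> x /(nthP 0)[i _ <-]; exact: hp.
exists d; split=> // i; have [h|h] := ltnP i (size p); first by apply: hd; exact: mem_nth.
by rewrite nth_default // mulr0; exact: sr0.
Qed.

End LocNoeth.

Lemma integ_scale (K : fieldType) (A : subr K) p d u : p \is monic -> root p u -> A d ->
  (forall i, A (d * p`_i)) -> integ A (d * u).
Proof.
move=> mp rp Ad hd; pose N := (size p).-1.
have sp : size p = N.+1 by rewrite prednK // lt0n size_poly_eq0 monic_neq0.
have lp : p`_N = 1 by exact: (eqP mp).
have [d0|d0] := eqVneq d 0; first by rewrite d0 mul0r; apply: integ_mem; exact: sr0.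
pose q := \poly_(i < N.+1) (p`_i * d ^+ (N - i)).
have sq : size q = N.+1 by rewrite size_poly_eq // subnn lp mulr1 oner_neq0.
exists q; split.
- by rewrite monicE /lead_coef sq coef_poly leqnn subnn lp mulr1.
- move=> i; rewrite coef_poly; case: ltnP => // hi; last exact: sr0.
  have [e|h] := eqVneq i N; first by rewrite e lp subnn mulr1; exact: sr1.
  have hi' : (i < N)%N by rewrite ltn_neqAle h -ltnS.
  rewrite -subnSK // exprS mulrA [p`_i * d]mulrC; apply: srM; [exact: hd|exact: srX].
- rewrite /root horner_poly (_ : \sum_(i < _) _ = d ^+ N * p.[u]); first by rewrite (eqP rp) mulr0.
  rewrite horner_coef sp big_distrr /=; apply: eq_bigr => i _.
  have hi : (i <= N)%N by rewrite -ltnS.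
  by rewrite (exprB_split d hi) exprMn; ring.
Qed.

Section LocInteg.
Variables (K : fieldType) (A : subr K) (P : set K).
Hypothesis pP : prime_of A P.

Lemma loc_integ u : integ (loc pP) u -> exists d, [/\ A d, ~ P d & integ A (d * u)].
Proof.
move=> [p [mp hp rp]]; have [d [Ad nd hd]] := common_denom_poly hp.
by exists d; split=> //; exact: integ_scale rp _ _.
Qed.

Lemma fracf_loc u : fracf (loc pP) u -> fracf A u.
Proof.
apply: fracf_min; last by move=> x; exact: fracf_inv.
by move=> _ [a [s [Aa As ns ->]]]; exists a, s; split=> //; exact: prime_neq0 pP ns.
Qed.

Lemma loc_normal : normalS A -> normalS (loc pP).
Proof.
move=> nA a s La Ls s0 h; have [d [Ad nd id]] := loc_integ h.
have d0 := prime_neq0 pP nd.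
exists (d * (a / s)), d; split=> //; last by rewrite mulrAC divff // mul1r.
apply: (normal_mem nA) => //; apply: srM; first exact: fracf_sub.
by apply: fracf_loc; exists a, s.
Qed.

End LocInteg.

Section PrimeIdeals.
Variables (K : fieldType).
Implicit Types (A O : subr K).

Lemma prime_contract A O P : (forall u, A u -> O u) -> prime_of O P ->
  prime_of A [set u | A u /\ P u].
Proof.
move=> AO [[PO P0 PD PM] P1 Pp]; split.
- split.
  + by move=> u [].
  + by split=> //; exact: sr0.
  + by move=> u v [Au Pu] [Av Pv]; split; [exact: srD|exact: PD].
  + by move=> a u Aa [Au Pu]; split; [exact: srM|apply: PM => //; exact: AO].
- by move=> [].
- by move=> a b Aa Ab [_ /Pp]; case=> [||h|h]; [exact: AO|exact: AO|left|right].
Qed.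

Definition nonu (O : K -> Prop) : set K := [set u | O u /\ ~ inu O u].

Definition localS (O : K -> Prop) := forall u v, nonu O u -> nonu O v -> nonu O (u + v).

Lemma inuM O u v : inu O u -> inu O v -> inu O (u * v).
Proof.
by move=> [u0 Ou] [v0 Ov]; split; [rewrite mulf_neq0|rewrite invfM; exact: srM].
Qed.
Lemma inuMl O u v : O u -> O v -> inu O (u * v) -> inu O u.
Proof.
move=> Ou Ov [uv0 Ouv]; move: uv0; rewrite mulf_eq0 negb_or => /andP[u0 v0].
split=> //; have -> : u^-1 = v * (u * v)^-1 by field; rewrite u0 v0.
exact: srM.
Qed.
Lemma inu1 O : inu O 1.
Proof. by split; rewrite ?oner_neq0 ?invr1 //; exact: sr1. Qed.
Lemma inuV O u : O u -> inu O u -> inu O u^-1.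
Proof. by move=> Ou [u0 _]; split; rewrite ?invr_eq0 ?invrK. Qed.

Lemma nonu_prime O : localS O -> prime_of O (nonu O).
Proof.
move=> lO; split.
- split; [by move=> u []|split; [exact: sr0|by case; rewrite eqxx]|exact: lO|].
  move=> a u Oa [Ou nu]; split; first exact: srM.
  by rewrite mulrC => /(inuMl Ou Oa).
- by case=> _; apply; exact: inu1.
- move=> a b Oa Ob [_ nab]; case: (pselect (inu O a)) => ha; last by left.
  by right; split=> // hb; apply: nab; exact: inuM.
Qed.

Lemma loc_nonu A P (pP : prime_of A P) u :
  nonu (loc pP) u <-> exists a s, [/\ P a, A s, ~ P s & u = a / s].
Proof.
have [[PA P0 PD PM] P1 Pp] := pP.
split=> [[[a [s [Aa As ns e]]] nu]|[a [s [Pa As ns e]]]].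
  exists a, s; split=> //; apply: contrapT => nPa; apply: nu.
  have a0 := prime_neq0 pP nPa; have s0 := prime_neq0 pP ns.
  split; first by rewrite e mulf_neq0 ?invr_eq0.
  by exists s, a; split=> //; rewrite e invfM invrK mulrC.
split; first by exists a, s; split=> //; exact: PA.
move=> [u0 [b [t [Ab At nt e']]]]; have s0 := prime_neq0 pP ns; have t0 := prime_neq0 pP nt.
have : s * t = a * b.
  have h : u * u^-1 = 1 by rewrite divff.
  by move: h; rewrite e' e => h; rewrite -[LHS]mulr1 -h; field; rewrite s0 t0.
move=> h; case: (Pp s t As At) => //; rewrite h mulrC; exact: PM (PA _ Pa) Pa || exact: PM.
Qed.

Lemma loc_local A P (pP : prime_of A P) : localS (loc pP).
Proof.
have [[PA P0 PD PM] P1 Pp] := pP.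
move=> u v /loc_nonu[a [s [Pa As ns ->]]] /loc_nonu[b [t [Pb At nt ->]]].
apply/loc_nonu; exists (t * a + s * b), (s * t); split.
- by apply: PD; apply: (PM).
- exact: srM. - exact: (primeM pP).
- by field; rewrite (prime_neq0 pP ns) (prime_neq0 pP nt).
Qed.

Lemma loc_contract A P (pP : prime_of A P) u : A u -> (nonu (loc pP) u <-> P u).
Proof.
move=> Au; split=> [[_ nu]|Pu].
  apply: contrapT => nPu; apply: nu; split; first exact: prime_neq0 pP nPu.
  exact: loc_unit.
by apply/loc_nonu; exists u, 1; split; rewrite ?divr1 //; [exact: sr1|case: pP].
Qed.

Lemma loc_charact A O (pQ : prime_of A [set u | A u /\ nonu O u]) : (forall u, A u -> O u) ->
  (forall u, O u -> exists a s, [/\ A a, A s, inu O s & u = a / s]) ->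
  forall u, O u <-> loc pQ u.
Proof.
move=> AO h u; split=> [/h[a [s [Aa As us ->]]]|[a [s [Aa As ns ->]]]].
  by exists a, s; split=> // -[_ []].
apply: srM; first exact: AO.
have : inu O s by apply: contrapT => h'; apply: ns; split=> //; split=> //; exact: AO.
by case.
Qed.

(** * Discrete valuation rings *)

Definition dvr (O : subr K) (t : K) := [/\ noeth O, normalS O, nonu O t, t != 0 &
  forall y, nonu O y -> O (y / t)].

(** If every power of [t] divided [z], the increasing ideals generated by the z / t^n would become
    stationary, which makes [t] a unit. *)
Lemma dvr_ord O t z : dvr O t -> O z -> z != 0 -> exists n u, [/\ inu O u, O u & z = u * t ^+ n].
Proof.
move=> [nO _ [Ot nt] t0 ht] Oz z0.
pose I n : set K := [set r | exists c, [/\ O c, O (z / t ^+ n) & r = c * (z / t ^+ n)] \/ r = 0].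
case: (pselect (forall n, O (z / t ^+ n))) => [hall|/existsNP[n hn]].
  have [|||N hN] := @noeth_chain _ O (fun n => [set r | exists2 c, O c & r = c * (z / t ^+ n)]).
  - exact: nO.
  - move=> n; split.
    + by move=> _ [c Oc ->]; exact: srM.
    + by exists 0; rewrite ?mul0r //; exact: sr0.
    + by move=> _ _ [c Oc ->] [d Od ->]; exists (c + d); rewrite ?mulrDl //; exact: srD.
    + by move=> a _ Oa [c Oc ->]; exists (a * c); rewrite ?mulrA //; exact: srM.
  - move=> n _ [c Oc ->]; exists (c * t); first exact: srM.
    by rewrite exprS; field; rewrite expf_neq0.
  have [c Oc e] : [set r | exists2 c, O c & r = c * (z / t ^+ N)] (z / t ^+ N.+1).
    by apply: hN; exists 1; rewrite ?mul1r //; exact: sr1.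
  exfalso; apply: nt; split=> //; suff -> : t^-1 = c by [].
  have w0 : z / t ^+ N != 0 by rewrite mulf_neq0 // invr_eq0 expf_neq0.
  by apply: (mulIf w0); rewrite -e exprS; field; rewrite expf_neq0.
elim: n hn => [|n IH] hn; first by exfalso; apply: hn; rewrite divr1.
case: (pselect (O (z / t ^+ n))) => h; last exact: IH.
exists n, (z / t ^+ n); split=> //; last by rewrite divfK // expf_neq0.
apply: contrapT => nu; apply: hn.
have -> : z / t ^+ n.+1 = (z / t ^+ n) / t by rewrite exprSr invfM mulrA mulrAC.
by apply: ht; split.
Qed.

(* P is an associated prime of the principal ideal generated by b. *)
Lemma dvr_exists O b : noeth O -> normalS O -> nonu O b -> b != 0 ->
  exists P (pP : prime_of O P) t, P b /\ dvr (loc pP) t.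
Proof.
move=> nO sO [Ob nb] b0.
(* The colon ideal (b : a); a maximal proper one among them is prime. *)
pose Q a : set K := [set r | O r /\ O (r * a / b)].
have iQ a : O a -> ideal_of O (Q a).
  move=> Oa; split.
  - by move=> u [].
  - by split; rewrite ?mul0r; exact: sr0.
  - by move=> u v [Ou hu] [Ov hv]; split; [|rewrite !mulrDl]; exact: srD.
  - by move=> c u Oc [Ou hu]; split; [|rewrite -2!mulrA (mulrA u)]; exact: srM.
have [a [[Oa na] ma]] : exists a, (O a /\ ~ O (a / b)) /\
    forall a', O a' -> ~ O (a' / b) -> Q a `<=` Q a' -> Q a' `<=` Q a.
  apply: contrapT => h.
  have /choice[f hf] : forall a, exists a', (O a /\ ~ O (a / b)) ->
      [/\ O a', ~ O (a' / b), Q a `<=` Q a' & ~ (Q a' `<=` Q a)].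
    move=> a; case: (pselect (O a /\ ~ O (a / b))) => ha; last by exists 0.
    apply: contrapT => h1; apply: h; exists a; split=> // a' Oa' na' h2.
    by apply: contrapT => h3; apply: h1; exists a'.
  have h1 n : O (iter n f 1) /\ ~ O (iter n f 1 / b).
    elim: n => [|n IH] /=; last by have [] := hf _ IH.
    by split; [exact: sr1|rewrite div1r => hb; apply: nb].
  have [|||N hN] := @noeth_chain _ O (fun n => Q (iter n f 1)).
  - exact: nO.
  - by move=> n; apply: iQ; exact: (h1 n).1.
  - by move=> n; have [] := hf _ (h1 n).
  by have [_ _ _] := hf _ (h1 N); apply; exact: hN N.+1.
have pQ : prime_of O (Q a).
  split; [exact: iQ|by move=> [_]; rewrite mul1r|].
  move=> x y Ox Oy [_ hxy]; case: (pselect (Q a y)) => hy; first by right.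
  left; apply: (ma (y * a)); first exact: srM.
  - by move=> h; apply: hy.
  - move=> r [Or hr]; split=> //; have -> : r * (y * a) / b = y * (r * a / b) by ring.
    exact: srM.
  - by split=> //; have -> : x * (y * a) / b = x * y * a / b by ring.
exists (Q a), pQ; pose u := a / b.
have Qu x : Q a x -> O (x * u) by move=> [_]; rewrite -mulrA.
have Qb : Q a b by split=> //; rewrite mulrAC divff ?mul1r.
have [s es] := nO _ (iQ _ Oa).
have Qs x : x \in s -> Q a x by move=> xs; rewrite es; exact: span_mem.
(* If the products x u all stayed in the prime, u = a/b would be integral by Cayley-Hamilton, hence
   in [O]. Where x u is a unit, division by [x] amounts to multiplication by [u], which carries the
   prime into [O]; so [x] is a uniformizer. *)
have [x Qx wu] : exists2 x, Q a x & inu (loc pQ) (x * u).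
  apply: contrapT => h; apply: na; apply: sO => //; apply: (@integ_mult _ O s).
    apply: contrapT => h0; suff : span O s `<=` [set 0] by rewrite -es => /(_ _ Qb)/eqP; rewrite (negPf b0).
    apply: span_min; first exact: ideal0.
    by move=> y ys; apply: contrapT => /eqP y0; apply: h0; exists y.
  move=> y /Qs Qy; rewrite -es mulrC; apply: contrapT => nQ; apply: h; exists y => //.
  split; first exact: (prime_neq0 pQ nQ).
  by apply: loc_unit => //; exact: Qu.
have Ox : O x by case: Qx.
have x0 : x != 0 by case: wu; rewrite mulf_eq0 negb_or => /andP[].
exists x; split=> //; split=> //; [exact: loc_noeth|exact: loc_normal|exact/loc_contract|].
move=> _ /loc_nonu[p [s' [Qp Os ns ->]]]; have s0 := prime_neq0 pQ ns.
have u0 : u != 0 by case: wu; rewrite mulf_eq0 negb_or => /andP[].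
have -> : p / s' / x = (p * u) * s'^-1 * (x * u)^-1 by field; rewrite u0 x0 s0.
apply: srM; last by case: wu.
apply: srM; last exact: loc_unit.
by apply: loc_sub; exact: Qu.
Qed.
End PrimeIdeals.

(** * Derivations *)

Section ResidueField.
Variables (R : comNzRingType) (M : set R).
Hypothesis M1 : ~ M 1.
Hypothesis MB : forall a b, M a -> M b -> M (a - b).
Hypothesis M0 : M 0.
Hypothesis MM : forall a b, M b -> M (a * b).
Hypothesis Mmax : forall a, ~ M a -> exists b, M (a * b - 1).

Definition res_ideal : {pred R} := fun a => `[< M a >].

Fact res_ideal_closed : idealr_closed res_ideal.
Proof.
split; [exact/asboolP|by apply/negP => /asboolP|].
move=> a u v /asboolP hu /asboolP hv; apply/asboolP.
by rewrite -[v]opprK; apply: MB; [exact: MM|rewrite -sub0r; exact: MB].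
Qed.
HB.instance Definition _ := isIdealr.Build R res_ideal res_ideal_closed.

Definition resT := {ideal_quot res_ideal}.
HB.instance Definition _ := GRing.ComNzRing.on resT.

Definition res_proj : R -> resT := \pi_(resT)%qT.

Lemma res_proj_zmod : zmod_morphism res_proj.
Proof. by move=> a b; exact: (rmorphB (\pi_{ideal_quot res_ideal}%qT : R -> _)). Qed.
Lemma res_proj_monoid : monoid_morphism res_proj.
Proof.
split; first exact: (rmorph1 (\pi_{ideal_quot res_ideal}%qT : R -> _)).
by move=> a b; exact: (rmorphM (\pi_{ideal_quot res_ideal}%qT : R -> _)).
Qed.

Lemma res_projK (a : resT) : exists r, a = res_proj r.
Proof. by exists (repr a); rewrite /res_proj reprK. Qed.

Lemma res_proj0 r : res_proj r = 0 <-> M r.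
Proof.
have -> : (0 : resT) = res_proj 0 by rewrite -(subrr (1 : R)) res_proj_zmod subrr.
split=> [/eqP|h]; rewrite /res_proj.
  by rewrite -Quotient.idealrBE subr0 => /asboolP.
by apply/eqP; rewrite -Quotient.idealrBE subr0; apply/asboolP.
Qed.

Definition res_inv (a : resT) : resT :=
  if pselect (exists b, a * b = 1) is left h then projT1 (cid h) else 0.

Fact res_mulVf a : a != 0 -> res_inv a * a = 1.
Proof.
move=> a0; rewrite /res_inv; case: pselect => [h|[]].
  by rewrite mulrC; exact: projT2 (cid h).
have [r er] := res_projK a.
have [b hb] : exists b, M (r * b - 1).
  by apply: Mmax => /res_proj0 h; move: a0; rewrite er h eqxx.
exists (res_proj b); apply/eqP; rewrite -subr_eq0 er; apply/eqP.
by rewrite -res_proj_monoid.2 -res_proj_monoid.1 -res_proj_zmod; apply/res_proj0.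
Qed.
Fact res_inv0 : res_inv 0 = 0.
Proof.
rewrite /res_inv; case: pselect => // h; exfalso.
by case: h => b; rewrite mul0r => /eqP; rewrite eq_sym oner_eq0.
Qed.
HB.instance Definition _ := GRing.ComNzRing_isField.Build resT res_mulVf res_inv0.
HB.instance Definition _ := GRing.isZmodMorphism.Build R resT res_proj res_proj_zmod.
HB.instance Definition _ := GRing.isMonoidMorphism.Build R resT res_proj res_proj_monoid.

Lemma residue_field : exists (k : fieldType) (p : {rmorphism R -> k}),
  (forall a, exists r, a = p r) /\ forall r, p r = 0 <-> M r.
Proof. by exists resT, res_proj; split; [exact: res_projK|exact: res_proj0]. Qed.

End ResidueField.

(** * Extension of derivations to a residue field, in characteristic zero *)

Section ExtendDerivation.
Variables (R : comNzRingType) (k : fieldType) (p : {rmorphism R -> k}).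
Hypothesis char0 : forall n, n.+1%:R != 0 :> k.
Hypothesis psurj : forall a, exists r, a = p r.

(* Graphs of derivations from a subring of R, containing the kernel of p, to k. *)
Record dgraph (G : set (R * k)) : Prop := DGraph {
  dg1 : G (1, 0);
  dgB : forall a x b y, G (a, x) -> G (b, y) -> G (a - b, x - y);
  dgM : forall a x b y, G (a, x) -> G (b, y) -> G (a * b, p a * y + p b * x);
  dg_fun : forall x, G (0, x) -> x = 0;
  dg_ker : forall a, p a = 0 -> exists x, G (a, x) /\ forall r, G (r * a, p r * x) }.

Section Graph.
Variables (G : set (R * k)) (dG : dgraph G).

Lemma dg0 : G (0, 0).
Proof. by have := dgB dG (dg1 dG) (dg1 dG); rewrite !subrr. Qed.
Lemma dgN a x : G (a, x) -> G (- a, - x).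
Proof. by move=> h; rewrite -[- a]sub0r -[- x]sub0r; apply: dgB => //; exact: dg0. Qed.
Lemma dgD a x b y : G (a, x) -> G (b, y) -> G (a + b, x + y).
Proof. by move=> h h'; rewrite -[b]opprK -[y]opprK; apply: dgB => //; exact: dgN. Qed.
Lemma dg_eq a x y : G (a, x) -> G (a, y) -> x = y.
Proof.
move=> h h'; apply/eqP; rewrite -subr_eq0; apply/eqP; apply: dg_fun dG _ _.
by have := dgB dG h h'; rewrite subrr.
Qed.
Lemma dg_lin a x r : p a = 0 -> G (a, x) -> G (r * a, p r * x).
Proof. by move=> pa h; have [y [hy hr]] := dg_ker dG pa; rewrite (dg_eq h hy). Qed.
Lemma dg_sum n (a : 'I_n -> R) (x : 'I_n -> k) : (forall i, G (a i, x i)) ->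
  G (\sum_i a i, \sum_i x i).
Proof.
elim: n a x => [|n IH] a x h; first by rewrite !big_ord0; exact: dg0.
by rewrite !big_ord_recr; apply: dgD => //; apply: IH.
Qed.

Definition dgpoly (f : {poly R}) (t : {poly k}) := forall i, G (f`_i, t`_i).

Lemma dgpolyB f t g u : dgpoly f t -> dgpoly g u -> dgpoly (f - g) (t - u).
Proof. by move=> hf hg i; rewrite !coefB; exact: dgB. Qed.
Lemma dgpolyM f t g u : dgpoly f t -> dgpoly g u ->
  dgpoly (f * g) (map_poly p f * u + map_poly p g * t).
Proof.
move=> hf hg i; rewrite coefD coefM coefM coefMr -big_split; apply: dg_sum => j.
by rewrite !coef_map /=; exact: dgM.
Qed.
Lemma dgpolyC a x : G (a, x) -> dgpoly a%:P x%:P.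
Proof. by move=> h i; rewrite !coefC; case: ifP => _ //; exact: dg0. Qed.
Lemma dgpolyX : dgpoly 'X 0.
Proof. by move=> i; rewrite coefX coef0; case: eqP => _; [exact: dg1|exact: dg0]. Qed.
Variables (z : R) (c : k).
(** The value that Leibniz forces on f(z) when [z] has value [c] and the coefficients of [f] have
    the values listed in [t]. *)
Definition dgval (f : {poly R}) (t : {poly k}) := t.[p z] + (map_poly p f)^`().[p z] * c.

Lemma dgvalB f t g u : dgval (f - g) (t - u) = dgval f t - dgval g u.
Proof. by rewrite /dgval rmorphB /= derivB !hornerD !hornerN; ring. Qed.
Lemma dgvalM f t g u : dgval (f * g) (map_poly p f * u + map_poly p g * t) =
  p f.[z] * dgval g u + p g.[z] * dgval f t.
Proof. by rewrite /dgval rmorphM /= derivM !hornerD !hornerM !horner_map /=; ring. Qed.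

Lemma dgval_ker f t : dgpoly f t -> map_poly p f = 0 -> G (f.[z], dgval f t).
Proof.
move=> hf f0; rewrite /dgval f0 deriv0 horner0 mul0r addr0.
have st : (size t <= size f)%N.
  apply/leq_sizeP => j hj; have := hf j; rewrite (nth_default _ hj).
  exact: dg_fun.
rewrite horner_coef (horner_coef_wide _ st); apply: dg_sum => i.
rewrite [f`_i * _]mulrC [t`_i * _]mulrC -rmorphXn; apply: dg_lin; last exact: hf.
by rewrite -coef_map f0 coef0.
Qed.

Definition dgadj : set (R * k) := [set ax | exists f t, [/\ dgpoly f t, ax.1 = f.[z] & ax.2 = dgval f t]].

Lemma dgadj_sub : G `<=` dgadj.
Proof.
move=> [a x] h; exists a%:P, x%:P; split; [exact: dgpolyC|by rewrite hornerC|].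
by rewrite /dgval map_polyC derivC !hornerC mul0r addr0.
Qed.
Lemma dgadj_mem : dgadj (z, c).
Proof.
exists 'X, 0; split; [exact: dgpolyX|by rewrite hornerX|].
by rewrite /dgval map_polyX derivX horner0 hornerC mul1r add0r.
Qed.
Lemma dgadj_dgraph : (forall f t, dgpoly f t -> p f.[z] = 0 -> G (f.[z], dgval f t)) ->
  dgraph dgadj.
Proof.
move=> key; split.
- by apply: dgadj_sub; exact: dg1.
- move=> a x b y [f [t [hf /= -> ->]]] [g [u [hg /= -> ->]]].
  exists (f - g), (t - u); split; [exact: dgpolyB|by rewrite hornerD hornerN|by rewrite dgvalB].
- move=> a x b y [f [t [hf /= -> ->]]] [g [u [hg /= -> ->]]].
  exists (f * g), (map_poly p f * u + map_poly p g * t); split; [exact: dgpolyM|by rewrite hornerM|by rewrite dgvalM].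
- move=> x [f [t [hf /= e ->]]]; have := key _ _ hf; rewrite -e rmorph0 => /(_ erefl).
  exact: dg_fun.
- move=> a pa; have [x [h hr]] := dg_ker dG pa.
  by exists x; split=> [|r]; apply: dgadj_sub.
Qed.

End Graph.

(** Closure under division by elements outside the kernel of [p], with values given by the quotient
    rule. *)
Definition dgfrac (G : set (R * k)) : set (R * k) :=
  [set rx | exists q x y, [/\ G (q, y), p q != 0, G (q * rx.1, x) & rx.2 = (x - p rx.1 * y) / p q]].

Lemma dgfrac_sub (G : set (R * k)) : dgraph G -> G `<=` dgfrac G.
Proof.
move=> dG [a x] h; exists 1, x, 0; rewrite /= rmorph1 oner_neq0 mul1r mulr0 subr0 divr1.
by split=> //; exact: dg1.
Qed.

Lemma dgraph_frac (G : set (R * k)) : dgraph G -> dgraph (dgfrac G).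
Proof.
move=> dG; split.
- by exists 1, 0, 0; rewrite /= rmorph1 oner_neq0 mulr1 mulr0 subrr mul0r; split=> //; exact: dg1.
- move=> a x b y [q [u [v [h1 q0 h2 /= ->]]]] [r [s [t [h3 r0 h4 /= ->]]]].
  exists (q * r), (p r * u + p (q * a) * t - (p q * s + p (r * b) * v)), (p q * t + p r * v).
  split=> /=; [exact: dgM|by rewrite rmorphM mulf_neq0| |].
    have -> : q * r * (a - b) = (q * a) * r - (r * b) * q by ring.
    have := dgB dG (dgM dG h2 h3) (dgM dG h4 h1).
    by congr (G (_, _)); ring.
  by rewrite !rmorphM rmorphB; field; rewrite q0 r0.
- move=> a x b y [q [u [v [h1 q0 h2 /= ->]]]] [r [s [t [h3 r0 h4 /= ->]]]].
  exists (q * r), (p (q * a) * s + p (r * b) * u), (p q * t + p r * v).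
  split=> /=; [exact: dgM|by rewrite rmorphM mulf_neq0| |].
    have -> : q * r * (a * b) = (q * a) * (r * b) by ring.
    exact: dgM.
  by rewrite !rmorphM; field; rewrite q0 r0.
- move=> x [q [u [v [h1 q0 /= h2 ->]]]]; rewrite mulr0 in h2.
  by rewrite (dg_fun dG h2) rmorph0 mul0r subrr mul0r.
- move=> a pa; have [x [h hr]] := dg_ker dG pa.
  by exists x; split=> [|r]; apply: dgfrac_sub.
Qed.

(** A maximal graph is total. To add [z], let [F] be the image of the domain in [k], which is a
    field by maximality. If p(z) is transcendental over [F], any value is consistent and 0 is taken.
    If it is algebraic, its minimal polynomial is separable and determines the value. *)
Theorem extend_derivation (G0 : set (R * k)) : dgraph G0 -> exists d : R -> k,
  [/\ forall a b, d (a + b) = d a + d b, forall a b, d (a * b) = p a * d b + p b * d a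
    & forall a x, G0 (a, x) -> d a = x].
Proof.
move=> dG0.
have [|F [S0 FS0] FP tF|G [[dG G0G] maxG]] :=
  @zorn_sets _ (fun G => dgraph G /\ G0 `<=` G) G0; first by split.
  have two S S' : F S -> F S' -> exists2 S'', F S'' & S `<=` S'' /\ S' `<=` S''.
    by move=> FS FS'; case: (tF _ _ FS FS') => h; [exists S'|exists S] => //; split.
  split; last by move=> x hx; exists S0 => //; case: (FP _ FS0) => _; exact.
  split.
  - by exists S0 => //; case: (FP _ FS0) => h _; exact: dg1.
  - move=> a x b y [S FS Su] [S' FS' Sv]; have [S'' FS'' [h1 h2]] := two _ _ FS FS'.
    by exists S'' => //; case: (FP _ FS'') => h _; apply: dgB => //; [exact: h1|exact: h2].
  - move=> a x b y [S FS Su] [S' FS' Sv]; have [S'' FS'' [h1 h2]] := two _ _ FS FS'.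
    by exists S'' => //; case: (FP _ FS'') => h _; apply: dgM => //; [exact: h1|exact: h2].
  - by move=> x [S FS Sx]; case: (FP _ FS) => h _; exact: dg_fun Sx.
  - move=> a pa; case: (FP _ FS0) => h _; have [x [h1 h2]] := dg_ker h pa.
    by exists x; split=> [|r]; exists S0.
have fracG r q y x : G (q, y) -> p q != 0 -> G (q * r, x) -> exists w, G (r, w).
  move=> h1 q0 h2; exists ((x - p r * y) / p q).
  apply: (maxG (dgfrac G)); [exact: dgfrac_sub| |by exists q, x, y].
  split; first exact: dgraph_frac.
  by move=> ? /G0G; exact: dgfrac_sub.
have domker a : p a = 0 -> exists x, G (a, x) by move=> /(dg_ker dG)[x [h _]]; exists x.
suff tot z : exists x, G (z, x).
  have [d hd] := choice tot.
  exists d; split=> [a b|a b|a x /G0G h]; apply: (dg_eq dG (hd _)) => //.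
    exact: (dgD dG).
  exact: (dgM dG).
have [F eF] : exists F : subr k, forall u, F u <-> exists a x, G (a, x) /\ u = p a.
  unshelve eexists (@Subr _ (fun u => exists a x, G (a, x) /\ u = p a) _ _ _) => //.
  - by exists 1, 0; rewrite rmorph1; split=> //; exact: dg1.
  - move=> _ _ [a [x [h ->]]] [b [y [h' ->]]]; exists (a - b), (x - y); rewrite rmorphB.
    by split=> //; exact: dgB.
  - move=> _ _ [a [x [h ->]]] [b [y [h' ->]]]; exists (a * b), (p a * y + p b * x).
    by rewrite rmorphM; split=> //; exact: dgM.
have FV u : F u -> F u^-1.
  move=> /eF[a [x [h ->]]]; have [->|a0] := eqVneq (p a) 0; first by rewrite invr0; exact: sr0.
  have [r er] := psurj (p a)^-1.
  have pk : p (a * r - 1) = 0 by rewrite rmorphB rmorphM rmorph1 -er divff // subrr.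
  have [y hy] := domker _ pk; have := dgD dG hy (dg1 dG); rewrite subrK => h'.
  have [w hw] := fracG _ _ _ _ h a0 h'.
  by apply/eF; exists r, w.
have lift (f : {poly k}) : pcoef F f -> exists g t, [/\ dgpoly G g t, map_poly p g = f & size g = size f].
  move=> hf.
  have /choice[g hg] : forall i, exists ax : R * k, [/\ G ax, p ax.1 = f`_i & f`_i = 0 -> ax.1 = 0].
    move=> i; have [e|f0] := eqVneq f`_i 0.
      by exists (0, 0); rewrite e rmorph0; split=> //; exact: dg0.
    by have /eF[a [x [h e]]] := hf i; exists (a, x); split=> // e'; rewrite e' eqxx in f0.
  pose g' := \poly_(i < size f) (g i).1.
  have eg : map_poly p g' = f.
    apply/polyP => i; rewrite coef_map coef_poly; case: ltnP => hi; first by case: (hg i).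
    by rewrite nth_default //; exact: rmorph0.
  exists g', (\poly_(i < size f) (g i).2); split=> //.
    move=> i; rewrite !coef_poly; case: ifP => _; last exact: dg0.
    by case: (hg i); case: (g i).
  apply/eqP; rewrite eqn_leq size_poly /= -{1}eg; apply/leq_sizeP => j hj.
  by rewrite coef_map nth_default //; exact: rmorph0.
have adj c : (forall f t, dgpoly G f t -> p f.[z] = 0 -> G (f.[z], dgval z c f t)) -> exists x, G (z, x).
  move=> key; exists c; apply: (maxG (dgadj G z c)); [exact: dgadj_sub| |exact: dgadj_mem].
  split; first exact: dgadj_dgraph.
  by move=> x /G0G; exact: dgadj_sub.
have pF f t : dgpoly G f t -> pcoef F (map_poly p f).
  by move=> hf i; rewrite coef_map /=; apply/eF; exists f`_i, t`_i.
case: (pselect (exists2 f : {poly k}, pcoef F f /\ f != 0 & root f (p z))); last first.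
  move=> htr; apply: (adj 0) => f t hf fz; apply: dgval_ker => //.
  apply/eqP; apply: contrapT => /negP f0; apply: htr; exists (map_poly p f).
    by split=> //; exact: pF hf.
  by rewrite /root horner_map fz.
move=> [f [hf f0] rf].
have [P mP] := minpoly_exists FV f0 hf rf.
have [_ nd] := minpoly_deriv char0 mP.
have [mon hP rP hm] := mP.
have [P0 [t0 [hP0 eP0 sP0]]] := lift _ hP.
have [|x0 hx0] := domker P0.[z].
  by rewrite -horner_map eP0; apply/eqP.
(* The solution of the linear equation saying that the lift [P0] of the minimal polynomial receives
   at [z] the value [x0] already assigned to P0(z), an element of the kernel. *)
pose c := (x0 - t0.[p z]) / P^`().[p z].
have ec : dgval z c P0 t0 = x0.
  by rewrite /dgval eP0 /c mulrC divfK // addrC subrK.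
apply: (adj c) => g t; have [n] := ubnP (size (map_poly p g)); elim: n g t => // n IH g t sg hg gz.
have rg : root (map_poly p g) (p z) by rewrite /root horner_map gz.
have [q hq eq] := hm _ (pF _ _ hg) rg.
have [q0 [u [hq0 eq0 _]]] := lift _ hq.
have e1 : map_poly p (g - q0 * P0) = 0 by rewrite rmorphB rmorphM /= eq0 eP0 -eq subrr.
have h1 := dgval_ker dG z c (dgpolyB dG hg (dgpolyM dG hq0 hP0)) e1.
have h2 : G (q0.[z] * P0.[z], p q0.[z] * x0).
  by apply: dg_lin => //; rewrite -horner_map eP0; apply/eqP.
have := dgD dG h1 h2.
rewrite dgvalB dgvalM ec hornerD hornerN hornerM subrK.
by rewrite -[p P0.[z]]horner_map eP0 (eqP rP) mul0r addr0 subrK.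
Qed.

End ExtendDerivation.

(** A transcendental [z] would carry the derivation d/dz of L[z], which extends to [K]. *)
Lemma algebraic_of_derivations (K : fieldType) (L : subr K) : (forall n, n.+1%:R != 0 :> K) ->
  (forall d : K -> K, (forall a b, d (a + b) = d a + d b) -> (forall a b, d (a * b) = a * d b + b * d a) ->
     (forall u, L u -> d u = 0) -> forall z, d z = 0) ->
  forall z, exists P : {poly K}, [/\ P != 0, pcoef L P & root P z].
Proof.
move=> char0 hd z; apply: contrapT => htr.
have tr (P : {poly K}) : pcoef L P -> P.[z] = 0 -> P = 0.
  move=> hP Pz; apply/eqP; apply: contrapT => /negP P0; apply: htr; exists P.
  by split=> //; apply/eqP.
pose G0 : set (K * K) := [set ax | exists P, [/\ pcoef L P, ax.1 = P.[z] & ax.2 = P^`().[z]]].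
have dG0 : dgraph (idfun : {rmorphism K -> K}) G0.
  split.
  - by exists 1; rewrite /= derivC !hornerC; split=> //; exact: pcoef1.
  - move=> a x b y [P [hP /= -> ->]] [Q [hQ /= -> ->]]; exists (P - Q).
    by rewrite /= derivB !hornerD !hornerN; split=> //; exact: pcoefB.
  - move=> a x b y [P [hP /= -> ->]] [Q [hQ /= -> ->]]; exists (P * Q).
    by rewrite /= derivM !hornerD !hornerM; split=> //; [exact: pcoefM|ring].
  - by move=> x [P [hP /= e ->]]; rewrite (tr P hP (esym e)) deriv0 horner0.
  - move=> a /= ->; exists 0; split=> [|r]; exists 0; rewrite /= deriv0 !horner0 ?mulr0; split=> //; exact: pcoef0.
have [|d [dD dM dG]] := extend_derivation char0 _ dG0; first by move=> a; exists a.
have d1 : d z = 1.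
  by apply: dG; exists 'X; rewrite /= derivX hornerX hornerC; split=> //; exact: pcoefX.
have d0 : d z = 0.
  apply: hd => [||u Lu]; [exact: dD|exact: dM|].
  by apply: dG; exists u%:P; rewrite /= derivC !hornerC; split=> //; exact: pcoefC.
by have := oner_neq0 K; rewrite -d1 d0 eqxx.
Qed.

Definition pimod (R : pzRingType) (k : fieldType) (p : {rmorphism R -> k}) : Type := k.
Section PiMod.
Variables (R : comUnitRingType) (k : fieldType) (p : {rmorphism R -> k}).
HB.instance Definition _ := GRing.Zmodule.on (pimod p).
Definition pimod_scale (r : R) (x : pimod p) : pimod p := p r * (x : k).
Fact pimod_scaleA a b v : pimod_scale a (pimod_scale b v) = pimod_scale (a * b) v.
Proof. by rewrite /pimod_scale rmorphM mulrA. Qed.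
Fact pimod_scale1 : left_id 1 pimod_scale.
Proof. by move=> v; rewrite /pimod_scale rmorph1 mul1r. Qed.
Fact pimod_scaleDr : right_distributive pimod_scale +%R.
Proof. by move=> a u v; exact: mulrDr. Qed.
Fact pimod_scaleDl v : {morph pimod_scale^~ v : a b / a + b}.
Proof. by move=> a b; rewrite /pimod_scale rmorphD; exact: mulrDl. Qed.
HB.instance Definition _ := GRing.Zmodule_isLmodule.Build R (pimod p)
  pimod_scaleA pimod_scale1 pimod_scaleDr pimod_scaleDl.
End PiMod.

Section Derivations.
Variables (k : fieldType) (R : comUnitRingType) (c : {rmorphism k -> R}).

Section Basic.
Variables (M : lmodType R) (d : R -> M).
Hypothesis hd : is_derivation c d.

Lemma derD a b : d (a + b) = d a + d b. Proof. by case: hd. Qed.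
Lemma derM a b : d (a * b) = a *: d b + b *: d a. Proof. by case: hd. Qed.
Lemma derc z : d (c z) = 0. Proof. by case: hd. Qed.
Lemma der1 : d 1 = 0. Proof. by rewrite -(rmorph1 c) derc. Qed.
Lemma der0 : d 0 = 0. Proof. by rewrite -(rmorph0 c) derc. Qed.
Lemma derN a : d (- a) = - d a.
Proof. by apply/eqP; rewrite -addr_eq0 -derD addNr der0. Qed.
Lemma derB a b : d (a - b) = d a - d b. Proof. by rewrite derD derN. Qed.
Lemma der_sum I (r : seq I) (P : pred I) (F : I -> R) :
  d (\sum_(i <- r | P i) F i) = \sum_(i <- r | P i) d (F i).
Proof. by elim/big_ind2: _ => [|a x b y <- <-|//]; [exact: der0|rewrite derD]. Qed.
Lemma derX a n : d (a ^+ n) = (a ^+ n.-1 *+ n) *: d a.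
Proof.
elim: n => [|n IH]; first by rewrite mulr0n scale0r der1.
rewrite exprS derM IH scalerA -scalerDl mulrnAr /=; congr (_ *: _).
case: n {IH} => [|n]; first by rewrite mulr0n add0r mulr1n.
by rewrite -exprS [RHS]mulrSr.
Qed.
Lemma derV a : a \is a GRing.unit -> d a^-1 = - (a^-1 * a^-1) *: d a.
Proof.
move=> ua; have : d (a * a^-1) = 0 by rewrite divrr // der1.
rewrite derM => /eqP; rewrite addr_eq0 => /eqP h.
have -> : d a^-1 = a^-1 *: (a *: d a^-1) by rewrite scalerA mulVr // scale1r.
by rewrite h scalerN scalerA scaleNr.
Qed.
Lemma der_horner (f : {poly R}) a : (forall i, d f`_i = 0) -> d f.[a] = f^`().[a] *: d a.
Proof.
move=> hf; rewrite horner_coef der_sum.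
have -> : f^`().[a] = \sum_(i < size f) f`_i * (a ^+ i.-1 *+ i).
  have [->|f0] := eqVneq f 0; first by rewrite deriv0 horner0 size_poly0 big_ord0.
  rewrite (horner_coef_wide _ (_ : size f^`() <= (size f).-1)%N); last first.
    by rewrite -ltnS prednK ?size_poly_gt0 // lt_size_deriv.
  rewrite -[in RHS](prednK (_ : 0 < size f)%N) ?size_poly_gt0 // big_ord_recl /= mulr0n mulr0 add0r.
  by apply: eq_bigr => i _; rewrite coef_deriv /bump leq0n add1n /= mulrnAl mulrnAr.
rewrite scaler_suml; apply: eq_bigr => i _.
by rewrite derM hf scaler0 addr0 derX scalerA.
Qed.
End Basic.

Lemma der_comb (M : lmodType R) n (e : 'I_n -> R) (D : 'I_n -> R -> M) :
  (forall i, is_derivation c (D i)) -> is_derivation c (fun z => \sum_i e i *: D i z).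
Proof.
move=> hD; split.
- by move=> a b; rewrite -big_split; apply: eq_bigr => i _; rewrite (derD (hD i)) scalerDr.
- move=> a b; rewrite !scaler_sumr -big_split; apply: eq_bigr => i _ /=.
  by rewrite (derM (hD i)) scalerDr !scalerA ![e i * _]mulrC.
- by move=> z; rewrite big1 // => i _; rewrite (derc (hD i)) scaler0.
Qed.

Lemma der_scaled (M : lmodType R) n (m : 'I_n -> M) (D : 'I_n -> R -> R) :
  (forall i, is_self_derivation c (D i)) -> is_derivation c (fun z => \sum_i D i z *: m i).
Proof.
move=> hD; split.
- by move=> a b; rewrite -big_split; apply: eq_bigr => i _; rewrite (derD (hD i)) scalerDl.
- move=> a b; rewrite !scaler_sumr -big_split; apply: eq_bigr => i _ /=.
  by rewrite (derM (hD i)) scalerDl !scalerA.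
- by move=> z; rewrite big1 // => i _; rewrite (derc (hD i)) scale0r.
Qed.

Lemma der_sub (M : lmodType R) (d d' : R -> M) : is_derivation c d -> is_derivation c d' ->
  is_derivation c (fun z => d z - d' z).
Proof.
move=> hd hd'; split.
- by move=> a b; rewrite (derD hd) (derD hd') opprD addrACA.
- by move=> a b; rewrite (derM hd) (derM hd') !scalerBr opprD addrACA.
- by move=> z; rewrite (derc hd) (derc hd') subrr.
Qed.

Lemma der_scale (M : lmodType R) a (d : R -> M) : is_derivation c d ->
  is_derivation c (fun z => a *: d z).
Proof.
move=> hd; split.
- by move=> x y; rewrite (derD hd) scalerDr.
- by move=> x y; rewrite (derM hd) scalerDr !scalerA ![a * _]mulrC.
- by move=> z; rewrite (derc hd) scaler0.
Qed.

(** Essential finite type over [k], phrased as an induction principle for [R]: generation by [s] and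
    the constants under ring operations and inversion of units. *)
Definition ess_finite := exists s : seq R, forall S : set R,
  (forall z, S (c z)) -> (forall x, x \in s -> S x) ->
  (forall x y, S x -> S y -> S (x - y)) -> (forall x y, S x -> S y -> S (x * y)) ->
  (forall x, S x -> x \is a GRing.unit -> S x^-1) -> forall r, S r.

Section Torsion.
Variables (K : fieldType) (i : {rmorphism R -> K}).
Hypothesis ii : injective i.
Hypothesis char0 : forall n, n.+1%:R != 0 :> K.
Variables (n : nat) (f : 'I_n -> R).
Hypothesis hK : forall d : K -> K, (forall a b, d (a + b) = d a + d b) ->
  (forall a b, d (a * b) = a * d b + b * d a) -> (forall z, d (i (c z)) = 0) ->
  (forall j, d (i (f j)) = 0) -> forall z, d z = 0.
Hypothesis efR : ess_finite.

Let kills (M : lmodType R) (d : R -> M) := is_derivation c d /\ forall j, d (f j) = 0.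

(** This is the torsion of the differentials modulo the df_j. Each [b] satisfies a shortest relation
    Q(b) = 0 with constant coefficients, so Q'(b) d(b) = 0 with Q'(b) nonzero; finitely many
    generators share one multiplier. The element [a] has to be uniform in [M] and [d]. *)
Lemma torsion_bound : exists2 a, a != 0 & forall (M : lmodType R) (d : R -> M), kills d -> forall z, a *: d z = 0.
Proof.
(* The elements constant for all these derivations at once. A derivation of [K] that kills them
   kills the [f j] and hence vanishes, so [K] is algebraic over them. *)
pose L0 : set K := [set u | exists r, i r = u /\ forall (M : lmodType R) (d : R -> M), kills d -> d r = 0].
have [L eL] : exists L : subr K, forall u, L u <-> L0 u.
  unshelve eexists (@Subr _ L0 _ _ _) => //.
  - by exists 1; rewrite rmorph1; split=> // M d [hd _]; exact: der1 hd.
  - move=> _ _ [r [<- hr]] [s [<- hs]]; exists (r - s); rewrite rmorphB; split=> // M d h.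
    by rewrite (derB h.1) (hr _ _ h) (hs _ _ h) subrr.
  - move=> _ _ [r [<- hr]] [s [<- hs]]; exists (r * s); rewrite rmorphM; split=> // M d h.
    by rewrite (derM h.1) (hr _ _ h) (hs _ _ h) !scaler0 addr0.
have alg := @algebraic_of_derivations K L char0.
have /alg{}alg : forall d : K -> K, (forall a b, d (a + b) = d a + d b) -> (forall a b, d (a * b) = a * d b + b * d a) ->
     (forall u, L u -> d u = 0) -> forall z, d z = 0.
  move=> d dD dM dL; apply: hK => // [z|j]; apply: dL; apply/eL.
    by exists (c z); split=> // M d' [h _]; exact: derc h _.
  by exists (f j); split=> // M d' [_]; exact.
have one b : exists2 a, a != 0 & forall (M : lmodType R) (d : R -> M), kills d -> a *: d b = 0.
  have ex : exists m, `[< exists P : {poly K}, [/\ P != 0, pcoef L P, root P (i b) & size P = m] >].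
    by have [P [P0 hP rP]] := alg (i b); exists (size P); apply/asboolP; exists P.
  case: (ex_minnP ex) => m /asboolP[P [P0 hP rP sP]] hm.
  have s1 : (1 < size P)%N by exact: root_size_gt1 rP.
  have d0 : P^`() != 0.
    apply/eqP => /polyP/(_ (size P).-2); rewrite coef_deriv coef0 prednK -?subn1 ?subn_gt0 //.
    rewrite subn1 -mulr_natr => /eqP; rewrite mulf_eq0 -/(lead_coef P) lead_coef_eq0 (negPf P0) /=.
    by apply/negP; rewrite -(prednK (_ : 0 < (size P).-1)%N) ?char0 // -ltnS prednK // ltnW.
  have nd : P^`().[i b] != 0.
    apply/negP => rd; have : (size P <= size P^`())%N.
      by rewrite sP; apply: hm; apply/asboolP; exists P^`(); split=> //; exact: pcoef_deriv.
    by rewrite leqNgt lt_size_deriv.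
  have /choice[r hr] : forall j, exists r, i r = P`_j /\
      forall (M : lmodType R) (d : R -> M), kills d -> d r = 0.
    by move=> j; apply/eL; exact: hP.
  pose Q := \poly_(j < size P) r j.
  have eQ : map_poly i Q = P.
    apply/polyP => j; rewrite coef_map coef_poly; case: ltnP => hj; first by case: (hr j).
    by rewrite nth_default //; exact: rmorph0.
  have Qb : Q.[b] = 0 by apply: ii; rewrite -horner_map eQ (eqP rP); exact/esym/rmorph0.
  exists Q^`().[b].
    by apply: contraNneq nd => e; rewrite -eQ deriv_map horner_map e; apply/eqP; exact: rmorph0.
  move=> M d h; rewrite -(der_horner h.1) ?Qb ?(der0 h.1) // => j.
  by rewrite coef_poly; case: ifP => _; [exact: (hr j).2|exact: der0 h.1].
have [s hs] := efR.
have [a a0 ha] : exists2 a, a != 0 & forall x, x \in s ->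
    forall (M : lmodType R) (d : R -> M), kills d -> a *: d x = 0.
  elim: (s) => [|x t [a a0 ha]]; first by exists 1; rewrite ?oner_neq0.
  have [b b0 hb] := one x; exists (a * b).
    by rewrite -(inj_eq ii) rmorphM rmorph0 mulf_neq0 // -(rmorph0 i) (inj_eq ii).
  move=> y; rewrite inE => /orP[/eqP->|yt] M d h; first by rewrite -scalerA (hb _ _ h) scaler0.
  by rewrite mulrC -scalerA (ha _ yt _ _ h) scaler0.
exists a => // M d h; apply: hs.
- by move=> z; rewrite (derc h.1) scaler0.
- by move=> x xs; exact: ha.
- by move=> x y hx hy; rewrite (derB h.1) scalerBr hx hy subrr.
- by move=> x y hx hy; rewrite (derM h.1) scalerDr !scalerA ![a * _]mulrC -!scalerA hx hy !scaler0 addr0.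
- by move=> x hx ux; rewrite (derV h.1) // scalerA mulrC -scalerA hx scaler0.
Qed.

End Torsion.
End Derivations.

Section Twist.
Variables (k : fieldType) (R : comUnitRingType) (c : {rmorphism k -> R}).
Variables (D : R -> R) (hD : is_self_derivation c D) (M : lmodType R).

(* The module M + M e on which r acts as r + D(r) e, where e^2 = 0. *)
Definition twist : Type := let _ := hD in (M * M)%type.
HB.instance Definition _ := GRing.Zmodule.on twist.
Definition twist_scale (r : R) (x : twist) : twist := (r *: x.1, r *: x.2 + D r *: x.1).
Fact twist_scaleA a b v : twist_scale a (twist_scale b v) = twist_scale (a * b) v.
Proof.
congr (_, _) => /=; first by rewrite scalerA.
rewrite (derM hD) scalerDr scalerDl !scalerA -addrA; congr (_ + _).
by congr (_ *: _ + _ *: _); exact: mulrC.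
Qed.
Fact twist_scale1 : left_id 1 twist_scale.
Proof. by case=> u v; rewrite /twist_scale /= !scale1r (der1 hD) scale0r addr0. Qed.
Fact twist_scaleDr : right_distributive twist_scale +%R.
Proof. by move=> a u v; congr (_, _) => /=; rewrite !scalerDr // addrACA. Qed.
Fact twist_scaleDl v : {morph twist_scale^~ v : a b / a + b}.
Proof. by move=> a b; congr (_, _) => /=; rewrite ?(derD hD) !scalerDl // addrACA. Qed.
HB.instance Definition _ := GRing.Zmodule_isLmodule.Build R twist
  twist_scaleA twist_scale1 twist_scaleDr twist_scaleDl.
End Twist.

Section Spanned.
Variables (k : fieldType) (R : comUnitRingType) (c : {rmorphism k -> R}).
Variables (n : nat) (D : 'I_n -> R -> R).
Hypothesis hD : forall i, is_self_derivation c (D i).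
Hypothesis hbr : forall i j, exists a : 'I_n -> R, forall z,
  D i (D j z) - D j (D i z) = \sum_l a l * D l z.

(** The coefficients [m i] lie in the target module: [a] times any derivation factors through z |->
    (D_i z)_i. *)
Definition spanned : set R := [set a | forall (M : lmodType R) (d : R -> M), is_derivation c d ->
  exists m : 'I_n -> M, forall z, a *: d z = \sum_i D i z *: m i].

Lemma spanned0 : spanned 0.
Proof. by move=> M d _; exists (fun=> 0) => z; rewrite scale0r big1 // => i _; rewrite scaler0. Qed.
Lemma spannedD a b : spanned a -> spanned b -> spanned (a + b).
Proof.
move=> ha hb M d hd; have [m em] := ha M d hd; have [m' em'] := hb M d hd.
exists (fun i => m i + m' i) => z; rewrite scalerDl em em' -big_split.
by apply: eq_bigr => i _; rewrite scalerDr.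
Qed.
Lemma spannedM a b : spanned b -> spanned (a * b).
Proof.
move=> hb M d hd; have [m em] := hb M d hd; exists (fun i => a *: m i) => z.
by rewrite -scalerA em scaler_sumr; apply: eq_bigr => i _; rewrite !scalerA mulrC.
Qed.

(** The pair (d z, d (D_j z)) is a derivation into the twisted module. Its second component produces
    the term D_j(a) d(z); the first component, taken at D_j z, removes a d(D_j z), and what remains
    consists of brackets of the [D i], which are combinations of them. *)
Lemma spanned_stable j a : spanned a -> spanned (D j a).
Proof.
move=> ha M d hd; pose T := twist (hD j) M.
pose d' : R -> T := fun z => (d z, d (D j z)).
have hd' : is_derivation c d'.
  split.
  - by move=> x y; congr (_, _) => /=; rewrite ?(derD (hD j)) (derD hd).
  - move=> x y; congr (_, _) => /=; first by rewrite (derM hd).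
    rewrite (derM (hD j)) (derD hd) !(derM hd) /=.
    by rewrite addrACA [X in _ = X]addrACA; congr (_ + _); rewrite addrC // [RHS]addrC.
  - by move=> z; congr (_, _) => /=; rewrite ?(derc (hD j)) ?(derc hd) ?(der0 hd).
have [m em] := ha T d' hd'.
have e1 z : a *: d z = \sum_i D i z *: (m i).1.
  have /(congr1 fst) := em z; rewrite (big_morph fst (id1 := 0) (op1 := +%R)) //.
have e2 z : a *: d (D j z) + D j a *: d z = \sum_i (D i z *: (m i).2 + D j (D i z) *: (m i).1).
  have /(congr1 snd) := em z; rewrite (big_morph snd (id1 := 0) (op1 := +%R)) //.
have /choice[b hb] : forall i, exists b : 'I_n -> R, forall z, D j (D i z) - D i (D j z) = \sum_l b l * D l z.
  by move=> i; exact: hbr.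
exists (fun l => (m l).2 + \sum_i b i l *: (m i).1) => z.
have := e2 z; rewrite e1 => /eqP; rewrite eq_sym addrC -subr_eq => /eqP <-.
rewrite -sumrB.
rewrite (eq_bigr (fun i => D i z *: (m i).2 + \sum_l (b i l * D l z) *: (m i).1)); last first.
  by move=> i _; rewrite -addrA -scalerBl hb scaler_suml.
rewrite big_split exchange_big -big_split; apply: eq_bigr => l _ /=.
rewrite scalerDr; congr (_ + _); rewrite scaler_sumr; apply: eq_bigr => i _.
by rewrite scalerA mulrC.
Qed.

(** By Cramer's rule, det times [d] minus a combination of the [D i] built from the adjugate matrix
    kills every [f j], so [a] annihilates the difference. *)
Lemma spanned_det (f : 'I_n -> R) a : (forall (M : lmodType R) (d : R -> M), is_derivation c d ->
    (forall j, d (f j) = 0) -> forall z, a *: d z = 0) ->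
  spanned (a * \det (\matrix_(i, j) D i (f j))).
Proof.
move=> ha M d hd; set N := \matrix_(i, j) D i (f j); pose B := \adj N.
pose d1 z := \sum_j (\sum_i B j i * D i z) *: d (f j).
have hd1 : is_derivation c d1.
  apply: (@der_scaled _ _ _ _ _ _ (fun j z => \sum_i B j i * D i z)) => j.
  exact: (@der_comb _ _ _ R^o).
have := ha M (fun z => \det N *: d z - d1 z) (der_sub (der_scale _ hd) hd1).
move=> h; exists (fun i => \sum_j (a * B j i) *: d (f j)) => z.
have hf j : \det N *: d (f j) - d1 (f j) = 0.
  apply/eqP; rewrite subr_eq0 /d1; apply/eqP.
  have e l : \sum_i B l i * D i (f j) = (\det N) *+ (l == j).
    have := mul_adj_mx N => /matrixP/(_ l j); rewrite !mxE => <-.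
    apply: eq_bigr => i _; have -> : N i j = D i (f j) by rewrite mxE.
    by [].
  under eq_bigr do rewrite e.
  rewrite (bigD1 j) //= eqxx mulr1n big1 ?addr0 // => l /negPf->.
  by rewrite mulr0n scale0r.
have /eqP := h hf z; rewrite scalerBr subr_eq0 scalerA => /eqP ->.
rewrite /d1 scaler_sumr; under [RHS]eq_bigr do rewrite scaler_sumr.
rewrite exchange_big; apply: eq_bigr => j _ /=; rewrite scalerA mulr_sumr scaler_suml.
by apply: eq_bigr => i _; rewrite scalerA; congr (_ *: _); ring.
Qed.

End Spanned.

(** * Dimension theory and the regularity criterion *)

Section Ideals.
Variable R : comPzRingType.
Implicit Types (I J P Q : set R).

Definition isideal I := [/\ I 0, forall a b, I a -> I b -> I (a + b) & forall a b, I b -> I (a * b)].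

Lemma isidealN I a : isideal I -> I a -> I (- a).
Proof. by move=> [_ _ h] Ia; rewrite -mulN1r; exact: h. Qed.
Lemma isidealB I a b : isideal I -> I a -> I b -> I (a - b).
Proof. by move=> iI Ia Ib; case: (iI) => _ h _; apply: h => //; exact: isidealN. Qed.
Lemma isideal_sum I T (r : seq T) (p : pred T) (F : T -> R) : isideal I ->
  (forall i, p i -> I (F i)) -> I (\sum_(i <- r | p i) F i).
Proof. by move=> [h0 hD _] h; elim/big_ind: _. Qed.
Lemma prime_isideal P : prime_ideal P -> isideal P.
Proof. by move=> [[? ?] ? _ _]; split. Qed.
Lemma primeM_neg P a b : prime_ideal P -> ~ P a -> ~ P b -> ~ P (a * b).
Proof. by move=> [_ _ _ h] na nb /h[]. Qed.
Lemma primeX_neg P a n : prime_ideal P -> ~ P a -> ~ P (a ^+ n).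
Proof.
move=> pP na; elim: n => [|n IH]; first by rewrite expr0; case: pP.
by rewrite exprS; exact: primeM_neg.
Qed.
Lemma prime_prod_neg P T (r : seq T) (F : T -> R) : prime_ideal P ->
  (forall i, ~ P (F i)) -> ~ P (\prod_(i <- r) F i).
Proof.
move=> pP h; elim: r => [|x r IH]; first by rewrite big_nil; case: pP.
by rewrite big_cons; exact: primeM_neg.
Qed.

Lemma ideal_gen_isideal n (a : 'I_n -> R) : isideal (ideal_gen a).
Proof.
split.
- by exists (fun=> 0); rewrite big1 // => i _; rewrite mul0r.
- move=> _ _ [c ->] [d ->]; exists (fun i => c i + d i); rewrite -big_split.
  by apply: eq_bigr => i _; rewrite mulrDl.
- move=> x _ [c ->]; exists (fun i => x * c i); rewrite mulr_sumr.
  by apply: eq_bigr => i _; exact: mulrA.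
Qed.

Lemma ideal_gen_mem n (a : 'I_n -> R) i : ideal_gen a (a i).
Proof.
exists (fun j => (j == i)%:R); rewrite (bigD1 i) //= eqxx mul1r big1 ?addr0 // => j /negPf->.
by rewrite mul0r.
Qed.

Lemma noetherian_chain (I : nat -> set R) : noetherian R -> (forall n, isideal (I n)) ->
  (forall n, I n `<=` I n.+1) -> exists N, forall n, I n `<=` I N.
Proof.
move=> nR iI sI.
have mono m n : (m <= n)%N -> I m `<=` I n.
  move=> /subnK <-; elim: (n - m)%N => [//|d IH]; rewrite addSn; exact: subset_trans IH _.
pose U := [set u | exists n, I n u].
have [|||m [a Ua]] := nR U.
- by exists 0%N; case: (iI 0%N).
- move=> u v [p Iu] [n Iv]; exists (maxn p n); case: (iI (maxn p n)) => _ h _; apply: h.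
    by apply: mono Iu; rewrite leq_maxl.
  by apply: mono Iv; rewrite leq_maxr.
- by move=> u v [n Iv]; exists n; case: (iI n) => _ _ h; exact: h.
have /choice[f hf] : forall i, exists n, I n (a i).
  by move=> i; have : U (a i) by rewrite Ua; exact: ideal_gen_mem.
exists (\max_i f i) => n u Iu; have : U u by exists n.
rewrite Ua => -[c ->]; apply: isideal_sum => // i _; case: (iI (\max_i f i)) => _ _; apply.
by apply: mono (hf i); exact: leq_bigmax.
Qed.

Lemma noetherian_max (F : set (set R)) I0 : noetherian R -> F I0 -> (forall I, F I -> isideal I) ->
  exists I, F I /\ forall J, F J -> I `<=` J -> J `<=` I.
Proof.
move=> nR F0 hF; apply: contrapT => h.
have /choice[f hf] : forall I, exists J, F I -> [/\ F J, I `<=` J & ~ (J `<=` I)].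
  move=> I; case: (pselect (F I)) => FI; last by exists I.
  apply: contrapT => h1; apply: h; exists I; split=> // J FJ IJ.
  by apply: contrapT => nJI; apply: h1; exists J.
have Fn n : F (iter n f I0) by elim: n => //= n IH; case: (hf _ IH).
have [||N hN] := @noetherian_chain (fun n => iter n f I0) nR.
- by move=> n; exact: hF.
- by move=> n; case: (hf _ (Fn n)).
by case: (hf _ (Fn N)) => _ _; apply; exact: hN N.+1.
Qed.

Lemma prime_disjoint I (S : set R) : isideal I -> S 1 -> (forall a b, S a -> S b -> S (a * b)) ->
  (forall a, S a -> ~ I a) -> exists P, [/\ prime_ideal P, I `<=` P & forall a, S a -> ~ P a].
Proof.
move=> iI S1 SM dI.
have [|F [J0 FJ0] FP tF|P [[iP IP dP] maxP]] := @zorn_sets _ (fun J => [/\ isideal J, I `<=` J & forall a, S a -> ~ J a]) I.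
- by split.
- split.
  + split.
    * by exists J0 => //; case: (FP _ FJ0) => -[].
    * move=> a b [J FJ Ja] [J' FJ' Jb]; case: (tF _ _ FJ FJ') => h.
        by exists J' => //; case: (FP _ FJ') => -[_ hD _] _ _; apply: hD => //; exact: h.
      by exists J => //; case: (FP _ FJ) => -[_ hD _] _ _; apply: hD => //; exact: h.
    * by move=> a b [J FJ Jb]; exists J => //; case: (FP _ FJ) => -[_ _ hM] _ _; exact: hM.
  + by move=> x Ix; exists J0 => //; case: (FP _ FJ0) => _ h _; exact: h.
  + by move=> a Sa [J FJ Ja]; case: (FP _ FJ) => _ _ h; exact: h Sa Ja.
have [P0 PD PM] := iP.
have ext x : ~ P x -> exists s r, S s /\ P (s - r * x).
  move=> nPx; pose J := [set y | exists r, P (y - r * x)].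
  have iJ : isideal J.
    split; first by exists 0; rewrite mul0r subr0.
      by move=> a b [r hr] [s hs]; exists (r + s); have := PD _ _ hr hs; congr P; ring.
    by move=> a b [r hr]; exists (a * r); have := PM a _ hr; congr P; ring.
  apply: contrapT => h; apply: nPx; apply: (maxP J).
  - by move=> y Py; exists 0; rewrite mul0r subr0.
  - split=> //; first by move=> y /IP Py; exists 0; rewrite mul0r subr0.
    by move=> a Sa [r hr]; apply: h; exists a, r.
  - by exists 1; rewrite mul1r subrr.
exists P; split=> //; split=> //; first exact: dP.
move=> a b Pab; case: (pselect (P a)) => na; first by left.
right; apply: contrapT => nb.
have [s [r [Ss hs]]] := ext _ na; have [t [q [St ht]]] := ext _ nb.
apply: (dP (s * t)); first exact: SM.
have -> : s * t = s * (t - q * b) + (q * b) * (s - r * a) + (r * q) * (a * b) by ring.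
by apply: (PD); [apply: (PD)|]; apply: (PM).
Qed.

End Ideals.

(** * Krull's principal ideal theorem *)

Section PrincipalIdealTheorem.
Variable R : comNzRingType.
Hypothesis nR : noetherian R.
Variables (Q0 Q1 Q2 : set R) (t : R).
Hypotheses (pQ0 : prime_ideal Q0) (pQ1 : prime_ideal Q1) (pQ2 : prime_ideal Q2).
Hypotheses (s01 : Q0 `<=` Q1) (s12 : Q1 `<=` Q2) (n10 : ~ (Q1 `<=` Q0)) (n21 : ~ (Q2 `<=` Q1)).
Hypothesis Q2t : Q2 t.
Hypothesis Q2min : forall Q, prime_ideal Q -> Q0 `<=` Q -> Q t -> Q `<=` Q2 -> Q2 `<=` Q.

Lemma nQ1t : ~ Q1 t.
Proof. by move=> Q1t; apply: n21; exact: Q2min. Qed.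

(** The contraction of the extension of [I] to the localization at [Q]. Saturated ideals of [R] thus
    replace ideals of local rings throughout this section. *)
Let sat (Q I : set R) : set R := [set a | exists s, ~ Q s /\ I (s * a)].

Lemma sat_ideal Q I : prime_ideal Q -> isideal I -> isideal (sat Q I).
Proof.
move=> pQ [I0 ID IM]; split.
- by exists 1; rewrite mulr0; split=> //; case: pQ.
- move=> a b [s [ns hs]] [u [nu hu]]; exists (s * u); split; first exact: primeM_neg.
  have -> : s * u * (a + b) = u * (s * a) + s * (u * b) by ring.
  by apply: (ID); apply: (IM).
- by move=> a b [s [ns hs]]; exists s; split=> //; rewrite mulrCA; exact: IM.
Qed.
Lemma sat_sub Q I : prime_ideal Q -> I `<=` sat Q I.
Proof. by move=> pQ a Ia; exists 1; rewrite mul1r; split=> //; case: pQ. Qed.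
Let saturated (Q I : set R) := forall s a, ~ Q s -> I (s * a) -> I a.
Lemma sat_saturated Q I : prime_ideal Q -> isideal I -> saturated Q (sat Q I).
Proof.
move=> pQ [I0 ID IM] s a ns [u [nu hu]]; exists (u * s); split; first exact: primeM_neg.
by rewrite -mulrA.
Qed.
Lemma sat_min Q I J : saturated Q J -> I `<=` J -> sat Q I `<=` J.
Proof. by move=> sJ IJ a [s [ns hs]]; apply: (sJ s) => //; exact: IJ. Qed.

Let addp (I : set R) z : set R := [set a | exists2 c, I (a - c * z) & True].
Lemma addp_ideal I z : isideal I -> isideal (addp I z).
Proof.
move=> [I0 ID IM]; split.
- by exists 0; rewrite // mul0r subr0.
- by move=> a b [c hc _] [d hd _]; exists (c + d) => //; have := ID _ _ hc hd; congr I; ring.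
- by move=> a b [c hc _]; exists (a * c) => //; have := IM a _ hc; congr I; ring.
Qed.
Lemma addp_sub I z : I `<=` addp I z.
Proof. by move=> a Ia; exists 0; rewrite // mul0r subr0. Qed.
Lemma addp_mem I z : isideal I -> addp I z z.
Proof. by move=> [I0 _ _]; exists 1; rewrite // mul1r subrr. Qed.

Lemma nilp x (J : set R) : Q2 x -> isideal J -> Q0 `<=` J -> J t -> saturated Q2 J -> exists N, J (x ^+ N).
Proof.
move=> Q2x iJ QJ Jt sJ; apply: contrapT => h.
pose S : set R := [set a | exists s N, ~ Q2 s /\ a = s * x ^+ N].
have [|||P [pP JP dP]] := @prime_disjoint _ J S iJ.
- by exists 1, 0%N; rewrite mul1r expr0; split=> //; case: pQ2.
- move=> _ _ [s [N [ns ->]]] [u [M [nu ->]]]; exists (s * u), (N + M)%N.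
  by split; [exact: primeM_neg|rewrite exprD; ring].
- by move=> _ [s [N [ns ->]]] /sJ hJ; apply: h; exists N; exact: hJ.
have PQ : P `<=` Q2.
  move=> y Py; apply: contrapT => ny; apply: (dP y) => //.
  by exists y, 0%N; rewrite expr0 mulr1.
apply: (dP x); first by exists 1, 1%N; rewrite mul1r expr1; split=> //; case: pQ2.
by apply: (Q2min pP) => //; [move=> y /QJ; exact: JP|exact: JP].
Qed.

Let good (J : set R) := [/\ isideal J, Q0 `<=` J, J t & saturated Q2 J].

(** The generators of [Q2] are nilpotent modulo [J]; multiplying by the last power of each that
    stays outside [J] produces [z]. *)
Lemma socle J : good J -> ~ J 1 -> exists z, ~ J z /\ forall x, Q2 x -> J (x * z).
Proof.
move=> [iJ QJ Jt sJ] nJ1; have [J0 JD JM] := iJ.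
have [[q0 qD] qM _ _] := pQ2.
have [m [x ex]] := nR q0 qD qM.
have Qx i : Q2 (x i) by rewrite ex; exact: ideal_gen_mem.
suff [z [nz hz]] : exists z, ~ J z /\ forall i, i \in enum 'I_m -> J (x i * z).
  exists z; split=> // y; rewrite ex => -[c ->]; rewrite big_distrl /=.
  apply: isideal_sum => // i _; rewrite -mulrA; apply: (JM); apply: hz; exact: mem_enum.
elim: (enum 'I_m) => [|i s [z [nz hz]]]; first by exists 1.
have [N hN] := nilp (Qx i) iJ QJ Jt sJ.
have ex' : exists e, `[< J (x i ^+ e * z) >] by exists N; apply/asboolP; rewrite mulrC; exact: JM.
case: (ex_minnP ex') => e /asboolP he hmin.
case: e he hmin => [|e] he hmin; first by exfalso; apply: nz; rewrite expr0 mul1r in he.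
exists (x i ^+ e * z); split.
  by move=> h; have := hmin e; rewrite ltnn => /(_ (introT (asboolP _) h)).
move=> j; rewrite inE => /orP[/eqP->|js]; first by rewrite mulrA -exprS.
by rewrite mulrCA; apply: (JM); exact: hz.
Qed.

(** This is the Artinian property of the localization at [Q2] modulo [Q0] and [t]. Take [J] maximal
    among the ideals lying under a chain that never becomes stationary. Adding a socle element [z]
    gives a chain above J + (z), which is stationary by maximality; as Q2 z lies in [J], the chain
    itself is then stationary. *)
Lemma dcc (I : nat -> set R) : (forall n, good (I n)) -> (forall n, I n.+1 `<=` I n) ->
  exists N, forall n, (N <= n)%N -> I n `<=` I n.+1.
Proof.
pose bad J := good J /\ exists I : nat -> set R, [/\ forall n, good (I n), forall n, I n.+1 `<=` I n,
  forall n, J `<=` I n & forall N, exists n, (N <= n)%N /\ ~ (I n `<=` I n.+1)].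
move=> gI dI; apply: contrapT => hbad.
have gJ0 : good (sat Q2 (addp Q0 t)).
  have iq := addp_ideal t (prime_isideal pQ0).
  split; [exact: sat_ideal| | |exact: sat_saturated].
    by move=> a Qa; apply: sat_sub => //; exact: addp_sub.
  by apply: sat_sub => //; apply: addp_mem; exact: prime_isideal.
have bad0 : bad (sat Q2 (addp Q0 t)).
  split=> //; exists I; split=> //.
    move=> n; case: (gI n) => iIn QI It sI; apply: sat_min => // a [c hc _].
    by case: iIn => _ hD hM; rewrite -(subrK (c * t) a); apply: hD; [exact: QI|exact: hM].
  move=> N; apply: contrapT => h; apply: hbad; exists N => n Nn; apply: contrapT => h1.
  by apply: h; exists n.
have [|J [[gJ [I' [gI' dI' JI' bI']]] maxJ]] := noetherian_max nR bad0.
  by move=> ? [[]].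
have [iJ QJ Jt sJ] := gJ.
have mono m n : (m <= n)%N -> I' n `<=` I' m.
  move=> /subnK <-; elim: (n - m)%N => [//|d IH]; rewrite addSn; exact: subset_trans IH.
case: (pselect (J 1)) => J1.
  have [n [_ nn]] := bI' 0%N; apply: nn => a _; apply: JI'.
  by rewrite -(mulr1 a); case: iJ => _ _ h; exact: h.
have [z [nz hz]] := socle gJ J1.
pose I2 n := sat Q2 (addp (I' n) z).
have gI2 n : good (I2 n).
  have [iI QI It sI] := gI' n; have ia := addp_ideal z iI.
  split; [exact: sat_ideal| | |exact: sat_saturated].
    by move=> a Qa; apply: sat_sub => //; apply: addp_sub; exact: QI.
  by apply: sat_sub => //; exact: addp_sub.
have stab : exists N, forall n, (N <= n)%N -> I2 n `<=` I2 n.+1.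
  apply: contrapT => nst.
  have gJ2 : good (sat Q2 (addp J z)).
    have ia := addp_ideal z iJ.
    split; [exact: sat_ideal| | |exact: sat_saturated].
      by move=> a Qa; apply: sat_sub => //; apply: addp_sub; exact: QJ.
    by apply: sat_sub => //; exact: addp_sub.
  have bJ2 : bad (sat Q2 (addp J z)).
    split=> //; exists I2; split=> //.
    - by move=> n a [s [ns [c hc _]]]; exists s; split=> //; exists c => //; exact: dI'.
    - by move=> n a [s [ns [c hc _]]]; exists s; split=> //; exists c => //; exact: JI'.
    - move=> N; apply: contrapT => h; apply: nst; exists N => n Nn; apply: contrapT => h1.
      by apply: h; exists n.
  apply: nz; apply: (maxJ _ bJ2).
    by move=> a Ja; apply: sat_sub => //; exact: addp_sub.
  by apply: sat_sub => //; exact: addp_mem.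
have [N hN] := stab.
case: (pselect (forall n, I' n z)) => hzI.
  have [n [Nn nn]] := bI' N; apply: nn => a Ia.
  have : I2 n.+1 a by apply: hN => //; apply: sat_sub => //; exact: addp_sub.
  have [iI QI It sI] := gI' n.+1; apply: sat_min => // b [c hc _].
  by case: iI => _ hD hM; rewrite -(subrK (c * z) b); apply: hD => //; apply: hM; exact: hzI.
have [n1 hn1] : exists n, ~ I' n z by apply/existsNP.
have [n [Nn nn]] := bI' (maxn N n1); apply: nn => a Ia.
move: Nn; rewrite geq_max => /andP[Nn n1n].
have : I2 n.+1 a by apply: hN => //; apply: sat_sub => //; exact: addp_sub.
move=> [s [ns [c hc _]]].
have [iI QI It sI] := gI' n.+1; have [iIn QIn Itn sIn] := gI' n.
have [_ ID IM] := iI; have [_ InD InM] := iIn.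
have Icz : I' n (c * z).
  have -> : c * z = s * a - (s * a - c * z) by ring.
  by apply: isidealB => //; [exact: InM|exact: dI'].
have Qc : Q2 c.
  by apply: contrapT => nc; apply: hn1; apply: (mono _ _ n1n); exact: sIn nc Icz.
apply: (sI s) => //; rewrite -(subrK (c * z) (s * a)); apply: (ID) => //.
by apply: JI'; exact: hz.
Qed.

Inductive mulI (I J : set R) : R -> Prop :=
| mulI0 : mulI I J 0
| mulID a b u : I a -> J b -> mulI I J u -> mulI I J (a * b + u).

Lemma mulI_ideal I J : isideal J -> isideal (mulI I J).
Proof.
move=> [J0 JD JM]; split; first exact: mulI0.
  by move=> a b ha hb; elim: ha => [|x y u Ix Jy _ IH]; rewrite ?add0r // -addrA; exact: mulID.
move=> a b; elim=> [|x y u Ix Jy _ IH]; first by rewrite mulr0; exact: mulI0.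
by rewrite mulrDr mulrCA; apply: mulID => //; exact: JM.
Qed.

(** One step of the symbolic powers of [Q1] modulo [Q0]; the iterates of the unit ideal are the
    [Y n]. *)
Let symp (J : set R) : set R := sat Q1 [set a | exists2 b, Q0 (a - b) & mulI Q1 J b].

Lemma symp_ideal0 J : isideal J -> isideal [set a | exists2 b, Q0 (a - b) & mulI Q1 J b].
Proof.
move=> iJ; have [m0 mD mM] := mulI_ideal Q1 iJ; have [q0 qD qM] := prime_isideal pQ0.
split; first by exists 0; rewrite // subr0.
  by move=> a b [x hx mx] [y hy my]; exists (x + y); [have := qD _ _ hx hy; congr Q0; ring|exact: mD].
by move=> a b [x hx mx]; exists (a * x); [have := qM a _ hx; congr Q0; ring|exact: mM].
Qed.

Let Y n := iter n symp setT.

Lemma Y_prop n : [/\ isideal (Y n), Q0 `<=` Y n & saturated Q1 (Y n)].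
Proof.
elim: n => [|n [iY QY sY]]; first by split=> //; split.
have h0 := symp_ideal0 iY.
split; [exact: sat_ideal| |exact: sat_saturated].
by move=> a Qa; apply: sat_sub => //; exists 0; rewrite ?subr0 //; exact: mulI0.
Qed.

Lemma Y_dec n : Y n.+1 `<=` Y n.
Proof.
elim: n => [//|n IH] a [s [ns [b hb mb]]]; exists s; split=> //; exists b => //.
by elim: mb => [|x y u Qx Yy _ hu]; [exact: mulI0|apply: mulID => //; exact: IH].
Qed.

Lemma Y_pow a n : Q1 a -> Y n (a ^+ n).
Proof.
move=> Qa; elim: n => [//|n IH]; apply: sat_sub => //; exists (a ^+ n.+1).
  by rewrite subrr; case: (prime_isideal pQ0).
by rewrite exprS -[_ * _]addr0; apply: mulID => //; exact: mulI0.
Qed.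

Lemma det_modp P m (s : 'I_m -> R) (C : 'M[R]_m) : prime_ideal P -> (forall i, ~ P (s i)) ->
  (forall i j, P (C i j)) -> ~ P (\det (\matrix_(i, j) ((s i) *+ (i == j) - C i j))).
Proof.
move=> pP ns hC; have iP := prime_isideal pP; have [P0 PD PM] := iP.
suff : P (\det (\matrix_(i, j) ((s i) *+ (i == j) - C i j)) - \prod_i s i).
  move=> h h'; apply: (@prime_prod_neg _ P _ (index_enum _) s) => //.
  by have := isidealB iP h' h; congr P; ring.
have -> : \prod_i s i = \det (\matrix_(i, j) ((s i) *+ (i == j))).
  rewrite (_ : (\matrix_(_, _) _) = diag_mx (\row_i s i)).
    by rewrite det_diag; apply: eq_bigr => i _; rewrite mxE.
  by apply/matrixP => i j; rewrite !mxE.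
rewrite /determinant -sumrB; apply: isideal_sum => // sg _; rewrite -mulrBr; apply: (PM).
elim: (index_enum _) => [|i r IH]; first by rewrite !big_nil subrr.
rewrite !big_cons !mxE.
set X := \prod_(j <- r) _ in IH *; set Z := \prod_(j <- r) _ in IH *.
set a0 := s i *+ _; set b0 := C i _.
have -> : (a0 - b0) * X - a0 * Z = a0 * (X - Z) - X * b0 by ring.
by apply: isidealB => //; apply: (PM) => //; exact: hC.
Qed.

(** Nakayama's lemma at [P]: the diagonal carries elements outside [P] instead of 1, and the
    determinant stays outside [P]. *)
Lemma cramer P m (s : 'I_m -> R) (C : 'M[R]_m) (y : 'I_m -> R) (J : set R) : prime_ideal P ->
  (forall i, ~ P (s i)) -> (forall i j, P (C i j)) -> isideal J -> saturated P J ->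
  (forall i, J (s i * y i - \sum_j C i j * y j)) -> forall i, J (y i).
Proof.
move=> pP ns hC iJ sJ h i; set N := \matrix_(i, j) ((s i) *+ (i == j) - C i j).
have hN : ~ P (\det N) by exact: det_modp.
apply: (sJ _ _ hN).
have e j : s j * y j - \sum_l C j l * y l = \sum_l N j l * y l.
  transitivity (\sum_l ((s j *+ (j == l)) * y l - C j l * y l)); last first.
    by apply: eq_bigr => l _; rewrite mxE mulrBl.
  rewrite sumrB; congr (_ - _); rewrite (bigD1 j) //= eqxx big1 ?addr0 // => l.
  by rewrite eq_sym => /negPf->; rewrite mul0r.
have -> : \det N * y i = \sum_j \adj N i j * (\sum_l N j l * y l).
  under eq_bigr do rewrite big_distrr /=.
  rewrite exchange_big /=.
  have e2 l : \sum_j \adj N i j * (N j l * y l) = (\det N *+ (i == l)) * y l.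
    have := mul_adj_mx N => /matrixP/(_ i l).
    rewrite [RHS]mxE => <-; rewrite [X in _ = X * _]mxE big_distrl /=.
    by apply: eq_bigr => j _; rewrite mulrA.
  under eq_bigr do rewrite e2.
  by rewrite (bigD1 i) //= eqxx mulr1n big1 ?addr0 // => l; rewrite eq_sym => /negPf->; rewrite mulr0n mul0r.
apply: isideal_sum => // j _; case: iJ => _ _; apply; rewrite -e; exact: h.
Qed.

Lemma principal_ideal_theorem : False.
Proof.
pose I n := sat Q2 (addp (Y n) t).
have satY n : saturated Q2 (Y n).
  by have [_ _ sY] := Y_prop n; move=> s a ns; apply: sY => Q1s; apply: ns; exact: s12.
have [||N hN] := @dcc I.
- move=> n; have [iY QY sY] := Y_prop n; have ia := addp_ideal t iY.
  split; [exact: sat_ideal| | |exact: sat_saturated].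
    by move=> a Qa; apply: sat_sub => //; apply: addp_sub; exact: QY.
  by apply: sat_sub => //; exact: addp_mem.
- by move=> n a [s [ns [c hc _]]]; exists s; split=> //; exists c => //; exact: Y_dec.
have [iY QY sY] := Y_prop N; have [iY' QY' sY'] := Y_prop N.+1.
have [Y0 YD YM] := iY.
have [m [y ey]] := nR Y0 YD YM.
have Yy i : Y N (y i) by rewrite ey; exact: ideal_gen_mem.
(* First use of Nakayama, at [Q2]. The descending chain gives Y_N inside Y_(N+1) + (t) up to
   saturation; since [t] is outside [Q1], the cofactor of [t] lies in Y_N, so Y_N = Y_(N+1). *)
have /choice[w hw] : forall i, exists w : R * ('I_m -> R),
    ~ Q2 w.1 /\ Y N.+1 (w.1 * y i - \sum_j (t * w.2 j) * y j).
  move=> i; have : I N.+1 (y i) by apply: hN => //; apply: sat_sub => //; exact: addp_sub.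
  move=> [s [ns [c hc _]]].
  have : Y N c.
    apply: (sY t _ nQ1t); have -> : t * c = s * y i - (s * y i - c * t) by ring.
    by apply: isidealB => //; [exact: YM|exact: Y_dec].
  rewrite ey => -[d ed]; exists (s, d); split=> //=; move: hc; rewrite ed.
  congr (Y N.+1 (_ - _)); rewrite big_distrl /=; by apply: eq_bigr => j _; ring.
have YN i : Y N.+1 (y i).
  apply: (@cramer Q2 m (fun i => (w i).1) (\matrix_(i, j) (t * (w i).2 j))) => //.
  - by move=> j; exact: (hw j).1.
  - by move=> j l; rewrite mxE mulrC; case: pQ2 => _ h _ _; exact: h.
  - by move=> j; under eq_bigr do rewrite mxE; exact: (hw j).2.
(* Second use, at [Q1]: now Y_N is Q1 Y_N modulo [Q0] up to saturation, so it lies in [Q0], although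
   it contains the N-th powers of the elements of [Q1]. *)
have /choice[v hv] : forall i, exists v : R * ('I_m -> R),
    [/\ ~ Q1 v.1, forall j, Q1 (v.2 j) & Q0 (v.1 * y i - \sum_j v.2 j * y j)].
  move=> i; have [s [ns [b hb mb]]] := YN i.
  suff [q [hq eb]] : exists q : 'I_m -> R, (forall j, Q1 (q j)) /\ b = \sum_j q j * y j.
    by exists (s, q); rewrite /= -eb.
  have [q0 qD qM] := prime_isideal pQ1.
  elim: mb => [|x z u Qx Yz _ [q [hq ->]]].
    by exists (fun=> 0); split=> //; rewrite big1 // => j _; rewrite mul0r.
  have : ideal_gen y z by rewrite -ey.
  move=> [c ->]; exists (fun j => x * c j + q j); split.
    by move=> j; apply: (qD) => //; rewrite mulrC; exact: qM.
  by rewrite big_distrr -big_split; apply: eq_bigr => j _ /=; ring.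
have y0 i : Q0 (y i).
  apply: (@cramer Q1 m (fun i => (v i).1) (\matrix_(i, j) (v i).2 j) y Q0) => //.
  - by move=> j; case: (hv j).
  - by move=> j l; rewrite mxE; case: (hv j).
  - exact: prime_isideal.
  - by move=> s a ns; case: pQ0 => _ _ _ /[apply] -[] // /s01.
  - by move=> j; under eq_bigr do rewrite mxE; case: (hv j).
apply: n10 => a /(Y_pow N); rewrite ey => -[c ec].
have h : Q0 (a ^+ N).
  rewrite ec; have iq := prime_isideal pQ0; apply: isideal_sum => // j _; case: iq => _ _; exact.
by apply: contrapT => na; exact: (primeX_neg pQ0 na h).
Qed.

End PrincipalIdealTheorem.

(** * The length of prime chains below an ideal with given generators *)

Section ChainBound.
Variable R : comNzRingType.
Hypothesis nR : noetherian R.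

Definition chain_of n (P : nat -> set R) := (forall i, (i <= n)%N -> prime_ideal (P i)) /\
  (forall i, (i < n)%N -> P i `<` P i.+1).

(** Working from the top, the principal ideal theorem yields a prime containing [t] strictly between
    P_n and P_(n+2); it replaces P_(n+1), and one descends. *)
Lemma chain_modify n P t : chain_of n.+1 P -> P n.+1 t -> exists P', [/\ chain_of n.+1 P', P' 0%N = P 0%N,
  P' n.+1 = P n.+1 & P' 1%N t].
Proof.
elim: n P => [|n IH] P [pP sP] Pt; first by exists P.
have [P1 [[pP1 sP1] e0 e2 Pt1]] : exists P1, [/\ chain_of n.+2 P1, P1 0%N = P 0%N, P1 n.+2 = P n.+2 & P1 n.+1 t].
  case: (pselect (P n.+1 t)) => h; first by exists P.
  have [Q [pQ [s0Q n0Q] Qt [sQ2 nQ2]]] : exists Q, [/\ prime_ideal Q, P n `<` Q, Q t & Q `<` P n.+2].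
    apply: contrapT => hQ.
    have [s01 n01] := sP n (leqnSn _); have [s12 n12] := sP n.+1 (leqnn _).
    have := @principal_ideal_theorem _ nR (P n) (P n.+1) (P n.+2) t; apply => //.
    - by apply: pP; lia. - by apply: pP; lia. - exact: pP.
    - move=> Q pQ PQ Qt QP; apply: contrapT => nQ; apply: hQ; exists Q; split=> //.
      split=> // QP'; apply: h.
      by apply: s01; exact: QP'.
  exists (fun i => if i == n.+1 then Q else P i); split.
  - split=> i hi.
      by case: eqP => // _; exact: pP.
    case: eqP => [e|ne].
      by rewrite e (_ : (n.+2 == n.+1) = false) //; apply/eqP; lia.
    case: eqP => [[e]|_]; first by rewrite e.
    exact: sP.
  - by case: eqP. - by case: eqP => //; lia.
  - by rewrite eqxx.
have [|P2 [[pP2 sP2] f0 f1 Pt2]] := IH P1 _ Pt1.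
  by split=> i hi; [apply: pP1; lia|apply: sP1; lia].
exists (fun i => if (i <= n.+1)%N then P2 i else P1 i); split.
- split=> i hi.
    by case: ifP => h; [exact: pP2|exact: pP1].
  case: (ltngtP i n.+1) => [h|h|->].
  + exact: sP2.
  + exact: sP1.
  + by rewrite f1; exact: sP1.
- by rewrite /= f0. - by rewrite ltnn. - by [].
Qed.

(** Once the chain is modified so that [t] lies in its second member, dropping the first member
    removes one generator. *)
Lemma chain_bound (s : seq R) n P : chain_of n P -> (forall x, x \in s -> P n x) ->
  (forall a, P n a -> exists2 c : 'I_(size s) -> R, P 0%N (a - \sum_i c i * s`_i) & True) -> (n <= size s)%N.
Proof.
elim: s n P => [|t s IH] n P [pP sP] Ps hs.
  case: n pP sP Ps hs => // n pP sP _ hs; exfalso.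
  have [s01 n10] := sP 0%N isT; apply: n10 => a Pa.
  have mono i : (1 <= i)%N -> (i <= n.+1)%N -> P 1%N `<=` P i.
    elim: i => // -[|i] IHi _ hi //; apply: subset_trans (IHi _ _) _ => //; first exact: ltnW.
    by case: (sP i.+1 hi).
  have [//|c hc _] := hs a; first by apply: (mono n.+1) => //.
  by rewrite big_ord0 subr0 in hc.
case: n pP sP Ps hs => // n pP sP Ps hs; rewrite ltnS.
have [||P' [[pP' sP'] e0 en Pt]] := @chain_modify n P t; [by split|by apply: Ps; rewrite mem_head|].
apply: (IH n (fun i => P' i.+1)).
- by split=> i hi; [exact: pP'|exact: sP'].
- by move=> x xs; rewrite en; apply: Ps; rewrite inE xs orbT.
move=> a; rewrite en => /hs[c hc _]; exists (fun i => c (lift ord0 i)) => //.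
rewrite big_ord_recl /= in hc.
have [P1D P1M] : (forall a b, P' 1%N a -> P' 1%N b -> P' 1%N (a + b)) /\ (forall a b, P' 1%N b -> P' 1%N (a * b)).
  by case: (pP' 1%N isT) => -[].
have -> : a - \sum_(i < size s) c (lift ord0 i) * s`_i =
  (a - (c ord0 * t + \sum_(i < size s) c (lift ord0 i) * s`_i)) + c ord0 * t by ring.
apply: P1D; last exact: P1M.
by case: (sP' 0%N isT) => h _; apply: h; rewrite e0.
Qed.
End ChainBound.

Section ResidueDerivation.
Variables (k0 : fieldType) (R : comUnitRingType) (c : {rmorphism k0 -> R}).
Variables (k : fieldType) (p : {rmorphism R -> k}).
Hypothesis char0 : forall n, n.+1%:R != 0 :> k.
Hypothesis psurj : forall a, exists r, a = p r.
Hypothesis pker : forall r, p r = 0 <-> nonunits R r.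

(* The derivation is defined on the subring c(k0) + m by a linear form on m / m^2,
   and then extended to R. *)
Lemma residue_derivation (b : set R) a : isideal b -> (forall x y, nonunits R x -> nonunits R y -> b (x * y)) ->
  (forall x, b x -> nonunits R x) -> nonunits R a -> ~ b a ->
  exists d : R -> pimod p, [/\ is_derivation c d, forall x, b x -> d x = 0 & d a = (1 : k)].
Proof.
move=> ib b2 bm ma nba.
have [|F [B0 FB0] FP tF|B [[iB bB Bm nBa] maxB]] :=
  @zorn_sets _ (fun B => [/\ isideal B, b `<=` B, forall x, B x -> nonunits R x & ~ B a]) b.
- by split.
- split.
  + split.
    * by exists B0 => //; case: (FP _ FB0) => -[].
    * move=> x y [J FJ Jx] [J' FJ' Jy]; case: (tF _ _ FJ FJ') => h.
        by exists J' => //; case: (FP _ FJ') => -[_ hD _] _ _ _; apply: hD => //; exact: h.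
      by exists J => //; case: (FP _ FJ) => -[_ hD _] _ _ _; apply: hD => //; exact: h.
    * by move=> x y [J FJ Jy]; exists J => //; case: (FP _ FJ) => -[_ _ hM] _ _ _; exact: hM.
  + by move=> x bx; exists B0 => //; case: (FP _ FB0) => _ h _ _; exact: h.
  + by move=> x [J FJ Jx]; case: (FP _ FJ) => _ _ h _; exact: h.
  + by move=> [J FJ Ja]; case: (FP _ FJ).
have [B_0 BD BM] := iB.
have mD x y : nonunits R x -> nonunits R y -> nonunits R (x + y).
  by move=> /pker hx /pker hy; apply/pker; rewrite rmorphD hx hy addr0.
have mM x y : nonunits R y -> nonunits R (x * y).
  by move=> /pker hy; apply/pker; rewrite rmorphM hy mulr0.
(* By maximality of [B] among ideals avoiding [a], the maximal ideal is B + R a. A nonunit [r] in a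
   = be + r x is impossible, since products of two nonunits lie in [b]. *)
have dec x : nonunits R x -> exists be r, B be /\ x = be + r * a.
  move=> mx; case: (pselect (B x)) => Bx.
    by exists x, 0; rewrite mul0r addr0.
  pose J := [set y | exists be r, B be /\ y = be + r * x].
  have [be [r [Bb ea]]] : J a.
    apply: contrapT => nJ; apply: Bx; apply: (maxB J).
    - by move=> y By; exists y, 0; rewrite mul0r addr0.
    - split=> //.
      + split; first by exists 0, 0; rewrite mul0r addr0.
          move=> _ _ [u [r [Bu ->]]] [v [s [Bv ->]]]; exists (u + v), (r + s).
          by split; [exact: BD|ring].
        by move=> y _ [u [r [Bu ->]]]; exists (y * u), (y * r); split; [exact: BM|ring].
      + by move=> y /bB By; exists y, 0; rewrite mul0r addr0.
      + by move=> _ [u [r [Bu ->]]]; apply: mD; [exact: Bm|exact: mM].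
    - by exists 0, 1; rewrite mul1r add0r.
  case: (boolP (r \is a GRing.unit)) => ur.
    exists (- (r^-1 * be)), r^-1; split; first by apply: isidealN => //; exact: BM.
    by rewrite ea mulrDr mulrA mulVr // mul1r addKr.
  exfalso; apply: nBa; rewrite ea; apply: BD => //; apply: bB; exact: b2.
pose G0 : set (R * k) := [set xy | exists x be r, [/\ B be, xy.1 = c x + be + r * a & xy.2 = p r]].
have cinj x : p (c x) = 0 -> x = 0.
  by move=> h; apply/eqP; rewrite -(fmorph_eq0 (p \o c)) /= h.
have pB be : B be -> p be = 0 by move=> /Bm /pker.
have pa : p a = 0 by apply/pker.
have dG0 : dgraph p G0.
  split.
  - by exists 1, 0, 0; rewrite /= rmorph1 rmorph0 mul0r !addr0.
  - move=> x u y v [e [be [r [Bb /= -> ->]]]] [e' [be' [r' [Bb' /= -> ->]]]].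
    exists (e - e'), (be - be'), (r - r'); rewrite /= !rmorphB; split=> //; last by ring.
    exact: isidealB.
  - move=> x u y v [e [be [r [Bb /= -> ->]]]] [e' [be' [r' [Bb' /= -> ->]]]].
    exists (e * e'), (c e * be' + c e' * be + be * be' + be * r' * a + be' * r * a + r * r' * (a * a)), (c e * r' + c e' * r).
    split=> /=; [|by rewrite rmorphM; ring|by rewrite !rmorphD !rmorphM pa (pB _ Bb) (pB _ Bb'); ring].
    have -> : c e * be' + c e' * be + be * be' + be * r' * a + be' * r * a + r * r' * (a * a) =
      (c e * be' + c e' * be) + (be * be' + (r' * a) * be) + ((r * a) * be' + (r * r') * (a * a)) by ring.
    by apply: (BD); [apply: (BD); apply: (BD)|apply: (BD)]; apply: (BM) => //; apply: bB; exact: b2.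
  - move=> x [e [be [r [Bb /= e0 ->]]]].
    have e1 : e = 0.
      by apply: cinj; have := congr1 p e0; rewrite rmorph0 !rmorphD rmorphM pa (pB _ Bb) mulr0 !addr0.
    apply/pker; rewrite /nonunits /=; apply/negP => ur; apply: nBa.
    have -> : a = r^-1 * (- be).
      have e2 : r * a = - be by apply/eqP; rewrite -addr_eq0 addrC e0 e1 rmorph0 add0r.
      by rewrite -e2 mulKr.
    by apply: BM; exact: isidealN.
  - move=> x /pker mx; have [be [r [Bb ->]]] := dec _ mx; exists (p r); split.
      by exists 0, be, r; rewrite /= rmorph0 add0r.
    move=> s; exists 0, (s * be), (s * r); rewrite /= rmorph0 add0r rmorphM; split=> //; [exact: BM|ring].
have [d [dD dM dG]] := extend_derivation char0 psurj dG0.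
exists d; split.
- split; [exact: dD|exact: dM|].
  by move=> z; apply: dG; exists z, 0, 0; rewrite /= rmorph0 mul0r !addr0.
- by move=> x /bB Bx; apply: dG; exists 0, x, 0; rewrite /= !rmorph0 mul0r add0r addr0.
- by apply: dG; exists 0, 0, 1; rewrite /= rmorph0 rmorph1 mul1r !add0r.
Qed.

End ResidueDerivation.

Section Nakayama.
Variables (R : comUnitRingType) (k : fieldType) (p : {rmorphism R -> k}).
Hypothesis pker : forall r, p r = 0 <-> nonunits R r.

Lemma nakayama_local n (x : 'I_n -> R) (I : set R) : isideal I ->
  (forall i, exists2 a : 'I_n -> R, forall j, nonunits R (a j) & I (x i - \sum_j a j * x j)) ->
  forall i, I (x i).
Proof.
move=> iI h; have /choice[A hA] : forall i, exists a : 'I_n -> R, (forall j, nonunits R (a j)) /\ I (x i - \sum_j a j * x j).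
  by move=> i; have [a h1 h2] := h i; exists a.
have [I0 ID IM] := iI.
pose N : 'M[R]_n := 1%:M - \matrix_(i, j) A i j.
have uN : \det N \is a GRing.unit.
  apply/negPn/negP => /pker; rewrite -det_map_mx (_ : map_mx p N = 1%:M) ?det1.
    by move/eqP; rewrite oner_eq0.
  apply/matrixP => i j; rewrite !mxE rmorphB (_ : p (A i j) = 0); last by apply/pker; exact: (hA i).1.
  by rewrite subr0 rmorphMn rmorph1.
move=> i; have -> : x i = (\det N)^-1 * \sum_j \adj N i j * (x j - \sum_l A j l * x l).
  have e j : x j - \sum_l A j l * x l = \sum_l N j l * x l.
    transitivity (\sum_l ((1%:M : 'M[R]_n) j l * x l - A j l * x l)); last first.
      by apply: eq_bigr => l _; rewrite !mxE mulrBl.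
    rewrite sumrB; congr (_ - _); rewrite (bigD1 j) //= mxE eqxx mul1r big1 ?addr0 // => l.
    by rewrite mxE eq_sym => /negPf->; rewrite mul0r.
  under eq_bigr do rewrite e big_distrr /=.
  rewrite exchange_big /=.
  have e2 l : \sum_j \adj N i j * (N j l * x l) = (\det N *+ (i == l)) * x l.
    have := mul_adj_mx N => /matrixP/(_ i l).
    rewrite [RHS]mxE => <-; rewrite [X in _ = X * _]mxE big_distrl /=.
    by apply: eq_bigr => j _; rewrite mulrA.
  under eq_bigr do rewrite e2.
  rewrite (bigD1 i) //= eqxx mulr1n big1 ?addr0 ?mulKr // => l.
  by rewrite eq_sym => /negPf->; rewrite mulr0n mul0r.
by apply: (IM); apply: isideal_sum => // j _; apply: (IM); exact: (hA j).2.
Qed.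
End Nakayama.

Section PrimeLift.
Variables (k0 : fieldType) (R : comUnitRingType) (c : {rmorphism k0 -> R}).
Hypothesis nR : noetherian R.
Hypothesis mloc : forall x y, nonunits R x -> nonunits R y -> nonunits R (x + y).
Hypothesis char0 : forall n, n.+1%:R != 0 :> k0.
Variables (P : set R) (t : R) (E : R -> R).
Hypothesis iP : isideal P.
Hypothesis hE : is_self_derivation c E.
Hypothesis EP : forall a, P a -> P (E a).
Hypothesis Et : E t = 1.
Hypothesis mt : nonunits R t.

Let Q : set R := [set a | exists r, P (a - r * t)].
Hypothesis pQ : prime_ideal Q.

Let un n : n.+1%:R \is a @GRing.unit R.
Proof. by rewrite -(rmorph_nat c); apply: rmorph_unit; rewrite unitfE. Qed.

Let Pr r : set R := [set a | exists u, P (a - t ^+ r * u)].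

(** Applying [E] to t^(r+1) u in [P], with E(t) = 1 and r + 1 invertible, puts t^r u in P +
    (t^(r+1)). So [a] is divisible by every power of [t] modulo [P], and the ascending chain of the
    (P : t^r) concludes. *)
Lemma t_regular a : P (t * a) -> P a.
Proof.
have [P0 PD PM] := iP.
have stepE r u : P (t ^+ r.+1 * u) -> exists v, P (t ^+ r * u - t ^+ r.+1 * v).
  move=> /EP; rewrite (derM hE) (derX hE) Et /= => h.
  exists (- ((r.+1%:R)^-1 * E u)).
  have := PM (r.+1%:R)^-1 _ h; congr P.
  have -> : t ^+ r.+1 *: (E u : R^o) = t ^+ r.+1 * E u by [].
  have -> : u *: ((t ^+ r *+ r.+1 : R) *: (1 : R^o)) = u * (t ^+ r *+ r.+1 * 1) by [].
  transitivity (((r.+1%:R)^-1 * r.+1%:R) * (t ^+ r * u) + t ^+ r.+1 * ((r.+1%:R)^-1 * E u)).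
    by rewrite mulr1 -[t ^+ r *+ _]mulr_natr; ring.
  by rewrite mulVr //; ring.
move=> ta; have all r : Pr r a.
  elim: r => [|r [u hu]]; first by exists a; rewrite expr0 mul1r subrr.
  have h1 : P (t ^+ r.+1 * u).
    have := isidealB iP ta (PM t _ hu); congr P; rewrite exprS; ring.
  have [v hv] := stepE _ _ h1; exists v.
  by have := PD _ _ hu hv; congr P; ring.
have [||N hN] := @noetherian_chain _ (fun r => [set x | P (t ^+ r * x)]) nR.
- move=> r; split; rewrite /= ?mulr0 //; first by move=> x y hx hy; rewrite mulrDr; exact: PD.
  by move=> x y hy; rewrite mulrCA; exact: PM.
- by move=> r x /= hx; rewrite exprS -mulrA; exact: PM.
have [u hu] := all N.
have : P (t ^+ N.+1 * u).
  have := isidealB iP ta (PM t _ hu); congr P; rewrite exprS; ring.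
move=> /hN /= h; by have := PD _ _ hu h; rewrite subrK.
Qed.

Lemma tX_regular r a : P (t ^+ r * a) -> P a.
Proof. by elim: r => [|r IH]; rewrite ?expr0 ?mul1r // exprS -mulrA => /t_regular. Qed.

(** The successive quotients of [a] by powers of [t] generate an increasing chain of ideals modulo
    [P]; when it stops, a unit 1 - v t annihilates one of them. *)
Lemma t_separated a : (forall r, Pr r a) -> P a.
Proof.
move=> /choice[u hu]; have [P0 PD PM] := iP.
have rel r : P (u r - t * u r.+1).
  apply: (@tX_regular r).
  by have := isidealB iP (hu r.+1) (hu r); congr P; rewrite exprS; ring.
have [||N hN] := @noetherian_chain _ (fun r => [set x | exists v, P (x - v * u r)]) nR.
- move=> r; split; first by exists 0; rewrite mul0r subr0.
    by move=> x y [v hv] [w hw]; exists (v + w); have := PD _ _ hv hw; congr P; ring.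
  by move=> x y [v hv]; exists (x * v); have := PM x _ hv; congr P; ring.
- move=> r x [v hv]; exists (v * t); have := PD _ _ hv (PM v _ (rel r)); congr P; ring.
have [|v hv] := hN N.+1 (u N.+1); first by exists 1; rewrite mul1r subrr.
have : P ((1 - v * t) * u N.+1).
  by have := PD _ _ hv (PM v _ (rel N)); congr P; ring.
have ut : 1 - v * t \is a GRing.unit.
  apply/negPn/negP => h; have mvt : nonunits R (v * t).
    apply/negP; rewrite unitrM => /andP[_]; exact/negP.
  have := mloc h mvt; rewrite subrK /nonunits /= unitr1; done.
move=> /(PM (1 - v * t)^-1); rewrite mulKr // => h.
have := PD _ _ (hu N.+1) (PM (t ^+ N.+1) _ h); by rewrite subrK.
Qed.

(** Modulo [P] every nonzero element is a power of [t] times an element outside the prime [Q], and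
    [t] is regular; products of such elements are nonzero. *)
Lemma prime_lift : prime_ideal P.
Proof.
have [P0 PD PM] := iP; have [_ _ Q1 Qp] := pQ.
have PQ a : P a -> Q a by move=> Pa; exists 0; rewrite mul0r subr0.
split=> //; first by move=> /PQ.
have ord a : ~ P a -> exists r u, P (a - t ^+ r * u) /\ ~ Q u.
  move=> nPa; apply: contrapT => h; apply: nPa; apply: t_separated.
  elim=> [|r [u hu]]; first by exists a; rewrite expr0 mul1r subrr.
  have [v hv] : Q u by apply: contrapT => nQ; apply: h; exists r, u.
  by exists v; have := PD _ _ hu (PM (t ^+ r) _ hv); congr P; rewrite exprSr; ring.
move=> a b Pab; apply: contrapT => /not_orP[/ord[r [u [hu nu]]] /ord[s [v [hv nv]]]].
have : P (t ^+ (r + s) * (u * v)).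
  have -> : t ^+ (r + s) * (u * v) = a * b - (b * (a - t ^+ r * u) + (t ^+ r * u) * (b - t ^+ s * v)).
    by rewrite exprD; ring.
  by apply: isidealB => //; apply: (PD); apply: (PM).
by move=> /tX_regular /PQ /Qp[].
Qed.
End PrimeLift.

Lemma derMs (k : fieldType) (R : comUnitRingType) (c : {rmorphism k -> R}) (D : R -> R) a b :
  is_self_derivation c D -> D (a * b) = a * D b + b * D a.
Proof. by move=> hD; exact: (derM hD). Qed.

(** * Regularity when the derivations of a local ring are spanned *)

Section Regular.
Variables (k0 : fieldType) (R : comUnitRingType) (c : {rmorphism k0 -> R}).
Hypothesis char0 : forall n, n.+1%:R != 0 :> k0.
Variables (K : fieldType) (inj : {rmorphism R -> K}).
Hypothesis injI : injective inj.
Hypothesis nR : noetherian R.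
Hypothesis mloc : forall x y, nonunits R x -> nonunits R y -> nonunits R (x + y).
Variables (n : nat) (D : 'I_n -> R -> R).
Hypothesis hD : forall i, is_self_derivation c (D i).
Hypothesis Sp : forall (M : lmodType R) (d : R -> M), is_derivation c d ->
  exists m : 'I_n -> M, forall z, d z = \sum_i D i z *: m i.

Lemma nonunitM x y : nonunits R y -> nonunits R (x * y).
Proof. by move=> my; apply/negP; rewrite unitrM => /andP[_]; exact/negP. Qed.
Lemma nonunits_ideal : isideal (nonunits R).
Proof.
split; [|exact: mloc|exact: nonunitM].
by rewrite /nonunits /= unitr0.
Qed.
Lemma nonunit_sum T (r : seq T) (q : pred T) (F : T -> R) :
  (forall i, q i -> nonunits R (F i)) -> nonunits R (\sum_(i <- r | q i) F i).
Proof. by have [h0 hA _] := nonunits_ideal; move=> h; elim/big_ind: _. Qed.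
Lemma nonunits_prime : prime_ideal (nonunits R).
Proof.
have [h0 hD' hM] := nonunits_ideal.
split=> //; first by rewrite /nonunits /= unitr1.
move=> a b; rewrite /nonunits /= unitrM negb_and => /orP[]; [by left|by right].
Qed.

Definition comb (E : R -> R) := exists e : 'I_n -> R, forall z, E z = \sum_l e l * D l z.

Lemma comb_der E : comb E -> is_self_derivation c E.
Proof.
move=> [e he]; have : is_self_derivation c (fun z => \sum_l e l * D l z).
  exact: (@der_comb _ _ _ R^o).
by rewrite (_ : (fun _ => _) = E) //; apply: funext => z; rewrite he.
Qed.

Lemma comb_sum m (a : 'I_m -> R) (E : 'I_m -> R -> R) : (forall i, comb (E i)) ->
  comb (fun z => \sum_i a i * E i z).
Proof.
move=> /choice[e he]; exists (fun l => \sum_i a i * e i l) => z.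
under eq_bigr do rewrite he big_distrr /=.
rewrite exchange_big; apply: eq_bigr => l _ /=; rewrite big_distrl /=.
by apply: eq_bigr => i _; rewrite mulrA.
Qed.

Definition dual d := exists (t : 'I_d -> R) (E : 'I_d -> R -> R),
  [/\ forall i, nonunits R (t i), forall i, comb (E i) & forall i j, E i (t j) = (i == j)%:R].

Lemma dual_of_unit d (t : 'I_d -> R) (E : 'I_d -> R -> R) : (forall i, nonunits R (t i)) ->
  (forall i, comb (E i)) -> \det (\matrix_(i, j) E i (t j)) \is a GRing.unit -> dual d.
Proof.
move=> mt cE; set N := \matrix_(i, j) _ => uN.
exists t, (fun i z => \sum_l invmx N i l * E l z); split=> // [i|i j]; first exact: comb_sum.
have := mulVmx (uN : N \in unitmx) => /matrixP/(_ i j); rewrite !mxE => <-.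
apply: eq_bigr => l _; congr (_ * _); by rewrite mxE.
Qed.

Lemma dual_bound d : dual d -> (d <= n)%N.
Proof.
move=> [t [E [_ /choice[e he] hE]]].
pose X : 'M[K]_(d, n) := \matrix_(i, l) inj (e i l).
pose Y : 'M[K]_(n, d) := \matrix_(l, j) inj (D l (t j)).
have XY : X *m Y = 1%:M.
  apply/matrixP => i j; rewrite !mxE; transitivity (inj (E i (t j))).
    by rewrite he rmorph_sum; apply: eq_bigr => l _; rewrite !mxE rmorphM.
  by rewrite hE rmorph_nat.
have := mxrankM_maxl X Y; rewrite XY mxrank1 => h; exact: leq_trans h (rank_leq_col X).
Qed.

Lemma maximal_dual : exists2 d, dual d & ~ dual d.+1.
Proof.
have ex : exists d, `[< dual d >].
  exists 0%N; apply/asboolP; exists (fun _ => 0), (fun _ _ => 0); split; by case.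
have bd d : `[< dual d >] -> (d <= n)%N by move=> /asboolP; exact: dual_bound.
case: (ex_maxnP ex bd) => d /asboolP hd hmax; exists d => // /asboolP /hmax.
by rewrite ltnn.
Qed.

Section Max.
Variables (k : fieldType) (p : {rmorphism R -> k}).
Hypothesis psurj : forall a, exists r, a = p r.
Hypothesis pker : forall r, p r = 0 <-> nonunits R r.
Variables (d : nat) (t : 'I_d -> R) (E : 'I_d -> R -> R).
Hypotheses (mt : forall i, nonunits R (t i)) (cE : forall i, comb (E i)).
Hypothesis Et : forall i j, E i (t j) = (i == j)%:R.
Hypothesis nd : ~ dual d.+1.

Let m2 := mulI (nonunits R) (nonunits R).
Let b : set R := [set r | exists e : 'I_d -> R, m2 (r - \sum_j e j * t j)].

Lemma m2_nonunits x : m2 x -> nonunits R x.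
Proof.
have [h0 hA hM] := nonunits_ideal.
by elim=> [//|y z u my mz _ IH]; apply: hA => //; exact: hM.
Qed.

(** Otherwise a derivation into the residue field kills m^2 and the [t j] but not a corrected [a].
    It is a combination of the [D i], and lifting its coefficients to [R] enlarges the dual system,
    against the maximality of [d]. *)
Lemma gens_mod_square a : nonunits R a -> b a.
Proof.
have im2 : isideal m2 by apply: mulI_ideal; exact: nonunits_ideal.
have [z0 zD zM] := im2; have [n0 nD nM] := nonunits_ideal.
move=> ma; apply: contrapT => nba.
have char0k m : m.+1%:R != 0 :> k.
  by rewrite -(rmorph_nat (p \o c)) fmorph_eq0.
have ib : isideal b.
  split.
  - by exists (fun=> 0); rewrite big1 ?subr0 // => j _; rewrite mul0r.
  - move=> x y [e he] [f hf]; exists (fun j => e j + f j).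
    have -> : \sum_j (e j + f j) * t j = \sum_j e j * t j + \sum_j f j * t j.
      by rewrite -big_split; apply: eq_bigr => j _; rewrite mulrDl.
    by have := zD _ _ he hf; congr m2; ring.
  - move=> x y [e he]; exists (fun j => x * e j).
    have -> : \sum_j x * e j * t j = x * \sum_j e j * t j.
      by rewrite mulr_sumr; apply: eq_bigr => j _; rewrite mulrA.
    by have := zM x _ he; rewrite mulrBr.
have bt j : b (t j).
  exists (fun l => (l == j)%:R); rewrite (bigD1 j) //= eqxx mul1r big1; first by rewrite addr0 subrr.
  by move=> l /negPf->; rewrite mul0r.
(* The correction makes every [E i] of [a'] a nonunit, so that the enlarged matrix is the identity
   modulo the maximal ideal. *)
pose a' := a - \sum_l E l a * t l.
have nba' : ~ b a'.
  move=> h; apply: nba; have [_ bD bM] := ib.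
  have -> : a = a' + \sum_l E l a * t l by rewrite /a' subrK.
  by apply: bD => //; apply: isideal_sum => // l _; exact: bM.
have ma' : nonunits R a'.
  apply: (isidealB nonunits_ideal ma); apply: nonunit_sum => l _; exact: nM.
have [||tau [dtau tb ta]] := residue_derivation c char0k psurj pker ib _ _ ma' nba'.
- move=> x y mx my; exists (fun=> 0); rewrite big1 ?subr0; last by move=> j _; rewrite mul0r.
  by rewrite -[x * y]addr0; apply: mulID => //; exact: mulI0.
- move=> x [e he]; rewrite -(subrK (\sum_j e j * t j) x); apply: nD; first exact: m2_nonunits.
  by apply: nonunit_sum => j _; exact: nM.
have [m hm] := Sp dtau.
have /choice[e he] : forall l, exists r, (m l : k) = p r by move=> l; exact: psurj.
pose E' z := \sum_l e l * D l z.
have pE' z : p (E' z) = tau z.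
  rewrite rmorph_sum hm; apply: eq_bigr => l _.
  by rewrite rmorphM -he mulrC.
pose t' (i : 'I_d.+1) := oapp t a' (unlift ord_max i).
pose E'' (i : 'I_d.+1) := oapp E E' (unlift ord_max i).
apply: nd; apply: (@dual_of_unit _ t' E'').
- by move=> i; rewrite /t'; case: unliftP => [j|] _ /=; [exact: mt|exact: ma'].
- by move=> i; rewrite /E''; case: unliftP => [j|] _ /=; [exact: cE|exists e].
apply/negPn/negP => /pker; rewrite -det_map_mx (_ : map_mx p _ = 1%:M) ?det1.
  by move/eqP; rewrite oner_eq0.
apply/matrixP => i j; rewrite !mxE /t' /E''.
case: (unliftP ord_max i) => [i0|] ->; case: (unliftP ord_max j) => [j0|] -> /=.
- by rewrite Et (inj_eq lift_inj) rmorph_nat.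
- rewrite eq_sym (negPf (neq_lift _ _)) /a' (derB (comb_der (cE i0))) (der_sum (comb_der (cE i0))).
  have pt l : p (t l) = 0 by apply/pker.
  rewrite rmorphB rmorph_sum (bigD1 i0) //= (derMs _ _ (comb_der (cE i0))) Et eqxx mulr1.
  rewrite rmorphD rmorphM pt mul0r addr0 big1 ?addr0 ?subrr // => l li.
  by rewrite (derMs _ _ (comb_der (cE i0))) Et eq_sym (negPf li) mulr0 add0r rmorphM pt mul0r.
- by rewrite (negPf (neq_lift _ _)) pE' tb.
- by rewrite eqxx pE' ta.
Qed.

Lemma nonunits_gen : nonunits R = ideal_gen t.
Proof.
have [n0 nD nM] := nonunits_ideal.
have [m [x ex]] := nR n0 nD nM.
have it := ideal_gen_isideal t.
apply/seteqP; split=> [r|_ [e ->]]; last by apply: nonunit_sum => j _; exact: nM.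
have gx : forall i, ideal_gen t (x i).
  apply: (nakayama_local pker it) => i.
  have [e he] : b (x i) by apply: gens_mod_square; rewrite ex; exact: ideal_gen_mem.
  suff [a [ha ea]] : exists a : 'I_m -> R, (forall j, nonunits R (a j)) /\ x i - \sum_j e j * t j = \sum_j a j * x j.
    exists a => //; rewrite -ea opprB addrCA subrr addr0.
    by exists e.
  elim: he => [|y z u my mz _ [a [ha ->]]].
    by exists (fun=> 0); split=> //; rewrite big1 // => j _; rewrite mul0r.
  have : ideal_gen x z by rewrite -ex.
  move=> [f ->]; exists (fun j => f j * y + a j); split.
    by move=> j; apply: nD => //; exact: nM.
  by rewrite mulr_sumr -big_split; apply: eq_bigr => j _ /=; ring.
rewrite ex => -[e ->]; apply: isideal_sum => // j _; case: it => _ _; exact.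
Qed.

(** Each of these ideals is stable under [E l] for l >= j, so [prime_lift] descends primality from
    P_d = m; the resulting chain gives the lower bound on the dimension. *)
Let P (j : nat) : set R := [set r | exists e : 'I_d -> R, r = \sum_(l : 'I_d | (l < j)%N) e l * t l].

Lemma P_ideal j : isideal (P j).
Proof.
split.
- by exists (fun=> 0); rewrite big1 // => l _; rewrite mul0r.
- move=> _ _ [e ->] [f ->]; exists (fun l => e l + f l); rewrite -big_split.
  by apply: eq_bigr => l _; rewrite mulrDl.
- move=> a _ [e ->]; exists (fun l => a * e l); rewrite mulr_sumr.
  by apply: eq_bigr => l _; rewrite mulrA.
Qed.

Lemma P_stable j (l : 'I_d) a : (j <= l)%N -> P j a -> P j (E l a).
Proof.
move=> jl [e ->]; exists (fun i => E l (e i)).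
rewrite (der_sum (comb_der (cE l))); apply: eq_bigr => i ij.
rewrite (derM (comb_der (cE l))) Et (_ : (l == i) = false); last first.
  by apply/eqP => li; rewrite li leqNgt ij in jl.
by rewrite scaler0 add0r; exact: mulrC.
Qed.

Lemma P_succ (j : 'I_d) : P j.+1 = [set a | exists r, P j (a - r * t j)].
Proof.
have split_sum (e : 'I_d -> R) : \sum_(l : 'I_d | (l < j.+1)%N) e l * t l = e j * t j + \sum_(l : 'I_d | (l < j)%N) e l * t l.
  rewrite (bigD1 j) ?ltnSn //=; congr (_ + _); apply: eq_bigl => l.
  by rewrite ltnS ltn_neqAle andbC.
apply/seteqP; split=> [_ [e ->]|a [r [e he]]].
  by exists (e j), e; rewrite split_sum addrAC subrr add0r.
exists (fun l => if l == j then r else e l); rewrite split_sum eqxx -(subrK (r * t j) a) he addrC.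
congr (_ + _); apply: eq_bigr => l lj; case: eqP => // e'; by rewrite e' ltnn in lj.
Qed.

Lemma P_top : P d = nonunits R.
Proof.
rewrite nonunits_gen; apply/seteqP; split=> _ [e ->]; exists e.
  by apply: eq_bigl => l; rewrite ltn_ord.
by apply/esym; apply: eq_bigl => l; rewrite ltn_ord.
Qed.

Lemma P_prime j : (j <= d)%N -> prime_ideal (P j).
Proof.
move=> /subKn <-; elim: (d - j)%N => [|m IH]; first by rewrite subn0 P_top; exact: nonunits_prime.
case: (ltnP m d) => md; last by rewrite (eqP (_ : d - m.+1 == d - m)%N) //; apply/eqP; lia.
have h : (d - m.+1 < d)%N by lia.
pose l := Ordinal h.
have e1 : (d - m = l.+1)%N by rewrite /=; lia.
rewrite e1 P_succ in IH.
apply: (prime_lift nR mloc char0 (P_ideal _) (comb_der (cE l)) _ _ (mt l) IH).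
- by move=> a; apply: P_stable.
- by rewrite Et eqxx.
Qed.

Lemma regular_of_dual : regular_local R.
Proof.
split=> //; exists d; split; last by exists t; exact: nonunits_gen.
have [n0 nD nM] := nonunits_ideal.
have Pm j a : P j a -> nonunits R a.
  by move=> [e ->]; apply: nonunit_sum => l _; exact: nM.
split.
  exists P; split=> [j|j jd]; first exact: P_prime.
  pose l := Ordinal jd.
  have hs : P j.+1 = [set a | exists r, P j (a - r * t l)] by exact: (P_succ l).
  split=> [a Pa|h].
    by rewrite hs; exists 0; rewrite mul0r subr0.
  have : P j (E l (t l)).
    apply: P_stable => //; apply: h; rewrite hs; exists 1; rewrite mul1r subrr; by case: (P_ideal j).
  by move=> /Pm; rewrite Et eqxx /nonunits /= unitr1.
move=> [Q [pQ sQ]].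
(* The last prime is replaced by the maximal ideal, whose [d] generators allow [chain_bound] to
   apply. *)
pose Q' j := if j == d.+1 then nonunits R else Q j.
have Qm j : (j <= d.+1)%N -> Q j `<=` nonunits R.
  move=> /pQ[[_ _] qM q1 _] a Qa; apply/negP => ua; apply: q1.
  by rewrite -(mulVr ua); exact: qM.
have cQ : chain_of d.+1 Q'.
  split=> j hj; rewrite /Q'.
    by case: eqP => _; [exact: nonunits_prime|exact: pQ].
  have -> : (j == d.+1) = false by apply/eqP; lia.
  case: eqP => [e|_]; last exact: sQ.
  have [h1 h2] := sQ j hj; rewrite e in h1 h2; split.
    by move=> a /h1; exact: Qm.
  by move=> h; apply: h2 => a /Qm; rewrite leqnn => /(_ isT) /h.
pose s := [seq t i | i <- enum 'I_d].
have ss : size s = d by rewrite size_map size_enum_ord.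
have := chain_bound nR cQ (s := s); rewrite ss ltnn => h; have := h _ _ => {h} h.
suff : false by [].
apply: h.
- by move=> x /mapP[i _ ->]; rewrite /Q' eqxx.
- move=> a; rewrite /Q' eqxx /= nonunits_gen => -[e ->].
  exists e => //; rewrite (_ : \sum_(i < d) e i * s`_i = \sum_i e i * t i) ?subrr.
    by case: (pQ 0%N isT) => -[].
  by apply: eq_bigr => i _; rewrite (nth_map i) ?size_enum_ord // nth_ord_enum.
Qed.
End Max.

Theorem regular_criterion : regular_local R.
Proof.
have [k [p [psurj pker]]] : exists (k : fieldType) (p : {rmorphism R -> k}),
    (forall a, exists r, a = p r) /\ forall r, p r = 0 <-> nonunits R r.
  have [n0 nD nM] := nonunits_ideal.
  apply: residue_field => //.
  - by rewrite /nonunits /= unitr1.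
  - by move=> a b; exact: (isidealB nonunits_ideal).
  - move=> a /negP/negPn ua; exists a^-1; rewrite divrr // subrr; exact: n0.
have [d [t [E [mt cE Et]]] nd] := maximal_dual.
exact: (regular_of_dual psurj pker mt cE Et nd).
Qed.

End Regular.

(** * Schemes through their function field *)

Lemma fracM (R : comUnitRingType) (a b s t : R) : s \is a GRing.unit -> t \is a GRing.unit ->
  a / s * (b / t) = a * b / (s * t).
Proof. by move=> us ut; rewrite invrM // mulrACA [s^-1 * _]mulrC. Qed.

Lemma fracB (R : comUnitRingType) (a b s t : R) : s \is a GRing.unit -> t \is a GRing.unit ->
  a / s - b / t = (a * t - b * s) / (s * t).
Proof.
move=> us ut; rewrite mulrBl -(fracM _ _ us ut) [s * t]mulrC -(fracM _ _ ut us).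
by rewrite !divrr // !mulr1.
Qed.

(** * Locally ringed spaces, affine charts and morphisms into them *)

Section Spaces.
Implicit Types X Y Z : lrspace.

Lemma openE_nbhs (T : topologicalType) (G : set T) :
  (forall t, G t -> exists V, [/\ open V, V t & V `<=` G]) -> open G.
Proof.
move=> h; have -> : G = \bigcup_(V in [set V | open V /\ V `<=` G]) V.
  apply/seteqP; split=> [t /h[V [oV Vt VG]]|t [V [_ VG] /VG//]]; by exists V.
by apply: bigcup_open => V [].
Qed.

Lemma rmorph_of (A B : pzRingType) (h : A -> B) : is_rmorphism h ->
  exists f : {rmorphism A -> B}, f =1 h.
Proof.
move=> [hB hM].
pose m1 := GRing.isZmodMorphism.Build A B h hB.
pose m2 := GRing.isMonoidMorphism.Build A B h hM.
pose f : {rmorphism A -> B} := HB.pack h m1 m2.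
by exists f.
Qed.

Lemma rmorphism_is (A B : pzRingType) (f : {rmorphism A -> B}) : is_rmorphism f.
Proof. by split; [move=> a b; exact: rmorphB|split; [exact: rmorph1|move=> a b; exact: rmorphM]]. Qed.

Lemma rmorph_ext (A B : pzRingType) (f g : {rmorphism A -> B}) : f =1 g -> f = g.
Proof.
move: f g => [f [[f1] [f2]]] [g [[g1] [g2]]] /= e.
have {}e : f = g by apply: funext.
subst g; congr (GRing.RMorphism.Pack (GRing.RMorphism.Class _ _)); congr (_ _); exact: Prop_irrelevance.
Qed.

Lemma family_at X (x : X) (a : stalk x) : exists s : forall y : X, stalk y, s x = a.
Proof.
exists (fun y => if pselect (x = y) is left e then eq_rect x (fun y => stalk y) a y e else 0).
by case: pselect => // e; rewrite (Prop_irrelevance e erefl).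
Qed.

(** The stalks at f z and g z are different types until the maps are identified, so pullbacks are
    compared on families of germs. *)
Lemma lrhom_ext Z X (f g : lrhom Z X) : (forall z, f z = g z) ->
  (forall z (s : forall x : X, stalk x), pull f z (s (f z)) = pull g z (s (g z))) -> f = g.
Proof.
case: f g => f pf fc fr fl [g pg gc gr gl] /= e; have {}e : f = g by apply: funext.
subst g => h.
have {}h : pf = pg.
  apply: functional_extensionality_dep => z; apply: rmorph_ext => a.
  by have [s <-] := family_at a; exact: h.
subst pg; congr LRHom; exact: Prop_irrelevance.
Qed.

Lemma lrhom_eqE Z X (f g : lrhom Z X) : f = g -> (forall z, f z = g z) /\
  (forall z (s : forall x : X, stalk x), pull f z (s (f z)) = pull g z (s (g z))).
Proof. by move=> ->. Qed.

Lemma hom_compA W X Y Z (f : lrhom Y Z) (g : lrhom X Y) (h : lrhom W X) :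
  hom_comp f (hom_comp g h) = hom_comp (hom_comp f g) h.
Proof. exact: lrhom_ext. Qed.

Lemma hom_comp1l X Y (f : lrhom X Y) : hom_comp (hom_id Y) f = f.
Proof. exact: lrhom_ext. Qed.

Lemma pullback_eq X Y S P (f : lrhom X S) (g : lrhom Y S) (p : lrhom P X) (q : lrhom P Y) Z (h h' : lrhom Z P) :
  is_pullback f g p q -> scheme Z -> hom_comp p h = hom_comp p h' -> hom_comp q h = hom_comp q h' -> h = h'.
Proof.
move=> [_ sq U] sZ ep eq; have [|t [_ tu]] := U Z (hom_comp p h) (hom_comp q h) sZ.
  by rewrite !hom_compA sq.
by rewrite -(tu h) // -(tu h').
Qed.

Lemma reg0 X U : open U -> reg U (fun x : X => 0).
Proof. by move=> oU; have := regB oU (reg1 oU) (reg1 oU); congr reg; apply: functional_extensionality_dep => x; rewrite subrr. Qed.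

Lemma reg_unit X U (s : forall x : X, stalk x) : open U -> reg U s ->
  open (U `&` [set x | s x \is a GRing.unit]) /\
  reg (U `&` [set x | s x \is a GRing.unit]) (fun x => (s x)^-1).
Proof.
move=> oU rs.
have key x : U x -> s x \is a GRing.unit -> exists V t, [/\ open V, V x, V `<=` U, reg V t &
    forall y, V y -> s y * t y = 1].
  move=> Ux ux; have [V [t [oV Vx rt et]]] := germ_surj (s x)^-1.
  have oUV : open (U `&` V) by exact: openI.
  have rsU : reg (U `&` V) s by apply: (reg_sub (U := U)) => // y [].
  have rtV : reg (U `&` V) t by apply: (reg_sub (U := V)) => // y [].
  have e1 : s x * t x = 1 by rewrite et mulrV.
  have [W [oW Wx hW]] := germ_inj oUV (conj Ux Vx) (regM oUV rsU rtV) (reg1 oUV) e1.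
  have oUVW : open (U `&` V `&` W) by exact: openI.
  exists (U `&` V `&` W), t; split=> //; first by move=> y [[]].
    by apply: (reg_sub (U := V)) => // y [[]].
  by move=> y [_ /hW].
have oD : open (U `&` [set x | s x \is a GRing.unit]).
  apply: openE_nbhs => x [Ux /= ux]; have [V [t [oV Vx VU rt h]]] := key x Ux ux.
  by exists V; split=> // y Vy; split; [exact: VU|rewrite /=; apply/unitrPr; exists (t y); exact: h].
split=> //; apply: reg_glue => // x [Ux /= ux].
have [V [t [oV Vx VU rt h]]] := key x Ux ux.
exists V, t; split=> // y [[_ /= uy] Vy].
by apply: (mulrI uy); rewrite mulrV // h.
Qed.

Lemma nonunits_stalk X (x : X) : forall a b : stalk x, nonunits _ a -> nonunits _ b -> nonunits _ (a + b).
Proof. by move=> a b; exact: stalk_local. Qed.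

Lemma nonunits_prime_loc (R : comUnitRingType) : (forall a b : R, nonunits R a -> nonunits R b -> nonunits R (a + b)) ->
  prime_ideal (nonunits R).
Proof.
move=> h; split; rewrite /nonunits /=.
- by split; [rewrite unitr0|exact: h].
- by move=> a b nb; apply: contra nb; rewrite unitrM => /andP[].
- by rewrite unitr1.
- by move=> a b; rewrite unitrM negb_and => /orP.
Qed.

Lemma prime_ideal_preim (A B : comPzRingType) (f : A -> B) (P : set B) : is_rmorphism f -> prime_ideal P ->
  prime_ideal (f @^-1` P).
Proof.
move=> /rmorph_of[h e] [[P0 PD] PM P1 Pp]; split; rewrite /preimage /=.
- by split=> [|a b]; rewrite -!e ?rmorph0 // rmorphD; exact: PD.
- by move=> a b; rewrite -!e rmorphM; exact: PM.
- by rewrite -e rmorph1.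
- by move=> a b; rewrite -!e rmorphM; exact: Pp.
Qed.

Section Chart.
Variables (X : lrspace) (U : set X) (A : comPzRingType) (phi : A -> forall x : X, stalk x).
Hypothesis ch : affine_chart U phi.

Lemma chart_phi x : U x -> exists f : {rmorphism A -> stalk x}, forall a, f a = phi a x.
Proof. by move=> /(chart_rmorphism ch)/rmorph_of. Qed.

Lemma chart_eq x y : U x -> U y ->
  (forall a, phi a x \is a GRing.unit <-> phi a y \is a GRing.unit) -> x = y.
Proof.
move=> Ux Uy h.
have pP := prime_ideal_preim (chart_rmorphism ch Ux) (nonunits_prime_loc (@nonunits_stalk X x)).
have [z [_ zu]] := chart_prime ch pP.
rewrite -(zu x) //; apply: zu; split=> //; apply/seteqP; split=> a /=; rewrite /nonunits /preimage /=.
  by move=> /negP n; apply/negP => /h.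
by move=> /negP n; apply/negP => /h.
Qed.

Lemma chart_refine x W : U x -> open W -> W x -> exists a, phi a x \is a GRing.unit /\
  forall y, U y -> phi a y \is a GRing.unit -> W y.
Proof.
move=> Ux oW Wx.
have WU : W `&` U `<=` U by move=> y [].
have [h _] := chart_topology ch WU; have [||a [ua ha]] := h _ x; rewrite //.
  by apply: openI => //; exact: chart_open ch.
by exists a; split=> // y Uy /(ha y Uy)[].
Qed.

Lemma chart_reg_phi a : reg U (phi a).
Proof.
have oU := chart_open ch.
apply/(chart_reg ch _ oU) => // x Ux; exists U, a, 1; split=> // y Uy.
by have [f e] := chart_phi Uy; rewrite -!e rmorph1 unitr1 divr1.
Qed.

Lemma chart_D_open a : open (U `&` [set x | phi a x \is a GRing.unit]).
Proof. exact: (reg_unit (chart_open ch) (chart_reg_phi a)).1. Qed.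

Lemma affine_hom_uniq Z (F G : lrhom Z X) : (forall z, U (F z)) -> (forall z, U (G z)) ->
  (forall z a, pull F z (phi a (F z)) = pull G z (phi a (G z))) -> F = G.
Proof.
move=> UF UG h.
have eu : forall z, F z = G z.
  move=> z; apply: chart_eq => // a; split=> u.
    by apply: (@hom_local _ _ G); rewrite -h; exact: rmorph_unit.
  by apply: (@hom_local _ _ F); rewrite h; exact: rmorph_unit.
apply: lrhom_ext => // z s.
have [a [b [ub e]]] := chart_fraction ch (UF z) (s (F z)).
have [ub' e'] : phi b (G z) \is a GRing.unit /\ s (G z) = phi a (G z) / phi b (G z) by rewrite -eu.
rewrite e e' !rmorphM !rmorphV // !h; congr (_ / _); exact: h.
Qed.

(** Morphisms into an affine scheme are ring maps to global sections: [z] goes to the prime of those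
    [a] for which [h a] is not invertible at [z], and fractions are pulled back by fractions. *)
Lemma affine_hom Z (h : A -> forall z : Z, stalk z) : (forall z, is_rmorphism (h^~ z)) ->
  (forall a, reg setT (h a)) ->
  exists F : lrhom Z X, (forall z, U (F z)) /\ forall z a, pull F z (phi a (F z)) = h a z.
Proof.
move=> hr hreg.
have key z : exists xq : {x : X & {rmorphism stalk x -> stalk z}},
    [/\ U (projT1 xq), forall a, projT2 xq (phi a (projT1 xq)) = h a z &
      forall a, projT2 xq a \is a GRing.unit -> a \is a GRing.unit].
  have pP := prime_ideal_preim (hr z) (nonunits_prime_loc (@nonunits_stalk Z z)).
  have [x [[Ux ex] _]] := chart_prime ch pP.
  have [f fE] := chart_phi Ux; have [k kE] := rmorph_of (hr z).
  have uE a : (h a z \is a GRing.unit) = (phi a x \is a GRing.unit).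
    have := congr1 (fun S : set A => S a) ex; rewrite /preimage /nonunits /= => e.
    by apply/idP/idP => u; apply: contraT => n; move: n; [rewrite -e|rewrite e]; rewrite u.
  have wd a b c d : phi b x \is a GRing.unit -> phi d x \is a GRing.unit ->
      phi a x / phi b x = phi c x / phi d x -> h a z / h b z = h c z / h d z.
    move=> ub ud e.
    have e1 : phi (a * d - c * b) x = 0.
      rewrite -fE rmorphB !rmorphM !fE; apply/eqP; rewrite subr_eq0; apply/eqP.
      by rewrite -[phi a x](divrK ub) e mulrAC divrK.
    have [s [us es]] := chart_kernel ch Ux e1.
    have : h s z * (h a z * h d z - h c z * h b z) = 0.
      by rewrite -!kE -!rmorphM -rmorphB -rmorphM es rmorph0.
    have us' : h s z \is a GRing.unit by rewrite uE.
    move=> /(congr1 (fun u => (h s z)^-1 * u)); rewrite mulKr // mulr0 => /eqP; rewrite subr_eq0 => /eqP e2.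
    have ub' : h b z \is a GRing.unit by rewrite uE.
    have ud' : h d z \is a GRing.unit by rewrite uE.
    by apply: (mulIr ub'); rewrite divrK // mulrAC -e2 mulrK.
  have /choice[q hq] : forall b : stalk x, exists r, forall a s, phi s x \is a GRing.unit ->
      b = phi a x / phi s x -> r = h a z / h s z.
    move=> b; have [a [s [us e]]] := chart_fraction ch Ux b.
    by exists (h a z / h s z) => a' s' us'; rewrite e; exact: wd.
  have qr : is_rmorphism q.
    split.
      move=> b b'; have [a [s [us e]]] := chart_fraction ch Ux b.
      have [a' [s' [us' e']]] := chart_fraction ch Ux b'.
      rewrite (hq b a s) // (hq b' a' s') //.
      have uhs : h s z \is a GRing.unit by rewrite uE.
      have uhs' : h s' z \is a GRing.unit by rewrite uE.
      rewrite (hq _ (a * s' - a' * s) (s * s')).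
      - by rewrite -!kE rmorphB !rmorphM !kE fracB.
      - by rewrite -fE rmorphM !fE unitrM us us'.
      - by rewrite e e' -!fE rmorphB !rmorphM !fE fracB.
    split.
      rewrite (hq 1 1 1); rewrite -?fE -?kE ?rmorph1 ?unitr1 ?divr1 //.
    move=> b b'; have [a [s [us e]]] := chart_fraction ch Ux b.
    have [a' [s' [us' e']]] := chart_fraction ch Ux b'.
    have uhs : h s z \is a GRing.unit by rewrite uE.
    have uhs' : h s' z \is a GRing.unit by rewrite uE.
    rewrite (hq b a s) // (hq b' a' s') // (hq _ (a * a') (s * s')).
    - by rewrite -!kE !rmorphM !kE fracM.
    - by rewrite -fE rmorphM !fE unitrM us us'.
    - by rewrite e e' -!fE !rmorphM !fE fracM.
  have [q' q'E] := rmorph_of qr.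
  exists (existT _ x q'); split=> //=.
    move=> a; rewrite q'E (hq _ a 1); rewrite -?fE -?kE ?rmorph1 ?unitr1 ?divr1 //.
  move=> b; rewrite q'E; have [a [s [us e]]] := chart_fraction ch Ux b.
  rewrite (hq b a s) // unitrM uE => /andP[ua _].
  by rewrite e unitrM ua unitrV.
pose xq z := projT1 (cid (key z)).
have hxq z : _ := projT2 (cid (key z)).
pose F z := projT1 (xq z).
have FU z : U (F z) by case: (hxq z).
have Fphi z a : projT2 (xq z) (phi a (F z)) = h a z by case: (hxq z).
have hD a : open [set z | h a z \is a GRing.unit].
  by have := (reg_unit openT (hreg a)).1; rewrite setTI.
have unitF z a : (h a z \is a GRing.unit) = (phi a (F z) \is a GRing.unit).
  have [_ _ hl] := hxq z; apply/idP/idP => u; last by rewrite -Fphi; exact: rmorph_unit.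
  by apply: hl; rewrite Fphi.
have Fopen W : open W -> open (F @^-1` W).
  move=> oW; apply: openE_nbhs => z Wz.
  have [a [ua ha]] := chart_refine (FU z) oW Wz.
  exists [set z | h a z \is a GRing.unit]; split=> //=; first by rewrite unitF.
  by move=> z' /=; rewrite unitF; apply: ha.
have Freg W s : open W -> reg W s -> reg (F @^-1` W) (fun z => projT2 (xq z) (s (F z))).
  move=> oW rs; have oFW := Fopen W oW.
  apply: reg_glue => // z Wz.
  have oWU : open (W `&` U) by apply: openI => //; exact: chart_open ch.
  have rs' : reg (W `&` U) s by apply: (reg_sub (U := W)) => // y [].
  have WU : W `&` U `<=` U by move=> y [].
  have [hh _] := chart_reg ch s oWU WU.
  have [V [a [b [oV Vx VW hV]]]] := hh rs' (F z) (conj Wz (FU z)).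
  have [oD rD] := reg_unit openT (hreg b).
  have rab : reg (setT `&` [set z | h b z \is a GRing.unit]) (fun z => h a z / h b z).
    by apply: (@regM _ _ (h a) (fun z => (h b z)^-1)) => //; apply: (reg_sub (U := setT) openT oD) => //.
  exists (setT `&` [set z | h b z \is a GRing.unit] `&` F @^-1` V), (fun z => h a z / h b z); split.
  - by apply: openI => //; exact: Fopen.
  - by split=> //; split=> //=; rewrite unitF; exact: (hV _ Vx).1.
  - by apply: (reg_sub oD _ _ rab); [apply: openI => //; exact: Fopen|move=> y []].
  - move=> y [_ [_ Vy]]; have [ub ->] := hV _ Vy.
    by rewrite rmorphM rmorphV // !Fphi.
have Fc : continuous F by apply/continuousP.
by exists (@LRHom Z X F (fun z => projT2 (xq z)) Fc Freg (fun z => let: And3 _ _ hl := hxq z in hl)).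
Qed.

(** The first hypothesis says that the family [j] is schematically dense in [Z]. *)
Lemma hom_eq_dense Z I (Zi : I -> lrspace) (j : forall i, lrhom (Zi i) Z) (F G : lrhom Z X) :
  (forall s : forall x : Z, stalk x, reg setT s -> (forall i t, pull (j i) t (s (j i t)) = 0) -> forall x, s x = 0) ->
  (forall x, U (F x)) -> (forall x, U (G x)) ->
  (forall i, hom_comp F (j i) = hom_comp G (j i)) -> F = G.
Proof.
move=> dn UF UG h; apply: affine_hom_uniq => // x a.
have rU (H : lrhom Z X) : (forall x, U (H x)) -> reg setT (fun x => pull H x (phi a (H x))).
  move=> UH; have := @hom_reg _ _ H U _ (chart_open ch) (chart_reg_phi a).
  by have -> : H @^-1` U = setT by apply/seteqP; split=> // t _; exact: UH.
apply/eqP; rewrite -subr_eq0; apply/eqP.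
apply: (dn (fun x => pull F x (phi a (F x)) - pull G x (phi a (G x)))).
  by apply: (regB openT); exact: rU.
move=> i t; rewrite rmorphB; apply/eqP; rewrite subr_eq0; apply/eqP.
exact: (lrhom_eqE (h i)).2 t (phi a).
Qed.

End Chart.

Lemma point_hom (k : fieldType) X (x : X) (r : {rmorphism stalk x -> k}) :
  (forall a, r a != 0 -> a \is a GRing.unit) ->
  exists F : lrhom (spec_field k) X, (forall t, F t = x) /\
    forall t (s : forall x, stalk x), pull F t (s (F t)) = r (s x).
Proof.
move=> hl.
have c : continuous (fun _ : spec_field k => x) by move=> t; exact: cvg_cst.
have hl' : forall (t : spec_field k) a, r a \is a GRing.unit -> a \is a GRing.unit.
  by move=> t a; rewrite unitfE; exact: hl.
by exists (@LRHom (spec_field k) X (fun=> x) (fun=> r) c (fun _ _ _ _ => I) hl').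
Qed.

Lemma residue_point X (x : X) : exists (k : fieldType) (r : {rmorphism stalk x -> k}),
  forall a, r a = 0 <-> a \isn't a GRing.unit.
Proof.
have [|||||k [r [_ hr]]] := @residue_field (stalk x) (nonunits (stalk x)).
- by rewrite /nonunits /= unitr1.
- by move=> a b na nb; apply: nonunits_stalk => //; rewrite /nonunits /= unitrN.
- by rewrite /nonunits /= unitr0.
- by move=> a b; rewrite /nonunits /= unitrM => /negPf->; rewrite andbF.
- move=> a; rewrite /nonunits /= => /negP; rewrite negbK => ua; exists a^-1.
  by rewrite mulrV // subrr unitr0.
by exists k, r => a; exact: hr.
Qed.

End Spaces.

(** * Spaces of local rings, and spectra used as test schemes *)

Record base_system (T : Type) := BaseSystem {
  base_set : set (set T);
  base_cover : forall t, exists2 B, base_set B & B t;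
  base_meet : forall B C, base_set B -> base_set C -> base_set (B `&` C) }.

Definition base_space (T : Type) (S : base_system T) : Type := T.

Section BaseSpace.
Variables (T : Type) (S : base_system T).
Let op : set (set T) := [set G | forall t, G t -> exists B, [/\ base_set S B, B t & B `<=` G]].
Fact base_opT : op setT.
Proof. by move=> t _; have [B SB Bt] := base_cover S t; exists B. Qed.
Fact base_opI : setI_closed op.
Proof.
move=> G H oG oH t [Gt Ht]; have [B [SB Bt BG]] := oG t Gt; have [C [SC Ct CH]] := oH t Ht.
by exists (B `&` C); split; [exact: base_meet|split|move=> x [/BG ? /CH ?]].
Qed.
Fact base_opU (I : Type) (f : I -> set T) : (forall i, op (f i)) -> op (\bigcup_i f i).
Proof.
move=> h t [i _ fit]; have [B [SB Bt Bf]] := h i t fit.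
by exists B; split=> // x /Bf; exists i.
Qed.
HB.instance Definition _ := gen_eqMixin (base_space S).
HB.instance Definition _ := gen_choiceMixin (base_space S).
HB.instance Definition _ := isOpenTopological.Build (base_space S) base_opT base_opI base_opU.

Lemma base_openP (G : set (base_space S)) :
  open G <-> forall t, G t -> exists B, [/\ base_set S B, B t & B `<=` G].
Proof. by []. Qed.

Lemma base_open (B : set (base_space S)) : base_set S B -> open B.
Proof. by move=> SB; apply/base_openP => t Bt; exists B; split. Qed.
End BaseSpace.

(* A section is a family of germs that are locally represented by a single
   element of [K]; [R t x a] says that [t] represents the germ [a] at [x]. *)
Section RelSpace.
Variables (T : topologicalType) (st : T -> comUnitRingType) (K : pzRingType).
Variable R : K -> forall x, st x -> Prop.
Hypothesis R1 : forall x, R 1 (1 : st x).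
Hypothesis RB : forall x t u (a b : st x), R t a -> R u b -> R (t - u) (a - b).
Hypothesis RM : forall x t u (a b : st x), R t a -> R u b -> R (t * u) (a * b).
Hypothesis R_surj : forall x (a : st x), exists t V, [/\ open V, V x, R t a & forall y, V y -> exists b : st y, R t b].
Hypothesis R_fun : forall x t (a b : st x), R t a -> R t b -> a = b.
Hypothesis R_inj : forall x t u (a : st x), R t a -> R u a -> exists V, [/\ open V, V x &
  forall y (b c : st y), V y -> R t b -> R u c -> b = c].
Hypothesis R_loc : forall x (a b : st x), a \isn't a GRing.unit -> b \isn't a GRing.unit ->
    a + b \isn't a GRing.unit.

Definition rel_reg (U : set T) (s : forall x, st x) :=
  forall x, U x -> exists V t, [/\ open V, V x & forall y, U y -> V y -> R t (s y)].

Definition rel_space : lrspace.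
Proof.
refine (@LRSpace T st rel_reg _ _ _ _ _ _ _ R_loc).
- move=> U V s oU oV VU rs x Vx; have [W [t [oW Wx h]]] := rs x (VU _ Vx).
  by exists W, t; split=> // y Vy; apply: h; exact: VU.
- move=> U s oU h x Ux; have [V [t [oV Vx rt e]]] := h x Ux.
  have [W [u [oW Wx hW]]] := rt x Vx; exists (V `&` W), u; split=> //; first exact: openI.
  by move=> y Uy [Vy Wy]; rewrite e //; exact: hW.
- by move=> U oU x Ux; exists setT, 1; split=> //; exact: openT.
- move=> U s t oU rs rt x Ux; have [V [a [oV Vx hV]]] := rs x Ux; have [W [b [oW Wx hW]]] := rt x Ux.
  exists (V `&` W), (a - b); split=> //; first exact: openI.
  by move=> y Uy [Vy Wy]; apply: RB; [exact: hV|exact: hW].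
- move=> U s t oU rs rt x Ux; have [V [a [oV Vx hV]]] := rs x Ux; have [W [b [oW Wx hW]]] := rt x Ux.
  exists (V `&` W), (a * b); split=> //; first exact: openI.
  by move=> y Uy [Vy Wy]; apply: RM; [exact: hV|exact: hW].
- move=> x a; have [t [V [oV Vx ta h]]] := R_surj a.
  pose s y : st y := if pselect (exists b : st y, R t b) is left h then projT1 (cid h) else 0.
  have sE y : V y -> R t (s y).
    by move=> /h hy; rewrite /s; case: pselect => // h'; case: (cid h').
  exists V, s; split=> //; first by move=> z Vz; exists V, t; split=> // w _; exact: sE.
  by apply: (R_fun (t := t)) => //; exact: sE.
- move=> U s t x oU Ux rs rt e; have [V [a [oV Vx hV]]] := rs x Ux; have [W [b [oW Wx hW]]] := rt x Ux.
  have [V' [oV' V'x h]] := @R_inj x a b (s x) (hV x Ux Vx) ltac:(rewrite e; exact: hW).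
  exists (U `&` V `&` W `&` V'); split=> //; first by do 3 apply: openI => //.
  by move=> y [[[Uy Vy] Wy] V'y]; apply: (h y) => //; [exact: hV|exact: hW].
Defined.
End RelSpace.

Lemma subr_ext (K : fieldType) (A B : subr K) : (forall u, A u <-> B u) -> A = B.
Proof.
case: A B => [A A1 AB AM] [B B1 BB BM] /= h.
have e : A = B by apply: funext => u; apply: propext.
by subst B; congr Subr; exact: Prop_irrelevance.
Qed.

Section SubLocal.
Variables (K : fieldType) (O : subr K).
Lemma sub_unit_inu (a : sub_of O) : a \is a GRing.unit <-> inu O (val a).
Proof. exact: sub_unitP. Qed.
Lemma sub_nonu (a : sub_of O) : a \isn't a GRing.unit <-> nonu O (val a).
Proof.
split=> [n|[_ n]]; first by split; [exact: sub_valP|move=> /sub_unit_inu u; rewrite u in n].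
by apply/negP => /sub_unit_inu.
Qed.
Lemma sub_local : localS O -> forall a b : sub_of O, a \isn't a GRing.unit -> b \isn't a GRing.unit ->
    a + b \isn't a GRing.unit.
Proof. by move=> h a b /sub_nonu na /sub_nonu nb; apply/sub_nonu; rewrite sub_valD; exact: h. Qed.
End SubLocal.

(* The points are local subrings [O t] of [K], lying over points [y t] of a base
   space; a base of open sets is given by the conditions [y t \in V] and
   [F `<=` O t], [F] finite, and sections are locally constant in [K]. *)
Section LocalRings.
Variables (K : fieldType) (Y : topologicalType) (T : Type) (y : T -> Y) (O : T -> subr K).
Hypothesis Oloc : forall t, localS (O t).

Definition lr_base_set : set (set T) := [set B | exists V F, open V /\
  B = [set t : T | V (y t) /\ forall u : K, u \in (F : seq K) -> O t u]].
Fact lr_cover t : exists2 B, lr_base_set B & B t.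
Proof. by exists setT => //; exists setT, [::]; split; [exact: openT|apply/seteqP; split]. Qed.
Fact lr_meet B C : lr_base_set B -> lr_base_set C -> lr_base_set (B `&` C).
Proof.
move=> [V [F [oV ->]]] [W [G [oW ->]]]; exists (V `&` W), (F ++ G); split; first exact: openI.
apply/seteqP; split=> [t [[Vt Ft] [Wt Gt]]|t [[Vt Wt] h]].
  by split=> // u; rewrite mem_cat => /orP[/Ft|/Gt].
by split; split=> // u uF; apply: h; rewrite mem_cat uF ?orbT.
Qed.
Definition lr_base := BaseSystem lr_cover lr_meet.

Let st (t : base_space lr_base) : comUnitRingType := sub_of (O t).
Let R (u : K) (t : base_space lr_base) (a : st t) := val a = u.

Lemma lr_open_mem u : open [set t : base_space lr_base | O t u].
Proof.
apply: base_open; exists setT, [:: u]; split; first exact: openT.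
apply/seteqP; split=> [t /= Ou|t [_ h]]; last by apply: h; rewrite mem_head.
by split=> // v; rewrite inE => /eqP->.
Qed.
Lemma lr_open_base V : open V -> open [set t : base_space lr_base | V (y t)].
Proof.
by move=> oV; apply: base_open; exists V, [::]; split=> //; apply/seteqP; split=> [t Vt|t []].
Qed.

Definition lr_space : lrspace.
Proof.
refine (@rel_space _ st K R _ _ _ _ _ _ _).
- by move=> t; rewrite /R.
- by move=> t u v a b; rewrite /R => <- <-.
- by move=> t u v a b; rewrite /R => <- <-.
- move=> t a; exists (val a), [set t' : base_space lr_base | O t' (val a)]; split=> //.
  + exact: lr_open_mem.
  + exact: sub_valP.
  + by move=> t' h; exists (mk_sub h).
- by move=> t u a b; rewrite /R => <- e; apply: val_inj.
- move=> t u v a; rewrite /R => <- <-; exists setT; split=> //; first exact: openT.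
  by move=> t' b c _ eb ec; apply: val_inj; rewrite eb ec.
- by move=> t; exact: sub_local.
Defined.

Lemma lr_reg (U : set lr_space) (s : forall t : lr_space, stalk t) :
  (forall t, U t -> exists V (u : K), [/\ open V, V t & forall t', U t' -> V t' -> val (s t' : sub_of (O t')) = u]) <-> reg U s.
Proof. by []. Qed.

(** The conditions say that the rings over [W] are the localizations of [B], that each prime of [B]
    occurs exactly once, and that the topology coming from [Y] is no finer on [W] than that of Spec
    B. *)
Lemma lr_chart (W : set lr_space) (B : subr K) : open W ->
  (forall t, W t -> forall u, B u -> O t u) ->
  (forall t, W t -> forall u, O t u -> exists a s, [/\ B a, B s, inu (O t) s & u = a / s]) ->
  (forall P, prime_of B P -> exists2 t, W t & P = [set u | B u /\ nonu (O t) u]) ->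
  (forall t t', W t -> W t' -> (forall u, B u -> (inu (O t) u <-> inu (O t') u)) -> t = t') ->
  (forall t V, W t -> open V -> V (y t) -> exists s, [/\ B s, inu (O t) s &
      forall t', W t' -> inu (O t') s -> V (y t')]) ->
  exists phi : sub_of B -> forall t : lr_space, stalk t,
    affine_chart W phi /\ forall t b, W t -> val (phi b t : sub_of (O t)) = val b.
Proof.
move=> oW BO frac pr inj ref.
pose phi (b : sub_of B) (t : lr_space) : stalk t :=
  if pselect (O t (val b)) is left h then mk_sub h else 0.
have phiE t b : W t -> val (phi b t : sub_of (O t)) = val b.
  move=> Wt; rewrite /phi; case: pselect => [h|[]]; first by rewrite val_mk_sub.
  by apply: BO => //; exact: sub_valP.
have phiu t b : W t -> (phi b t \is a GRing.unit) <-> inu (O t) (val b).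
  by move=> Wt; rewrite -(phiE t b Wt); exact: sub_unit_inu.
have nphiu t b : W t -> (phi b t \isn't a GRing.unit) <-> nonu (O t) (val b).
  by move=> Wt; rewrite -(phiE t b Wt); exact: sub_nonu.
exists phi; split=> //; split=> //.
- move=> t Wt; split; first by move=> a b; apply: val_inj; rewrite sub_valB !phiE.
  by split; [apply: val_inj; rewrite phiE|move=> a b; apply: val_inj; rewrite sub_valM !phiE].
- move=> P [[P0 PD] PM P1 Pp].
  have pP : prime_of B [set u | exists2 a : sub_of B, P a & u = val a].
    split; first split.
    + by move=> _ [a _ ->]; exact: sub_valP.
    + by exists 0.
    + by move=> _ _ [a Pa ->] [b Pb ->]; exists (a + b); [exact: PD|].
    + by move=> c _ Bc [a Pa ->]; exists (mk_sub Bc * a); [exact: PM|].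
    + by move=> [a Pa] /esym/(@val_inj _ _ (sub_of B) a 1) e; apply: P1; rewrite -e.
    + move=> a b Ba Bb [c Pc e].
      have [|h|h] := Pp (mk_sub Ba) (mk_sub Bb); [|by left; exists (mk_sub Ba)|by right; exists (mk_sub Bb)].
      by have -> : mk_sub Ba * mk_sub Bb = c by apply: val_inj.
  have [t Wt e] := pr _ pP; have e' : P = [set a | phi a t \isn't a GRing.unit].
    apply/seteqP; split=> a /=.
      move=> Pa; apply/nphiu => //; suff : [set u | B u /\ nonu (O t) u] (val a) by case.
      by rewrite -e; exists a.
    move=> /nphiu-/(_ Wt) n; have : [set u | B u /\ nonu (O t) u] (val a) by split=> //; exact: sub_valP.
    by rewrite -e => -[b Pb /val_inj ->].
  exists t; split=> // t' [Wt' e2]; apply: inj => // u Bu.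
  have := congr1 (fun S : set _ => S (mk_sub Bu)) (etrans (esym e') e2) => /= {}e2.
  split=> h.
    apply/(phiu t' (mk_sub Bu) Wt'); apply: contraT; rewrite -e2 => /negP[].
    by apply/(phiu t (mk_sub Bu) Wt).
  apply/(phiu t (mk_sub Bu) Wt); apply: contraT; rewrite e2 => /negP[].
  by apply/(phiu t' (mk_sub Bu) Wt').
- move=> G GW; split.
    move=> /base_openP oG t Gt; have [_ [[V [F [oV ->]]] [Vt Ft] VG]] := oG t Gt.
    have Wt := GW t Gt.
    have [s [Bs us hs]] := ref t V Wt oV Vt.
    (* The product of denominators of the members of [F]: where it is invertible, all of [F] is in
       the local ring. *)
    have [s' [Bs' us' hs']] : exists s', [/\ B s', inu (O t) s' & forall t', W t' -> inu (O t') s' ->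
        forall u, u \in F -> O t' u].
      elim: F Ft {VG} => [|u F IH] h; first by exists 1; split=> //; [exact: sr1|exact: inu1].
      have [|s' [Bs' us' hs']] := IH; first by move=> v vF; apply: h; rewrite inE vF orbT.
      have [a [d [Ba Bd ud eu]]] := frac t Wt u (h _ (mem_head _ _)).
      exists (s' * d); split; [exact: srM|exact: inuM|move=> t' Wt' ut v].
      have h1 : inu (O t') s' by apply: inuMl ut; apply: BO.
      have h2 : inu (O t') d by rewrite mulrC in ut; apply: inuMl ut; apply: BO.
      rewrite inE => /orP[/eqP->|/(hs' _ Wt' h1)//].
      by rewrite eu; apply: srM; [exact: BO|exact: h2.2].
    exists (mk_sub (srM Bs Bs')); split; first by apply/phiu => //=; exact: inuM.
    move=> t' Wt' /phiu-/(_ Wt') /= u'; apply: VG; split.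
      by apply: hs => //; apply: inuMl u'; apply: BO.
    by apply: hs' => //; rewrite mulrC in u'; apply: inuMl u'; apply: BO.
  move=> h; apply: openE_nbhs => t Gt; have [a [ua ha]] := h t Gt.
  exists (W `&` [set t | O t (val a)^-1]); split.
  + by apply: openI => //; exact: lr_open_mem.
  + by split; [exact: GW|have /phiu := ua => /(_ (GW t Gt))[]].
  + move=> t' [Wt' ut]; apply: ha => //; apply/phiu => //; split=> //.
    by have /phiu := ua => /(_ (GW t Gt))[].
- move=> t Wt b; have [a [s [Ba Bs us e]]] := frac t Wt (val b) (sub_valP b).
  have u : phi (mk_sub Bs) t \is a GRing.unit by apply/phiu.
  exists (mk_sub Ba), (mk_sub Bs); split=> //; apply: (mulIr u); rewrite divrK //.
  by apply: val_inj; rewrite sub_valM !phiE //= e divfK // us.1.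
- move=> t Wt a /(congr1 val); rewrite phiE // sub_val0 => e; exists 1; split.
    by apply/phiu => //; exact: inu1.
  by rewrite mul1r; apply: val_inj.
- move=> G s oG GW; split.
    move=> /lr_reg rs t Gt; have [V [u [oV Vt hV]]] := rs t Gt; have Wt := GW t Gt.
    have Otu : O t u by rewrite -(hV t) //; exact: sub_valP.
    have [a [d [Ba Bd ud eu]]] := frac t Wt u Otu.
    exists (G `&` V `&` [set t | O t d^-1]), (mk_sub Ba), (mk_sub Bd); split=> //.
    + by apply: openI; [exact: openI|exact: lr_open_mem].
    + by split=> //; exact: ud.2.
    + by move=> t' [[]].
    + move=> t' [[Gt' Vt'] Ot']; have Wt' := GW _ Gt'.
      have u' : phi (mk_sub Bd) t' \is a GRing.unit by apply/phiu => //; split=> //; exact: ud.1.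
      split=> //; apply: (mulIr u'); rewrite divrK //.
      by apply: val_inj; rewrite sub_valM !phiE //= hV // eu divfK // ud.1.
  move=> h; apply/lr_reg => t Gt; have [V [a [b [oV Vt VG hV]]]] := h t Gt.
  exists V, (val a / val b); split=> // t' Gt' Vt'; have [ub ->] := hV t' Vt'.
  have Wt' := GW t' Gt'; have /phiu := ub => /(_ Wt') [b0 _].
  by apply: (mulIf b0); rewrite divfK // -(phiE t' a Wt') -[X in _ * X](phiE t' b Wt') -sub_valM divrK.
Qed.

End LocalRings.

Lemma rmorph_factor (T A B : pzRingType) (f : {rmorphism T -> A}) (g : T -> B) :
  (forall x, exists t, x = f t) -> is_rmorphism g -> (forall t, f t = 0 -> g t = 0) ->
  exists r : {rmorphism A -> B}, forall t, r (f t) = g t.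
Proof.
move=> sf [gB [g1 gM]] h.
have /choice[q hq] : forall x, exists y, forall a, x = f a -> y = g a.
  move=> x; have [a ->] := sf x; exists (g a) => b e.
  by apply/eqP; rewrite -subr_eq0 -gB; apply/eqP/h; rewrite rmorphB e subrr.
have [|r rE] := @rmorph_of _ _ q.
  split.
    move=> x y; have [a ea] := sf x; have [b eb] := sf y.
    by rewrite (hq x a ea) (hq y b eb) -gB; apply: hq; rewrite rmorphB ea eb.
  split; first by rewrite -g1; apply: hq; rewrite rmorph1.
  move=> x y; have [a ea] := sf x; have [b eb] := sf y.
  by rewrite (hq x a ea) (hq y b eb) -gM; apply: hq; rewrite rmorphM ea eb.
by exists r => t; rewrite rE; exact: hq.
Qed.

Section SpecSubring.
Variables (L : fieldType) (A : subr L).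

Let pt := {P : set L | prime_of A P}.
Let stk (t : pt) : subr L := loc (proj2_sig t).
Fact stk_local (t : pt) : localS (stk t). Proof. exact: loc_local. Qed.

(** A one point base suffices, because the conditions on membership in the local rings already
    generate the Zariski topology. *)
Definition spec_subr : lrspace :=
  lr_space (fun _ : pt => (tt : discrete_topology unit)) stk_local.

Definition spec_pt P (pP : prime_of A P) : spec_subr := exist _ P pP.

Lemma spec_subr_val (t : spec_subr) u : A u -> (inu (stk t) u <-> ~ proj1_sig t u).
Proof.
move=> Au; case: t => P pP; rewrite /inu /=; split=> [[u0 h]|nu].
  by apply/(loc_unitP pP).
by split; [exact: (prime_neq0 pP nu)|exact: (loc_unit pP)].
Qed.

Lemma spec_subr_chart : exists phi : sub_of A -> forall t : spec_subr, stalk t,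
  affine_chart setT phi /\ forall t b, val (phi b t : sub_of (stk t)) = val b.
Proof.
have [||||||phi [ch e]] := @lr_chart L (discrete_topology unit) pt (fun=> tt) stk stk_local setT A.
- exact: openT.
- by move=> t _ u Au; exact: loc_sub.
- move=> t _ u [a [s [Aa As ns e]]]; exists a, s; split=> //; exact/spec_subr_val.
- move=> P pP; exists (spec_pt pP) => //; apply/seteqP; split=> u.
    have [[PA _ _ _] _ _] := pP.
    move=> Pu; split; first exact: PA.
    by apply/(loc_contract pP) => //; exact: PA.
  by move=> [Au]; move=> /(loc_contract pP)-/(_ Au).
- move=> [P pP] [Q pQ] _ _ h; have e : P = Q.
    have [[PA _ _ _] _ _] := pP; have [[QA _ _ _] _ _] := pQ.
    apply/seteqP; split=> u.
      move=> Pu; have Au := PA _ Pu; apply: contrapT => nQ.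
      by have := (spec_subr_val (spec_pt pP) Au).1 ((h u Au).2 ((spec_subr_val (spec_pt pQ) Au).2 nQ)); apply.
    move=> Qu; have Au := QA _ Qu; apply: contrapT => nP.
    by have := (spec_subr_val (spec_pt pQ) Au).1 ((h u Au).1 ((spec_subr_val (spec_pt pP) Au).2 nP)); apply.
  by subst Q; congr exist; exact: Prop_irrelevance.
- by move=> t V _ _ Vt; exists 1; split; [exact: sr1|exact: inu1|move=> t' _ _; case: (tt) Vt].
by exists phi; split=> // t b; exact: e.
Qed.

Lemma spec_subr_scheme : scheme spec_subr.
Proof. by move=> t; have [phi [ch _]] := spec_subr_chart; exists setT, (sub_of A), phi. Qed.

Lemma spec_subr_hom (X : lrspace) (U : set X) (B : comPzRingType) (phi : B -> forall x : X, stalk x)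
    (th : B -> L) : affine_chart U phi -> is_rmorphism th -> (forall b, A (th b)) ->
  exists F : lrhom spec_subr X, (forall t, U (F t)) /\
    forall t b, val (pull F t (phi b (F t)) : sub_of (stk t)) = th b.
Proof.
move=> ch [thB [th1 thM]] Ath.
pose h b (t : spec_subr) : stalk t := mk_sub (loc_sub (proj2_sig t) (Ath b)).
have [||F [UF hF]] := @affine_hom _ _ _ _ ch spec_subr h.
- move=> t; split; first by move=> a b; apply: val_inj; rewrite sub_valB /= thB.
  by split; [apply: val_inj; rewrite /= th1|move=> a b; apply: val_inj; rewrite sub_valM /= thM].
- by move=> b; apply: (iffLR (lr_reg _ _)) => t _; exists setT, (th b); split=> //; exact: openT.
by exists F; split=> // t b; rewrite hF.
Qed.

Fact prime_of0 : prime_of A [set 0].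
Proof.
split; first split.
- by move=> _ ->; exact: sr0.
- by [].
- by move=> _ _ -> ->; rewrite addr0.
- by move=> a _ _ ->; rewrite mulr0.
- by move=> /eqP; rewrite oner_eq0.
- by move=> a b _ _ /eqP; rewrite mulf_eq0 => /orP[] /eqP; [left|right].
Qed.

Lemma spec_subr_generic : exists (xi : spec_subr) (j : lrhom (spec_field L) spec_subr),
  [/\ forall t, j t = xi, forall t (s : forall x : spec_subr, stalk x),
         pull j t (s (j t)) = val (s xi : sub_of (stk xi)),
      forall x (G : set spec_subr), open G -> G x -> G xi
    & forall s : forall x : spec_subr, stalk x, reg setT s -> s xi = 0 -> forall x, s x = 0].
Proof.
pose xi := spec_pt prime_of0.
have gen x (G : set spec_subr) : open G -> G x -> G xi.
  move=> /base_openP oG Gx; have [_ [[V [F [oV ->]]] [Vx Fx] h]] := oG x Gx.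
  apply: h; split=> // u /Fx; case: x {Gx Vx Fx} => P pP /= [a [s [Aa As ns e]]].
  by exists a, s; split=> //; exact/eqP/(prime_neq0 pP ns).
pose r : {rmorphism stalk xi -> L} := (val : sub_of (stk xi) -> L).
have [a an0|j [jx jp]] := @point_hom L spec_subr xi r.
  apply/sub_unit_inu; split=> //.
  have /= [b [s [Ab As s0 e]]] := sub_valP (a : sub_of (stk xi)).
  move: an0; rewrite /r /= e => n0; exists s, b; split=> //; last by rewrite invf_div.
  by move=> b0; move: n0; rewrite b0 mul0r eqxx.
exists xi, j; split=> // s rs s0 x.
have [V [u [oV Vx h]]] := (lr_reg setT s).2 rs x I.
apply: val_inj; rewrite (h x) // -(h xi) //; last exact: gen oV Vx.
by rewrite s0.
Qed.

End SpecSubring.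

Section SpecVNR.
Variables (T : comNzRingType).
Hypothesis vnr : forall a : T, exists b, a * a * b = a.

(** From a (a b - 1) = 0 every prime is maximal; for the same reason the localizations are the
    residue fields, which serve as stalks below. *)
Lemma vnr_prime (P : set T) : prime_ideal P -> exists kr : {k : fieldType & {rmorphism T -> k}},
  (forall x, exists t, x = projT2 kr t) /\ forall t, projT2 kr t = 0 <-> P t.
Proof.
move=> pP; have iP := prime_isideal pP; have [[P0 PD] PM P1 Pp] := pP.
have [||||a na|k [r hr]] := @residue_field T P; rewrite //; [by move=> a b; exact: isidealB| |by exists (existT _ k r)].
have [b e] := vnr a; exists b.
have : P (a * (a * b - 1)) by rewrite mulrBr mulr1 mulrA e subrr.
by case/Pp.
Qed.

Let pt := {P : set T | prime_ideal P}.
Let kr (t : pt) := projT1 (cid (vnr_prime (proj2_sig t))).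
Let kk (t : pt) : fieldType := projT1 (kr t).
Let rr (t : pt) : {rmorphism T -> kk t} := projT2 (kr t).
Let rr_surj t : forall x, exists a, x = rr t a. Proof. by rewrite /rr /kk /kr; case: (cid _) => r []. Qed.
Let rr0 t a : rr t a = 0 <-> proj1_sig t a. Proof. by rewrite /rr /kk /kr; case: (cid _) => r []. Qed.

Let vnr_base_set : set (set pt) := [set B | exists a, B = [set t | ~ proj1_sig t a]].
Fact vnr_cover t : exists2 B, vnr_base_set B & B t.
Proof. by exists [set t | ~ proj1_sig t 1]; [exists 1|case: t => P []]. Qed.
Fact vnr_meet B C : vnr_base_set B -> vnr_base_set C -> vnr_base_set (B `&` C).
Proof.
move=> [a ->] [b ->]; exists (a * b); apply/seteqP; split=> -[P pP] /=.
  by move=> [na nb]; apply: primeM_neg.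
have [_ PM _ _] := pP; move=> n; split=> h; apply: n; last exact: PM.
by rewrite mulrC; exact: PM.
Qed.
Let vnr_base := BaseSystem vnr_cover vnr_meet.
Let top : topologicalType := base_space vnr_base.
Let st (t : top) : comUnitRingType := kk t.
Let R (a : T) (t : top) (x : st t) := x = rr t a.

Definition spec_vnr : lrspace.
Proof.
refine (@rel_space top st T R _ _ _ _ _ _ _).
- by move=> t; rewrite /R rmorph1.
- by move=> t a b x y; rewrite /R => -> ->; rewrite rmorphB.
- by move=> t a b x y; rewrite /R => -> ->; rewrite rmorphM.
- move=> t x; have [a e] := rr_surj x; exists a, setT; split=> //; first exact: openT.
  by move=> y _; exists (rr y a).
- by move=> t a x y; rewrite /R => -> ->.
- move=> t a b x; rewrite /R => -> e.
  have [c ec] := vnr (a - b); have [d ed] : exists d, d = 1 - (a - b) * c by eexists.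
  exists [set t' | ~ proj1_sig t' d]; split.
  + by apply: base_open; exists d.
  + rewrite /= -rr0 ed rmorphB rmorph1 rmorphM rmorphB e subrr mul0r subr0.
    by move/eqP; rewrite oner_eq0.
  + move=> t' x' y' nd -> ->; apply/eqP; rewrite -subr_eq0 -rmorphB; apply/eqP/rr0.
    have [_ _ _ Pp] := proj2_sig t'.
    have : proj1_sig t' ((a - b) * d).
      have -> : (a - b) * d = 0 by rewrite ed mulrBr mulr1 mulrA ec subrr.
      by have [[]] := proj2_sig t'.
    by case/Pp.
- by move=> t a b; rewrite !unitfE !negbK => /eqP-> /eqP->; rewrite addr0.
Defined.

Definition vnr_pt P (pP : prime_ideal P) : spec_vnr := exist _ P pP.
Definition vnr_res (t : spec_vnr) : {rmorphism T -> stalk t} := rr t.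
Lemma vnr_res0 t a : vnr_res t a = 0 <-> proj1_sig t a. Proof. exact: rr0. Qed.
Lemma vnr_res_surj t x : exists a, x = vnr_res t a. Proof. exact: rr_surj. Qed.
Lemma vnr_unit (t : spec_vnr) (x : stalk t) : (x \is a GRing.unit) = (x != 0).
Proof. exact: unitfE. Qed.
Lemma vnr_unit_res (t : spec_vnr) a : vnr_res t a \is a GRing.unit <-> ~ proj1_sig t a.
Proof. by rewrite vnr_unit -vnr_res0; split=> /eqP. Qed.
Lemma vnr_open (G : set spec_vnr) : open G <-> forall t, G t -> exists a, ~ proj1_sig t a /\
  forall t', ~ proj1_sig t' a -> G t'.
Proof.
split=> [/base_openP oG t Gt|h].
  by have [_ [[a ->] na aG]] := oG t Gt; exists a.
apply/base_openP => t Gt; have [a [na aG]] := h t Gt.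
by exists [set t | ~ proj1_sig t a]; split=> //; exists a.
Qed.
Lemma vnr_reg (U : set spec_vnr) (s : forall t : spec_vnr, stalk t) :
  reg U s <-> forall t, U t -> exists V a, [/\ open V, V t & forall t', U t' -> V t' -> s t' = vnr_res t' a].
Proof. by []. Qed.

Lemma spec_vnr_chart : affine_chart setT (fun a (t : spec_vnr) => vnr_res t a).
Proof.
split.
- exact: openT.
- by move=> t _; exact: rmorphism_is.
- move=> P pP; exists (vnr_pt pP); split.
    split=> //; apply/seteqP; split=> a /=; rewrite vnr_unit negbK; last by move=> /eqP/vnr_res0.
    by move=> Pa; exact/eqP/vnr_res0.
  move=> [Q pQ] [_ e]; suff e' : P = Q by subst Q; congr exist; exact: Prop_irrelevance.
  rewrite e; apply/seteqP; split=> a /=; rewrite vnr_unit negbK; first by move=> /eqP/vnr_res0.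
  by move=> Qa; exact/eqP/vnr_res0.
- move=> W _; rewrite vnr_open; split=> h t Wt; have [a [ua ha]] := h t Wt; exists a.
    by split; [exact/vnr_unit_res|move=> t' _ /vnr_unit_res; exact: ha].
  by split; [exact/vnr_unit_res|move=> t' /vnr_unit_res; exact: ha].
- by move=> t _ b; have [a ->] := vnr_res_surj b; exists a, 1; rewrite rmorph1 unitr1 divr1.
- move=> t _ a /vnr_res0 ta; have [b e] := vnr a; exists (1 - a * b); split.
    apply/vnr_unit_res => h; have [[_ PD] PM P1 _] := proj2_sig t; apply: P1.
    by rewrite -[1](subrK (a * b)); apply: PD => //; rewrite mulrC; exact: PM.
  by rewrite mulrBl mul1r mulrAC e subrr.
- move=> W s oW _; rewrite vnr_reg; split=> h t Wt.
    have [V [a [oV Vt hV]]] := h t Wt; exists (W `&` V), a, 1; split=> //; first exact: openI.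
    by move=> t' [Wt' Vt']; rewrite rmorph1 unitr1 divr1 hV.
  have [V [a [b [oV Vt VW hV]]]] := h t Wt; have [c e] := vnr b.
  exists V, (a * c); split=> // t' _ Vt'; have [ub ->] := hV t' Vt'.
  rewrite rmorphM; congr (_ * _); apply: (mulrI ub); rewrite mulrV //.
  by apply: (mulrI ub); rewrite mulr1 mulrA -!rmorphM e.
Qed.

Lemma spec_vnr_scheme : scheme spec_vnr.
Proof. by move=> t; exists setT, T, (fun a t => vnr_res t a); split=> //; exact: spec_vnr_chart. Qed.

Lemma spec_vnr_hom (X : lrspace) (U : set X) (B : comPzRingType) (phi : B -> forall x : X, stalk x)
    (th : B -> T) : affine_chart U phi -> is_rmorphism th ->
  exists F : lrhom spec_vnr X, (forall t, U (F t)) /\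
    forall t b, pull F t (phi b (F t)) = vnr_res t (th b).
Proof.
move=> ch [thB [th1 thM]].
apply: (@affine_hom _ _ _ _ ch spec_vnr (fun b t => vnr_res t (th b))).
  move=> t; split; first by move=> a b; rewrite thB rmorphB.
  by split; [rewrite th1 rmorph1|move=> a b; rewrite thM rmorphM].
by move=> b; apply/vnr_reg => t _; exists setT, (th b); split=> //; exact: openT.
Qed.

End SpecVNR.

Section FieldProduct.
Variables (J : Type) (i0 : J) (F : J -> fieldType).
(** The index [i0] is recorded because the product of an empty family has 1 = 0. *)
Definition fprodT : Type := let _ := i0 in forall i : J, F i.
HB.instance Definition _ := gen_eqMixin fprodT.
HB.instance Definition _ := gen_choiceMixin fprodT.
Let fext (a b : fprodT) : (forall i, a i = b i) -> a = b.
Proof. exact: functional_extensionality_dep. Qed.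
Let add (a b : fprodT) : fprodT := fun i => a i + b i.
Let opp (a : fprodT) : fprodT := fun i => - a i.
Let mul (a b : fprodT) : fprodT := fun i => a i * b i.
Let zero : fprodT := fun i => 0.
Let one : fprodT := fun i => 1.
Fact fprod_addA : associative add. Proof. by move=> a b c; apply: fext => i; exact: addrA. Qed.
Fact fprod_addC : commutative add. Proof. by move=> a b; apply: fext => i; exact: addrC. Qed.
Fact fprod_add0 : left_id zero add. Proof. by move=> a; apply: fext => i; exact: add0r. Qed.
Fact fprod_addN : left_inverse zero opp add. Proof. by move=> a; apply: fext => i; exact: addNr. Qed.
HB.instance Definition _ := GRing.isZmodule.Build fprodT fprod_addA fprod_addC fprod_add0 fprod_addN.
Fact fprod_mulA : associative mul. Proof. by move=> a b c; apply: fext => i; exact: mulrA. Qed.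
Fact fprod_mulC : commutative mul. Proof. by move=> a b; apply: fext => i; exact: mulrC. Qed.
Fact fprod_mul1 : left_id one mul. Proof. by move=> a; apply: fext => i; exact: mul1r. Qed.
Fact fprod_mulD : left_distributive mul add. Proof. by move=> a b c; apply: fext => i; exact: mulrDl. Qed.
Fact fprod_10 : one != 0 :> fprodT.
Proof. by apply/eqP => /(congr1 (fun a : fprodT => a i0)) /eqP; rewrite oner_eq0. Qed.
HB.instance Definition _ := GRing.Zmodule_isComNzRing.Build fprodT
  fprod_mulA fprod_mulC fprod_mul1 fprod_mulD fprod_10.

Lemma fprodB (a b : fprodT) i : (a - b) i = a i - b i. Proof. by []. Qed.
Lemma fprodM (a b : fprodT) i : (a * b) i = a i * b i. Proof. by []. Qed.
Lemma fprod_vnr (a : fprodT) : exists b, a * a * b = a.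
Proof.
exists (fun i => (a i)^-1); apply: fext => i; rewrite !fprodM.
by have [->|a0] := eqVneq (a i) 0; rewrite ?mul0r // mulfK.
Qed.
Lemma fprod_prime i : prime_ideal [set a : fprodT | a i = 0].
Proof.
split=> /=.
- by split=> // a b ea eb; have -> : (a + b) i = a i + b i by []; rewrite ea eb addr0.
- by move=> a b e; rewrite fprodM e mulr0.
- by move/eqP; rewrite oner_eq0.
- by move=> a b; rewrite fprodM => /eqP; rewrite mulf_eq0 => /orP[] /eqP; [left|right].
Qed.

Lemma fprod_point i : exists j : lrhom (spec_field (F i)) (spec_vnr fprod_vnr),
  (forall t, j t = vnr_pt fprod_vnr (fprod_prime i)) /\
  forall t a, pull j t (vnr_res (j t) a) = a i.
Proof.
set z := vnr_pt fprod_vnr (fprod_prime i).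
have [||a /vnr_res0//|r rE] := @rmorph_factor _ _ _ (vnr_res z) (fun a => a i).
- by move=> x; exact: vnr_res_surj.
- by [].
have [x|j [jz jp]] := @point_hom _ _ z r.
  have [a ->] := vnr_res_surj x; rewrite rE => a0.
  by apply/vnr_unit_res => /= e; rewrite e eqxx in a0.
exists j; split=> // t a; by rewrite (jp t (fun x => vnr_res x a)) rE.
Qed.

(** Near [x] the section is a single element [a], on the basic open set of some [e]. Vanishing at
    the coordinate points of that set means a e = 0. *)
Lemma fprod_dense (s : forall x : spec_vnr fprod_vnr, stalk x) : reg setT s ->
  (forall i, s (vnr_pt fprod_vnr (fprod_prime i)) = 0) -> forall x, s x = 0.
Proof.
move=> /vnr_reg rs s0 x; have [V [a [oV Vx hV]]] := rs x Logic.I.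
have [e [ne he]] := (vnr_open V).1 oV x Vx.
apply: (etrans (hV x Logic.I Vx)); apply/vnr_res0.
have [[P0 _] _ _ Pp] := proj2_sig x.
have : proj1_sig x (a * e).
  have -> : a * e = 0; last by [].
  apply: fext => i; rewrite fprodM; have [->|ei] := eqVneq (e i) 0; first by rewrite mulr0.
  have /hV : V (vnr_pt fprod_vnr (fprod_prime i)) by apply: he => /= /eqP; rewrite (negPf ei).
  by rewrite s0 => /(_ I)/esym/vnr_res0 /= ->; rewrite mul0r.
by case/Pp.
Qed.

End FieldProduct.

Lemma comUnitRing_field (R : comUnitRingType) : (forall a : R, a != 0 -> a \is a GRing.unit) ->
  exists (K : fieldType) (e : {rmorphism R -> K}), bijective e.
Proof.
move=> h.
pose m := GRing.ComUnitRing_isField.Build R h.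
pose K : fieldType := HB.pack (GRing.ComUnitRing.sort R) m.
have [|e eE] := @rmorph_of R K id.
  by split; [|split].
by exists K, e; exists id => x; rewrite eE.
Qed.

Lemma unit_neq0 (R : comUnitRingType) (a : R) : a \is a GRing.unit -> a != 0.
Proof. by apply: contraL => /eqP->; rewrite unitr0. Qed.

(** * The function field of an integral scheme *)

Section FunctionField.
Variable X : lrspace.
Hypothesis schemeX : scheme X.
Hypothesis integralX : integral_scheme X.

Lemma chart_zero_or (U : set X) (A : comPzRingType) (phi : A -> forall x : X, stalk x) a b :
  affine_chart U phi -> (forall x, U x -> phi a x * phi b x = 0) -> U !=set0 ->
  (forall x, U x -> phi a x = 0) \/ (forall x, U x -> phi b x = 0).
Proof.
move=> ch h U0; apply: (integralX.2 U) => //; first exact: chart_open ch.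
  exact: chart_reg_phi.
exact: chart_reg_phi.
Qed.

(** The indicator functions of two disjoint nonempty open sets would be sections on their union with
    product zero. *)
Lemma open_meet (U V : set X) : open U -> open V -> U !=set0 -> V !=set0 -> U `&` V !=set0.
Proof.
move=> oU oV [u Uu] [v Vv]; apply: contrapT => n.
have dis x : U x -> V x -> False by move=> Ux Vx; apply: n; exists x.
pose ch (W : set X) (x : X) : stalk x := if pselect (W x) then 1 else 0.
have regc W W' : open W -> open W' -> (forall x, W x -> W' x -> False) -> reg (W `|` W') (ch W).
  move=> oW oW' d; apply: reg_glue; first exact: openU.
  move=> x [Wx|Wx].
    exists W, (fun=> 1); split=> //; first exact: reg1.
    by move=> y [_ Wy]; rewrite /ch; case: pselect.
  exists W', (fun=> 0); split=> //; first exact: reg0.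
  by move=> y [_ Wy]; rewrite /ch; case: pselect => // /d[].
have rV : reg (U `|` V) (ch V).
  by rewrite setUC; apply: regc => // x Vx Ux; exact: dis Ux Vx.
have oUV : open (U `|` V) by exact: openU.
have ne : U `|` V !=set0 by exists u; left.
have [||e|e] := integralX.2 (U `|` V) (ch U) (ch V) oUV ne _ rV; first exact: regc.
- move=> x _; rewrite /ch; case: (pselect (U x)) => Ux; case: (pselect (V x)) => Vx; rewrite /= ?mul0r ?mulr0 //.
  by case: (dis x).
- have := e u (or_introl Uu); rewrite /ch; case: pselect => // _ /eqP; by rewrite oner_eq0.
- have := e v (or_intror Vv); rewrite /ch; case: pselect => // _ /eqP; by rewrite oner_eq0.
Qed.

(** The generic point is the prime of the functions vanishing on a whole chart; it lies in every
    nonempty open set, and its stalk is a field. A germ elsewhere goes to the germ at [eta] of any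
    section representing it. *)
Theorem function_field_exists : exists (K : fieldType) (g : forall x : X, {rmorphism stalk x -> K}) (eta : X),
  [/\ is_function_field g, forall W, open W -> W !=set0 -> W eta & forall u, exists a, g eta a = u].
Proof.
have [[x0 _] _] := integralX.
have [U0 [B [psi [Ux0 ch]]]] := schemeX x0.
have oU0 := chart_open ch.
pose N : set B := [set b | forall x, U0 x -> psi b x = 0].
have pN : prime_ideal N.
  split.
  - split=> [x Ux|a b Na Nb x Ux]; have [f fE] := chart_phi ch Ux; rewrite -!fE ?rmorph0 //.
    by rewrite rmorphD !fE Na // Nb // addr0.
  - by move=> a b Nb x Ux; have [f fE] := chart_phi ch Ux; rewrite -!fE rmorphM !fE Nb // mulr0.
  - by move=> /(_ x0 Ux0); have [f fE] := chart_phi ch Ux0; rewrite -fE rmorph1 => /eqP; rewrite oner_eq0.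
  - move=> a b Nab; apply: (chart_zero_or ch); last by exists x0.
    by move=> x Ux; have := Nab x Ux; have [f fE] := chart_phi ch Ux; rewrite -!fE rmorphM.
have [eta [[Ue eN] _]] := chart_prime ch pN.
have Nu b : psi b eta \isn't a GRing.unit -> N b.
  by move=> nb; rewrite eN.
have gen W : open W -> W !=set0 -> W eta.
  move=> oW W0; have [w [Ww Uw]] : W `&` U0 !=set0 by apply: open_meet => //; exists x0.
  have [a [ua ha]] := chart_refine ch Uw oW Ww.
  apply: ha => //; apply: contraT => /Nu /(_ w Uw) e.
  by have := unit_neq0 ua; rewrite e eqxx.
have fieldE (a : stalk eta) : a != 0 -> a \is a GRing.unit.
  have [b [s [us ->]]] := chart_fraction ch Ue a; apply: contraR.
  rewrite unitrM unitrV us andbT => /Nu /(_ eta Ue) ->; by rewrite mul0r.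
have [K [e [e' ee' e'e]]] := comUnitRing_field fieldE.
have gx : forall x : X, exists gx : {rmorphism stalk x -> K}, forall V s, open V -> V x -> reg V s -> gx (s x) = e (s eta).
  move=> x.
  have /choice[h hE] : forall a : stalk x, exists y, forall V s, open V -> V x -> reg V s -> s x = a -> y = e (s eta).
    move=> a; have [V [s [oV Vx rs es]]] := germ_surj a.
    exists (e (s eta)) => W t oW Wx rt et; congr (e _).
    have oVW : open (V `&` W) by exact: openI.
    have [||V' [oV' V'x h]] := @germ_inj _ (V `&` W) s t x oVW (conj Vx Wx) _ _ (etrans es (esym et)).
    - by apply: (reg_sub oV) => // y [].
    - by apply: (reg_sub oW) => // y [].
    by apply: h; apply: gen => //; exists x.
  have common a b : exists V s t, [/\ open V, V x, reg V s, reg V t & s x = a /\ t x = b].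
    have [V [s [oV Vx rs es]]] := germ_surj a; have [W [t [oW Wx rt et]]] := germ_surj b.
    have oVW : open (V `&` W) by exact: openI.
    exists (V `&` W), s, t; split=> //.
    - by apply: (reg_sub oV) => // y [].
    - by apply: (reg_sub oW) => // y [].
  have [|f fE] := @rmorph_of _ _ h.
    split.
      move=> a b; have [V [s [t [oV Vx rs rt [ea eb]]]]] := common a b.
      rewrite (hE a V s) // (hE b V t) // (hE (a - b) V (fun x => s x - t x)) ?rmorphB //.
        exact: regB.
      by rewrite ea eb.
    split; first by rewrite (hE 1 setT (fun=> 1)) ?rmorph1 //; [exact: openT|apply: reg1; exact: openT].
    move=> a b; have [V [s [t [oV Vx rs rt [ea eb]]]]] := common a b.
    rewrite (hE a V s) // (hE b V t) // (hE (a * b) V (fun x => s x * t x)) ?rmorphM //.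
      exact: regM.
    by rewrite ea eb.
  by exists f => V s oV Vx rs; rewrite fE; apply: (hE _ V).
pose g x := projT1 (cid (gx x)).
have gE x V s : open V -> V x -> reg V s -> g x (s x) = e (s eta).
  by move=> oV Vx rs; rewrite /g; case: (cid (gx x)) => f fE /=; exact: (fE V).
exists K, g, eta; split=> //; last first.
  move=> u; have [V [s [oV Vx rs es]]] := germ_surj (e' u).
  by exists (e' u); rewrite -es (gE _ V) // es e'e.
split; last first.
  by move=> U s x y oU rs Ux Uy; rewrite (gE _ U) // (gE _ U).
move=> x; have [U [A [phi [Ux chx]]]] := schemeX x.
have oU := chart_open chx.
have Ueta : U eta by apply: gen => //; exists x.
split.
  suff h a : g x a = 0 -> a = 0.
    by move=> a b e0; apply/eqP; rewrite -subr_eq0; apply/eqP/h; rewrite rmorphB e0 subrr.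
  have [b [s [us ->]]] := chart_fraction chx Ux a.
  rewrite rmorphM (rmorphV (g x) us) (gE x U) //; last exact: chart_reg_phi.
  have gs0 : g x (phi s x) != 0 by apply: unit_neq0; exact: rmorph_unit.
  move=> /eqP; rewrite mulf_eq0 invr_eq0 (negPf gs0) orbF => /eqP e0.
  have {}e0 : phi b eta = 0 by apply: (can_inj ee'); rewrite e0 rmorph0.
  have [t [ut et]] := chart_kernel chx Ueta e0.
  have [||h|h] := @chart_zero_or U A phi t b chx.
  - move=> y Uy; have [f fE] := chart_phi chx Uy; by rewrite -!fE -rmorphM et rmorph0.
  - by exists x.
  - by have := unit_neq0 ut; rewrite h // eqxx.
  - by rewrite h // mul0r.
move=> z; have [a [s [us ez]]] := chart_fraction chx Ueta (e' z).
exists (phi a x), (phi s x); rewrite !(gE x U) //; try exact: chart_reg_phi.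
have us' : e (phi s eta) \is a GRing.unit by exact: rmorph_unit.
split; first exact: unit_neq0.
by rewrite -rmorphV // -rmorphM -ez e'e.
Qed.

End FunctionField.

Definition range_subr (R : pzRingType) (K : fieldType) (i : {rmorphism R -> K}) : subr K.
Proof.
exists (range i).
- by exists 1; rewrite ?rmorph1.
- by move=> _ _ [a _ <-] [b _ <-]; exists (a - b); rewrite ?rmorphB.
- by move=> _ _ [a _ <-] [b _ <-]; exists (a * b); rewrite ?rmorphM.
Defined.

Lemma range_mem (R : pzRingType) (K : fieldType) (i : {rmorphism R -> K}) a : range_subr i (i a).
Proof. by exists a. Qed.

Lemma range_field (k K : fieldType) (c : {rmorphism k -> K}) u : range_subr c u -> range_subr c u^-1.
Proof. by move=> [z _ <-]; exists z^-1; rewrite ?fmorphV. Qed.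

Section RangeLemmas.
Variables (R : comUnitRingType) (K : fieldType) (i : {rmorphism R -> K}).
Hypothesis iI : injective i.

Lemma inu_range a : inu (range_subr i) (i a) <-> a \is a GRing.unit.
Proof.
split=> [[a0 [b _ e]]|ua].
  by apply/unitrPr; exists b; apply: iI; rewrite rmorphM e mulfV ?rmorph1.
by split; [apply: unit_neq0; exact: rmorph_unit|exists a^-1; rewrite ?rmorphV].
Qed.

Lemma nonu_range a : nonu (range_subr i) (i a) <-> nonunits R a.
Proof.
split=> [[_ n]|n]; first by apply/negP => /inu_range.
by split; [exact: range_mem|move=> /inu_range ua; move: n; rewrite /nonunits /= ua].
Qed.

Lemma range_local : (forall a b, nonunits R a -> nonunits R b -> nonunits R (a + b)) -> localS (range_subr i).
Proof.
move=> h _ _ [[a _ <-] na] [[b _ <-] nb]; rewrite -rmorphD; apply/nonu_range; apply: h; apply/nonu_range; split=> //; exact: range_mem.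
Qed.

Lemma noetherian_range : noeth (range_subr i) -> noetherian R.
Proof.
move=> nO I I0 ID IM.
have [|s Is] := nO [set i a | a in I].
  split.
  - by move=> _ [a _ <-]; exact: range_mem.
  - by exists 0; rewrite ?rmorph0.
  - by move=> _ _ [a Ia <-] [b Ib <-]; exists (a + b); [exact: ID|rewrite rmorphD].
  - by move=> _ _ [a _ <-] [b Ib <-]; exists (a * b); [exact: IM|rewrite rmorphM].
have /choice[a ha] : forall j : 'I_(size s), exists a, I a /\ i a = s`_j.
  move=> j; have : span (range_subr i) s s`_j by apply: span_mem; rewrite mem_nth.
  by rewrite -Is => -[a Ia e]; exists a.
exists (size s), a; apply/seteqP; split=> [b Ib|b [c ->]]; last first.
  by apply: (big_ind (fun x => I x)) => // j _; apply: IM; exact: (ha j).1.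
have /span_sumP[c hc e] : span (range_subr i) s (i b) by rewrite -Is; exists b.
have /choice[d hd] : forall j, exists d, i d = c j by move=> j; have [d _ <-] := hc j; exists d.
exists (fun j => d j); apply: iI; rewrite e rmorph_sum; apply: eq_bigr => j _.
by rewrite rmorphM hd (ha j).2.
Qed.

Lemma ess_finite_range (k : fieldType) (c : {rmorphism k -> R}) (k0 : subr K) l :
  (forall u, k0 u <-> exists z, u = i (c z)) ->
  (forall u, adj k0 l u -> range i u) ->
  (forall a, exists x y, [/\ adj k0 l x, adj k0 l y, inu (range_subr i) y & i a = x / y]) -> ess_finite c.
Proof.
move=> hk0 hl hf.
have /choice[r hr] : forall u, exists r, u \in l -> i r = u.
  move=> u; case: (pselect (u \in l)) => [/(adj_mem k0)/hl[r _ e]|n]; first by exists r.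
  by exists 0.
exists [seq r u | u <- l] => S Sc Sl SB SM SV a.
have S1 : S 1 by rewrite -(rmorph1 c).
have @T : subr K.
  exists [set u | exists2 b, S b & i b = u].
  - by exists 1; rewrite ?rmorph1.
  - by move=> _ _ [b Sb <-] [b' Sb' <-]; exists (b - b'); [exact: SB|rewrite rmorphB].
  - by move=> _ _ [b Sb <-] [b' Sb' <-]; exists (b * b'); [exact: SM|rewrite rmorphM].
have lT : forall u, adj k0 l u -> T u.
  apply: (@adj_min K k0 T l).
    by move=> u /hk0[z ->]; exists (c z).
  by move=> u ul; exists (r u); [apply: Sl; exact: map_f|exact: hr].
have [x [y [/lT[b Sb ex] /lT[d Sd ey] uy e]]] := hf a.
have ud : d \is a GRing.unit by apply/inu_range; rewrite ey.
have -> : a = b * d^-1 by apply: iI; rewrite rmorphM rmorphV // ex ey.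
exact: (SM _ _ Sb (SV _ Sd ud)).
Qed.

(** The hypothesis concerns some other fraction field. With denominators cleared, an integral
    equation is an identity in [R], and so it can be moved between the two fields. *)
Lemma normal_range : integrally_closed_domain R -> normalS (range_subr i).
Proof.
move=> [K' [j [[jI _] hj]]] _ _ [a _ <-] [s _ <-] s0 [p [mp hp rp]].
have key (L : fieldType) (h : {rmorphism R -> L}) (q : {poly R}) : injective h -> h s != 0 ->
    root (map_poly h q) (h a / h s) <-> \sum_(m < size q) q`_m * a ^+ m * s ^+ (size q - m) = 0.
  move=> hI hs0.
  have e : (map_poly h q).[h a / h s] * h s ^+ size q = h (\sum_(m < size q) q`_m * a ^+ m * s ^+ (size q - m)).
    rewrite (horner_coef_wide _ (size_poly _ _)) big_distrl rmorph_sum /=; apply: eq_bigr => m _.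
    rewrite coef_map_id0 ?rmorph0 // !rmorphM !rmorphXn /= exprMn exprVn.
    have -> : h s ^+ size q = h s ^+ (size q - m) * h s ^+ m by rewrite -exprD subnK // ltnW.
    by field; rewrite expf_neq0.
  rewrite /root; split=> [/eqP e0|e0]; first by apply: hI; rewrite -e e0 mul0r rmorph0.
  by move: e; rewrite e0 rmorph0 => /eqP; rewrite mulf_eq0 (negPf (expf_neq0 _ hs0)) orbF.
have [q eq] : exists q : {poly R}, p = map_poly i q.
  have /choice[q hq] : forall m, exists r, i r = p`_m by move=> m; have [r _ <-] := hp m; exists r.
  exists (\poly_(m < size p) q m); apply/polyP => m; rewrite coef_map_id0 ?rmorph0 // coef_poly.
  by case: ltnP => h; [rewrite hq|rewrite rmorph0 nth_default].
have mq : q \is monic.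
  move: mp; rewrite eq !monicE lead_coef_map_inj ?rmorph0 //.
  by move=> /eqP e; apply/eqP/iI; rewrite e rmorph1.
have js0 : j s != 0 by apply/eqP => e; case/eqP: s0; rewrite (jI s 0) ?rmorph0 // e rmorph0.
have : range j (j a / j s).
  apply: hj; exists q => //; apply/key => //; apply/(key _ i) => //; by rewrite -eq.
move=> [r _ e]; exists r => //.
have -> : a = r * s by apply: jI; rewrite rmorphM e divfK.
by rewrite rmorphM mulfK.
Qed.

End RangeLemmas.

(** * Stalks and charts as subrings of the function field *)

Section KModel.
Variables (X : lrspace) (K : fieldType) (g : forall x : X, {rmorphism stalk x -> K}).
Hypothesis Fg : is_function_field g.

Lemma g_inj x : injective (g x). Proof. by case: (Fg.1 x). Qed.

Definition ostk x : subr K := range_subr (g x).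

Lemma ostk_local x : localS (ostk x).
Proof. by apply: range_local; [exact: g_inj|exact: nonunits_stalk]. Qed.

Lemma ostk_frac x z : fracf (ostk x) z.
Proof.
have [_ /(_ z)[a [b [b0 ->]]]] := Fg.1 x; exists (g x a), (g x b); split=> //; exact: range_mem.
Qed.

Lemma ostk_open x u : ostk x u -> exists V, [/\ open V, V x & forall y, V y -> ostk y u].
Proof.
move=> [a _ <-]; have [V [s [oV Vx rs <-]]] := germ_surj a; exists V; split=> // y Vy.
by rewrite (Fg.2 V s x y) //; exact: range_mem.
Qed.

Lemma reg_of_value V (f : forall x : X, stalk x) u : open V -> (forall y, V y -> g y (f y) = u) -> reg V f.
Proof.
move=> oV h; apply: reg_glue => // x Vx.
have [W [s [oW Wx rs e]]] := germ_surj (f x); exists W, s; split=> // y [Vy Wy].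
by apply: g_inj; rewrite h // (Fg.2 W s y x) // e h.
Qed.

Definition kchart (U : set X) (A : subr K) := U !=set0 /\ exists (B : comPzRingType) (psi : B -> forall x : X, stalk x),
  affine_chart U psi /\ forall u, A u <-> exists b, forall x, U x -> g x (psi b x) = u.

Section Chart.
Variables (U : set X) (A : subr K).
Hypothesis UA : kchart U A.

Lemma kc_open : open U. Proof. by have [_ [B [psi [ch _]]]] := UA; exact: chart_open ch. Qed.

Lemma kc_sub x u : U x -> A u -> ostk x u.
Proof. by move=> Ux; have [_ [B [psi [ch hA]]]] := UA; move=> /hA[b /(_ x Ux) <-]; exact: range_mem. Qed.

Lemma kc_frac x u : U x -> ostk x u -> exists a s, [/\ A a, A s, inu (ostk x) s & u = a / s].
Proof.
move=> Ux [a _ <-]; have [_ [B [psi [ch hA]]]] := UA.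
have val b : A (g x (psi b x)).
  by apply/hA; exists b => y Uy; apply: (Fg.2 U) => //; [exact: kc_open|exact: chart_reg_phi].
have [b [s [us ->]]] := chart_fraction ch Ux a.
exists (g x (psi b x)), (g x (psi s x)); split=> //; first by apply/inu_range => //; exact: g_inj.
by rewrite rmorphM rmorphV.
Qed.

Lemma kc_prime_of x : U x -> prime_of A [set u | A u /\ nonu (ostk x) u].
Proof.
move=> Ux; apply: (prime_contract (O := ostk x)); first by move=> u; exact: kc_sub.
by apply: nonu_prime; exact: ostk_local.
Qed.

Lemma kc_prime P : prime_of A P -> exists2 x, U x & P = [set u | A u /\ nonu (ostk x) u].
Proof.
move=> [[PA P0 PD PM] P1 Pp]; have [[x0 Ux0] [B [psi [ch hA]]]] := UA.
have val b x : U x -> A (g x (psi b x)).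
  by move=> Ux; apply/hA; exists b => y Uy; apply: (Fg.2 U) => //; [exact: kc_open|exact: chart_reg_phi].
have [f fE] := chart_phi ch Ux0.
pose kv b := g x0 (f b).
have kvE b x : U x -> kv b = g x (psi b x).
  by move=> Ux; rewrite /kv fE; apply: (Fg.2 U) => //; [exact: kc_open|exact: chart_reg_phi].
have Akv b : A (kv b) by rewrite (kvE b x0) //; exact: val.
have pQ : prime_ideal [set b | P (kv b)].
  split; rewrite /= /kv.
  - split=> [|a b]; first by rewrite !rmorph0.
    by rewrite !rmorphD; exact: PD.
  - by move=> a b Pb; rewrite !rmorphM; apply: PM => //; exact: Akv.
  - by rewrite !rmorph1.
  - by move=> a b; rewrite !rmorphM; apply: Pp; exact: Akv.
have [x [[Ux ex] _]] := chart_prime ch pQ.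
exists x => //; apply/seteqP; split=> u.
  move=> Pu; have Au := PA _ Pu; split=> //; have [b hb] := (hA u).1 Au.
  rewrite -(hb x Ux); apply/nonu_range; first exact: g_inj.
  rewrite /nonunits /=; have : [set b | P (kv b)] b by rewrite /= (kvE b x) // hb.
  by rewrite ex.
move=> [Au nu]; have [b hb] := (hA u).1 Au.
have nb : [set a | psi a x \isn't a GRing.unit] b.
  by apply/(@nonu_range _ _ (g x)); [exact: g_inj|rewrite hb].
by move: nb; rewrite -ex /= (kvE b x) // hb.
Qed.

Lemma kc_uniq x y : U x -> U y -> (forall u, A u -> (inu (ostk x) u <-> inu (ostk y) u)) -> x = y.
Proof.
move=> Ux Uy h; have [_ [B [psi [ch hA]]]] := UA.
apply: (chart_eq ch) => // b.
have e : g x (psi b x) = g y (psi b y) by apply: (Fg.2 U) => //; [exact: kc_open|exact: chart_reg_phi].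
have Ab : A (g x (psi b x)).
  by apply/hA; exists b => z Uz; apply: (Fg.2 U) => //; [exact: kc_open|exact: chart_reg_phi].
have := h _ Ab; rewrite {2}e => h'.
by split=> [/(inu_range (@g_inj x))/h'/(inu_range (@g_inj y))|/(inu_range (@g_inj y))/h'/(inu_range (@g_inj x))].
Qed.

Lemma kc_refine x V : U x -> open V -> V x -> exists s, [/\ A s, inu (ostk x) s &
  forall y, U y -> inu (ostk y) s -> V y].
Proof.
move=> Ux oV Vx; have [_ [B [psi [ch hA]]]] := UA.
have [b [ub hb]] := chart_refine ch Ux oV Vx.
have e y : U y -> g x (psi b x) = g y (psi b y) by move=> Uy; apply: (Fg.2 U) => //; [exact: kc_open|exact: chart_reg_phi].
exists (g x (psi b x)); split.
- by apply/hA; exists b => y Uy; rewrite (e y).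
- by apply/inu_range => //; exact: g_inj.
- by move=> y Uy; rewrite (e y Uy) => /(inu_range (@g_inj y)); exact: hb.
Qed.

Lemma kc_loc x : U x -> exists P (pP : prime_of A P), ostk x = loc pP /\ P = [set u | A u /\ nonu (ostk x) u].
Proof.
move=> Ux; exists _, (kc_prime_of Ux); split=> //; apply: subr_ext; apply: loc_charact.
  by move=> u; exact: kc_sub.
by move=> u; exact: kc_frac.
Qed.

Lemma kc_noeth x : noeth A -> U x -> noeth (ostk x).
Proof. by move=> nA /kc_loc[P [pP [-> _]]]; exact: loc_noeth. Qed.

Lemma kc_full z : fracf A z.
Proof.
have [[x Ux] _] := UA; apply: (fracf_min (A := ostk x)) (ostk_frac x z); last exact: fracf_inv.
move=> u /(kc_frac Ux)[a [s [Aa As [s0 _] ->]]]; by exists a, s.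
Qed.

End Chart.

Variables (k : fieldType) (sX : lrhom X (spec_field k)) (c : {rmorphism k -> K}).
Hypothesis gc : forall x z, g x (pull sX x z) = c z.

Theorem finite_chart : finite_type sX -> forall x, exists U l, U x /\ kchart U (adj (range_subr c) l).
Proof.
move=> ft x; have [V [A [phi [Vy chV [m [U [eU hU]]]]]]] := ft (sX x).
have : (sX @^-1` V) x by [].
rewrite eU => -[i _ Uix]; have [B [psi [h [ch hp [d [b hb]]]]]] := hU i.
have hv e y z : U i y -> U i z -> g y (psi e y) = g z (psi e z).
  by move=> Uy Uz; apply: (Fg.2 (U i)) => //; [exact: chart_open ch|exact: chart_reg_phi].
have [f fE] := chart_phi ch Uix.
pose kv e := g x (f e).
pose l := [seq kv (b j) | j <- enum 'I_d].
exists (U i), l; split=> //; split; first by exists x.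
exists B, psi; split=> // u.
suff -> : adj (range_subr c) l u <-> exists e, kv e = u.
  split=> -[e he]; exists e; first by move=> y Uy; rewrite -he /kv fE; exact: hv.
  by rewrite /kv fE he.
split; last first.
  move=> [e <-]; suff : [set e | adj (range_subr c) l (kv e)] e by [].
  rewrite (hb [set e | adj (range_subr c) l (kv e)]) //=.
  - move=> _ [a _ <-] /=; rewrite /kv fE hp // gc; apply: adj_sub; exact: range_mem.
  - by move=> j; apply: adj_mem; apply: map_f; rewrite mem_enum.
  - by move=> y z hy hz; rewrite /kv !rmorphB; exact: srB.
  - by move=> y z hy hz; rewrite /kv !rmorphM; exact: srM.
pose T := range_subr (g x \o f).
move=> hu; suff [e _ <-] : T u by exists e.
apply: (@adj_min K (range_subr c) T l _ _ u hu) => w; last by move=> /mapP[j _ ->]; exact: (range_mem (g x \o f)).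
move=> [z _ <-].
have [a [s [us ez]]] := chart_fraction chV Vy z.
(* Finite type is relative to the ring [A] of a chart of Spec k, not to [k]. As Spec k has one
   point, an element of [A] invertible there lies in no prime and is a unit of [A]; hence scalars
   lift to [A]. *)
have [s' es] : exists s', s * s' = 1.
  apply: contrapT => ns.
  have [||||P [pP sP _]] := @prime_disjoint A [set r | exists r', r = s * r'] [set 1]; rewrite //.
  - split; first by exists 0; rewrite mulr0.
    + by move=> _ _ [p ->] [q ->]; exists (p + q); rewrite mulrDr.
    + by move=> p _ [q ->]; exists (p * q); rewrite mulrCA.
  - by move=> _ _ -> ->; rewrite mulr1.
  - by move=> _ -> [s' e]; apply: ns; exists s'.
  have [y [[_ eP] _]] := chart_prime chV pP.
  have : P s by apply: sP; exists 1; rewrite mulr1.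
  rewrite eP /=; have -> : y = sX x by case: (y); case: (sX x).
  by rewrite us.
have [q qE] := chart_phi chV Vy.
have {}ez : z = phi (a * s') (sX x).
  have e1 : phi s (sX x) * phi s' (sX x) = 1 by rewrite -!qE -rmorphM es; exact: rmorph1.
  by rewrite ez (mulr1_eq e1) -!qE; exact/esym/rmorphM.
exists (h (a * s')) => //=.
by rewrite fE hp // gc -ez.
Qed.

End KModel.

(** * Tangent frames and stable ideals *)

Section FieldDerivations.
Variables (k R : pzRingType) (c : {rmorphism k -> R}).

Lemma self_derP (F : R -> R) : is_self_derivation c F <->
  [/\ forall a b, F (a + b) = F a + F b, forall a b, F (a * b) = a * F b + b * F a & forall z, F (c z) = 0].
Proof. by []. Qed.
End FieldDerivations.

Section KDerivations.
Variables (k K : fieldType) (c : {rmorphism k -> K}).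
Implicit Types (F : K -> K) (O A : subr K).

Lemma kder_div F a s : is_self_derivation c F -> s != 0 -> F (a / s) = (F a - a / s * F s) / s.
Proof.
move=> hF s0; apply: (canRL (mulfK s0)).
have -> : F a = a / s * F s + s * F (a / s) by rewrite -(derMs _ _ hF) divfK.
by rewrite addrAC subrr add0r mulrC.
Qed.

Lemma kder_comb n (e : 'I_n -> K) (E : 'I_n -> K -> K) : (forall i, is_self_derivation c (E i)) ->
  is_self_derivation c (fun u => \sum_i e i * E i u).
Proof. by move=> hE; exact: (@der_comb _ _ c K^o n e E hE). Qed.

Lemma kder_sub F G : is_self_derivation c F -> is_self_derivation c G ->
  is_self_derivation c (fun u => F u - G u).
Proof. exact: der_sub. Qed.

Lemma kder_bracket F G : is_self_derivation c F -> is_self_derivation c G ->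
  is_self_derivation c (fun u => F (G u) - G (F u)).
Proof.
move=> hF hG; apply/self_derP; split.
- by move=> a b; rewrite (derD hG) (derD hF) (derD hF) (derD hG); ring.
- move=> a b; rewrite (derMs _ _ hG) (derMs _ _ hF) (derD hF) (derD hG) !(derMs _ _ hF) !(derMs _ _ hG); ring.
- by move=> z; rewrite (derc hF) (derc hG) (der0 hF) (der0 hG) subrr.
Qed.

Lemma kder_frac F A O : is_self_derivation c F -> (forall u, A u -> O u) -> (forall u, A u -> O (F u)) ->
  (forall u, O u -> exists a s, [/\ A a, A s, inu O s & u = a / s]) -> forall u, O u -> O (F u).
Proof.
move=> hF AO AF fr u /fr[a [s [Aa As [s0 us] ->]]]; rewrite (kder_div _ hF s0).
apply: srM => //; apply: srB; first exact: AF.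
by apply: srM; [apply: srM => //; exact: AO|exact: AF].
Qed.

Lemma kder_adj F A l O : is_self_derivation c F -> (forall u, adj A l u -> O u) ->
  (forall u, A u -> O (F u)) -> (forall u, u \in l -> O (F u)) -> forall u, adj A l u -> O (F u).
Proof.
move=> hF lO AF lF.
have [T TE] : exists T : subr K, forall u, T u <-> O u /\ O (F u).
  have @T : subr K.
    exists [set u | O u /\ O (F u)].
    - by split; [exact: sr1|rewrite (der1 hF); exact: sr0].
    - by move=> u v [Ou Fu] [Ov Fv]; split; [exact: srB|rewrite (derB hF); exact: srB].
    - move=> u v [Ou Fu] [Ov Fv]; split; first exact: srM.
      by rewrite (derMs _ _ hF); apply: srD; exact: srM.
  by exists T.
move=> u hu; apply: ((TE u).1 _).2; apply: (@adj_min K A T l _ _ u hu).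
  by move=> w Aw; apply/TE; split; [apply: lO; exact: adj_sub|exact: AF].
by move=> w wl; apply/TE; split; [apply: lO; exact: adj_mem|exact: lF].
Qed.

Lemma kder_eq0 F O : is_self_derivation c F -> (forall z, fracf O z) -> (forall u, O u -> F u = 0) -> forall u, F u = 0.
Proof.
move=> hF fr h u; have [a [s [Oa Os s0 ->]]] := fr u.
by rewrite (kder_div _ hF s0) (h a Oa) (h s Os) mulr0 subrr mul0r.
Qed.

Variables (R : comUnitRingType) (cR : {rmorphism k -> R}) (i : {rmorphism R -> K}).
Hypothesis iI : injective i.
Hypothesis icR : forall z, i (cR z) = c z.

Lemma kder_restrict F : is_self_derivation c F -> (forall u, range_subr i u -> range_subr i (F u)) ->
  exists D : R -> R, is_self_derivation cR D /\ forall a, i (D a) = F (i a).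
Proof.
move=> hF h; have /choice[D hD] : forall a, exists b, i b = F (i a).
  by move=> a; have [b _ e] := h _ (range_mem i a); exists b.
exists D; split=> //; apply/self_derP; split.
- by move=> a b; apply: iI; rewrite rmorphD !hD rmorphD (derD hF).
- by move=> a b; apply: iI; rewrite rmorphD !rmorphM !hD rmorphM (derMs _ _ hF).
- by move=> z; apply: iI; rewrite hD icR (derc hF) rmorph0.
Qed.

Lemma kder_extend D : (forall z, exists a b, i b != 0 /\ z = i a / i b) -> is_self_derivation cR D ->
  exists F : K -> K, is_self_derivation c F /\ forall a, F (i a) = i (D a).
Proof.
move=> fr hD.
have /choice[F hF] : forall z, exists y, forall a b, i b != 0 -> z = i a / i b -> y = (i (D a) - z * i (D b)) / i b.
  move=> z; have [a [b [b0 e]]] := fr z; exists ((i (D a) - z * i (D b)) / i b) => a' b' b'0 e'.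
  have e1 : a * b' = a' * b.
    by apply: iI; rewrite !rmorphM -[i a](divfK b0) -e e' mulrAC divfK.
  have := congr1 (fun x => i (D x)) e1; rewrite !(derMs _ _ hD) !rmorphD !rmorphM => e2.
  have ea : i a = z * i b by rewrite e divfK.
  have ea' : i a' = z * i b' by rewrite {1}e' divfK.
  rewrite ea ea' in e2; move/eqP: e2; rewrite -subr_eq0 => /eqP e2.
  by apply/eqP; rewrite eqr_div // -subr_eq0 -e2; apply/eqP; ring.
exists F; split; last first.
  by move=> a; rewrite (hF _ a 1) ?rmorph1 ?oner_neq0 ?divr1 // (der1 hD) rmorph0 mulr0 subr0.
apply/self_derP; split.
- move=> x y; have [a [b [b0 ex]]] := fr x; have [a' [b' [b'0 ey]]] := fr y.
  rewrite (hF x a b) // (hF y a' b') // (hF (x + y) (a * b' + a' * b) (b * b')).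
  + rewrite (derD hD) !(derMs _ _ hD) !rmorphD !rmorphM ex ey; field; by rewrite b0 b'0.
  + by rewrite rmorphM mulf_neq0.
  + rewrite rmorphD !rmorphM ex ey; field; by rewrite b0 b'0.
- move=> x y; have [a [b [b0 ex]]] := fr x; have [a' [b' [b'0 ey]]] := fr y.
  rewrite (hF x a b) // (hF y a' b') // (hF (x * y) (a * a') (b * b')).
  + rewrite !(derMs _ _ hD) !rmorphD !rmorphM ex ey; field; by rewrite b0 b'0.
  + by rewrite rmorphM mulf_neq0.
  + rewrite !rmorphM ex ey; field; by rewrite b0 b'0.
- move=> z; rewrite -icR (hF _ (cR z) 1) ?rmorph1 ?oner_neq0 ?divr1 // (derc hD) (der1 hD).
  by rewrite rmorph0 mulr0 subrr.
Qed.

End KDerivations.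

Section Frame.
Variables (X : lrspace) (K : fieldType) (g : forall x : X, {rmorphism stalk x -> K}).
Hypothesis Fg : is_function_field g.
Variable eta : X.
Hypothesis eta_gen : forall W, open W -> W !=set0 -> W eta.
Hypothesis eta_surj : forall u, exists a, g eta a = u.
Variables (k : fieldType) (sX : lrhom X (spec_field k)) (c : {rmorphism k -> K}).
Hypothesis gc : forall x z, g x (pull sX x z) = c z.
Hypothesis ft : finite_type sX.

Let gI x := g_inj Fg (x := x).

Lemma ostk_open_seq x (l : seq K) : (forall u, u \in l -> ostk g x u) ->
  exists V, [/\ open V, V x & forall y, V y -> forall u, u \in l -> ostk g y u].
Proof.
elim: l => [|u l IH] h; first by exists setT; split=> //; exact: openT.
have [|V [oV Vx hV]] := IH; first by move=> v vl; apply: h; rewrite inE vl orbT.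
have [W [oW Wx hW]] := ostk_open Fg (h u (mem_head _ _)).
exists (V `&` W); split=> //; first exact: openI.
by move=> y [Vy Wy] v; rewrite inE => /orP[/eqP->|]; [exact: hW|exact: hV].
Qed.

Lemma tangent_extend U D : open U -> U !=set0 -> tangent_section sX U D ->
  exists E : K -> K, is_self_derivation c E /\ forall y, U y -> forall a, E (g y a) = g y (D y a).
Proof.
move=> oU U0 [hD hreg]; have Ue := eta_gen oU U0.
have [gi hgi] := choice eta_surj.
have ggi a : gi (g eta a) = a by apply: (@gI eta); rewrite hgi.
have hDe := hD eta Ue.
have [F [hF FE]] := @kder_extend k K c (stalk eta) (pull sX eta) (g eta) (@gI eta) (gc (x := eta)) (D eta)
  (Fg.1 eta).2 hDe.
exists F; split=> // y Uy a.
have [V [s [oV Vy rs <-]]] := germ_surj a.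
have oUV : open (U `&` V) by exact: openI.
have rsU : reg (U `&` V) s by apply: (reg_sub oV) => // z [].
have e1 : g y (s y) = g eta (s eta) by apply: (Fg.2 (U `&` V)) => //; apply: eta_gen => //; exists y.
have UVs : U `&` V `<=` U by move=> z [].
have := hreg _ _ oUV UVs rsU => rD.
have e2 : g y (D y (s y)) = g eta (D eta (s eta)).
  by apply: (Fg.2 (U `&` V) _ y eta oUV rD) => //; apply: eta_gen => //; exists y.
by rewrite e1 e2 FE.
Qed.

(** Only the images of finitely many chart generators have to be regular near [y]; Leibniz and the
    quotient rule do the rest. *)
Lemma kder_spread y F : is_self_derivation c F -> (forall u, ostk g y u -> ostk g y (F u)) ->
  exists W, [/\ open W, W y & forall y' u, W y' -> ostk g y' u -> ostk g y' (F u)].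
Proof.
move=> hF Fy; have [V [l [Vy UA]]] := finite_chart Fg gc ft y.
have [|W [oW Wy hW]] := @ostk_open_seq y [seq F u | u <- l].
  by move=> _ /mapP[u ul ->]; apply: Fy; apply: (kc_sub UA) => //; exact: adj_mem.
exists (V `&` W); split=> //; first by apply: openI => //; exact: kc_open UA.
move=> y' u [Vy' Wy']; apply: (@kder_frac _ _ c F (adj (range_subr c) l) _ hF).
- by move=> v; exact: (kc_sub UA).
- apply: (kder_adj hF); first by move=> v; exact: (kc_sub UA).
    by move=> _ [z _ <-]; rewrite (derc hF); exact: sr0.
  by move=> v vl; apply: hW => //; exact: map_f.
- by move=> v; exact: (kc_frac Fg UA).
Qed.

Theorem frame_exists : tangent_locally_free sX -> forall x, exists U n (E : 'I_n -> K -> K),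
  [/\ open U, U x, forall i, is_self_derivation c (E i) /\ (forall y u, U y -> ostk g y u -> ostk g y (E i u)),
      forall y F, U y -> is_self_derivation c F -> (forall u, ostk g y u -> ostk g y (F u)) ->
        exists a : 'I_n -> K, (forall i, ostk g y (a i)) /\ forall u, F u = \sum_i a i * E i u
    & forall a : 'I_n -> K, (forall u, \sum_i a i * E i u = 0) -> forall i, a i = 0].
Proof.
move=> tX x; have [U [n [D [oU Ux hD fr]]]] := tX x.
have U0 : U !=set0 by exists x.
have /choice[E hE] : forall i, exists E : K -> K, is_self_derivation c E /\ forall y, U y -> forall a, E (g y a) = g y (D i y a).
  by move=> i; exact: tangent_extend.
exists U, n, E; split=> //.
- move=> i; split; first exact: (hE i).1.
  by move=> y _ Uy [a _ <-]; rewrite (hE i).2 //; exact: range_mem.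
(* The local freeness speaks of sections of the tangent sheaf, so [F] is first turned into one on a
   neighbourhood of [y]. *)
- move=> y F Uy hF Fy; have [W [oW Wy hW]] := kder_spread hF Fy.
  have oUW : open (U `&` W) by exact: openI.
  have rp y' : W y' -> forall u, range_subr (g y') u -> range_subr (g y') (F u) by move=> Wy' u; exact: hW.
  have hG y' : exists G : stalk y' -> stalk y', W y' -> is_self_derivation (pull sX y') G /\ forall a, g y' (G a) = F (g y' a).
    case: (pselect (W y')) => [Wy'|n0]; last by exists (fun=> 0).
    by have [G hG] := kder_restrict (@gI y') (gc (x := y')) hF (rp y' Wy'); exists G.
  pose G y' := projT1 (cid (hG y')).
  have GE y' : W y' -> is_self_derivation (pull sX y') (G y') /\ forall a, g y' (G y' a) = F (g y' a).
    by rewrite /G; case: (cid (hG y')).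
  have UWU : U `&` W `<=` U by move=> z [].
  have [h1 _] := fr (U `&` W) oUW UWU.
  have [|a [ra ha]] := h1 G.
    split; first by move=> z [_ Wz]; exact: (GE z Wz).1.
    move=> V f oV VU rf; case: (pselect (V !=set0)) => [[z0 Vz0]|V0].
      apply: (reg_of_value Fg (u := F (g z0 (f z0)))) => // z Vz.
      by rewrite (GE z (VU _ Vz).2).2 (Fg.2 V f z z0).
    by apply: (reg_of_value Fg (u := 0)) => // z Vz; case: V0; exists z.
  exists (fun i => g y (a i y)); split; first by move=> i; exact: range_mem.
  move=> u; apply/eqP; rewrite -subr_eq0; apply/eqP; move: u.
  apply: (@kder_eq0 _ _ c _ (ostk g y)).
  + by apply: kder_sub => //; apply: kder_comb => i; exact: (hE i).1.
  + by move=> z; exact: ostk_frac.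
  + move=> _ [b _ <-]; rewrite -(GE y Wy).2 ha // rmorph_sum; apply/eqP; rewrite subr_eq0; apply/eqP.
    by apply: eq_bigr => i _; rewrite rmorphM (hE i).2.
(* Elements of [K] are regular near the generic point, where the independence of the sheaf frame
   applies. *)
- move=> a a0.
  have [|W [oW We hW]] := @ostk_open_seq eta [seq a i | i <- enum 'I_n].
    by move=> _ /mapP[i _ ->]; have [b <-] := eta_surj (a i); exact: range_mem.
  have oUW : open (U `&` W) by exact: openI.
  have hb i y : exists b : stalk y, W y -> g y b = a i.
    case: (pselect (W y)) => [Wy|nW]; last by exists 0.
    by have [|b _ e] := hW y Wy (a i); [apply: map_f; rewrite mem_enum|exists b].
  pose b i y := projT1 (cid (hb i y)).
  have bE i y : W y -> g y (b i y) = a i by rewrite /b; case: (cid (hb i y)).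
  have UWU : U `&` W `<=` U by move=> z [].
  have [_ h2] := fr (U `&` W) oUW UWU.
  have b0 := h2 b _ _.
  have Ue : U eta by exact: eta_gen.
  move=> i; rewrite -(bE i eta We) b0 ?rmorph0 //.
    by move=> j; apply: (reg_of_value Fg (u := a j)) => // y [_ Wy]; exact: bE.
  move=> y [Uy Wy] z; apply: (@gI y); rewrite rmorph0 -[RHS](a0 (g y z)) rmorph_sum.
  by apply: eq_bigr => j _; rewrite rmorphM bE // (hE j).2.
Qed.

End Frame.

(** * Ideals stable under derivations *)

Section StablePrime.
Variables (k K : fieldType) (c : {rmorphism k -> K}) (O : subr K).
Hypothesis Oloc : localS O.
Hypothesis Onat : forall m, O m.+1%:R^-1.
Hypothesis char0 : forall m, m.+1%:R != 0 :> K.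
Variables (n : nat) (E : 'I_n -> K -> K).
Hypothesis hE : forall i, is_self_derivation c (E i).
Hypothesis EO : forall i u, O u -> O (E i u).

(** For [P] an ideal and [F] preserving [O], the largest F-stable ideal inside [P]. *)
Definition hull (F : K -> K) (P : set K) : set K := [set a | O a /\ forall m, P (iter m F a)].

Section Hull.
Variables (F : K -> K) (P : set K).
Hypothesis hF : is_self_derivation c F.
Hypothesis FO : forall u, O u -> O (F u).
Hypothesis pP : prime_of O P.

Let PO u : P u -> O u. Proof. by case: pP => [[h _ _ _] _ _]; exact: h. Qed.
Let P0 : P 0. Proof. by case: pP => [[_ h _ _] _ _]. Qed.
Let PD u v : P u -> P v -> P (u + v). Proof. by case: pP => [[_ _ h _] _ _]; exact: h. Qed.
Let PM u v : O u -> P v -> P (u * v). Proof. by case: pP => [[_ _ _ h] _ _]; exact: h. Qed.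

Let iterD m a b : iter m F (a + b) = iter m F a + iter m F b.
Proof. by elim: m => //= m ->; rewrite (derD hF). Qed.
Let iterO m a : O a -> O (iter m F a). Proof. by move=> Oa; elim: m => //= m; exact: FO. Qed.

Let PB u v : P u -> P v -> P (u - v).
Proof. by move=> Pu Pv; rewrite -[v]mul1r -mulNr; apply: PD => //; apply: PM => //; apply: srN; exact: sr1. Qed.
Let iterM N a b : iter N.+1 F (a * b) = iter N F (a * F b) + iter N F (F a * b).
Proof. by rewrite iterSr (derMs _ _ hF) iterD [b * F a]mulrC. Qed.

Let leib_mem N p q a b : O a -> O b -> (N < p + q)%N -> (forall i, (i < p)%N -> P (iter i F a)) ->
  (forall i, (i < q)%N -> P (iter i F b)) -> P (iter N F (a * b)).
Proof.
elim: N p q a b => [|N IH] p q a b Oa Ob lt ha hb.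
  case: p ha lt => [|p] ha lt; last by rewrite /= mulrC; apply: PM => //; exact: (ha 0%N).
  by apply: PM => //; exact: (hb 0%N).
rewrite iterM; apply: PD.
  apply: (IH p q.-1 a (F b) Oa (FO Ob)) => //; first by lia.
  by move=> i hi; rewrite -iterSr; apply: hb; lia.
apply: (IH p.-1 q (F a) b (FO Oa) Ob) => //; first by lia.
by move=> i hi; rewrite -iterSr; apply: ha; lia.
Qed.

Let leib_top p q a b : O a -> O b -> (forall i, (i < p)%N -> P (iter i F a)) ->
  (forall i, (i < q)%N -> P (iter i F b)) ->
  P (iter (p + q) F (a * b) - (iter p F a * iter q F b) *+ 'C(p + q, p)).
Proof.
have [N] := ubnP (p + q); elim: N p q a b => // N IH p q a b ltN Oa Ob ha hb.
case: p ltN ha => [|p] ltN ha; case: q ltN hb => [|q] ltN hb.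
- by rewrite /= bin0 subrr.
- have h1 : P (iter (0 + q) F (a * F b) - (iter 0 F a * iter q F (F b)) *+ 'C(0 + q, 0)).
    by apply: IH => //; [exact: FO|move=> i hi; rewrite -iterSr; exact: hb].
  have h2 : P (iter q F (F a * b)) by apply: (@leib_mem q 0 q.+1) => //; exact: FO.
  rewrite add0n bin0 mulr1n -iterSr in h1.
  by rewrite add0n bin0 mulr1n iterM addrAC; exact: PD.
- have h1 : P (iter (p + 0) F (F a * b) - (iter p F (F a) * iter 0 F b) *+ 'C(p + 0, p)).
    by apply: IH => //; [exact: FO|move=> i hi; rewrite -iterSr; exact: ha].
  have h2 : P (iter p F (a * F b)) by apply: (@leib_mem p p.+1 0) => //; [exact: FO|lia].
  rewrite addn0 binn mulr1n -iterSr in h1.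
  by rewrite addn0 binn mulr1n iterM -addrA; exact: PD.
- have e : (p + q.+1)%N = (p.+1 + q)%N by lia.
  have h1 : P (iter (p.+1 + q) F (a * F b) - (iter p.+1 F a * iter q F (F b)) *+ 'C(p.+1 + q, p.+1)).
    by apply: IH => //; [lia|exact: FO|move=> i hi; rewrite -iterSr; exact: hb].
  have h2 : P (iter (p + q.+1) F (F a * b) - (iter p F (F a) * iter q.+1 F b) *+ 'C(p + q.+1, p)).
    by apply: IH => //; [exact: FO|move=> i hi; rewrite -iterSr; exact: ha].
  rewrite -!iterSr e in h1 h2.
  have -> : (p.+1 + q.+1 = (p.+1 + q).+1)%N by lia.
  rewrite binS mulrnDr opprD iterM addrACA; exact: PD.
Qed.

(** Let p and q be the first exponents with F^p a and F^q b outside [P]. Modulo [P], Leibniz leaves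
    in F^(p+q)(ab) only binomial(p+q,p) F^p a F^q b, and the binomial coefficient is invertible. *)
Lemma hull_prime : prime_of O (hull F P).
Proof.
have F0 m : iter m F 0 = 0 by elim: m => //= m ->; rewrite (der0 hF).
split; first split.
- by move=> u [].
- by split=> [|m]; [exact: sr0|rewrite F0].
- by move=> u v [Ou hu] [Ov hv]; split=> [|m]; [exact: srD|rewrite iterD; exact: PD].
- move=> a u Oa [Ou hu]; split=> [|m]; first exact: srM.
  by apply: (@leib_mem m 0 m.+1) => //.
- by move=> [_ /(_ 0%N)] /=; case: pP.
- move=> a b Oa Ob [_ hab]; apply: contrapT => /not_orP[na nb].
  have first u : O u -> ~ hull F P u -> exists p, ~ P (iter p F u) /\ forall i, (i < p)%N -> P (iter i F u).
    move=> Ou nu; have [m nm] : exists m, ~ P (iter m F u).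
      by apply: contrapT => h; apply: nu; split=> // m; apply: contrapT => h'; apply: h; exists m.
    have ex : exists m, `[< ~ P (iter m F u) >] by exists m; apply/asboolP.
    case: (ex_minnP ex) => p /asboolP np hp; exists p; split=> // i ip.
    by apply: contrapT => /asboolP/hp; rewrite leqNgt ip.
  have [p [np hp]] := first a Oa na; have [q [nq hq]] := first b Ob nb.
  have [_ P1 Pp] := pP.
  have h := leib_top Oa Ob hp hq.
  have : P ((iter p F a * iter q F b) *+ 'C(p + q, p)).
    have -> : (iter p F a * iter q F b) *+ 'C(p + q, p) = iter (p + q) F (a * b) -
        (iter (p + q) F (a * b) - (iter p F a * iter q F b) *+ 'C(p + q, p)) by rewrite subKr.
    exact: PB.
  have : (0 < 'C(p + q, p))%N by rewrite bin_gt0 leq_addr.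
  case: 'C(p + q, p) => // m _ /(PM (Onat m)).
  rewrite -[(_ * _) *+ _]mulr_natl mulrA mulVf ?char0 // mul1r.
  by case/(Pp _ _ (iterO p Oa) (iterO q Ob)).
Qed.

Lemma hull_sub : hull F P `<=` P. Proof. by move=> u [_ /(_ 0%N)]. Qed.
Lemma hull_stable u : hull F P u -> hull F P (F u).
Proof. by move=> [Ou hu]; split=> [|m]; [exact: FO|rewrite -iterSr]. Qed.
Lemma hull_max I : I `<=` P -> (forall u, I u -> O u) -> (forall u, I u -> I (F u)) -> I `<=` hull F P.
Proof.
move=> IP IO IF u Iu; split=> [|m]; first exact: IO.
by apply: IP; elim: m => //= m; exact: IF.
Qed.
End Hull.

Lemma hull_mono F (P Q : set K) : P `<=` Q -> hull F P `<=` hull F Q.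
Proof. by move=> PQ u [Ou hu]; split=> // m; exact: PQ. Qed.

(** Hulls are iterated along words in the derivations and intersected. The intersection is prime
    although primes are not closed under intersection: the hull along w1 ++ w2 is contained in those
    along w1 and along w2, so the family is directed downwards. *)
Theorem stable_prime : exists P, [/\ prime_of O P, P `<=` nonu O, forall i u, P u -> P (E i u) &
  forall I, ideal_of O I -> (forall i u, I u -> I (E i u)) -> I `<=` nonu O -> I `<=` P].
Proof.
pose H (w : seq 'I_n) (B : set K) := foldr (fun i => hull (E i)) B w.
have pH w B : prime_of O B -> prime_of O (H w B).
  by move=> pB; elim: w => //= i w h; exact: (hull_prime (hE i) (@EO i) h).
have subH w B : H w B `<=` B.
  by elim: w => //= i w IH u /hull_sub/IH.
have monoH w B C : B `<=` C -> H w B `<=` H w C.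
  by move=> BC; elim: w => //= i w IH; exact: hull_mono.
have pm := nonu_prime Oloc.
exists [set u | forall w, H w (nonu O) u]; split.
- split; first split.
  + by move=> u /(_ [::])[].
  + by move=> w; have [[_ h _ _] _ _] := pH w _ pm.
  + by move=> u v hu hv w; have [[_ _ h _] _ _] := pH w _ pm; exact: h.
  + by move=> a u Oa hu w; have [[_ _ _ h] _ _] := pH w _ pm; exact: h.
  + by move=> /(_ [::]) /=; case: pm.
  + move=> a b Oa Ob hab; apply: contrapT => /not_orP[/existsNP[w1 n1] /existsNP[w2 n2]].
    have e : H (w1 ++ w2) (nonu O) = H w1 (H w2 (nonu O)) by rewrite /H foldr_cat.
    have [_ _ h] := pH (w1 ++ w2) _ pm.
    case: (h a b Oa Ob (hab _)); rewrite e.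
      by move/(monoH w1 _ _ (subH w2 _)).
    by move/subH.
- by move=> u /(_ [::]).
- move=> i u hu w; have := hu (i :: w); move=> /= /hull_stable; move=> /(_ (EO i)).
  exact: hull_sub.
- move=> I [IO _ _ _] Is Im u Iu w.
  suff : I `<=` H w (nonu O) by apply.
  elim: w => //= i w IH; apply: hull_max => //; exact: Is.
Qed.

End StablePrime.

Section DualFrame.
Variables (k K : fieldType) (c : {rmorphism k -> K}) (n : nat) (E : 'I_n -> K -> K).
Hypothesis hE : forall i, is_self_derivation c (E i).

(** As long as the columns have rank r < n, some combination of the derivations kills the chosen
    elements; by independence it is nonzero on some element of [O], which is added. *)
Lemma exists_det (O : K -> Prop) :
  (forall a : 'I_n -> K, (forall u, O u -> \sum_i a i * E i u = 0) -> forall i, a i = 0) ->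
  exists f : 'I_n -> K, (forall j, O (f j)) /\ \det (\matrix_(i, j) E i (f j)) != 0.
Proof.
move=> ind.
suff : forall r, (r <= n)%N -> exists f : 'I_r -> K, (forall j, O (f j)) /\
    \rank (\matrix_(j < r, i < n) E i (f j)) = r.
  move=> /(_ n (leqnn n))[f [Of rf]]; exists f; split=> //.
  have -> : (\matrix_(i, j) E i (f j)) = (\matrix_(j < n, i < n) E i (f j))^T.
    by apply/matrixP => i j; rewrite !mxE.
  by rewrite det_tr -unitfE -unitmxE -row_free_unit /row_free rf.
elim=> [_|r IH rn].
  by exists (fun _ => 0); split=> [[]//|]; apply/eqP; rewrite -leqn0; exact: rank_leq_row.
have [f [Of rf]] := IH (ltnW rn).
set M := \matrix_(j, i) E i (f j) in rf.
have [v [v0 Mv]] : exists v : 'rV[K]_n, v != 0 /\ v *m M^T = 0.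
  have : kermx M^T != 0 by rewrite -mxrank_eq0 mxrank_ker mxrank_tr rf -lt0n subn_gt0.
  by move=> /rowV0Pn[v /sub_kermxP vM v0]; exists v.
have [u [Ou nu]] : exists u, O u /\ \sum_i v 0 i * E i u != 0.
  apply: contrapT => h; case/eqP: v0; apply/rowP => i; rewrite mxE; apply: (ind (fun i => v 0 i)) => u Ou.
  by apply: contrapT => /eqP nu; apply: h; exists u.
pose f' (j : 'I_(r + 1)) := match fintype.split j with inl j => f j | inr _ => u end.
rewrite -addn1; exists f'; split; first by move=> j; rewrite /f'; case: fintype.split.
pose ru : 'rV[K]_n := \row_i E i u.
have -> : \matrix_(j, i) E i (f' j) = col_mx M ru.
  apply/matrixP => j i; rewrite !mxE /f'; case: (fintype.split j) => j'; by rewrite !mxE.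
apply/eqP; rewrite eqn_leq rank_leq_row /= -addsmxE addn1.
have : (M < M + ru)%MS.
  rewrite ltmxE addsmxSl addsmx_sub submx_refl /=; apply/negP.
  move=> /submxP[w ew]; case/eqP: nu.
  have := congr1 (fun N : 'M_1 => N 0 0) (congr1 (fun x => v *m x^T) ew).
  rewrite trmx_mul mulmxA Mv mul0mx !mxE => e; rewrite -[RHS]e.
  by apply: eq_bigr => i _; rewrite !mxE.
by move/rank_ltmx; rewrite rf.
Qed.

Hypothesis hspan : forall F, is_self_derivation c F -> exists a : 'I_n -> K, forall u, F u = \sum_i a i * E i u.

Lemma dual_exists (f : 'I_n -> K) : \det (\matrix_(i, j) E i (f j)) != 0 ->
  exists d : 'I_n -> K -> K, [/\ forall i, is_self_derivation c (d i), forall i j, d i (f j) = (i == j)%:R,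
    forall F, is_self_derivation c F -> forall u, F u = \sum_i F (f i) * d i u
  & forall i u, exists a : 'I_n -> K, d i u = \sum_l a l * E l u].
Proof.
set M := \matrix_(i, j) E i (f j) => dM.
have uM : M \in unitmx by rewrite unitmxE unitfE.
pose d i u := \sum_l invmx M i l * E l u.
have hd i : is_self_derivation c (d i) by exact: kder_comb.
have df i j : d i (f j) = (i == j)%:R.
  have := congr1 (fun N : 'M_n => N i j) (mulVmx uM); rewrite !mxE => <-.
  by apply: eq_bigr => l _; rewrite !mxE.
exists d; split=> //; last by move=> i u; exists (fun l => invmx M i l).
move=> F hF u.
have hG : is_self_derivation c (fun u => F u - \sum_i F (f i) * d i u) by apply: kder_sub => //; exact: kder_comb.
have [a ha] := hspan hG.
suff a0 : \row_i a i = 0.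
  apply/eqP; rewrite -subr_eq0 ha big1 // => i _.
  by have := congr1 (fun N : 'rV_n => N 0 i) a0; rewrite !mxE => ->; rewrite mul0r.
have : (\row_i a i) *m M = 0.
  apply/rowP => j; rewrite !mxE; under eq_bigr do rewrite !mxE.
  rewrite -ha (bigD1 j) //= df eqxx mulr1 big1 ?addr0 ?subrr // => i ij.
  by rewrite df (negPf ij) mulr0.
by move=> e; rewrite -[LHS](mulmxK uM) e mul0mx.
Qed.

End DualFrame.

Section SpannedFrame.
Variables (k K : fieldType) (c : {rmorphism k -> K}).
Hypothesis char0 : forall m, m.+1%:R != 0 :> K.
Variables (R : comUnitRingType) (cR : {rmorphism k -> R}) (i : {rmorphism R -> K}).
Hypothesis iI : injective i.
Hypothesis icR : forall z, i (cR z) = c z.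
Hypothesis efR : ess_finite cR.
Variables (n : nat) (E : 'I_n -> K -> K).
Hypothesis hE : forall j, is_self_derivation c (E j).
Hypothesis ER : forall j u, range_subr i u -> range_subr i (E j u).
Hypothesis hspan : forall F, is_self_derivation c F -> exists a : 'I_n -> K, forall u, F u = \sum_j a j * E j u.
Hypothesis hind : forall a : 'I_n -> K, (forall u, range_subr i u -> \sum_j a j * E j u = 0) -> forall j, a j = 0.
Hypothesis hbr : forall j l, exists a : 'I_n -> K, (forall m, range_subr i (a m)) /\
  forall u, E j (E l u) - E l (E j u) = \sum_m a m * E m u.

(** The nonzero member of the spanned ideal is a torsion bound times the determinant of E_j(f_l),
    for elements [f] of the ring with nonzero determinant: a derivation of [K] killing these [f] is
    zero. *)
Lemma spanned_frame : exists D : 'I_n -> R -> R,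
  [/\ forall j, is_self_derivation cR (D j) /\ forall a, i (D j a) = E j (i a),
      isideal (spanned cR D), forall j a, spanned cR D a -> spanned cR D (D j a)
    & exists2 a, a != 0 & spanned cR D a].
Proof.
have /choice[D hD] : forall j, exists D : R -> R, is_self_derivation cR D /\ forall a, i (D a) = E j (i a).
  by move=> j; apply: (kder_restrict iI icR (hE j)); exact: ER.
have hD1 j := (hD j).1.
exists D; split=> //.
- split; [exact: spanned0|exact: spannedD|exact: spannedM].
- move=> j a; apply: spanned_stable => // j' l.
  have [e [er he]] := hbr j' l; have /choice[b hb] : forall m, exists b, i b = e m.
    by move=> m; have [b _ <-] := er m; exists b.
  exists b => z; apply: iI; rewrite rmorphB rmorph_sum !(hD _).2 he.
  by apply: eq_bigr => m _; rewrite rmorphM hb (hD m).2.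
have [f [fR df]] := exists_det hind.
have /choice[f' hf'] : forall j, exists a, i a = f j by move=> j; have [a _ <-] := fR j; exists a.
have [d [hd ddf dspan _]] := dual_exists hE hspan df.
have [|a a0 ha] := @torsion_bound k R cR K i iI char0 n f' _ efR.
  move=> F FD FM Fc Ff z.
  have hF : is_self_derivation c F by apply/self_derP; split=> // x; rewrite -icR.
  by rewrite (dspan F hF) big1 // => j _; rewrite -hf' Ff mul0r.
exists (a * \det (\matrix_(j, l) D j (f' l))); last first.
  by apply: spanned_det => // M d' hd' kf z; apply: ha; split.
apply: contraNneq df => /(congr1 i); rewrite rmorphM rmorph0 => /eqP; rewrite mulf_eq0.
have -> /= : (i a == 0) = false.
  by apply/negP => /eqP e; case/eqP: a0; apply: iI; rewrite e rmorph0.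
rewrite -det_map_mx => /eqP <-; apply/eqP; congr (\det _).
by apply/matrixP => j l; rewrite !mxE (hD j).2 hf'.
Qed.

Theorem simple_regular : noetherian R -> (forall x y, nonunits R x -> nonunits R y -> nonunits R (x + y)) ->
  (forall I, ideal_of (range_subr i) I -> (forall j u, I u -> I (E j u)) -> (exists2 u, I u & u != 0) -> I 1) ->
  regular_local R.
Proof.
move=> nR mloc simp; have [D [hD [S0 SD SM] Sst [a a0 Sa]]] := spanned_frame.
have char0k m : m.+1%:R != 0 :> k.
  by have := char0 m; apply: contraNneq => e; rewrite -(rmorph_nat c) e rmorph0.
have hD1 j := (hD j).1.
have [|||b S1 eb] := simp [set i b | b in spanned cR D].
- split.
  + by move=> _ [b _ <-]; exact: range_mem.
  + by exists 0; rewrite ?rmorph0.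
  + by move=> _ _ [x Sx <-] [y Sy <-]; exists (x + y); [exact: SD|rewrite rmorphD].
  + by move=> _ _ [x _ <-] [y Sy <-]; exists (x * y); [exact: SM|rewrite rmorphM].
- by move=> j _ [b Sb <-]; exists (D j b); [exact: Sst|exact: (hD j).2].
- by exists (i a); [exists a|apply: contraNneq a0 => e; apply/eqP/iI; rewrite e rmorph0].
apply: (regular_criterion char0k i nR mloc hD1) => M d hd.
have [m hm] := S1 M d hd; exists m => z.
have b1 : b = 1 by apply: iI; rewrite eb rmorph1.
by rewrite -hm b1 scale1r.
Qed.

End SpannedFrame.

Lemma basis_of_spanned (k : fieldType) (R : comUnitRingType) (cR : {rmorphism k -> R}) n
    (D : 'I_n -> R -> R) (f : 'I_n -> R) : (forall j, is_self_derivation cR (D j)) ->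
  (forall i j, D i (f j) = (i == j)%:R) -> spanned cR D 1 -> differential_basis cR f.
Proof.
move=> hD Df S1 M m.
have val (e : 'I_n -> M) j : \sum_i D i (f j) *: e i = e j.
  by rewrite (bigD1 j) //= Df eqxx scale1r big1 ?addr0 // => i ij; rewrite Df (negPf ij) scale0r.
exists (fun z => \sum_i D i z *: m i); split.
  by split; [exact: der_scaled|exact: val].
move=> d [hd df]; apply: funext => z.
have [m' hm'] := S1 M d hd.
have e j : m' j = m j by rewrite -df -[RHS]scale1r hm' val.
rewrite -[RHS]scale1r hm'; apply: eq_bigr => j _; by rewrite e.
Qed.

(** * Derivations of discrete valuation rings *)

Section DVR.
Variables (K : fieldType) (O : subr K) (t : K).
Hypothesis dO : dvr O t.
Hypothesis frO : forall z, fracf O z.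

Let t0 : t != 0. Proof. by case: dO. Qed.
Let Ot : O t. Proof. by case: dO => _ _ [h _]. Qed.

Lemma dvr_tV : ~ O t^-1.
Proof. by move=> h; have [_ _ [_ nt] _ _] := dO; apply: nt. Qed.

Lemma dvr_le u u' y a b : inu O u -> O u -> O u' -> O y -> u * t ^+ a = u' * t ^+ b * y -> (b <= a)%N.
Proof.
move=> [u0 uV] Ou Ou' Oy e; rewrite leqNgt; apply/negP => ab; apply: dvr_tV.
have {}e : u = u' * t ^+ (b - a) * y.
  apply: (mulIf (expf_neq0 a t0)); rewrite e.
  by rewrite -{1}(subnK (ltnW ab)) exprD; ring.
have [m em] : exists m, (b - a)%N = m.+1 by exists (b - a).-1; lia.
have -> : t^-1 = u' * t ^+ m * y * u^-1.
  by apply: (mulIf u0); rewrite divfK // {1}e em exprS; field.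
by apply: srM => //; apply: srM => //; apply: srM => //; exact: srX.
Qed.

Lemma dvr_ordz z : z != 0 -> exists u (m : int), [/\ inu O u, O u & z = u * t ^ m].
Proof.
move=> z0; have [a [s [Oa Os s0 ez]]] := frO z.
have a0 : a != 0 by apply: contraNneq z0 => e; rewrite ez e mul0r.
have [p [u [iu Ou ea]]] := dvr_ord dO Oa a0; have [q [v [iv Ov es]]] := dvr_ord dO Os s0.
exists (u / v), (p%:Z - q%:Z); split.
- by apply: inuM => //; exact: inuV.
- by apply: srM => //; case: iv.
- rewrite ez ea es expfzDr // -invr_expz -!exprnP; have := iv.1 => v0; field.
  by rewrite v0 expf_neq0.
Qed.

Lemma dvr_alt w : ~ O w -> w != 0 /\ exists2 y, O y & w^-1 = t * y.
Proof.
move=> nw; have w0 : w != 0 by apply: contra_notN nw => /eqP->; exact: sr0.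
split=> //; have [u [m [[u0 uV] Ou ew]]] := dvr_ordz w0.
case: m ew => m ew; first by case: nw; rewrite ew; apply: srM => //; exact: srX.
exists (u^-1 * t ^+ m); first by apply: srM => //; exact: srX.
by rewrite ew NegzE -exprnN invfM invrK exprS; ring.
Qed.

Lemma dvr_local : localS O.
Proof.
have nonuE u : nonu O u <-> exists2 y, O y & u = t * y.
  split=> [nu|[y Oy ->]].
    have [_ _ _ _ h] := dO; exists (u / t); first exact: h.
    by rewrite mulrC divfK.
  split; first exact: srM.
  move=> [ty0 h]; apply: dvr_tV.
  have y0 : y != 0 by apply: contraNneq ty0 => ->; rewrite mulr0.
  have -> : t^-1 = y * (t * y)^-1 by field; rewrite t0 y0.
  exact: srM.
move=> u v /nonuE[x Ox ->] /nonuE[y Oy ->]; apply/nonuE; exists (x + y); first exact: srD.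
by rewrite mulrDr.
Qed.

Section DVRFrame.
Variables (k : fieldType) (c : {rmorphism k -> K}).
Hypothesis char0 : forall m, m.+1%:R != 0 :> K.
Hypothesis kO : forall u, range_subr c u -> O u.
Variables (n : nat) (E : 'I_n -> K -> K).
Hypothesis hE : forall i, is_self_derivation c (E i).
Hypothesis EO : forall i u, O u -> O (E i u).
Hypothesis hspan : forall F, is_self_derivation c F -> exists a : 'I_n -> K, forall u, F u = \sum_i a i * E i u.
Hypothesis hind : forall a : 'I_n -> K, (forall u, \sum_i a i * E i u = 0) -> forall i, a i = 0.

Let det_f (f : 'I_n -> K) := \det (\matrix_(i, j) E i (f j)).

Lemma det_O f : (forall j, O (f j)) -> O (det_f f).
Proof.
move=> Of; apply: sr_sum => s _; apply: srM; first by apply: srX; apply: srN; exact: sr1.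
by apply: sr_prod => i _; rewrite mxE; exact: EO.
Qed.

(** Choose [f] in [O] with det E_i(f_j) of least valuation. If the dual d_i took some w of [O]
    outside [O], replacing f_i by w would multiply the determinant by d_i(w), of negative
    valuation. *)
Lemma minimal_dual : exists (f : 'I_n -> K) (d : 'I_n -> K -> K),
  [/\ forall j, O (f j), det_f f != 0, forall i, is_self_derivation c (d i) /\ forall u, O u -> O (d i u),
      forall i j, d i (f j) = (i == j)%:R
    & forall F, is_self_derivation c F -> forall u, F u = \sum_i F (f i) * d i u].
Proof.
pose good m := exists f : 'I_n -> K, (forall j, O (f j)) /\ exists u, [/\ inu O u, O u & det_f f = u * t ^+ m].
have ex : exists m, `[< good m >].
  have [|f [Of df]] := @exists_det _ _ E O.
    move=> a ha; apply: hind => u; move: u; apply: (kder_eq0 (kder_comb a hE) frO ha).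
  have [m [u [iu Ou e]]] := dvr_ord dO (det_O Of) df.
  by exists m; apply/asboolP; exists f; split=> //; exists u.
case: (ex_minnP ex) => m /asboolP[f [Of [u [iu Ou ef]]]] min.
have df : det_f f != 0 by rewrite ef mulf_neq0 ?expf_neq0 //; exact: iu.1.
have [d [hd ddf dsp _]] := dual_exists hE hspan df.
exists f, d; split=> // i; split=> // w Ow; apply: contrapT => nw.
pose f' j := if j == i then w else f j.
have Of' j : O (f' j) by rewrite /f'; case: eqP.
have e1 : (\matrix_(a, b) E a (f' b)) = (\matrix_(a, b) E a (f b)) *m (\matrix_(a, b) d a (f' b)).
  apply/matrixP => a b; rewrite !mxE (dsp _ (hE a)); apply: eq_bigr => l _; by rewrite !mxE.
have e2 : \det (\matrix_(a, b) d a (f' b)) = d i w.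
  rewrite (expand_det_row _ i) (bigD1 i) //= big1 => [|j ji].
    rewrite addr0 mxE /f' eqxx /cofactor -signr_odd oddD addbb mul1r.
    have -> : row' i (col' i (\matrix_(a, b) d a (if b == i then w else f b))) = 1%:M.
      by apply/matrixP => a b; rewrite !mxE eq_sym (negPf (neq_lift i b)) ddf (inj_eq lift_inj).
    by rewrite det1 mulr1.
  by rewrite mxE /f' (negPf ji) ddf eq_sym (negPf ji) mul0r.
have e3 : det_f f' = det_f f * d i w by rewrite /det_f e1 det_mulmx e2.
have [w0 [y Oy ey]] := dvr_alt nw.
have df' : det_f f' != 0 by rewrite e3 mulf_neq0.
have [m' [u' [iu' Ou' e']]] := dvr_ord dO (det_O Of') df'.
have : (m <= m')%N by apply: min; apply/asboolP; exists f'; split=> //; exists u'.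
have : (m'.+1 <= m)%N.
  apply: (@dvr_le u u' y) => //; rewrite -ef.
  have -> : det_f f = det_f f' * (d i w)^-1 by rewrite e3 mulfK.
  by rewrite ey e' exprS; ring.
lia.
Qed.

Section Uniformizer.
Variables (f : 'I_n -> K) (d : 'I_n -> K -> K).
Hypothesis Of : forall j, O (f j).
Hypothesis hd : forall i, is_self_derivation c (d i).
Hypothesis dO' : forall i u, O u -> O (d i u).
Hypothesis ddf : forall i j, d i (f j) = (i == j)%:R.
Hypothesis dsp : forall F, is_self_derivation c F -> forall u, F u = \sum_i F (f i) * d i u.

Let word (w : seq 'I_n) (u : K) := foldr (fun j u => d j u) u w.

(** Each d_j acts as the partial derivative in f_j. Differentiating as often as the degree leaves
    the leading coefficient times a factorial, which involves one variable less. *)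
Lemma word_const (js : seq 'I_n) : uniq js -> forall b, adj (range_subr c) [seq f j | j <- js] b -> b != 0 ->
  exists w, exists2 z, range_subr c z & z != 0 /\ word w b = z.
Proof.
elim: js => [_ b kb b0|j js IH /andP[jj uj] b]; first by exists [::], b.
move=> /= [p hp ->] b0.
have p0 : p != 0 by apply: contraNneq b0 => ->; rewrite horner0.
have kill u : adj (range_subr c) [seq f j | j <- js] u -> d j u = 0.
  move=> hu; have [T TE] : exists T : subr K, forall u, T u <-> d j u = 0.
    have @T : subr K.
      exists [set u | d j u = 0].
      - exact: der1 (hd j).
      - by move=> x y hx hy; rewrite /= (derB (hd j)) hx hy subrr.
      - by move=> x y hx hy; rewrite /= (derMs _ _ (hd j)) hx hy !mulr0 addr0.
    by exists T.
  apply/TE; apply: (@adj_min K (range_subr c) T _ _ _ u hu).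
    by move=> _ [z _ <-]; apply/TE; exact: (derc (hd j)).
  move=> _ /mapP[l lj ->]; apply/TE; rewrite ddf; by case: eqP => // e; case/negP: jj; rewrite e.
have iter m : iter m (d j) p.[f j] = (p^`(m)).[f j] /\ pcoef (adj (range_subr c) [seq f j | j <- js]) (p^`(m)).
  elim: m => [|m [IHm hm]]; first by rewrite derivn0.
  rewrite derivnS; split; last exact: pcoef_deriv.
  rewrite iterS IHm (der_horner (hd j)); last by move=> l; exact: kill.
  by rewrite ddf eqxx /GRing.scale /= mulr1.
have [e hm] := iter (size p).-1.
have e2 : p^`((size p).-1) = ((lead_coef p) *+ (size p).-1`!)%:P.
  apply/polyP => l; rewrite coef_derivn coefC; case: l => [|l] /=.
    by rewrite addn0 ffactnn.
  rewrite nth_default ?mul0rn //; move: p0; rewrite -size_poly_gt0; lia.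
rewrite e2 hornerC in e.
have nz : lead_coef p *+ (size p).-1`! != 0.
  have := fact_gt0 (size p).-1; case: (_)`! => // l _.
  by rewrite -mulr_natl mulf_neq0 ?lead_coef_eq0 //; exact: char0.
have [|w [z kz [z0 ez]]] := IH uj _ _ nz.
  by have := hm 0%N; rewrite e2 coefC.
exists (w ++ nseq (size p).-1 j), z => //; split=> //.
rewrite -ez /word foldr_cat -e; congr foldr.
by elim: (size p).-1 => //= m ->.
Qed.

(** Otherwise the maximal ideal is stable under the [d i], so by [word_const] it meets k[f] only in
    0 and the field k(f) lies in [O]. Derivations killing k(f) vanish, so [t] is algebraic over it,
    and 1/t lies in k(f)[t], inside [O]. *)
Lemma uniformizer_derivative : exists i, inu O (d i t).
Proof.
apply: contrapT => /forallNP nt.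
have nonut u : nonu O u -> exists2 y, O y & u = t * y.
  move=> nu; have [_ _ _ _ h] := dO; exists (u / t); first exact: h.
  by rewrite mulrC divfK.
have mloc := dvr_local; have pm := nonu_prime mloc; have [[_ _ mD mM] _ _] := pm.
have mt : nonu O t by case: dO.
have ms i u : nonu O u -> nonu O (d i u).
  move=> /nonut[y Oy ->]; rewrite (derMs _ _ (hd i)); apply: mD.
    by rewrite mulrC; apply: mM => //; exact: dO'.
  by apply: mM => //; split; [exact: dO'|exact: nt].
have mw w u : nonu O u -> nonu O (word w u) by move=> nu; elim: w => //= j w IH; exact: ms.
pose A := adj (range_subr c) [seq f j | j <- enum 'I_n].
have AO u : A u -> O u.
  apply: adj_min => // _ /mapP[j _ ->]; exact: Of.
have LO u : fracf A u -> O u.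
  move=> [a [s [Aa As s0 ->]]]; apply: srM; first exact: AO.
  apply: contrapT => nO; have ns : nonu O s by split; [exact: AO|case].
  have [w [z kz [z0 ez]]] := word_const (enum_uniq _) As s0.
  have : nonu O z by rewrite -ez; exact: mw.
  by move=> [_]; apply; split=> //; apply: kO; exact: range_field.
have Lf u : fracf A u -> fracf A u^-1 by exact: fracf_inv.
have [|P [P0 hP rP]] := @algebraic_of_derivations K (fracf A) char0 _ t.
  move=> F FD FM FL z; have hF : is_self_derivation c F.
    apply/self_derP; split=> // x; apply: FL; apply: fracf_sub; apply: adj_sub; exact: range_mem.
  rewrite (dsp hF) big1 // => i _; rewrite FL ?mul0r //; apply: fracf_sub; apply: adj_mem.
  by apply: map_f; rewrite mem_enum.
have it : integ (fracf A) t.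
  exists ((lead_coef P)^-1 *: P); split.
  - by rewrite monicE lead_coefZ mulVf // lead_coef_eq0.
  - by apply: pcoefZ => //; apply: Lf; exact: hP.
  - by rewrite rootZ // invr_eq0 lead_coef_eq0.
apply: dvr_tV; apply: (@adj1_min K (fracf A) O t LO Ot).
exact: integ_field_inv.
Qed.
End Uniformizer.

End DVRFrame.
End DVR.

Section DVRBasis.
Variables (K : fieldType) (O : subr K) (t : K).
Hypothesis dO : dvr O t.
Hypothesis frO : forall z, fracf O z.
Variables (k : fieldType) (c : {rmorphism k -> K}).
Hypothesis char0 : forall m, m.+1%:R != 0 :> K.
Hypothesis kO : forall u, range_subr c u -> O u.

Lemma dvr_nat m : O m.+1%:R^-1.
Proof. by apply: kO; apply: range_field; exists m.+1%:R; rewrite ?rmorph_nat. Qed.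

Lemma range_val u : range_subr (val : {rmorphism sub_of O -> K}) u <-> O u.
Proof. by split=> [[a _ <-]|Ou]; [exact: sub_valP|exists (mk_sub Ou)]. Qed.

Section Basis.
Variable cR : {rmorphism k -> sub_of O}.
Hypothesis cRE : forall z, val (cR z) = c z.
Hypothesis efR : ess_finite cR.
Variables (n : nat) (E : 'I_n -> K -> K).
Hypothesis hE : forall i, is_self_derivation c (E i).
Hypothesis EO : forall i u, O u -> O (E i u).
Hypothesis hspan : forall F, is_self_derivation c F -> exists a : 'I_n -> K, forall u, F u = \sum_i a i * E i u.
Hypothesis hind : forall a : 'I_n -> K, (forall u, \sum_i a i * E i u = 0) -> forall i, a i = 0.

(** With respect to the dual derivations the spanned ideal is nonzero and stable. Since one of them
    maps the uniformizer to a unit, stability forces this ideal to contain 1. *)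
Theorem dvr_basis : exists (f : 'I_n -> sub_of O) (d : 'I_n -> K -> K),
  [/\ differential_basis cR f, \det (\matrix_(i, j) E i (val (f j))) != 0,
      forall i, is_self_derivation c (d i)
    & forall F, is_self_derivation c F -> forall u, F u = \sum_i F (val (f i)) * d i u].
Proof.
have [f [d [Of df hd ddf dsp]]] := minimal_dual dO frO hE EO hspan hind.
have hd1 i := (hd i).1.
have hd2 i u : O u -> O (d i u) by exact: (hd i).2.
have [i0 [dt0 dtV]] := uniformizer_derivative dO char0 kO Of hd1 hd2 ddf dsp.
have [f' hf'] : exists f' : 'I_n -> sub_of O, forall j, val (f' j) = f j by exists (fun j => mk_sub (Of j)).
have [||||D [hD [S0 SD SM] Sst [a a0 Sa]]] := @spanned_frame k K c char0 (sub_of O) cR val val_inj cRE efR n d hd1.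
- by move=> j u /range_val Ou; apply/range_val; exact: hd2.
- by move=> F hF; exists (fun i => F (f i)); exact: dsp.
- move=> e he j; have := he (f j); rewrite (bigD1 j) //= ddf eqxx mulr1 big1 => [|i ij].
    by rewrite addr0; apply; apply/range_val.
  by rewrite ddf (negPf ij) mulr0.
(* The dual derivations commute: a bracket kills every [f m], hence vanishes. *)
- move=> j l; exists (fun=> 0); split; first by move=> m; apply/range_val; exact: sr0.
  move=> u; rewrite (dsp _ (kder_bracket (hd1 j) (hd1 l))) !big1 // => m _; rewrite ?mul0r //.
  have nat0 F b : is_self_derivation c F -> F (b%:R : K) = 0.
    by move=> hF; rewrite -(rmorph_nat c) (derc hF).
  by rewrite !ddf !nat0 // subrr mul0r.
have hD1 j := (hD j).1.
have ex : exists m, `[< exists b u, [/\ spanned cR D b, inu O u, O u & val b = u * t ^+ m] >].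
  have va0 : val a != 0 by apply: contraNneq a0 => e; apply/eqP/val_inj.
  have [m [u [iu Ou e]]] := dvr_ord dO (sub_valP a) va0.
  by exists m; apply/asboolP; exists a, u.
case: (ex_minnP ex) => m /asboolP[b [u [Sb iu Ou eb]]] min.
(* An element u t^(m+1) of least valuation would be mapped by D_i0 to one of valuation m, as m + 1
   is invertible. *)
have S1 : spanned cR D 1.
  case: m min eb => [_|m min] eb.
    have -> : 1 = mk_sub iu.2 * b.
      by apply: val_inj; rewrite sub_valM eb /= expr0 mulr1 mulVf //; case: iu.
    exact: SM.
  suff : (m.+1 <= m)%N by rewrite ltnn.
  apply: min; apply/asboolP; exists (D i0 b), (t * d i0 u + u * d i0 t *+ m.+1).
  have Ot : O t by case: dO => _ _ [].
  have Oin : O (t * d i0 u + u * d i0 t *+ m.+1).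
    by apply: srD; [apply: srM => //; exact: hd2|apply: sr_muln; apply: srM => //; exact: hd2].
  split=> //; first exact: Sst.
    apply: contrapT => nin; have [] : nonu O (u * d i0 t *+ m.+1).
      have -> : u * d i0 t *+ m.+1 = (t * d i0 u + u * d i0 t *+ m.+1) + (- d i0 u) * t by ring.
      have mloc := dvr_local dO; have [[_ _ mD mM] _ _] := nonu_prime mloc.
      apply: mD; first by split.
      by apply: mM; [apply: srN; exact: hd2|case: dO].
    move=> _; apply; rewrite -mulr_natl; apply: inuM; last exact: inuM.
    by split; [exact: char0|exact: dvr_nat].
  have -> : val (D i0 b) = d i0 (u * t ^+ m.+1) by rewrite -eb; exact: (hD i0).2.
  rewrite (derMs _ _ (hd1 i0)) (derX (hd1 i0)) /= /GRing.scale /= exprS; ring.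
exists f', d; split=> //; last by move=> F hF u'; rewrite (dsp F hF); apply: eq_bigr => i _; rewrite hf'.
  apply: (basis_of_spanned hD1) => // i j; apply: val_inj.
  transitivity (d i (f j)); first by rewrite -hf'; exact: (hD i).2.
  by rewrite ddf; case: (i == j).
by rewrite (_ : \matrix_(i, j) _ = \matrix_(i, j) E i (f j)) //; apply/matrixP => i j; rewrite !mxE hf'.
Qed.
End Basis.

Section ExtendDerivation.
Variable F : K -> K.
Hypothesis hF : is_self_derivation c F.

Section Iterate.
Variable z : K.
(** The j-fold commutator of [G] with multiplication by [z]. For G = F^m and j = m it is
    multiplication by m! F(z)^m. *)
Let Fixpoint ad (j : nat) (G : K -> K) (y : K) : K :=
  if j is j'.+1 then ad j' G (y * z) - z * ad j' G y else G y.

Let ad_comp j G y : ad j (fun y => F (G y)) y = F (ad j G y) + (F z *+ j) * ad j.-1 G y.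
Proof.
elim: j y => [|[|j] IH] y; first by rewrite /= mulr0n mul0r addr0.
  by rewrite /= (derB hF) (derMs _ _ hF) mulr1n; ring.
have e : forall j G y, ad j.+1 G y = ad j G (y * z) - z * ad j G y by [].
rewrite [ad j.+2 (fun _ => _) y]e !IH /= -/(ad j.+1 G (y * z)) -/(ad j.+1 G y).
have -> : ad j G (y * z) = ad j.+1 G y + z * ad j G y by rewrite e subrK.
move: (ad j.+1 G (y * z)) (ad j.+1 G y) (ad j G y) => a b b'.
by rewrite (derB hF) (derMs _ _ hF) (mulrS _ j.+1); ring.
Qed.

Let ad_iter m : (forall y, ad m.+1 (iter m F) y = 0) /\ forall y, ad m (iter m F) y = (F z ^+ m *+ m`!) * y.
Proof.
elim: m => [|m [IH1 IH2]].
  by split=> y; rewrite /= ?mulr1n ?expr0 ?mul1r // mulrC subrr.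
have e y : ad m.+1 (iter m.+1 F) y = (F z ^+ m.+1 *+ m.+1`!) * y.
  rewrite (ad_comp m.+1 (iter m F)) IH1 (der0 hF) add0r /= IH2 factS mulnC mulrnA exprS -mulrnAr.
  by move: (F z ^+ m *+ m`!) => x; rewrite -mulrnAl mulrA.
split=> // y.
rewrite -[ad m.+2 _ y]/(ad m.+1 (iter m.+1 F) (y * z) - z * ad m.+1 (iter m.+1 F) y) !e; ring.
Qed.

Let ad_mem j G y : O z -> (forall i, O (G (y * z ^+ i))) -> O (ad j G y).
Proof.
move=> Oz; elim: j y => [|j IH] y h; first by have := h 0%N; rewrite expr0 mulr1.
apply: srB; first by apply: IH => i; rewrite -mulrA -exprS.
by apply: srM => //; exact: IH.
Qed.

(** The commutator formula uses only the F-images of the y z^i, all in [C]; so F(z)^m y is in [O]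
    for every m. A fixed [y] cannot compensate arbitrarily large poles of F(z)^m. *)
Lemma kder_dvr_elt (C : subr K) y : (forall u, C u -> O u) -> (forall u, C u -> C (F u)) ->
  O z -> y != 0 -> (forall m, C (y * z ^+ m)) -> O (F z).
Proof.
move=> CO FC Oz y0 Cy.
have Om m : O (F z ^+ m * y).
  have : O ((F z ^+ m *+ m`!) * y).
    rewrite -(ad_iter m).2; apply: ad_mem => // i; apply: CO.
    by elim: (m) (Cy i) => //= l IH /IH; exact: FC.
  have := fact_gt0 m; case: (m`!) => // l _ h.
  have -> : F z ^+ m * y = l.+1%:R^-1 * ((F z ^+ m *+ l.+1) * y).
    by rewrite -[F z ^+ m *+ l.+1]mulr_natl -mulrA mulKf // char0.
  by apply: srM => //; exact: dvr_nat.
apply: contrapT => nO; have [w0 [v Ov ev]] := dvr_alt dO frO nO.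
have Oy : O y by apply: CO; have := Cy 0%N; rewrite expr0 mulr1.
have [N [u [iu Ou eu]]] := dvr_ord dO Oy y0.
have : (N.+1 <= N)%N; last by rewrite ltnn.
apply: (dvr_le dO (u := u) (u' := F z ^+ N.+1 * y) (y := v ^+ N.+1)) => //; first exact: srX.
rewrite -eu -mulrA -exprMn -ev exprVn mulrAC mulfV ?mul1r // expf_neq0 //.
Qed.
End Iterate.

Lemma kder_dvr (C B : subr K) : (forall u, C u -> O u) -> (forall u, C u -> C (F u)) ->
  (forall z, fracf C z) -> (forall z, B z -> O z /\ integ C z) ->
  (forall u, O u -> exists a s, [/\ B a, B s, inu O s & u = a / s]) -> forall u, O u -> O (F u).
Proof.
move=> CO FC frC hB; apply: (kder_frac hF) => z Bz; first exact: (hB z Bz).1.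
have [Oz iz] := hB z Bz; have [y [_ y0 hy]] := integ_denom (frC z) iz.
exact: (kder_dvr_elt CO FC Oz y0 hy).
Qed.

(** In F(x/b) = F(x)/b - (x/b)(F(b)/b) both F(x) and F(b) are again in the centre [M]. *)
Lemma kder_blowup (A : subr K) (M : set K) b l : (forall u, A u -> A (F u)) -> (forall u, M u -> M (F u)) ->
  M b -> b != 0 -> (forall x, x \in l -> M x) -> (forall u, M u -> adj A [seq x / b | x <- l] (u / b)) ->
  forall u, adj A [seq x / b | x <- l] u -> adj A [seq x / b | x <- l] (F u).
Proof.
move=> FA FM Mb b0 lM hM; apply: (kder_adj hF) => // [u Au|_ /mapP[x xl ->]].
  by apply: adj_sub; exact: FA.
rewrite (kder_div _ hF b0).
have -> : (F x - x / b * F b) / b = F x / b - x / b * (F b / b) by rewrite mulrBl mulrA.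
by apply: srB; [|apply: srM]; apply: hM; [apply: FM; exact: lM|exact: lM|exact: FM].
Qed.
End ExtendDerivation.

End DVRBasis.

(** * The normalized blowup *)

Lemma intcl_normal (K : fieldType) (A : subr K) : normalS (intcl A).
Proof. by move=> a s _ _ _; exact: integ_trans. Qed.

Lemma full_integ (K : fieldType) (R : subr K) u : normalS R -> (forall z, fracf R z) -> integ R u -> R u.
Proof. by move=> nR fR; apply: normal_mem. Qed.

Lemma inu_sub (K : fieldType) (O R : subr K) u : (forall v, O v -> R v) -> inu O u -> inu R u.
Proof. by move=> OR [u0 uV]; split=> //; exact: OR. Qed.

(** * Construction of the normalized blowup *)

Section Blowup.
Variables (X : lrspace) (K : fieldType) (g : forall x : X, {rmorphism stalk x -> K}).
Hypothesis Fg : is_function_field g.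
Variable eta : X.
Hypothesis eta_gen : forall W, open W -> W !=set0 -> W eta.
Hypothesis eta_surj : forall u, exists a, g eta a = u.
Variables (k : fieldType) (sX : lrhom X (spec_field k)) (c : {rmorphism k -> K}).
Hypothesis gc : forall x z, g x (pull sX x z) = c z.
Hypothesis ft : finite_type sX.
Hypothesis char0 : forall m, m.+1%:R != 0 :> K.
Hypothesis normalX : forall x, normalS (ostk g x).
Variable z : X.
Hypothesis z_nonfield : exists2 u, nonu (ostk g z) u & u != 0.

Let O := ostk g.
Let k0 := range_subr c.

(** Membership of [y] in the closure of [z]. *)
Definition zspec (y : X) := forall W, open W -> W y -> W z.

Lemma zspec_sub y u : zspec y -> O y u -> O z u.
Proof. by move=> zy /(ostk_open Fg)[V [oV Vy h]]; apply: h; exact: zy. Qed.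

Lemma eta_nzspec : ~ zspec eta.
Proof.
move=> h; have [u [Ou nu] u0] := z_nonfield; apply: nu; split=> //.
by apply: (zspec_sub h); have [a <-] := eta_surj u^-1; exact: range_mem.
Qed.

Lemma nzspec_open : open [set y | ~ zspec y].
Proof.
apply: openE_nbhs => y /existsNP[W /not_implyP[oW /not_implyP[Wy nWz]]].
by exists W; split=> // y' Wy' /(_ W oW Wy').
Qed.

(* The stalks of the ideal sheaf of the closure of z. *)
Definition idl y : set K := [set u | O y u /\ (zspec y -> nonu (O z) u)].

Lemma idl1 y : ~ zspec y -> idl y 1.
Proof. by move=> nz; split=> //; exact: sr1. Qed.

Section ChartIdeal.
Variables (U : set X) (A : subr K).
Hypothesis UA : kchart g U A.
Definition idlA : set K := [set u | A u /\ (U z -> nonu (O z) u)].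

Lemma idlA_ideal : ideal_of A idlA.
Proof.
case: (pselect (U z)) => Uz; last first.
  split; rewrite /idlA /=.
  - by move=> u [].
  - by split=> //; exact: sr0.
  - by move=> u v [Au _] [Av _]; split=> //; exact: srD.
  - by move=> a u Aa [Au _]; split=> //; exact: srM.
have [[h1 h2 h3 h4] _ _] := kc_prime_of Fg UA Uz.
split; rewrite /idlA /=.
- by move=> u [].
- by have [] := h2; split.
- by move=> u v [Au hu] [Av hv]; have [] := h3 u v (conj Au (hu Uz)) (conj Av (hv Uz)); split.
- by move=> a u Aa [Au hu]; have [] := h4 a u Aa (conj Au (hu Uz)); split.
Qed.

Lemma idlA_sub y u : U y -> idlA u -> idl y u.
Proof.
move=> Uy [Au hu]; split; first exact: (kc_sub UA).
by move=> zy; apply: hu; apply: zy => //; exact: (kc_open UA).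
Qed.

Lemma idl_frac y u : U y -> idl y u -> exists a s, [/\ idlA a, A s, inu (O y) s & u = a / s].
Proof.
move=> Uy [Ou hu]; have [a [s [Aa As us eu]]] := kc_frac Fg UA Uy Ou.
case: (pselect (zspec y)) => [zy|nz].
  exists a, s; split=> //; split=> // _; split; first by apply: (zspec_sub zy); exact: (kc_sub UA Uy).
  move=> ua; case: (hu zy) => _; apply; rewrite eu; apply: inuM => //.
  have us' : inu (O z) s by split; [case: us|apply: (zspec_sub zy); case: us].
  by apply: inuV => //; apply: (zspec_sub zy); exact: (kc_sub UA).
case: (pselect (U z)) => Uz; last first.
  by exists a, s; split=> //; split.
have /existsNP[W /not_implyP[oW /not_implyP[Wy nWz]]] := nz.
have [e [Ae ue he]] := kc_refine Fg UA Uy oW Wy.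
exists (a * e), (s * e); split; last by rewrite eu; have := us.1; have := ue.1 => e0 s0; field; rewrite s0 e0.
- split; first exact: srM.
  move=> _; have [[_ _ _ h] _ _] := nonu_prime (ostk_local Fg (x := z)).
  apply: h; first exact: (kc_sub UA).
  by split; [exact: (kc_sub UA)|move=> ue'; apply: nWz; exact: he].
- exact: srM.
- exact: inuM.
Qed.
End ChartIdeal.

(* The points over y are the localizations of the normalized charts
   of the blowup, characterized by minimality without reference to a chart. *)
Definition bpt (y : X) (R : subr K) (b : K) := [/\ localS R /\ normalS R, forall u, O y u -> R u,
  forall u, nonu (O y) u -> nonu R u, [/\ b != 0, idl y b & forall u, idl y u -> R (u / b)]
  & forall R1 : subr K, localS R1 -> normalS R1 -> (forall u, R1 u -> R u) ->
      (forall u, R1 u -> inu R u -> inu R1 u) -> (forall u, O y u -> R1 u) ->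
      (forall u, idl y u -> R1 (u / b)) -> forall u, R u -> R1 u].

(** The local generator [b] is hidden, so that a local ring seen in several charts is a single point
    and no gluing is required. *)
Definition bpts := {yR : X * subr K | exists b, bpt yR.1 yR.2 b}.
Definition bbase (t : bpts) : X := (proj1_sig t).1.
Definition bring (t : bpts) : subr K := (proj1_sig t).2.

Lemma bringP (t : bpts) : exists b, bpt (bbase t) (bring t) b. Proof. by case: t. Qed.
Lemma bring_local (t : bpts) : localS (bring t). Proof. by have [b [[]]] := bringP t. Qed.
Lemma bring_normal (t : bpts) : normalS (bring t). Proof. by have [b [[]]] := bringP t. Qed.
Lemma bring_sub (t : bpts) u : O (bbase t) u -> bring t u. Proof. by have [b [_ h _ _ _]] := bringP t; exact: h. Qed.
Lemma bring_nonu (t : bpts) u : nonu (O (bbase t)) u -> nonu (bring t) u.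
Proof. by have [b [_ _ h _ _]] := bringP t; exact: h. Qed.
Lemma bring_frac (t : bpts) w : fracf (bring t) w.
Proof. by apply: (fracf_mono (A := O (bbase t))); [move=> u; exact: bring_sub|exact: ostk_frac]. Qed.
Lemma bring_inu (t : bpts) u : O (bbase t) u -> (inu (O (bbase t)) u <-> inu (bring t) u).
Proof.
move=> Ou; split; first by apply: inu_sub => v; exact: bring_sub.
by move=> iu; apply: contrapT => n; have [] := bring_nonu (conj Ou n).
Qed.
Lemma bpts_eq (t t' : bpts) : bbase t = bbase t' -> (forall u, bring t u <-> bring t' u) -> t = t'.
Proof.
case: t t' => [[y R] h] [[y' R'] h']; rewrite /bbase /bring /= => e1 /subr_ext e2; subst y' R'.
congr exist; exact: Prop_irrelevance.
Qed.

Definition blow : lrspace := lr_space bbase bring_local.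

Section BlowChart.
Variables (U : set X) (A : subr K).
Hypothesis UA : kchart g U A.
Variable bs : seq K.
Hypothesis ebs : idlA U A = span A bs.
Variable b : K.
Hypothesis bbs : b \in bs.
Hypothesis b0 : b != 0.

Let gens := [seq x / b | x <- bs].
Definition bchart : set blow := [set t | U (bbase t) /\ forall u, u \in gens -> bring t u].
Let B := intcl (adj A gens).

Lemma bs_idl x : x \in bs -> idlA U A x.
Proof. by rewrite ebs; exact: span_mem. Qed.

Lemma idlA_gens (R : subr K) u : (forall a, A a -> R a) -> (forall x, x \in gens -> R x) ->
  idlA U A u -> R (u / b).
Proof.
rewrite ebs => AR gR; apply: (@span_closed K A [set u | R (u / b)]) => //=.
- by rewrite mul0r; exact: sr0.
- by move=> x y hx hy; rewrite mulrDl; exact: srD.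
- by move=> a x Aa hx; rewrite -mulrA; apply: srM => //; exact: AR.
- by move=> x xb; apply: gR; exact: map_f.
Qed.

Lemma B_sub (R : subr K) : normalS R -> (forall w, fracf R w) -> (forall a, A a -> R a) ->
  (forall x, x \in gens -> R x) -> forall u, B u -> R u.
Proof.
move=> nR fR AR gR u hu; apply: full_integ => //; apply: integ_sub hu; exact: adj_min.
Qed.

Lemma AB u : A u -> B u. Proof. by move=> Au; apply: integ_mem; exact: adj_sub. Qed.

Lemma idlB u : idlA U A u -> B (u / b).
Proof. by apply: idlA_gens => [a|x hx]; [exact: AB|apply: integ_mem; exact: adj_mem]. Qed.

Section Point.
Variable t : blow.
Hypothesis Wt : bchart t.
Let y := bbase t.
Let R := bring t.
Let Uy : U y := Wt.1.

Lemma bchart_A a : A a -> R a.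
Proof. by move=> Aa; apply: bring_sub; exact: (kc_sub UA). Qed.

Lemma bchart_B u : B u -> R u.
Proof. apply: B_sub; [exact: bring_normal|exact: bring_frac|exact: bchart_A|exact: Wt.2]. Qed.

Lemma inuA s : A s -> inu (O y) s <-> inu R s.
Proof. by move=> As; apply: bring_inu; exact: (kc_sub UA). Qed.

(** The localization of [B] at the contracted maximal ideal satisfies all conditions of the
    minimality clause of [bpt], for the generator [b1] of that point too, since b1/b is a unit times
    a quotient invertible in [R]. *)
Lemma bchart_frac u : R u -> exists a s, [/\ B a, B s, inu R s & u = a / s].
Proof.
have [b1 [_ _ _ [b10 ib1 hb1] min]] := bringP t; rewrite -/y -/R in ib1 hb1 min.
have pQ : prime_of B [set u | B u /\ nonu R u].
  by apply: (prime_contract bchart_B); apply: nonu_prime; exact: bring_local.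
have nQ s : B s -> inu R s -> ~ [set u | B u /\ nonu R u] s by move=> Bs us [_ [_ /(_ us)]].
have QV s : B s -> inu R s -> loc pQ s^-1 by move=> Bs us; apply: loc_unit => //; exact: nQ.
have Bl v : B v -> loc pQ v by exact: loc_sub.
move=> Ru; suff [a [s [Ba Bs ns ->]]] : loc pQ u.
  exists a, s; split=> //; apply: contrapT => n; apply: ns; split=> //; split=> //; exact: bchart_B.
apply: min Ru.
- exact: loc_local.
- by apply: loc_normal; exact: intcl_normal.
- move=> _ [a [s [Ba Bs ns ->]]]; apply: srM; first exact: bchart_B.
  have Rs := bchart_B Bs.
  have [//|n] := pselect (inu R s); first by case.
  by case: ns; split.
- move=> _ [a [s [Ba Bs ns ->]]] ua; split; first by case: ua.
  have us : inu R s.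
    by apply: contrapT => n; apply: ns; split=> //; split=> //; exact: bchart_B.
  have ua' : inu R a by rewrite -[a](divfK us.1); exact: inuM.
  by rewrite invf_div; apply: srM; [exact: Bl|exact: QV].
- move=> v Ov; have [a [s [Aa As us ->]]] := kc_frac Fg UA Uy Ov.
  by apply: srM; [apply: Bl; exact: AB|apply: QV; [exact: AB|exact/inuA]].
- move=> v /(idl_frac UA Uy)[a' [s' [ia' As' us' ->]]].
  have [a [s [ia As us e1]]] := idl_frac UA Uy ib1.
  have ib : idl y b by apply: (idlA_sub UA) => //; exact: bs_idl.
  have a0 : a != 0 by apply: contraNneq b10 => a0; rewrite e1 a0 mul0r.
  have uab : inu R (a / b).
    have -> : a / b = s * (b1 / b) by rewrite e1; have := us.1 => s0; field; rewrite s0 b0.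
    apply: inuM; first exact/inuA.
    split; first by rewrite mulf_neq0 ?invr_neq0.
    by rewrite invf_div; exact: hb1.
  have -> : a' / s' / b1 = (a' / b) * s'^-1 * s * (a / b)^-1.
    by rewrite e1; have := us.1; have := us'.1 => s'0 s0; field; rewrite s'0 s0 b0 a0.
  apply: srM; last by apply: QV => //; exact: idlB.
  apply: srM; last by apply: Bl; exact: AB.
  by apply: srM; [apply: Bl; exact: idlB|apply: QV; [exact: AB|exact/inuA]].
Qed.
End Point.

Lemma bchart_pt Q (pQ : prime_of B Q) : exists2 t, bchart t & Q = [set u | B u /\ nonu (bring t) u] /\ forall u, bring t u <-> loc pQ u.
Proof.
have [y Uy ey] := kc_prime Fg UA (prime_contract AB pQ).
have nQ s : A s -> inu (O y) s -> ~ Q s.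
  move=> As us Qs; have : [set u | A u /\ Q u] s by [].
  by rewrite ey => -[_ [_]]; apply.
have gl u : idl y u -> loc pQ (u / b).
  move=> /(idl_frac UA Uy)[a [s [ia As us ->]]].
  exists (a / b), s; split; [exact: idlB|exact: AB|exact: nQ|by rewrite mulrAC].
have P : bpt y (loc pQ) b.
  split.
  - by split; [exact: loc_local|apply: loc_normal; exact: intcl_normal].
  - move=> u /(kc_frac Fg UA Uy)[a [s [Aa As us ->]]].
    by exists a, s; split=> //; [exact: AB|exact: AB|exact: nQ].
  - move=> u nu; have [a [s [Aa As us eu]]] := kc_frac Fg UA Uy nu.1.
    apply/loc_nonu; exists a, s; split=> //; [|exact: AB|exact: nQ].
    have : [set u | A u /\ nonu (O y) u] a.
      split=> //; split; first exact: (kc_sub UA).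
      move=> ua; case: (nu) => _; apply; rewrite eu; apply: inuM => //; apply: inuV => //; exact: (kc_sub UA).
    by rewrite -ey => -[].
  - by split=> //; apply: (idlA_sub UA) => //; exact: bs_idl.
  - move=> R1 l1 n1 s1 u1 O1 g1.
    have BR1 v : B v -> R1 v.
      apply: B_sub => //.
      + by move=> w; apply: (fracf_mono (A := O y)) => //; exact: ostk_frac.
      + by move=> a Aa; apply: O1; exact: (kc_sub UA).
      + by move=> x /mapP[x' x'bs ->]; apply: g1; apply: (idlA_sub UA) => //; exact: bs_idl.
    move=> _ [a [s [Ba Bs ns ->]]]; apply: srM; first exact: BR1.
    have [//|_ //] := u1 s (BR1 _ Bs).
    by split; [exact: (prime_neq0 pQ)|exact: loc_unit].
exists (exist _ (y, loc pQ) (ex_intro _ b P) : blow).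
  split=> //= u /mapP[x xb ->]; apply: gl; apply: (idlA_sub UA) => //; exact: bs_idl.
split=> //; apply/seteqP; split=> u /=.
  move=> Qu; have Bu : B u by case: (pQ) => [[h _ _ _] _ _]; exact: h.
  by split=> //; exact: (loc_contract pQ Bu).2 Qu.
by move=> [Bu nu]; exact: (loc_contract pQ Bu).1 nu.
Qed.

Lemma bchart_open : open bchart.
Proof.
apply: base_open; exists U, gens; split; first exact: (kc_open UA).
by [].
Qed.

Lemma blow_chart : exists phi : sub_of B -> forall t : blow, stalk t,
  affine_chart bchart phi /\ forall t b, bchart t -> val (phi b t : sub_of (bring t)) = val b.
Proof.
apply: (@lr_chart K X bpts bbase bring bring_local bchart B).
- exact: bchart_open.
- by move=> t Wt u; exact: bchart_B.
- by move=> t Wt u; exact: bchart_frac.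
- by move=> P pP; have [t Wt [e _]] := bchart_pt pP; exists t.
- move=> t t' Wt Wt' h.
  have ey : bbase t = bbase t'.
    apply: (kc_uniq Fg UA Wt.1 Wt'.1) => u Au.
    by rewrite (inuA Wt Au) (inuA Wt' Au); apply: h; exact: AB.
  apply: bpts_eq => // u; split=> /bchart_frac[] // a [s [Ba Bs us ->]].
    by apply: srM; [exact: (bchart_B Wt')|case: ((h s Bs).1 us)].
  by apply: srM; [exact: (bchart_B Wt)|case: ((h s Bs).2 us)].
- move=> t V Wt oV Vt; have [s [As us hs]] := kc_refine Fg UA Wt.1 oV Vt.
  exists s; split; [exact: AB|exact/(inuA Wt)|].
  by move=> t' Wt' us'; apply: hs; [exact: Wt'.1|exact/(inuA Wt')].
Qed.
End BlowChart.

(** Dividing b1 = sum of e_i bs_i / s by [b1] writes 1 as a combination of the bs_i/b1 in a local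
    ring, so one of these is a unit. *)
Lemma bchart_cover U A bs (t : blow) : kchart g U A -> idlA U A = span A bs -> U (bbase t) ->
  exists2 b, b \in bs & b != 0 /\ bchart U bs b t.
Proof.
move=> UA ebs Uy.
have [b1 [_ _ _ [b10 ib1 hb1] _]] := bringP t.
have [a [s [ia As us e1]]] := idl_frac UA Uy ib1.
have := ia; rewrite ebs => /span_sumP[e he ea].
have Rb x : x \in bs -> bring t (x / b1).
  by move=> xb; apply: hb1; apply: (idlA_sub UA) => //; rewrite ebs; exact: span_mem.
have mloc := bring_local (t := t); have [[_ m0 mD mM] m1 _] := nonu_prime mloc.
have [i nui] : exists i : 'I_(size bs), inu (bring t) (bs`_i / b1).
  apply: contrapT => /forallNP n; apply: m1.
  have -> : 1 = \sum_(i < size bs) (e i / s) * (bs`_i / b1).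
    have -> : 1 = a / s / b1 :> K by rewrite -e1 divff.
    rewrite ea !big_distrl /=; apply: eq_bigr => i _; have := us.1 => s0; field; by rewrite s0 b10.
  elim/big_ind: _ => // i _; apply: mM.
    by apply: bring_sub; apply: srM; [exact: (kc_sub UA)|case: us].
  by split; [apply: Rb; exact: mem_nth|exact: n].
have bi : bs`_i \in bs by exact: mem_nth.
have bi0 : bs`_i != 0 by have := nui.1; rewrite mulf_eq0 negb_or => /andP[].
exists bs`_i => //; split=> //; split=> // _ /mapP[x xb ->].
have -> : x / bs`_i = (x / b1) * (bs`_i / b1)^-1 by field; rewrite b10 bi0.
by apply: srM; [exact: Rb|case: nui].
Qed.

Lemma good_chart y : exists U l bs, [/\ U y, kchart g U (adj k0 l), noeth (adj k0 l) &
  idlA U (adj k0 l) = span (adj k0 l) bs].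
Proof.
have [U [l [Uy UA]]] := finite_chart Fg gc ft y.
have nA : noeth (adj k0 l) by apply: hilbert_basis; apply: noeth_field => u ku _; exact: range_field.
have [bs e] := nA _ (idlA_ideal UA).
by exists U, l, bs.
Qed.

Lemma blow_scheme : scheme blow.
Proof.
move=> t; have [U [l [bs [Uy UA nA e]]]] := good_chart (bbase t).
have [b bb [b0 Wt]] := bchart_cover UA e Uy.
have [phi [ch _]] := blow_chart UA e bb b0.
by exists (bchart U bs b), (sub_of (intcl (adj (adj k0 l) [seq x / b | x <- bs]))), phi.
Qed.

Lemma blow_pt y R b : bpt y R b -> exists t : blow, bbase t = y /\ bring t = R.
Proof. by move=> P; exists (exist _ (y, R) (ex_intro _ b P)). Qed.

Lemma blow_gen : exists t : blow, [/\ bbase t = eta, forall u, bring t u & forall W : set blow, open W -> W !=set0 -> W t].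
Proof.
have all_eta u : O eta u by have [a <-] := eta_surj u; exact: range_mem.
have [t [et eR]] : exists t : blow, bbase t = eta /\ bring t = subr_full K.
  apply: (@blow_pt eta (subr_full K) 1); split=> //.
  - by split=> // u v [_ nu] [_ nv]; split=> // n; apply: nu; split=> //; apply: contra_notN nv => /eqP u0; move: n; rewrite u0 add0r.
  - move=> u [_ nu]; split=> // -[u0 _]; apply: nu; split=> //.
  - split=> //; [exact: oner_neq0|exact: idl1 eta_nzspec].
  - by move=> R1 _ _ _ _ h _ u _; exact: h.
exists t; split=> //; first by rewrite eR.
move=> W /base_openP oW [x Wx]; have [_ [[V [F [oV ->]]] [Vx _] h]] := oW x Wx.
apply: h; split; first by rewrite et; apply: eta_gen => //; exists (bbase x).
by move=> u _; rewrite eR.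
Qed.

Lemma blow_const (U : set blow) (s : forall t : blow, stalk t) (t t' : blow) : open U -> reg U s -> U t -> U t' ->
  val (s t : sub_of (bring t)) = val (s t' : sub_of (bring t')).
Proof.
have [e [_ _ eg]] := blow_gen.
move=> oU /lr_reg rs.
suff h x : U x -> val (s x : sub_of (bring x)) = val (s e : sub_of (bring e)) by move=> Ut Ut'; rewrite (h t) // (h t').
move=> Ux; have [V [u [oV Vx hV]]] := rs x Ux.
have Ue : U e by apply: eg => //; exists x.
have Ve : V e by apply: eg => //; exists x.
by rewrite (hV x) // (hV e).
Qed.

Lemma blow_integral : integral_scheme blow.
Proof.
have [e [_ _ eg]] := blow_gen; split; first by exists e.
move=> U s t oU U0 rs rt st; have Ue : U e by exact: eg.
have := congr1 (val : sub_of (bring e) -> K) (st e Ue); rewrite sub_valM sub_val0 => /eqP.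
rewrite mulf_eq0 => /orP[] /eqP h; [left|right] => x Ux; apply: val_inj.
  by rewrite (blow_const oU rs Ux Ue) h.
by rewrite (blow_const oU rt Ux Ue) h.
Qed.

Definition gblow (t : blow) : {rmorphism stalk t -> K} := (val : sub_of (bring t) -> K).

Lemma gblow_frac t : is_fraction_field (gblow t).
Proof.
split; first exact: val_inj.
move=> u; have [a [s [Ra Rs s0 e]]] := bring_frac t u.
by exists (mk_sub Ra), (mk_sub Rs).
Qed.

Lemma blow_function_field : is_function_field gblow.
Proof. by split; [exact: gblow_frac|move=> U s t t' oU rs Ut Ut'; exact: (blow_const oU rs Ut Ut')]. Qed.

Lemma blow_normal : normal_scheme blow.
Proof.
move=> t; exists K, (gblow t); split; first exact: gblow_frac.
move=> u /integ_over iu.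
have Ru : bring t u by apply: full_integ iu; [exact: bring_normal|exact: bring_frac].
by exists (mk_sub Ru).
Qed.

Lemma blow_map : exists p : lrhom blow X, (forall t, p t = bbase t) /\
  forall t (s : forall x : X, stalk x), val (pull p t (s (p t)) : sub_of (bring t)) = g (bbase t) (s (bbase t)).
Proof.
have gR (t : blow) a : bring t (g (bbase t) a) by apply: bring_sub; exact: range_mem.
pose q (t : blow) (a : stalk (bbase t)) : sub_of (bring t) := mk_sub (gR t a).
have qr t : is_rmorphism (q t).
  split; first by move=> a b; apply: val_inj; rewrite sub_valB /= rmorphB.
  by split; [apply: val_inj; rewrite /= rmorph1|move=> a b; apply: val_inj; rewrite sub_valM /= rmorphM].
pose pl t := projT1 (cid (rmorph_of (qr t))).
have plE t a : val (pl t a) = g (bbase t) a by rewrite /pl; case: (cid _) => f fE /=; rewrite fE.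
have pc : continuous (bbase : blow -> X).
  by apply/continuousP => W oW; exact: lr_open_base.
have preg (W : set X) s : open W -> reg W s -> reg (bbase @^-1` W : set blow) (fun t => pl t (s (bbase t))).
  move=> oW rs; apply: (iffLR (lr_reg _ _)) => t Wt; exists (bbase @^-1` W), (g (bbase t) (s (bbase t))); split=> //.
    exact: lr_open_base.
  by move=> t' Wt' _; rewrite plE; exact: (Fg.2 W).
have ploc (t : blow) a : pl t a \is a GRing.unit -> a \is a GRing.unit.
  move=> /sub_unit_inu; rewrite plE => iu.
  by apply/(inu_range (g_inj Fg (x := bbase t))); apply/bring_inu => //; exact: range_mem.
by exists (@LRHom blow X bbase pl pc preg ploc).
Qed.

End Blowup.

Lemma adj_cat (K : fieldType) (A : subr K) s1 s2 : adj A (s1 ++ s2) = adj (adj A s2) s1.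
Proof. by elim: s1 => //= b s1 ->. Qed.

(** The conductor [d] times the integral closure is an ideal of the noetherian ring k0[s]; dividing
    its generators by [d] generates the closure. *)
Lemma intcl_finite (K : fieldType) (k0 : subr K) s : (forall m, m.+1%:R != 0 :> K) -> (forall u, k0 u -> k0 u^-1) ->
  (forall w, fracf (adj k0 s) w) -> exists s', (forall x, x \in s' -> intcl (adj k0 s) x) /\
    forall u, intcl (adj k0 s) u -> adj (adj k0 s) s' u.
Proof.
move=> char0 ki fr; have [d [d0 Ad hd]] := conductor char0 s ki.
have nA : noeth (adj k0 s) by apply: hilbert_basis; apply: noeth_field => u ku _; exact: ki.
have [|l el] := nA [set v | exists2 u, integ (adj k0 s) u & v = d * u].
  split.
  - by move=> _ [u iu ->]; exact: hd.
  - by exists 0; [apply: integ_mem; exact: sr0|rewrite mulr0].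
  - by move=> _ _ [u iu ->] [v iv ->]; exists (u + v); [exact: (@srD _ (intcl (adj k0 s)))|rewrite mulrDr].
  - move=> a _ Aa [u iu ->]; exists (a * u); last by rewrite mulrCA.
    by apply: (@srM _ (intcl (adj k0 s))) => //; exact: integ_mem.
exists [seq x / d | x <- l]; split.
  move=> _ /mapP[x xl ->]; have : span (adj k0 s) l x by exact: span_mem.
  by rewrite -el => -[u iu ->]; rewrite mulrC mulKf.
move=> u iu; have : span (adj k0 s) l (d * u) by rewrite -el; exists u.
move=> sp; suff H v : span (adj k0 s) l v -> adj (adj k0 s) [seq x / d | x <- l] (v / d).
  by have := H _ sp; rewrite mulrAC divff // mul1r.
move: v; apply: (@span_closed K (adj k0 s) [set v | adj (adj k0 s) [seq x / d | x <- l] (v / d)]) => //=.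
- by rewrite mul0r; exact: sr0.
- by move=> x y hx hy; rewrite mulrDl; exact: srD.
- by move=> a x Aa hx; rewrite -mulrA; apply: srM => //; exact: adj_sub.
- by move=> x xl; apply: adj_mem; exact: map_f.
Qed.

(** * The blowup map is of finite type and birational *)

Section BlowMap.
Variables (X : lrspace) (K : fieldType) (g : forall x : X, {rmorphism stalk x -> K}).
Hypothesis Fg : is_function_field g.
Variable eta : X.
Hypothesis eta_gen : forall W, open W -> W !=set0 -> W eta.
Hypothesis eta_surj : forall u, exists a, g eta a = u.
Variables (k : fieldType) (sX : lrhom X (spec_field k)) (c : {rmorphism k -> K}).
Hypothesis gc : forall x z, g x (pull sX x z) = c z.
Hypothesis ft : finite_type sX.
Hypothesis char0 : forall m, m.+1%:R != 0 :> K.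
Hypothesis normalX : forall x, normalS (ostk g x).
Variable z : X.
Hypothesis z_nonfield : exists2 u, nonu (ostk g z) u & u != 0.
Variable p : lrhom (blow g z) X.
Hypothesis p1 : forall t, p t = bbase t.
Hypothesis p2 : forall t (s : forall x : X, stalk x),
  val (pull p t (s (p t)) : sub_of (bring t)) = g (bbase t) (s (bbase t)).

Theorem blow_finite : finite_type p.
Proof.
move=> y; have [U [l [bs [Uy UA nA ebs]]]] := good_chart Fg gc ft z y.
have [_ [Bx [psi [ch hA]]]] := UA.
have [f fE] := chart_phi ch Uy.
pose A := adj (range_subr c) l.
have Akv a : A (g y (f a)).
  apply/hA; exists a => x Ux; rewrite fE; apply: (Fg.2 U) => //; [exact: chart_open ch|exact: chart_reg_phi].
exists U, Bx, psi; split=> //.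
pose bs' := [seq b <- bs | b != 0].
exists (size bs'), (fun i => bchart (g := g) (z := z) U bs bs'`_i); split.
  apply/seteqP; split=> [t|t [i _ [Ut _]]]; last by rewrite /preimage /= p1.
  rewrite /preimage /= p1 => Ut; have [b bb [b0 Wt]] := bchart_cover Fg UA ebs Ut.
  have bb' : b \in bs' by rewrite mem_filter b0.
  have ib : (index b bs' < size bs')%N by rewrite index_mem.
  by exists (Ordinal ib) => //=; rewrite nth_index.
move=> i; set b := bs'`_i.
have : b \in bs' by exact: mem_nth.
rewrite mem_filter => /andP[b0 bb].
have [phi [chB phiE]] := blow_chart Fg UA ebs bb b0.
set C := adj _ _ in phi chB phiE.
have BA u : A u -> intcl C u by move=> Au; apply: integ_mem; exact: adj_sub.
pose h a : sub_of (intcl C) := mk_sub (BA _ (Akv a)).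
have [|h' hE] := @rmorph_of _ _ h.
  split; first by move=> a a'; apply: val_inj; rewrite sub_valB /= !rmorphB.
  by split; [apply: val_inj; rewrite /= !rmorph1|move=> a a'; apply: val_inj; rewrite sub_valM /= !rmorphM].
exists (sub_of (intcl C)), phi, h'; split=> //.
  move=> a t Wt; apply: val_inj; rewrite phiE // hE p2 /= fE.
  apply: (Fg.2 U) => //; [exact: chart_open ch|exact: chart_reg_phi|exact: Wt.1].
have eC : C = adj (range_subr c) ([seq x / b | x <- bs] ++ l) by rewrite adj_cat.
have [||s' [s'C hs']] := @intcl_finite K (range_subr c) ([seq x / b | x <- bs] ++ l) char0.
- by move=> u; exact: range_field.
- rewrite -eC => w; apply: (fracf_mono (A := A)); last exact: (kc_full Fg UA).
  by move=> u; exact: adj_sub.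
rewrite -eC in s'C hs'.
pose gn := [seq x / b | x <- bs] ++ s'.
have gnC (j : 'I_(size gn)) : intcl C gn`_j.
  have : gn`_j \in gn by exact: mem_nth.
  rewrite mem_cat => /orP[h1|/s'C//]; apply: integ_mem; exact: adj_mem.
exists (size gn), (fun j => mk_sub (gnC j)) => S rS gS SB SM.
have S1 : S 1 by apply: rS; exists 1; rewrite ?rmorph1.
have [T TE] : exists T : subr K, forall u, T u <-> exists2 a : sub_of (intcl C), S a & val a = u.
  have @T : subr K.
    exists [set u | exists2 a : sub_of (intcl C), S a & val a = u].
    - by exists 1.
    - by move=> _ _ [a Sa <-] [a' Sa' <-]; exists (a - a'); [exact: SB|rewrite sub_valB].
    - by move=> _ _ [a Sa <-] [a' Sa' <-]; exists (a * a'); [exact: SM|rewrite sub_valM].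
  by exists T.
have Tg x : x \in gn -> T x.
  move=> xg; apply/TE; have ix : (index x gn < size gn)%N by rewrite index_mem.
  by exists (mk_sub (gnC (Ordinal ix))); [exact: gS|rewrite /= nth_index].
have TA u : A u -> T u.
  move=> Au; apply/TE; have [a ha] := (hA u).1 Au; exists (h' a); first by apply: rS; exists a.
  by rewrite hE /= fE ha.
have TC u : C u -> T u.
  by apply: (@adj_min K A T) => // x xb; apply: Tg; rewrite mem_cat xb.
apply/seteqP; split=> // a _.
have : T (val a).
  apply: (@adj_min K C T s' TC) => //; first by move=> x xs; apply: Tg; rewrite mem_cat xs orbT.
  by apply: hs'; exact: sub_valP.
by move=> /TE[a' Sa' /val_inj <-].
Qed.

(** Off the closure of [z] the ideal contains 1, so [b] is a unit and minimality compares the point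
    with the stalk itself. *)
Lemma bring_trivial (t : blow g z) : ~ zspec z (bbase t) -> forall u, bring t u -> ostk g (bbase t) u.
Proof.
move=> nz; have [b [_ h1 h2 [b0 ib hb] min]] := bringP t.
have i1 := idl1 g nz.
have bu : inu (ostk g (bbase t)) b.
  apply/bring_inu; first by case: ib.
  by split=> //; have := hb 1 i1; rewrite div1r.
apply: min => //; [exact: ostk_local|by move=> u; case: (bu) => _ bV Ou iu; exact/bring_inu|].
by move=> u [Ou _]; apply: srM => //; case: bu.
Qed.

Theorem blow_birational : birational p.
Proof.
have [e [ee _ eg]] := blow_gen Fg eta_gen eta_surj z_nonfield.
have enz : ~ zspec z eta by exact: (eta_nzspec Fg eta_surj z_nonfield).
have oV := nzspec_open z.
have sec y : ~ zspec z y -> exists t : blow g z, bbase t = y /\ bring t = ostk g y.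
  move=> nz; apply: (@blow_pt _ _ g z y (ostk g y) 1); split=> //.
  - by split; [exact: ostk_local|exact: normalX].
  - by split; [exact: oner_neq0|exact: idl1|move=> u [Ou _]; rewrite divr1].
exists [set t | ~ zspec z (bbase t)], [set y | ~ zspec z y]; split.
- split; first exact: (@lr_open_base K X (bpts g z) (bbase (z := z)) (bring (z := z)) [set y | ~ zspec z y] oV).
  by move=> W W0 oW; exists e; split; [exact: eg|rewrite /= ee].
- by split=> // W W0 oW; exists eta; split=> //; exact: eta_gen.
- split.
  + by move=> t /=; rewrite p1.
  + move=> t t' /set_mem /= nt /set_mem /= nt'; rewrite !p1 => ey; apply: bpts_eq => // u.
    split=> [/(bring_trivial nt)|/(bring_trivial nt')]; first by rewrite ey; exact: bring_sub.
    by rewrite -ey; exact: bring_sub.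
  + by move=> y ny; have [t [et _]] := sec y ny; exists t; rewrite /= ?p1 et.
- move=> W oW WU; apply: openE_nbhs => _ [t Wt <-]; rewrite p1.
  have nt := WU t Wt.
  have [_ [[V [F [oV' ->]]] [Vt Ft] h]] := (base_openP W).1 oW t Wt.
  have [|V' [oV'' V't hV']] := ostk_open_seq Fg (x := bbase t) (l := F).
    by move=> u uF; apply: bring_trivial => //; exact: Ft.
  exists (V `&` V' `&` [set y | ~ zspec z y]); split=> //; first by do 2 apply: openI => //.
  move=> y [[Vy V'y] ny]; have [t' [et' er']] := sec y ny.
  exists t'; last by rewrite p1.
  by apply: h; split; [rewrite et'|move=> u uF; rewrite er'; exact: hV'].
- move=> t nt.
  have /choice[q hq] : forall b : stalk t, exists a : stalk (p t), pull p t a = b.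
    move=> b; have : ostk g (bbase t) (val (b : sub_of (bring t))) by apply: bring_trivial => //; exact: sub_valP.
    move=> [a _ ea]; have [s es] := family_at a.
    by exists (s (p t)); apply: val_inj; rewrite p2 es.
  exists q => // a; have [s sa] := family_at a; have [s' sa'] := family_at (q (pull p t a)).
  have e1 := p2 t s; have e2 := p2 t s'; rewrite sa in e1; rewrite sa' hq e1 in e2.
  have := g_inj Fg e2; rewrite -(p1 t) sa sa'; exact: esym.
Qed.

End BlowMap.

Lemma spec_field_scheme (k : fieldType) : scheme (spec_field k).
Proof.
move=> x; exists setT, k, (fun a (_ : spec_field k) => a); split=> //.
have one y : y = x by case: y; case: x.
split.
- exact: openT.
- by move=> y _; split.
- move=> P [[P0 _] PM P1 _]; exists x; split; last by move=> y _; rewrite (one y).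
  split=> //; apply/seteqP; split=> a /=; rewrite unitfE negbK.
    by move=> Pa; apply: contrapT => /negP a0; apply: P1; rewrite -(mulVf a0); exact: PM.
  by move=> /eqP->.
- move=> W _; split=> [_ y Wy|_].
    by exists 1; split=> [|y' _ _]; [exact: unitr1|rewrite (one y') -(one y)].
  apply: openE_nbhs => y Wy; exists W; split=> //.
  have [-> //|W0] := pselect (W = setT); last by case: W0; apply/seteqP; split=> // y' _; rewrite (one y') -(one y).
- by move=> y _ b; exists b, 1; rewrite unitr1 divr1.
- by move=> y _ a /= ->; exists 1; rewrite unitr1 mulr0.
- move=> W s oW _; split=> // _ y Wy; exists W, (s y), 1; split=> // y' Wy'.
  by rewrite unitr1 divr1; have -> : y' = y by rewrite (one y') (one y).
Qed.

(** * The blowup map is separated *)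

Section Separated.
Variables (X : lrspace) (K : fieldType) (g : forall x : X, {rmorphism stalk x -> K}).
Hypothesis Fg : is_function_field g.
Variables (k : fieldType) (sX : lrhom X (spec_field k)) (c : {rmorphism k -> K}).
Hypothesis gc : forall x z, g x (pull sX x z) = c z.
Hypothesis ft : finite_type sX.
Variable z : X.
Variable p : lrhom (blow g z) X.
Hypothesis p1 : forall t, p t = bbase t.
Hypothesis p2 : forall t (s : forall x : X, stalk x),
  val (pull p t (s (p t)) : sub_of (bring t)) = g (bbase t) (s (bbase t)).

(** [r1] and [r2] stand for evaluation in a common residue field. Applied to (b2/b1)(b1/b2) = 1, the
    last hypothesis makes b1/b2 a unit at [t2], so both points lie in one chart; applied to
    numerators and denominators it compares units. *)
Lemma bring_same_chart (t1 t2 : blow g z) U A bs b1 b2 (L : fieldType) (r1 r2 : K -> L) :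
  kchart g U A -> idlA g z U A = span A bs -> b1 \in bs -> b1 != 0 -> b2 \in bs -> b2 != 0 ->
  bchart U bs b1 t1 -> bchart U bs b2 t2 ->
  let B b := intcl (adj A [seq x / b | x <- bs]) in
  (forall u, bring t1 u -> (r1 u != 0 <-> inu (bring t1) u)) ->
  (forall u, bring t2 u -> (r2 u != 0 <-> inu (bring t2) u)) ->
  (forall x1 y1 x2 y2, B b1 x1 -> B b1 y1 -> B b2 x2 -> B b2 y2 -> x1 * x2 = y1 * y2 -> r1 x1 * r2 x2 = r1 y1 * r2 y2) ->
  forall w, bring t1 w -> bring t2 w.
Proof.
move=> UA ebs b1b b10 b2b b20 W1 W2 B h1 h2 rel.
have B1t := bchart_B Fg UA W1; have B2t := bchart_B Fg UA W2.
have B1 b : B b 1 by exact: sr1.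
have n1 : r1 1 != 0 by apply/h1; [exact: sr1|exact: inu1].
have n2 : r2 1 != 0 by apply/h2; [exact: sr1|exact: inu1].
have gB b x : x \in bs -> B b (x / b) by move=> xb; apply: integ_mem; apply: adj_mem; exact: map_f.
have u12 : inu (bring t2) (b1 / b2).
  apply/h2; first by apply: B2t; exact: gB.
  have e : b2 / b1 * (b1 / b2) = 1 * 1 by field; rewrite b10 b20.
  have := rel _ _ _ _ (gB b1 b2 b2b) (B1 b1) (gB b2 b1 b1b) (B1 b2) e => e'.
  by have := mulf_neq0 n1 n2; rewrite -e' mulf_eq0 negb_or => /andP[].
have BB u : B b1 u -> bring t2 u.
  apply: B_sub; [exact: bring_normal|exact: bring_frac|exact: (bchart_A UA W2)|].
  move=> _ /mapP[x xb ->].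
  have -> : x / b1 = (x / b2) * (b1 / b2)^-1 by field; rewrite b10 b20.
  by apply: srM; [apply: B2t; exact: gB|case: u12].
move=> w /(bchart_frac Fg UA ebs b1b b10 W1)[a [s [Ba Bs us ->]]].
apply: srM; first exact: BB.
suff [] : inu (bring t2) s by [].
have [a' [s' [Ba' Bs' us' e]]] := bchart_frac Fg UA ebs b2b b20 W2 (BB s Bs).
rewrite e; apply: inuM; last by apply: inuV => //; exact: B2t.
apply/h2; first exact: B2t.
have e2 : s * s' = 1 * a' by rewrite e divfK ?mul1r //; case: us'.
have := rel _ _ _ _ Bs (B1 b1) Bs' Ba' e2 => e3.
have : r1 s * r2 s' != 0.
  by apply: mulf_neq0; [apply/h1 => //; exact: B1t|apply/h2 => //; exact: B2t].
by rewrite e3 mulf_eq0 negb_or => /andP[].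
Qed.

Theorem blow_separated : Defs.separated p.
Proof.
move=> P pr1 pr2 d pb e1 e2.
have pt1 t : pr1 (d t) = t := (lrhom_eqE e1).1 t.
have pt2 t : pr2 (d t) = t := (lrhom_eqE e2).1 t.
have pl1 t (s : forall t : blow g z, stalk t) : pull d t (pull pr1 (d t) (s (pr1 (d t)))) = s t := (lrhom_eqE e1).2 t s.
have pl2 t (s : forall t : blow g z, stalk t) : pull d t (pull pr2 (d t) (s (pr2 (d t)))) = s t := (lrhom_eqE e2).2 t s.
split; last first.
- by move=> t b; have [s <-] := family_at b; exists (pull pr1 (d t) (s (pr1 (d t)))).
- move=> U oU; exists (pr1 @^-1` U).
    by apply: open_comp => // x _; exact: hom_continuous.
  by apply/seteqP; split=> t; rewrite /preimage /= pt1.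
- by move=> t t' /(congr1 pr1); rewrite !pt1.
suff main y : (forall V, open V -> V y -> exists t, V (d t)) -> range d y.
  rewrite -openC; apply: openE_nbhs => y ny; apply: contrapT => h; apply: ny; apply: main => V oV Vy.
  apply: contrapT => n; apply: h; exists V; split=> // x Vx [t _ ex]; apply: n; exists t; by rewrite ex.
move=> near.
have [_ sq _] := pb.
have [L [r hr]] := residue_point y.
have rl a : r a != 0 -> a \is a GRing.unit by move=> /eqP n; apply: contraT => /hr.
have [j [jy jp]] := point_hom rl.
have sqy : bbase (pr1 y) = bbase (pr2 y) by rewrite -!p1; exact: (lrhom_eqE sq).1 y.
have [U [l [bs [Uy UA nA ebs]]]] := good_chart Fg gc ft z (bbase (pr1 y)).
set A := adj _ _ in UA nA ebs.
pose ev (f : lrhom P (blow g z)) (u : K) : L := r (pull f y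
  (if pselect (bring (f y) u) is left h then mk_sub h else 0 : sub_of (bring (f y)))).
have evE (f : lrhom P (blow g z)) (s : forall t, stalk t) u : val (s (f y) : sub_of (bring (f y))) = u ->
    r (pull f y (s (f y))) = ev f u.
  move=> <-; rewrite /ev; case: pselect => [h|[]]; last exact: sub_valP.
  by congr (r (pull f y _)); apply: val_inj.
have evu (f : lrhom P (blow g z)) u : bring (f y) u -> (ev f u != 0 <-> inu (bring (f y)) u).
  move=> Ru; rewrite /ev; case: pselect => // h; split.
    by move=> /rl /hom_local /sub_unit_inu.
  move=> iu; have : mk_sub h \is a GRing.unit by apply/sub_unit_inu.
  by move=> /(rmorph_unit (pull f y))/(rmorph_unit r); rewrite unitfE.
have rel b1 b2 : b1 \in bs -> b1 != 0 -> b2 \in bs -> b2 != 0 -> bchart U bs b1 (pr1 y) -> bchart U bs b2 (pr2 y) ->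
  let B b := intcl (adj A [seq x / b | x <- bs]) in
  forall x1 y1 x2 y2, B b1 x1 -> B b1 y1 -> B b2 x2 -> B b2 y2 -> x1 * x2 = y1 * y2 ->
    ev pr1 x1 * ev pr2 x2 = ev pr1 y1 * ev pr2 y2.
  move=> b1b b10 b2b b20 W1 W2 B x1 y1 x2 y2 Bx1 By1 Bx2 By2 e.
  have [phi1 [ch1 phi1E]] := blow_chart Fg UA ebs b1b b10.
  have [phi2 [ch2 phi2E]] := blow_chart Fg UA ebs b2b b20.
  rewrite -(evE pr1 (phi1 (mk_sub Bx1))) ?phi1E // -(evE pr1 (phi1 (mk_sub By1))) ?phi1E //.
  rewrite -(evE pr2 (phi2 (mk_sub Bx2))) ?phi2E // -(evE pr2 (phi2 (mk_sub By2))) ?phi2E //.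
  (* If the difference were invertible at [y], it would be so on a neighbourhood, which meets the
     diagonal; there it pulls back to x1 x2 - y1 y2 = 0. *)
  apply/eqP; rewrite -subr_eq0; apply: contraT; rewrite -!rmorphM -rmorphB => /rl ut.
  pose G := pr1 @^-1` (bchart U bs b1) `&` pr2 @^-1` (bchart U bs b2).
  have oW1 : open (pr1 @^-1` (bchart U bs b1)).
    by apply: open_comp; [move=> x _; exact: hom_continuous|exact: chart_open ch1].
  have oW2 : open (pr2 @^-1` (bchart U bs b2)).
    by apply: open_comp; [move=> x _; exact: hom_continuous|exact: chart_open ch2].
  have oG : open G by exact: openI.
  have rg1 v : reg G (fun x => pull pr1 x (phi1 v (pr1 x))).
    apply: (reg_sub oW1) => // [x []//|].
    exact: (@hom_reg _ _ pr1 _ _ (chart_open ch1) (chart_reg_phi ch1 v)).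
  have rg2 v : reg G (fun x => pull pr2 x (phi2 v (pr2 x))).
    apply: (reg_sub oW2) => // [x []//|].
    exact: (@hom_reg _ _ pr2 _ _ (chart_open ch2) (chart_reg_phi ch2 v)).
  have rt := regB oG (regM oG (rg1 (mk_sub Bx1)) (rg2 (mk_sub Bx2))) (regM oG (rg1 (mk_sub By1)) (rg2 (mk_sub By2))).
  have [oD _] := reg_unit oG rt.
  have [|t [[Gt1 Gt2] /= ut']] := near _ oD; first by split.
  have := rmorph_unit (pull d t) ut'.
  rewrite rmorphB !rmorphM !pl1 !pl2 => ut2; have := unit_neq0 ut2.
  rewrite /preimage /= pt1 in Gt1; rewrite /preimage /= pt2 in Gt2.
  by case/eqP; apply: val_inj; rewrite sub_valB !sub_valM !phi1E // !phi2E //= e subrr.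
have [b1 b1b [b10 W1]] := bchart_cover Fg UA ebs Uy.
have Uy2 : U (bbase (pr2 y)) by rewrite -sqy.
have [b2 b2b [b20 W2]] := bchart_cover Fg UA ebs Uy2.
have et : pr1 y = pr2 y.
  apply: bpts_eq => // u; split.
    apply: (bring_same_chart UA ebs b1b b10 b2b b20 W1 W2 (evu pr1) (evu pr2)); exact: rel.
  apply: (bring_same_chart UA ebs b2b b20 b1b b10 W2 W1 (evu pr2) (evu pr1)) => x1 y1 x2 y2 h1 h2 h3 h4 e.
  rewrite [LHS]mulrC [RHS]mulrC; apply: (rel b1 b2) => //; by rewrite mulrC e mulrC.
have W2' : bchart U bs b1 (pr2 y) by rewrite -et.
have [phi1 [ch1 phi1E]] := blow_chart Fg UA ebs b1b b10.
have ej : hom_comp pr1 j = hom_comp pr2 j.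
  apply: (affine_hom_uniq ch1) => [t|t|t v]; rewrite /= ?jy //.
  rewrite (jp t (fun x => pull pr1 x (phi1 v (pr1 x)))) (jp t (fun x => pull pr2 x (phi1 v (pr2 x)))).
  rewrite (evE pr1 (phi1 v) (val v)) ?phi1E // (evE pr2 (phi1 v) (val v)) ?phi1E //.
  have B1 : intcl (adj A [seq x / b1 | x <- bs]) 1 by exact: sr1.
  have Bv := sub_valP v.
  have one f : ev f 1 = 1.
    rewrite -(evE f (fun=> 1)) ?rmorph1 //.
  have e1' : val v * 1 = 1 * val v by rewrite mulr1 mul1r.
  by have := rel b1 b1 b1b b10 b1b b10 W1 W2' _ _ _ _ Bv B1 B1 Bv e1'; rewrite !one mulr1 mul1r.
exists (pr1 (j tt)) => //.
(* The two projections of the point [j] agree, so by uniqueness of maps into the fibre product [j]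
   factors through the diagonal. *)
have : hom_comp d (hom_comp pr1 j) = j.
  apply: (pullback_eq pb (@spec_field_scheme L)).
    by rewrite hom_compA e1 hom_comp1l.
  by rewrite hom_compA e2 hom_comp1l.
by move=> /lrhom_eqE[/(_ tt) h _]; rewrite -(jy tt) -[RHS]h.
Qed.

End Separated.

Lemma valring_local (K : fieldType) (V : subr K) : valring V -> localS V.
Proof.
move=> vV.
have one u v : V u -> ~ inu V v -> v != 0 -> V v -> V (u / v) -> nonu V (u + v).
  move=> Vu nv v0 Vv Vuv; split; first exact: srD.
  have -> : u + v = v * (u / v + 1) by field.
  by move=> iu; apply: nv; apply: inuMl iu => //; apply: srD => //; exact: sr1.
move=> u v [Vu nu] [Vv nv].
have [->|u0] := eqVneq u 0; first by rewrite add0r.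
have [->|v0] := eqVneq v 0; first by rewrite addr0.
have [h|h] := vV (u / v) (mulf_neq0 u0 (invr_neq0 v0)); first exact: one.
by rewrite addrC; apply: one => //; rewrite -invf_div.
Qed.

Lemma residue_points (P : lrspace) : exists (k : P -> fieldType) (r : forall x, {rmorphism stalk x -> k x})
    (j : forall x, lrhom (spec_field (k x)) P),
  forall x, [/\ forall a, r x a = 0 <-> a \isn't a GRing.unit, forall t, j x t = x &
    forall t (s : forall x, stalk x), pull (j x) t (s (j x t)) = r x (s x)].
Proof.
have h (x : P) : exists krj : {k : fieldType & ({rmorphism stalk x -> k} * lrhom (spec_field k) P)%type},
    [/\ forall a, (projT2 krj).1 a = 0 <-> a \isn't a GRing.unit, forall t, (projT2 krj).2 t = x &
    forall t (s : forall x, stalk x), pull (projT2 krj).2 t (s ((projT2 krj).2 t)) = (projT2 krj).1 (s x)].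
  have [k [r hr]] := residue_point x.
  have [a /eqP ra|j [jx jp]] := @point_hom k P x r; last by exists (existT _ k (r, j)).
  by apply: contraT => /hr.
exists (fun x => projT1 (projT1 (cid (h x)))), (fun x => (projT2 (projT1 (cid (h x)))).1),
  (fun x => (projT2 (projT1 (cid (h x)))).2) => x; exact: (projT2 (cid (h x))).
Qed.

(** * The blowup map is universally closed *)

Section UniversallyClosed.
Variables (X : lrspace) (K : fieldType) (g : forall x : X, {rmorphism stalk x -> K}).
Hypothesis Fg : is_function_field g.
Variable z : X.
Variable p : lrhom (blow g z) X.
Hypothesis p1 : forall t, p t = bbase t.
Hypothesis p2 : forall t (s : forall x : X, stalk x),
  val (pull p t (s (p t)) : sub_of (bring t)) = g (bbase t) (s (bbase t)).
Variables (U : set X) (A : subr K) (bs : seq K).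
Hypothesis UA : kchart g U A.
Hypothesis ebs : idlA g z U A = span A bs.
Variables (Y P : lrspace) (gg : lrhom Y X) (pp : lrhom P (blow g z)) (q : lrhom P Y).
Hypothesis pb : is_pullback p gg pp q.
Variable C : set P.
Hypothesis closedC : closed C.
Variables (UY : set Y) (RY : comPzRingType) (phi : RY -> forall y : Y, stalk y).
Hypothesis chY : affine_chart UY phi.
Variable y : Y.
Hypotheses (UYy : UY y) (Uy : U (gg y)).

Let sq : hom_comp p pp = hom_comp gg q. Proof. by case: pb. Qed.
Let ppq c : bbase (pp c) = gg (q c). Proof. by rewrite -p1; exact: (lrhom_eqE sq).1. Qed.

Let base_unit : exists f0, phi f0 y \is a GRing.unit /\ forall y', UY y' -> phi f0 y' \is a GRing.unit -> U (gg y').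
Proof.
apply: (chart_refine chY UYy (W := gg @^-1` U)) => //.
by apply: open_comp; [move=> x _; exact: hom_continuous|exact: kc_open UA].
Qed.

Let phiM a b y' : UY y' -> phi (a * b) y' \is a GRing.unit <-> phi a y' \is a GRing.unit /\ phi b y' \is a GRing.unit.
Proof.
move=> Uy'; have [f fE] := chart_phi chY Uy'; rewrite -!fE rmorphM unitrM.
by split=> [/andP//|[-> ->]].
Qed.
Let phi1 y' : UY y' -> phi 1 y' \is a GRing.unit.
Proof. by move=> Uy'; have [f fE] := chart_phi chY Uy'; rewrite -fE rmorph1 unitr1. Qed.

(* A point [c] of C lying over a generization of [y] is found as a point
   of the spectrum of a product of residue fields, whose coordinate points are in C. *)
Lemma closure_generization : (forall V, open V -> V y -> exists c, C c /\ V (q c)) ->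
  exists c b, [/\ C c, UY (q c), forall a, phi a y \is a GRing.unit -> phi a (q c) \is a GRing.unit,
    b \in bs /\ b != 0 & bchart U bs b (pp c)].
Proof.
move=> near; have [f0 [uf0 hf0]] := base_unit.
pose good b a := exists c, [/\ C c, UY (q c), phi (f0 * a) (q c) \is a GRing.unit & bchart U bs b (pp c)].
(* If each of the finitely many charts failed for some [a b], the product of these would yield a
   point of [C] in none of the charts. *)
have [b [bb [b0 hb]]] : exists b, b \in bs /\ (b != 0 /\ forall a, phi a y \is a GRing.unit -> good b a).
  apply: contrapT => n.
  have /choice[a ha] : forall b, exists a, phi a y \is a GRing.unit /\ (b \in bs -> b != 0 -> ~ good b a).
    move=> b; apply: contrapT => n'; apply: n; exists b; split.
      by apply: contrapT => nb; apply: n'; exists 1; split=> //; exact: phi1.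
    split; first by apply: contraT => b0; case: n'; exists 1; split; [exact: phi1|move=> _ h; rewrite h in b0].
    by move=> a ua; apply: contrapT => ng; apply: n'; exists a.
  pose F := \prod_(b <- bs) a b.
  have uF : phi F y \is a GRing.unit.
    rewrite /F; elim: (bs) => [|b l IH]; first by rewrite big_nil; exact: phi1.
    by rewrite big_cons; apply/phiM => //; split=> //; exact: (ha b).1.
  have uff : phi (f0 * F) y \is a GRing.unit by apply/phiM.
  have [c [Cc [Uc /= uc]]] := near _ (chart_D_open chY (f0 * F)) (conj UYy uff).
  have [u1 u2] := (phiM f0 F Uc).1 uc.
  have Upc : U (bbase (pp c)) by rewrite ppq; exact: hf0.
  have [b bb [b0 Wb]] := bchart_cover Fg UA ebs Upc.
  have [_ /(_ bb b0)] := ha b; apply; exists c; split=> //; apply/phiM => //; split=> //.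
  by move: u2; rewrite /F (big_rem b) //= => /(phiM _ _ Uc)[].
(* One point of [C] is chosen for each function not vanishing at [y]; a limit of these points is
   taken in the spectrum of the product of their residue fields. *)
pose J := {a : RY | phi a y \is a GRing.unit}.
pose i1 : J := exist _ 1 (phi1 UYy).
have /choice[cc hcc] : forall i : J, exists c, [/\ C c, UY (q c), phi (f0 * proj1_sig i) (q c) \is a GRing.unit & bchart U bs b (pp c)].
  by move=> [a ua]; exact: hb.
have [kap0 [rr0 [jj0 hrj]]] := residue_points P.
pose kap (i : J) := kap0 (cc i).
pose rr i : {rmorphism stalk (cc i) -> kap i} := rr0 (cc i).
pose jj i : lrhom (spec_field (kap i)) P := jj0 (cc i).
have jjc i t : jj i t = cc i by have [_ h _] := hrj (cc i); exact: h.
have jjp i t (s : forall x : P, stalk x) : pull (jj i) t (s (jj i t)) = rr i (s (cc i)).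
  by have [_ _ h] := hrj (cc i); exact: h.
have UYc i : UY (q (cc i)) by case: (hcc i).
have Wc i : bchart U bs b (pp (cc i)) by case: (hcc i).
have [phiB [chB phiBE]] := blow_chart Fg UA ebs bb b0.
pose thY (a : RY) : fprodT i1 kap := fun i => rr i (pull q (cc i) (phi a (q (cc i)))).
have thYr : is_rmorphism thY.
  split; first by move=> a a'; apply: functional_extensionality_dep => i; have [f fE] := chart_phi chY (UYc i);
    rewrite fprodB /thY -!fE !rmorphB.
  split; first by apply: functional_extensionality_dep => i; have [f fE] := chart_phi chY (UYc i);
    rewrite /thY -!fE !rmorph1.
  by move=> a a'; apply: functional_extensionality_dep => i; have [f fE] := chart_phi chY (UYc i);
    rewrite fprodM /thY -!fE !rmorphM.
pose thB v : fprodT i1 kap := fun i => rr i (pull pp (cc i) (phiB v (pp (cc i)))).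
have thBr : is_rmorphism thB.
  split; first by move=> a a'; apply: functional_extensionality_dep => i; have [f fE] := chart_phi chB (Wc i);
    rewrite fprodB /thB -!fE !rmorphB.
  split; first by apply: functional_extensionality_dep => i; have [f fE] := chart_phi chB (Wc i);
    rewrite /thB -!fE !rmorph1.
  by move=> a a'; apply: functional_extensionality_dep => i; have [f fE] := chart_phi chB (Wc i);
    rewrite fprodM /thB -!fE !rmorphM.
pose vnr := @fprod_vnr J i1 kap.
have [FY [UFY FYp]] := spec_vnr_hom vnr chY thYr.
have [FX [WFX FXp]] := spec_vnr_hom vnr chB thBr.
have [io hio] : exists io : forall i, lrhom (spec_field (kap i)) (spec_vnr vnr), forall i,
    (forall t, io i t = vnr_pt vnr (@fprod_prime J i1 kap i)) /\ forall t a, pull (io i) t (vnr_res (io i t) a) = a i.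
  by exists (fun i => projT1 (cid (@fprod_point J i1 kap i))) => i; exact: (projT2 (cid (@fprod_point J i1 kap i))).
have eX i : hom_comp FX (io i) = hom_comp pp (jj i).
  apply: (affine_hom_uniq chB) => [t|t|t v] /=; first exact: WFX.
    by rewrite jjc.
  by rewrite FXp (hio i).2 (jjp i t (fun x => pull pp x (phiB v (pp x)))).
have eY i : hom_comp FY (io i) = hom_comp q (jj i).
  apply: (affine_hom_uniq chY) => [t|t|t a] /=; first exact: UFY.
    by rewrite jjc.
  by rewrite FYp (hio i).2 (jjp i t (fun x => pull q x (phi a (q x)))).
have unitY (t : spec_vnr vnr) a : (forall i, phi a (q (cc i)) \is a GRing.unit) -> phi a (FY t) \is a GRing.unit.
  move=> ua; apply: (@hom_local _ _ FY); rewrite FYp; apply/vnr_unit_res => h.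
  have [_ PM P1 _] := proj2_sig t; apply: P1.
  pose w : fprodT i1 kap := fun i => (thY a i)^-1.
  have -> : 1 = w * thY a.
    apply: functional_extensionality_dep => i; rewrite fprodM mulVf //.
    by apply: unit_neq0; do 2 apply: rmorph_unit; exact: ua.
  exact: PM.
have eXY : hom_comp p FX = hom_comp gg FY.
  have [_ [Bx [psi [chX _]]]] := UA.
  apply: (hom_eq_dense chX (j := io)) => [s rs s0|t|t|i].
  - apply: fprod_dense => // i; have [a ea] := vnr_res_surj (s (io i tt)).
    have e0 := etrans (esym (congr1 (pull (io i) tt) ea)) (s0 i tt).
    have ai := etrans (esym ((hio i).2 tt a)) e0.
    rewrite -((hio i).1 tt) ea; apply/vnr_res0; rewrite (hio i).1; exact: ai.
  - by rewrite /= p1; case: (WFX t).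
  - rewrite /=; apply: hf0; first exact: UFY.
    by apply: unitY => i; have [_ Uq uq _] := hcc i; exact: ((phiM f0 _ Uq).1 uq).1.
  - by rewrite -!hom_compA eX eY !hom_compA sq.
have [_ _ pbU] := pb.
have [H [[HX HY] _]] := pbU _ _ _ (@spec_vnr_scheme _ vnr) eXY.
have eH i : hom_comp H (io i) = jj i.
  apply: (pullback_eq pb (@spec_field_scheme (kap i))).
    by rewrite hom_compA HX eX.
  by rewrite hom_compA HY eY.
(* The images of functions invertible at [y] form a multiplicative set; it misses 0 because the
   coordinate indexed by [a] is nonzero on [thY a]. A prime avoiding this set lies over a
   generization of [y]. *)
have [|||_ [a ua <-] e0|Q [pQ _ Qn]] := @prime_disjoint (fprodT i1 kap) [set 0] [set thY a | a in [set a | phi a y \is a GRing.unit]].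
- by split=> // [_ _ -> ->|a' _ ->]; rewrite ?addr0 ?mulr0.
- by exists 1; [exact: phi1|case: thYr => _ []].
- move=> _ _ [a ua <-] [a' ua' <-]; exists (a * a'); first exact/phiM.
  by case: thYr => _ [_ ->].
- have := congr1 (fun t : fprodT i1 kap => t (exist _ a ua)) e0.
  have [_ Uq uq _] := hcc (exist _ a ua); rewrite /thY.
  have := unit_neq0 (rmorph_unit (rr (exist _ a ua)) (rmorph_unit (pull q _) ((phiM _ _ Uq).1 uq).2)).
  by move=> /= n e; rewrite e eqxx in n.
pose t0 := vnr_pt vnr pQ.
have qH : q (H t0) = FY t0 := (lrhom_eqE HY).1 t0.
have pH : pp (H t0) = FX t0 := (lrhom_eqE HX).1 t0.
exists (H t0), b; split=> //; [|by rewrite qH| |by rewrite pH].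
(* A nonempty open set of the spectrum contains a coordinate point, and the coordinate points map
   into the closed set [C]. *)
- apply: contrapT => nC.
  have oG : open (H @^-1` (~` C)).
    by apply: open_comp; [move=> x _; exact: hom_continuous|rewrite openC].
  have [e [ne he]] := (vnr_open _).1 oG t0 nC.
  have [i ei] : exists i, e i != 0.
    apply: contrapT => /forallNP h; apply: ne; have -> : e = 0; last by case: (pQ) => [[]].
    by apply: functional_extensionality_dep => i; apply: contrapT => /eqP; exact: h.
  have := he (io i tt); rewrite (hio i).1 /= => h.
  have : (~` C) (H (vnr_pt vnr (@fprod_prime J i1 kap i))).
    by apply: he => /= e0; rewrite e0 eqxx in ei.
  rewrite -((hio i).1 tt) (_ : H (io i tt) = jj i tt); last exact: (lrhom_eqE (eH i)).1.
  by rewrite jjc; case: (hcc i).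
- move=> a ua; rewrite qH; apply: (@hom_local _ _ FY); rewrite FYp; apply/vnr_unit_res.
  by apply: Qn; exists a.
Qed.

(* The valuative criterion, for a valuation ring dominating the local ring of [y] in the
   residue field of [c]. *)
Lemma specialization_lift c b : C c -> UY (q c) -> (forall a, phi a y \is a GRing.unit -> phi a (q c) \is a GRing.unit) ->
  b \in bs -> b != 0 -> bchart U bs b (pp c) -> exists2 c', C c' & q c' = y.
Proof.
move=> Cc Uqc gen bb b0 Wb.
have [L [r hr]] := residue_point c.
have rl a : r a != 0 -> a \is a GRing.unit by move=> /eqP n; apply: contraT => /hr.
have [jc [jcc jcp]] := point_hom rl.
have [f fE] := chart_phi chY Uqc; have [fy fyE] := chart_phi chY UYy.
pose th : {rmorphism RY -> L} := r \o pull q c \o f.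
have thE a : th a = r (pull q c (phi a (q c))) by rewrite /= fE.
have th0 a : phi a y \is a GRing.unit -> th a != 0.
  by move=> /gen ua; rewrite thE; apply: unit_neq0; do 2 apply: rmorph_unit.
pose P0 : set L := [set u | exists2 a, phi a y \isn't a GRing.unit & u = th a].
have P0u a : P0 (th a) -> phi a y \isn't a GRing.unit.
  move=> [a' na' e]; apply/negP => ua.
  have nd : phi (a - a') y \isn't a GRing.unit.
    by apply/negP => /th0; rewrite rmorphB e subrr eqxx.
  have : phi a y \isn't a GRing.unit.
    rewrite -[a](subrK a') -fyE rmorphD !fyE; exact: nonunits_stalk.
  by rewrite ua.
have pP0 : prime_of (range_subr th) P0.
  split; first split.
  - by move=> _ [a _ ->]; exact: range_mem.
  - by exists 0; rewrite ?rmorph0 // -fyE rmorph0 unitr0.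
  - move=> _ _ [a na ->] [a' na' ->]; exists (a + a'); last by rewrite rmorphD.
    rewrite -fyE rmorphD !fyE; exact: nonunits_stalk.
  - move=> _ _ [a _ <-] [a' na' ->]; exists (a * a'); last by rewrite rmorphM.
    by apply/negP => /(phiM _ _ UYy)[_]; exact/negP.
  - by rewrite -(rmorph1 th) => /P0u; rewrite phi1.
  - move=> _ _ [a _ <-] [a' _ <-]; rewrite -rmorphM => /P0u n.
    have [ua|na] := boolP (phi a y \is a GRing.unit); last by left; exists a.
    have [ua'|na'] := boolP (phi a' y \is a GRing.unit); last by right; exists a'.
    by case/negP: n; apply/phiM.
have [V [RV valV PV]] := chevalley pP0.
have Vth a : V (th a) by apply: RV; exact: range_mem.
have VthV a : phi a y \is a GRing.unit -> inu V (th a).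
  by move=> ua; apply: contrapT => /(PV _ (range_mem th a)).2 /P0u; rewrite ua.
pose R := bring (pp c).
pose ev (u : K) : L := r (pull pp c (if pselect (R u) is left h then mk_sub h else 0 : sub_of R)).
have evE (s : forall t, stalk t) u : val (s (pp c) : sub_of R) = u -> r (pull pp c (s (pp c))) = ev u.
  move=> <-; rewrite /ev; case: pselect => [h|[]]; last exact: sub_valP.
  by congr (r (pull pp c _)); apply: val_inj.
have evu u : R u -> ev u != 0 -> inu R u.
  by move=> Ru; rewrite /ev; case: pselect => // h /rl /hom_local /sub_unit_inu.
have evB u v : R u -> R v -> ev (u - v) = ev u - ev v.
  move=> Ru Rv; rewrite /ev; case: pselect => [h|[]]; last exact: srB.
  case: pselect => // h1; case: pselect => // h2; rewrite -!rmorphB; congr (r (pull pp c _)); exact: val_inj.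
have evM u v : R u -> R v -> ev (u * v) = ev u * ev v.
  move=> Ru Rv; rewrite /ev; case: pselect => [h|[]]; last exact: srM.
  case: pselect => // h1; case: pselect => // h2; rewrite -!rmorphM; congr (r (pull pp c _)); exact: val_inj.
have ev1 : ev 1 = 1.
  rewrite /ev; case: pselect => [h|[]]; last exact: sr1.
  by have -> : mk_sub h = 1 by [apply: val_inj]; rewrite !rmorph1.
have AR : forall u, A u -> R u := bchart_A UA Wb.
(* Near [y] a function on [U] is a fraction over [RY] whose denominator is invertible at [y]; that
   neighbourhood also contains the generization [q c]. *)
have AV u : A u -> V (ev u).
  have [_ [Bx [psi [chX hA]]]] := UA.
  move=> /hA[e he]; have Upc : U (bbase (pp c)) := Wb.1.
  rewrite -(evE (fun t => pull p t (psi e (p t))) u); last by rewrite p2 he.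
  have -> : r (pull pp c (pull p (pp c) (psi e (p (pp c))))) = r (pull q c (pull gg (q c) (psi e (gg (q c))))).
    by congr (r _); exact: (lrhom_eqE sq).2 c (psi e).
  have og : open (gg @^-1` U) by apply: open_comp; [move=> x _; exact: hom_continuous|exact: kc_open UA].
  have rg := @hom_reg _ _ gg _ _ (chart_open chX) (chart_reg_phi chX e).
  have oG : open (gg @^-1` U `&` UY) by apply: openI => //; exact: chart_open chY.
  have GU : gg @^-1` U `&` UY `<=` UY by move=> x [].
  have rG : reg (gg @^-1` U `&` UY) (fun x => pull gg x (psi e (gg x))) by apply: (reg_sub og) => // x [].
  have [V' [a [s [oV' V'y _ hV']]]] := (chart_reg chY _ oG GU).1 rG y (conj Uy UYy).
  have [a0 [ua0 ha0]] := chart_refine chY UYy oV' V'y.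
  have V'c : V' (q c) by apply: ha0 => //; exact: gen.
  have [us es] := hV' _ V'c; rewrite es rmorphM rmorphM.
  have [us' _] := hV' _ V'y.
  rewrite (rmorphV (pull q c) us) (rmorphV r (rmorph_unit (pull q c) us)) -!thE.
  by apply: srM => //; case: (VthV _ us').
have Rgen x : x \in bs -> R (x / b) by move=> xb; apply: Wb.2; exact: map_f.
(* The chart is changed to a generator of least value, as for projective space: then all coordinates
   of the point lie in [V]. *)
have [_ /mapP[b' b'b ->] [evb' hb']] : exists2 x, x \in [seq ev (x / b) | x <- bs] & x != 0 /\
    forall w, w \in [seq ev (x / b) | x <- bs] -> V (w / x).
  apply: valring_min => //; exists 1; last exact: oner_neq0.
  by apply/mapP; exists b; rewrite ?divff ?ev1.
have ub' : inu R (b' / b) by apply: evu => //; exact: Rgen.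
have b'0 : b' != 0 by have := ub'.1; rewrite mulf_eq0 negb_or => /andP[].
have quo x : x \in bs -> R (x / b') /\ V (ev (x / b')).
  move=> xb; have e : x / b' = (x / b) * (b' / b)^-1 by field; rewrite b0 b'0.
  have Rx : R (x / b') by rewrite e; apply: srM; [exact: Rgen|case: ub'].
  split=> //; have -> : ev (x / b') = ev (x / b) / ev (b' / b).
    apply: (mulIf evb'); rewrite divfK // -evM //; last exact: Rgen.
    by congr ev; field; rewrite b0 b'0.
  by apply: hb'; exact: map_f.
have Wb' : bchart U bs b' (pp c) by split; [case: Wb|move=> _ /mapP[x xb ->]; case: (quo x xb)].
have [phiB [chB phiBE]] := blow_chart Fg UA ebs b'b b'0.
set D := adj A _ in phiB chB phiBE.
have BR : forall u, intcl D u -> R u := bchart_B Fg UA Wb'.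
have DV u : D u -> R u /\ V (ev u).
  have [S SE] : exists S : subr K, forall u, S u <-> R u /\ V (ev u).
    have @S : subr K.
      exists [set u | R u /\ V (ev u)].
      - by split; [exact: sr1|rewrite ev1; exact: sr1].
      - by move=> x y' [Rx Vx] [Ry Vy]; split; [exact: srB|rewrite evB //; exact: srB].
      - by move=> x y' [Rx Vx] [Ry Vy]; split; [exact: srM|rewrite evM //; exact: srM].
    by exists S.
  move=> Du; apply/SE; apply: (@adj_min K A S _ _ _ u Du).
    by move=> x Ax; apply/SE; split; [exact: AR|exact: AV].
  by move=> _ /mapP[x xb ->]; apply/SE; exact: quo.
pose thB (v : sub_of (intcl D)) : L := r (pull pp c (phiB v (pp c))).
have thBE v : thB v = ev (val v) by apply: evE; rewrite phiBE.
have thBr : is_rmorphism thB.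
  have [f' f'E] := chart_phi chB Wb'.
  split; first by move=> x x'; rewrite /thB -!f'E !rmorphB.
  by split; [rewrite /thB -f'E !rmorph1|move=> x x'; rewrite /thB -!f'E !rmorphM].
(* Reducing an integral equation to the residue field shows that the value is integral over [V],
   which is integrally closed. *)
have VB v : V (thB v).
  rewrite thBE; apply: valring_integ => //.
  have [Q [mQ hQ rQ]] := sub_valP v; have Rv := BR _ (sub_valP v).
  have [Q' eQ'] := pcoef_lift (A := R) (p := Q) (fun i => (DV _ (hQ i)).1).
  pose h : {rmorphism sub_of R -> L} := r \o (pull pp c : {rmorphism sub_of R -> stalk c}).
  have hE w : h w = ev (val w).
    rewrite /h /= /ev; case: pselect => [h'|[]]; last exact: sub_valP.
    by congr (r (pull pp c _)); exact: val_inj.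
  exists (map_poly h Q'); split.
  - by apply: monic_map; rewrite eQ' map_val_monic in mQ.
  - move=> i; have e : (map_poly h Q')`_i = ev Q`_i by rewrite eQ' !coef_map; exact: hE.
    by rewrite e; exact: (DV _ (hQ i)).2.
  - have -> : ev (val v) = h (mk_sub Rv) by rewrite hE.
    apply: rmorph_root; move: rQ; rewrite eQ' -[val v]/(val (mk_sub Rv)) /root horner_map /=.
    by move=> /eqP e; apply/eqP/val_inj.
have [FX [WFX FXp]] := spec_subr_hom chB thBr VB.
have [FY [UFY FYp]] := spec_subr_hom chY (rmorphism_is th) Vth.
have [xi [jV [jVx jVp xigen xidn]]] := spec_subr_generic V.
have eX : hom_comp FX jV = hom_comp pp jc.
  apply: (affine_hom_uniq chB) => [t|t|t v] /=; first exact: WFX.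
    by rewrite jcc.
  rewrite (jVp t (fun x => pull FX x (phiB v (FX x)))) FXp.
  by rewrite (jcp t (fun x => pull pp x (phiB v (pp x)))).
have eY : hom_comp FY jV = hom_comp q jc.
  apply: (affine_hom_uniq chY) => [t|t|t a] /=; first exact: UFY.
    by rewrite jcc.
  rewrite (jVp t (fun x => pull FY x (phi a (FY x)))) FYp thE.
  by rewrite (jcp t (fun x => pull q x (phi a (q x)))).
have unitFY (t : spec_subr V) a : phi a (FY t) \is a GRing.unit <-> ~ proj1_sig t (th a).
  rewrite -(spec_subr_val t (Vth a)) -(FYp t a); split; last by move=> /sub_unit_inu u; apply: (@hom_local _ _ FY).
  by move=> /(rmorph_unit (pull FY t))/sub_unit_inu.
have [f0 [uf0 hf0]] := base_unit.
have nprime (t : spec_subr V) u : inu V u -> ~ proj1_sig t u.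
  move=> [u0 uV] Pu; have [[_ _ _ PM] P1 _] := proj2_sig t; apply: P1.
  by rewrite -(mulVf u0); exact: PM.
have eXY : hom_comp p FX = hom_comp gg FY.
  have [_ [Bx [psi [chX _]]]] := UA.
  apply: (hom_eq_dense chX (j := fun _ : unit => jV)) => [s rs s0|t|t|i].
  - by apply: xidn => //; apply: val_inj; rewrite -(jVp tt) (s0 tt tt).
  - by rewrite /= p1; case: (WFX t).
  - by rewrite /=; apply: hf0; [exact: UFY|apply/unitFY; apply: nprime; exact: VthV].
  - by rewrite -!hom_compA eX eY !hom_compA sq.
have [_ _ pbU] := pb.
have [H [[HX HY] _]] := pbU _ _ _ (@spec_subr_scheme L V) eXY.
have eH : hom_comp H jV = jc.
  apply: (pullback_eq pb (@spec_field_scheme L)).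
    by rewrite hom_compA HX eX.
  by rewrite hom_compA HY eY.
have Hxi : H xi = c by rewrite -(jVx tt) -(jcc tt); exact: (lrhom_eqE eH).1 tt.
(* The closed point of Spec V is the specialization wanted: its image lies in [C] because the
   generic point maps to [c], and it lies over [y] because [V] dominates the local ring there. *)
have pM := nonu_prime (valring_local valV).
pose tm := spec_pt pM.
exists (H tm).
  apply: contrapT => nC.
  have oG : open (H @^-1` (~` C)).
    by apply: open_comp; [move=> x _; exact: hom_continuous|rewrite openC].
  by have := xigen tm _ oG nC; rewrite /preimage /= Hxi.
rewrite (_ : q (H tm) = FY tm); last exact: (lrhom_eqE HY).1.
apply: (chart_eq chY) => // a; rewrite unitFY /=; split=> [n|/VthV ua [_]//].
apply: contraT => na; case: n; have h : P0 (th a) by exists a.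
by split; [exact: Vth|move=> iu; exact: ((PV _ (range_mem th a)).1 h iu)].
Qed.

End UniversallyClosed.

Section Proper.
Variables (X : lrspace) (K : fieldType) (g : forall x : X, {rmorphism stalk x -> K}).
Hypothesis Fg : is_function_field g.
Variables (k : fieldType) (sX : lrhom X (spec_field k)) (c : {rmorphism k -> K}).
Hypothesis gc : forall x z, g x (pull sX x z) = c z.
Hypothesis ft : finite_type sX.
Hypothesis char0 : forall m, m.+1%:R != 0 :> K.
Variable z : X.
Variable p : lrhom (blow g z) X.
Hypothesis p1 : forall t, p t = bbase t.
Hypothesis p2 : forall t (s : forall x : X, stalk x),
  val (pull p t (s (p t)) : sub_of (bring t)) = g (bbase t) (s (bbase t)).

Theorem blow_proper : proper_morphism p.
Proof.
split; [exact: (blow_separated Fg gc ft p1)|exact: (blow_finite Fg gc ft char0 p1 p2)|].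
move=> Y P gg pp q sY pb C cC.
suff main y : (forall V, open V -> V y -> exists c, C c /\ V (q c)) -> (q @` C) y.
  rewrite -openC; apply: openE_nbhs => y ny; apply: contrapT => h; apply: ny; apply: main => V oV Vy.
  apply: contrapT => n; apply: h; exists V; split=> // x Vx [c' Cc' ex]; apply: n; exists c'; by rewrite ex.
move=> near; have [UY [RY [phi [UYy chY]]]] := sY y.
have [U [l [bs [Uy UA nA ebs]]]] := good_chart Fg gc ft z (gg y).
have [c0 [b [Cc Uqc gen [bb b0] Wb]]] := closure_generization Fg p1 UA ebs pb cC chY UYy Uy near.
have [c' Cc' e] := specialization_lift Fg p1 p2 UA ebs pb cC chY UYy Uy Cc Uqc gen bb b0 Wb.
by exists c'.
Qed.
End Proper.

(** * Terminal singularities *)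

Section CodimensionOne.
Variables (K : fieldType) (O : subr K).

Lemma dvr_codim1 t : dvr O t -> krull_dim (sub_of O) 1.
Proof.
move=> dO; have [_ _ nt t0 ht] := dO.
have mloc := dvr_local dO; have [[_ m0 mD mM] m1 mp] := nonu_prime mloc.
have prime_top (P : set (sub_of O)) : prime_ideal P -> (exists2 a, P a & a != 0) -> forall b, nonu O (val b) -> P b.
  move=> [[P0 _] PM P1 Pp] [a Pa a0] b nb.
  have va0 : val a != 0 by apply: contraNneq a0 => e; apply/eqP/val_inj.
  have [m [u [iu Ou ea]]] := dvr_ord dO (sub_valP a) va0.
  pose t' := mk_sub nt.1; have Pt : P t'.
    have : P (t' ^+ m).
      have -> : t' ^+ m = mk_sub iu.2 * a.
        by apply: val_inj; rewrite sub_valM rmorphXn ea mulKf //; case: iu.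
      exact: PM.
    by elim: (m) => [|l IH]; [rewrite expr0|rewrite exprS => /Pp[]].
  have -> : b = mk_sub (ht _ nb) * t' by apply: val_inj; rewrite sub_valM divfK.
  exact: PM.
split.
  exists (fun i => if i is 0%N then [set 0] else [set a | nonu O (val a)]); split.
    move=> [|i] _.
      split.
      - by split=> // _ _ -> ->; rewrite addr0.
      - by move=> a _ ->; rewrite /= mulr0.
      - by move=> /eqP; rewrite oner_eq0.
      - move=> a b /= /(congr1 val); rewrite sub_valM sub_val0 => /eqP; rewrite mulf_eq0.
        by move=> /orP[] /eqP e; [left|right]; apply: val_inj.
    split=> /=.
    - by split=> // a b; exact: mD.
    - by move=> a b; apply: mM; exact: sub_valP.
    - exact: m1.
    - by move=> a b; apply: mp; exact: sub_valP.
  move=> [|//] _; split; first by move=> _ ->.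
  move=> h; have := h (mk_sub nt.1) nt => /(congr1 val) /=; exact/eqP.
move=> [P [hP lP]].
have [P01 n10] := lP 0%N isT; have [P12 n21] := lP 1%N isT.
have [[P00 _] _ _ _] := hP 0%N isT; have [_ P2M P21 _] := hP 2%N isT.
apply: n21 => b P2b; apply: (prime_top _ (hP 1%N isT)).
  apply: contrapT => h; apply: n10 => a Pa.
  by case: (eqVneq a 0) => [->//|a0]; case: h; exists a.
split; first exact: sub_valP.
move=> [b0 bV]; apply: P21.
have -> : 1 = mk_sub bV * b by apply: val_inj; rewrite sub_valM mulVf.
exact: P2M.
Qed.
End CodimensionOne.

Section Stalks.
Variables (X : lrspace) (K : fieldType) (g : forall x : X, {rmorphism stalk x -> K}).
Hypothesis Fg : is_function_field g.
Variables (k : fieldType) (sX : lrhom X (spec_field k)) (c : {rmorphism k -> K}).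
Hypothesis gc : forall x z, g x (pull sX x z) = c z.
Hypothesis ft : finite_type sX.

Lemma ostk_c x u : range_subr c u -> ostk g x u.
Proof. by move=> [z _ <-]; rewrite -(gc (x := x)); exact: range_mem. Qed.

Lemma noeth_c l : noeth (adj (range_subr c) l).
Proof. by apply: hilbert_basis; apply: noeth_field => u ku _; exact: range_field. Qed.

Lemma ostk_noeth x : noeth (ostk g x).
Proof.
have [U [l [Ux UA]]] := finite_chart Fg gc ft x.
exact: (kc_noeth Fg UA (@noeth_c l) Ux).
Qed.

Lemma stalk_noetherian (x : X) : noetherian (stalk x).
Proof. by apply: (noetherian_range (@g_inj _ _ _ Fg x)); exact: ostk_noeth. Qed.

Lemma stalk_ess_finite x : ess_finite (pull sX x).
Proof.
have [U [l [Ux UA]]] := finite_chart Fg gc ft x.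
apply: (@ess_finite_range _ K (g x) (@g_inj _ _ _ Fg x) k (pull sX x) (range_subr c) l).
- by move=> u; split=> [[z _ <-]|[z ->]]; [exists z; rewrite gc|rewrite gc; exact: range_mem].
- by move=> u; exact: (kc_sub UA).
- by move=> a; have [u [s [Au As us e]]] := kc_frac Fg UA Ux (range_mem (g x) a); exists u, s.
Qed.

Lemma field_ess_finite : (exists x : X, True) -> ess_finite c.
Proof.
move=> [x _]; have [U [l [Ux UA]]] := finite_chart Fg gc ft x.
apply: (@ess_finite_range K K (@idfun K) _ k c (range_subr c) l) => //.
- by move=> u; split=> [[z _ <-]|[z ->]]; [exists z|exact: range_mem].
- move=> a; have [u [s [Au As s0 e]]] := kc_full Fg UA a; exists u, s; split=> //.
  by split=> //; exists s^-1.
Qed.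

(** [z] is the point of a chart around [x] with prime P; it specializes to [x], so it lies in [U].
    Stability passes to the maximal ideal at [z] by the quotient rule. *)
Lemma stable_point (U : set X) x (P : set K) n (E : 'I_n -> K -> K) : open U -> U x ->
  (forall i, is_self_derivation c (E i)) -> (forall i y u, U y -> ostk g y u -> ostk g y (E i u)) ->
  prime_of (ostk g x) P -> P `<=` nonu (ostk g x) -> (forall i u, P u -> P (E i u)) -> (exists2 u, P u & u != 0) ->
  exists z, [/\ U z, forall i u, nonu (ostk g z) u -> nonu (ostk g z) (E i u) & exists2 u, nonu (ostk g z) u & u != 0].
Proof.
move=> oU Ux hE EO pP Pn PE [u0 Pu0 u00]; have [V [l [Vx UA]]] := finite_chart Fg gc ft x.
set A := adj _ l in UA.
have AO u : A u -> ostk g x u by exact: (kc_sub UA).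
have [z Vz ez] := kc_prime Fg UA (prime_contract AO pP).
have memz u : A u -> P u -> nonu (ostk g z) u.
  by move=> Au Pu; have [] : [set u | A u /\ nonu (ostk g z) u] u by rewrite -ez.
have unitz u : A u -> inu (ostk g x) u -> inu (ostk g z) u.
  move=> Au iu; apply: contrapT => nu; have [_ /Pn[_ /(_ iu)//]] : [set u | A u /\ P u] u.
  by rewrite ez; split=> //; split=> //; exact: (kc_sub UA).
have Uz : U z by have [s [As us hs]] := kc_refine Fg UA Vx oU Ux; apply: hs => //; exact: unitz.
have [[mO m0 mD mM] _ mp] := nonu_prime (ostk_local Fg (x := z)).
have [[PO P0 PD PM] _ _] := pP.
have Pz u : P u -> nonu (ostk g z) u.
  move=> Pu; have [a [s [Aa As us eu]]] := kc_frac Fg UA Vx (PO _ Pu).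
  have [s0 zs] := unitz s As us.
  have ea : a = s * u by rewrite eu mulrC divfK.
  rewrite eu mulrC; apply: (mM) => //; apply: memz => //; rewrite ea; apply: PM => //; exact: AO.
exists z; split=> //; last by exists u0 => //; exact: Pz.
move=> i u nu; have [a [s [Aa As [s0 zs] eu]]] := kc_frac Fg UA Vz nu.1.
have ea : a = s * u by rewrite eu mulrC divfK.
have na : nonu (ostk g z) a by rewrite ea; apply: (mM) => //; exact: (kc_sub UA).
have Pa : P a by have [] : [set u | A u /\ P u] a by rewrite ez.
have := nu; rewrite {2}eu (kder_div _ (hE i) s0) -eu => nu'.
rewrite mulrC; apply: (mM) => //; apply: (mD) (Pz _ (PE i _ Pa)) _.
rewrite -mulrN mulrC; apply: (mM) nu; apply: srN; apply: EO => //; exact: (kc_sub UA).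
Qed.

(** An associated prime P of a nonzero nonunit has a discrete valuation ring as localization; either
    P is maximal, or 0 < P < m is the chain. *)
Lemma dvr_or_chain (z : X) : (forall x, normalS (ostk g x)) -> (exists2 u, nonu (ostk g z) u & u != 0) ->
  (exists t, dvr (ostk g z) t) \/ prime_chain (stalk z) 2.
Proof.
move=> nX [b nb b0]; have [P [pP [t [Pb dt]]]] := dvr_exists (@ostk_noeth z) (nX z) nb b0.
have mloc := ostk_local Fg (x := z); have pm := nonu_prime mloc.
have [[PO P0 PD PM] P1 Pp] := pP.
have gI := @g_inj _ _ _ Fg z.
have Pn : P `<=` nonu (ostk g z).
  move=> u Pu; split; first exact: PO.
  by move=> [u0 uV]; apply: P1; rewrite -(mulVf u0); exact: PM.
case: (pselect (nonu (ostk g z) `<=` P)) => h; [left|right].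
  exists t; rewrite (_ : ostk g z = loc pP) //; apply: subr_ext => u; split; first exact: loc_sub.
  move=> [a [s [Oa Os ns ->]]]; apply: srM => //; apply: contrapT => nV; apply: ns; apply: h.
  by split=> // -[].
have pre (Q : set K) : prime_of (ostk g z) Q -> prime_ideal [set a | Q (g z a)].
  move=> [[QO Q0 QD QM] Q1 Qp]; split=> /=.
  - by rewrite rmorph0; split=> // a a'; rewrite rmorphD; exact: QD.
  - by move=> a a' Qa; rewrite rmorphM; apply: QM => //; exact: range_mem.
  - by rewrite rmorph1.
  - by move=> a a'; rewrite rmorphM; apply: Qp; exact: range_mem.
exists (fun i => if i is 0%N then [set 0] else if i is 1%N then [set a | P (g z a)] else [set a | nonu (ostk g z) (g z a)]).
split.
  move=> [|[|i]] _; [|exact: pre|exact: pre].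
  split.
  - by split=> // _ _ -> ->; rewrite addr0.
  - by move=> a _ ->; rewrite /= mulr0.
  - by move=> /(congr1 (g z)) /eqP; rewrite rmorph1 rmorph0 oner_eq0.
  - move=> a a' /= /(congr1 (g z)); rewrite rmorphM rmorph0 => /eqP; rewrite mulf_eq0.
    by move=> /orP[] /eqP e; [left|right]; apply: gI; rewrite e rmorph0.
move=> [|[|//]] _; split.
- by move=> _ ->; rewrite /= rmorph0.
- move=> h'; have [b' _ eb] := PO _ Pb; have := h' b'; rewrite /= eb => /(_ Pb) e.
  by move: b0; rewrite -eb e rmorph0 eqxx.
- by move=> a; exact: Pn.
- move=> h'; apply: h => u nu; have [a _ ea] := nu.1; rewrite -ea; apply: h'; by rewrite /= ea.
Qed.

End Stalks.

Lemma det_mem (K : fieldType) (O : subr K) n (M : 'M[K]_n) : (forall i j, O (M i j)) -> O (\det M).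
Proof.
move=> h; apply: sr_sum => s _; apply: srM; first by apply: srX; apply: srN; exact: sr1.
by apply: sr_prod => i _; exact: h.
Qed.

Lemma wedge_comp (K : fieldType) n (x : 'I_n -> K) (D d : 'I_n -> K -> K) (a : 'I_n -> 'I_n -> K) :
  (forall i u, D i u = \sum_l a i l * d l u) -> wedge x D = \det (\matrix_(i, l) a i l) * wedge x d.
Proof.
move=> h; rewrite /wedge -det_mulmx; congr (\det _); apply/matrixP => i j.
by rewrite !mxE h; apply: eq_bigr => l _; rewrite !mxE.
Qed.

Section Frame.
Variables (X : lrspace) (K : fieldType) (g : forall x : X, {rmorphism stalk x -> K}).
Hypothesis Fg : is_function_field g.
Variable eta : X.
Hypothesis eta_gen : forall W, open W -> W !=set0 -> W eta.
Hypothesis eta_surj : forall u, exists a, g eta a = u.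
Variables (k : fieldType) (sX : lrhom X (spec_field k)) (c : {rmorphism k -> K}).
Hypothesis gc : forall x z, g x (pull sX x z) = c z.
Hypothesis ft : finite_type sX.
Hypothesis char0 : forall m, m.+1%:R != 0 :> K.
Variables (U : set X) (n : nat) (E : 'I_n -> K -> K).
Hypothesis oU : open U.
Hypothesis U0 : U !=set0.
Hypothesis hE : forall i, is_self_derivation c (E i).
Hypothesis EO : forall i y u, U y -> ostk g y u -> ostk g y (E i u).
Hypothesis hF : forall y F, U y -> is_self_derivation c F -> (forall u, ostk g y u -> ostk g y (F u)) ->
  exists a : 'I_n -> K, (forall i, ostk g y (a i)) /\ forall u, F u = \sum_i a i * E i u.
Hypothesis hind : forall a : 'I_n -> K, (forall u, \sum_i a i * E i u = 0) -> forall i, a i = 0.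

Lemma frame_span F : is_self_derivation c F -> exists a : 'I_n -> K, forall u, F u = \sum_i a i * E i u.
Proof.
move=> dF; have [|a [_ h]] := hF (eta_gen oU U0) dF; last by exists a.
by move=> u _; have [a <-] := eta_surj (F u); exact: range_mem.
Qed.

Lemma frame_ind y (a : 'I_n -> K) : (forall u, ostk g y u -> \sum_i a i * E i u = 0) -> forall i, a i = 0.
Proof.
move=> h; apply: hind; apply: (kder_eq0 (O := ostk g y) (kder_comb a hE)) => // u; exact: ostk_frac.
Qed.

(** The derivation sending the uniformizer to a unit preserves the stalk, hence is a combination of
    the frame with coefficients in it. *)
Lemma dvr_not_stable y t : U y -> dvr (ostk g y) t ->
  ~ forall i u, nonu (ostk g y) u -> nonu (ostk g y) (E i u).
Proof.
move=> Uy dO sE; have EOy i u : ostk g y u -> ostk g y (E i u) by exact: EO.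
have [f [d [Of _ hd ddf dsp]]] := minimal_dual dO (ostk_frac Fg y) hE EOy frame_span hind.
have hd1 i := (hd i).1.
have hd2 i u : ostk g y u -> ostk g y (d i u) by exact: (hd i).2.
have kO u : range_subr c u -> ostk g y u by exact: (ostk_c gc).
have [i it] := uniformizer_derivative dO char0 kO Of hd1 hd2 ddf dsp.
have [a [Oa ea]] := hF Uy (hd1 i) (hd2 i).
have [[_ m0 mD mM] _ _] := nonu_prime (ostk_local Fg (x := y)).
have [_] : nonu (ostk g y) (d i t); last exact.
rewrite ea; elim/big_ind: _ => // j _; apply: (mM) => //; apply: sE; by case: dO.
Qed.

Lemma simple_point_regular x : U x ->
  (forall P, prime_of (ostk g x) P -> P `<=` nonu (ostk g x) -> (forall i u, P u -> P (E i u)) -> forall u, P u -> u = 0) ->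
  regular_local (stalk x).
Proof.
move=> Ux simp; have EOx i u : ostk g x u -> ostk g x (E i u) by exact: EO.
have gI := @g_inj _ _ _ Fg x.
apply: (@simple_regular k K c char0 (stalk x) (pull sX x) (g x) gI (gc (x := x)) (stalk_ess_finite Fg gc ft x) n E hE EOx).
- exact: frame_span.
- exact: (frame_ind (y := x)).
- move=> j l; apply: (hF Ux); first exact: kder_bracket.
  by move=> u Ou; apply: srB; do 2 apply: (EOx).
- exact: (stalk_noetherian Fg gc ft).
- exact: nonunits_stalk.
- move=> I iI Is [u0 Iu0 u00]; have [IO _ _ IM] := iI; apply: contrapT => nI1.
  have In : I `<=` nonu (ostk g x).
    move=> u Iu; split; first exact: IO.
    by move=> [v0 uV]; apply: nI1; rewrite -(mulVf v0); exact: IM.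
  have Onat m : ostk g x m.+1%:R^-1.
    by apply: (ostk_c gc); apply: range_field; exists m.+1%:R; rewrite ?rmorph_nat.
  have [P [pP Pn PE Pmax]] := stable_prime (ostk_local Fg (x := x)) Onat char0 hE EOx.
  by move: u00; rewrite (simp P pP Pn PE u0) ?eqxx //; exact: (Pmax I).
Qed.

(** The derivations dual to [f] are combinations of the frame over the stalk, so a determinant in
    the stalk times the wedge equals 1. *)
Lemma frame_wedge_unit y (f : 'I_n -> stalk y) : U y -> differential_basis (pull sX y) f ->
  inu (ostk g y) (wedge (fun j => g y (f j)) E).
Proof.
move=> Uy bf; have gI := @g_inj _ _ _ Fg y.
have /choice[D hD] : forall i, exists D : stalk y -> stalk y, is_self_derivation (pull sX y) D /\ forall j, D (f j) = (i == j)%:R.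
  by move=> i; have [D [hD _]] := bf (stalk y)^o (fun j => (i == j)%:R); exists D.
have /choice[F hFi] : forall i, exists F : K -> K, is_self_derivation c F /\ forall a, F (g y a) = g y (D i a).
  by move=> i; exact: (kder_extend gI (gc (x := y)) (Fg.1 y).2 (hD i).1).
have /choice[a ha] : forall i, exists a : 'I_n -> K, (forall l, ostk g y (a l)) /\ forall u, F i u = \sum_l a l * E l u.
  move=> i; apply: hF => //; first exact: (hFi i).1.
  by move=> _ [b _ <-]; rewrite (hFi i).2; exact: range_mem.
have Oa : ostk g y (\det (\matrix_(i, l) a i l)) by apply: det_mem => i l; rewrite mxE; exact: (ha i).1.
have := wedge_comp (fun j => g y (f j)) (fun i => (ha i).2).
have -> : wedge (fun j => g y (f j)) F = 1.
  rewrite /wedge (_ : \matrix_(i, j) _ = 1%:M) ?det1 //; apply/matrixP => i j.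
  by rewrite !mxE (hFi i).2 (hD i).2; case: (i == j); rewrite ?rmorph1 ?rmorph0.
set w := wedge _ E; set b := \det _ in Oa * => e.
have w0 : w != 0 by apply/eqP => w0; move/eqP: e; rewrite w0 mulr0 oner_eq0.
by split=> //; rewrite (_ : w^-1 = b) //; apply: (mulIf w0); rewrite mulVf.
Qed.

Lemma frame_top_form (f : 'I_n -> K) : wedge f E != 0 -> rational_top_form c (wedge f).
Proof.
move=> f0; exists 1, f; split; [exact: oner_neq0| |by move=> D _; rewrite mul1r].
have [d [hd df dsp _]] := dual_exists hE frame_span f0.
have rI u : range_subr (@idfun K) u by exists u.
have efK : ess_finite c by apply: (field_ess_finite Fg gc ft); exists eta.
have [|||D [hD [S0 SD SM] _ [a a0 Sa]]] := @spanned_frame k K c char0 K c (@idfun K) (fun _ _ => id) (fun=> erefl) efK n d hd (fun _ _ _ => rI _).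
- by move=> F hF'; exists (fun i => F (f i)); exact: dsp.
- move=> e he j; have := he (f j) (rI _); rewrite (bigD1 j) //= df eqxx mulr1 big1 ?addr0 // => i ij.
  by rewrite df (negPf ij) mulr0.
- move=> j l; exists (fun m => d j (d l (f m)) - d l (d j (f m))); split=> // u.
  exact: (dsp _ (kder_bracket (hd j) (hd l))).
apply: (basis_of_spanned (D := D)); first by move=> j; exact: (hD j).1.
- by move=> i j; have /= -> := (hD i).2 (f j); exact: df.
- by rewrite -(mulVf a0); exact: SM.
Qed.

(** The form evaluated on the frame is an equation of the canonical divisor on all of [U], with
    index 1. [Q_Cartier] serves only to provide a differential basis at each point of codimension 1;
    this basis pairs with the frame to a unit. *)
Lemma frame_local_equation (f : 'I_n -> K) : wedge f E != 0 -> Q_Cartier c (wedge f) sX g ->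
  local_equation c (wedge f) sX g 1 U (wedge f E).
Proof.
move=> f0 [r r0 qc]; split=> // y Uy cy; have [U' [phi [_ Uy' [_ le]]]] := qc y.
have [m om _] := le y Uy' cy; exists m => //; rewrite mul1r.
have [f' [h [bf [t [u [nt ut eh]]] ew]]] := om.
have [w0 [v _ ev]] := frame_wedge_unit Uy bf; have [v' _ ev'] : ostk g y (wedge (fun j => g y (f' j)) E).
  by apply: det_mem => i j; rewrite mxE; apply: EO => //; exact: range_mem.
exists t, (u * v'); split=> //.
  rewrite unitrM ut; apply/(inu_range (@g_inj _ _ _ Fg y)); rewrite ev'; exact: frame_wedge_unit.
by rewrite ew // eh rmorphM ev' mulrAC.
Qed.

End Frame.

Section Divisor.
Variables (X : lrspace) (K : fieldType) (g : forall x : X, {rmorphism stalk x -> K}).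
Hypothesis Fg : is_function_field g.
Variables (k : fieldType) (sX : lrhom X (spec_field k)) (c : {rmorphism k -> K}).
Hypothesis gc : forall x z, g x (pull sX x z) = c z.
Hypothesis ft : finite_type sX.
Hypothesis char0 : forall m, m.+1%:R != 0 :> K.
Variable z : X.
Hypothesis z_nonfield : exists2 u, nonu (ostk g z) u & u != 0.

(** A valuation ring dominating the stalk at [z] has a centre on the normalized chart, so that the
    fibre over [z] is not empty; a prime of height one through [b] is then taken in the local ring
    of the centre. *)
Theorem blow_divisor : exists (e : blow g z) t, [/\ bbase e = z, dvr (bring e) t,
  forall F, is_self_derivation c F -> (forall u, ostk g z u -> ostk g z (F u)) ->
    (forall u, nonu (ostk g z) u -> nonu (ostk g z) (F u)) -> forall u, bring e u -> bring e (F u)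
  & forall cR : {rmorphism k -> sub_of (bring e)}, (forall a, val (cR a) = c a) -> ess_finite cR].
Proof.
have Oloc := ostk_local Fg (x := z); have pm := nonu_prime Oloc.
have [[mO m0 mD mM] m1 mp] := pm.
have [V [OV vV mV]] := chevalley pm.
have [U [l [bs [Uz UA nA ebs]]]] := good_chart Fg gc ft z z.
set A := adj _ l in UA nA ebs.
have AO u : A u -> ostk g z u by exact: (kc_sub UA).
have idlAE u : idlA g z U A u <-> A u /\ nonu (ostk g z) u by split=> [[Au h]|[Au h]]; split=> //; exact: h.
(* A generator of least value for [V], so that [V] contains the ring of its chart. *)
have [b bb [b0 Vb]] : exists2 b, b \in bs & b != 0 /\ forall y, y \in bs -> V (y / b).
  apply: (valring_min vV); have [u nu u0] := z_nonfield.
  have [a [s [Aa As us eu]]] := kc_frac Fg UA Uz nu.1.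
  have ea : a = s * u by rewrite eu mulrC divfK //; case: us.
  have : idlA g z U A a by apply/idlAE; split=> //; rewrite ea; apply: mM => //; exact: AO.
  have a0 : a != 0 by rewrite ea mulf_neq0 //; case: us.
  rewrite ebs => sa; apply: contrapT => h; case/eqP: a0.
  apply: (@span_closed K A [set 0] bs _ _ _ _ _ sa) => //=.
  - by move=> x y -> ->; rewrite addr0.
  - by move=> x y _ ->; rewrite mulr0.
  - by move=> x xb; apply/eqP; apply: contrapT => /negP x0; apply: h; exists x.
set gens := [seq x / b | x <- bs].
set C := adj A gens; set B := intcl C.
have CV u : C u -> V u.
  by apply: adj_min => [v /AO/OV //|_ /mapP[x xb ->]]; exact: Vb.
have BV u : B u -> V u by move=> iu; apply: (valring_integ vV); exact: integ_sub iu.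
have Vloc := valring_local vV.
have pQ0 := prime_contract BV (nonu_prime Vloc).
have AB u : A u -> B u by move=> Au; apply: integ_mem; exact: adj_sub.
have [s' [s'B hs']] : exists s', (forall x, x \in s' -> B x) /\ forall u, B u -> adj C s' u.
  rewrite /B /C /A -adj_cat; apply: intcl_finite => // [u|w]; first exact: range_field.
  by rewrite adj_cat; apply: (fracf_mono (A := A)) (kc_full Fg UA w) => u Au; exact: adj_sub.
have eB : B = adj (range_subr c) (s' ++ gens ++ l).
  rewrite !adj_cat; apply: subr_ext => u; split; first exact: hs'.
  by apply: (@adj_min K C B s') => // v Cv; exact: integ_mem.
have nB : noeth B by rewrite eB; exact: noeth_c.
have Ab : A b /\ nonu (ostk g z) b by apply/idlAE; rewrite ebs; exact: span_mem.
have nVO u : nonu (ostk g z) u -> nonu V u.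
  by move=> nu; split; [exact: OV nu.1|exact: ((mV u nu.1).1 nu)].
pose R1 := loc pQ0.
have nb1 : nonu R1 b.
  by apply/(loc_contract pQ0 (AB _ Ab.1)); split; [exact: AB Ab.1|exact: nVO Ab.2].
have nR1 : noeth R1 by exact: loc_noeth.
have sR1 : normalS R1 by apply: loc_normal; exact: intcl_normal.
have [P [pP [t [Pb dt]]]] := dvr_exists nR1 sR1 nb1 b0.
set O' := loc pP in dt.
have Oloc' : localS O' by exact: loc_local.
have R1O u : R1 u -> O' u by exact: loc_sub.
have BO u : B u -> O' u by move=> Bu; apply: R1O; exact: loc_sub.
have pQ := prime_contract BO (nonu_prime Oloc').
(* [O'] is a localization of a localization of [B]; here the two denominators are merged. *)
have fr u : O' u -> exists a s, [/\ B a, B s, inu O' s & u = a / s].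
  move=> [a [s [[a1 [a2 [Ba1 Ba2 na2 ->]]] [s1 [s2 [Bs1 Bs2 ns2 es]]] ns ->]]].
  have s20 := prime_neq0 pQ0 ns2; have a20 := prime_neq0 pQ0 na2.
  have s0 := prime_neq0 pP ns.
  have s10 : s1 != 0 by apply: contraNneq s0 => e; rewrite es e mul0r.
  have iR v : B v -> v != 0 -> ~ [set u | B u /\ nonu V u] v -> inu O' v.
    by move=> Bv v0 nv; split=> //; apply: R1O; exact: loc_unit.
  have iis : inu O' s.
    by split=> //; apply: loc_unit => //; exists s1, s2.
  have is1 : inu O' s1.
    have -> : s1 = s * s2 by rewrite es divfK.
    by apply: inuM => //; exact: iR.
  exists (a1 * s2), (a2 * s1); split; [exact: srM|exact: srM| |].
    by apply: inuM => //; exact: iR.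
  by rewrite es; field; rewrite s20 a20 s10.
have [e We [eQ ebr]] := bchart_pt Fg UA ebs bb b0 pQ.
have eO : bring e = O'.
  apply: subr_ext => u; apply: (iff_trans (ebr u)); apply: iff_sym; exact: (loc_charact pQ BO fr).
(* A nonunit u at [z] is (u/b) b with u/b in [B] and [b] in the prime, so it stays a nonunit at [e];
   units at [z] remain units because [V] dominates the stalk. *)
have ez : bbase e = z.
  apply: (kc_uniq Fg UA We.1 Uz) => u Au.
  apply: (iff_trans (bring_inu (kc_sub UA We.1 Au))); rewrite eO; split=> [iu|[u0 uV]].
    apply: contrapT => nu; have nOu : nonu (ostk g z) u by split=> //; exact: AO.
    have Bub : B (u / b).
      apply: (@idlA_gens X K g z U A bs ebs b B) => [v|v vg|]; [exact: AB|by apply: integ_mem; exact: adj_mem|].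
      by apply/idlAE.
    have [[_ _ _ M'] _ _] := nonu_prime Oloc'.
    have nb' : nonu O' b by apply/(loc_contract pP (loc_sub pQ0 (AB _ Ab.1))).
    have [_ /(_ iu)] : nonu O' u by rewrite -(divfK b0 u); apply: M' => //; exact: BO.
    by [].
  split=> //; apply: R1O; apply: loc_unit; first exact: AB.
  by move=> [_ [_]]; apply; split=> //; exact: OV.
have AOe u : ostk g z u -> bring e u by rewrite -{1}ez; exact: bring_sub.
exists e, t; split=> //; first by rewrite eO.
  move=> F dF FO Fm.
  pose C1 := adj (ostk g z) gens.
  have CC1 u : C u -> C1 u.
    by apply: adj_min => [v Av|v vg]; [apply: adj_sub; exact: AO|exact: adj_mem].
  have C1e u : C1 u -> bring e u by apply: adj_min => [v|v]; [exact: AOe|exact: We.2].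
  have FC1 u : C1 u -> C1 (F u).
    apply: (kder_blowup dF FO Fm Ab.2 b0 (l := bs)) => [x xb|v nv].
      by have /idlAE[] : idlA g z U A x by rewrite ebs; exact: span_mem.
    have [a [s [Aa As us ev]]] := kc_frac Fg UA Uz nv.1.
    have ea : a = s * v by rewrite ev mulrC divfK //; case: us.
    have na : nonu (ostk g z) a by rewrite ea; apply: mM => //; exact: AO.
    have -> : v / b = s^-1 * (a / b) by rewrite ev; ring.
    apply: srM; first by apply: adj_sub; case: us.
    apply: (@idlA_gens X K g z U A bs ebs b C1) => [w Aw|w wg|]; [by apply: adj_sub; exact: AO|exact: adj_mem|].
    by apply/idlAE.
  have kO u : range_subr c u -> bring e u by move=> ku; apply: AOe; exact: (ostk_c gc).
  have dte : dvr (bring e) t by rewrite eO.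
  apply: (kder_dvr (B := B) dte (bring_frac Fg e) char0 kO dF C1e FC1).
  - by move=> w; apply: (fracf_mono (A := ostk g z)); [move=> v; exact: adj_sub|exact: ostk_frac].
  - by move=> w Bw; split; [rewrite eO; exact: BO|exact: integ_sub Bw].
  - by rewrite eO.
move=> cR cE.
apply: (@ess_finite_range _ K (val : {rmorphism sub_of (bring e) -> K}) val_inj k cR (range_subr c) (s' ++ gens ++ l)).
- by move=> u; split=> [[a _ <-]|[a ->]]; exists a => //; exact: (esym (cE a)).
- by rewrite -eB => u Bu; apply/range_val; rewrite eO; exact: BO.
- move=> a; have := sub_valP a; rewrite {1}eO => /fr[x [y [Bx By [y0 yV] ea]]].
  exists x, y; rewrite -eB; split=> //; split=> //; apply/range_val; by rewrite eO.
Qed.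

End Divisor.

Lemma blow_ord_at (X : lrspace) (K : fieldType) (g : forall x : X, {rmorphism stalk x -> K}) (z : X)
    (e : blow g z) t u (m : int) : dvr (bring e) t -> inu (bring e) u -> bring e u ->
  ord_at (@gblow X K g z) e (u * t ^ m) m.
Proof.
move=> de iu Ou; have [_ _ [Ot nt] t0 ht] := de.
exists (mk_sub Ot), (mk_sub Ou); split=> //; last by apply/sub_unit_inu.
apply/seteqP; split=> a.
  move=> /sub_nonu/ht h; exists (mk_sub h); apply: val_inj; by rewrite sub_valM /= divfK.
move=> [b ->]; apply/sub_nonu; rewrite sub_valM.
have [[_ _ _ mM] _ _] := nonu_prime (dvr_local de).
by apply: mM; [exact: sub_valP|split].
Qed.

Theorem proposition5p18 (k : fieldType) (char0 : [pchar k] =i pred0)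
    (X : lrspace) (s : lrhom X (spec_field k))
    (schemeX : scheme X) (integralX : integral_scheme X)
    (normalX : normal_scheme X)
    (finite_typeX : finite_type s) (tangentX : tangent_locally_free s)
    (terminalX : terminal s) :
  regular_scheme X.
Proof.
have [K [g [eta [Fg eta_gen eta_surj]]]] := function_field_exists schemeX integralX.
have [c cE] : exists c : {rmorphism k -> K}, c =1 fun a => g eta (pull s eta a).
  apply: rmorph_of; split; first by move=> a b; rewrite -rmorphB -rmorphB.
  by split=> [|a b]; rewrite -?rmorphM -?rmorphM // rmorph1 rmorph1.
have gc x a : g x (pull s x a) = c a.
  rewrite cE; apply: (Fg.2 setT (fun x => pull s x a) x eta) => //; first exact: openT.
  exact: (@hom_reg _ _ s setT (fun=> a) openT).
have charK m : m.+1%:R != 0 :> K.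
  by rewrite -(rmorph_nat c) fmorph_eq0 ((pcharf0P k).1 char0).
have normalO x : normalS (ostk g x) by apply: normal_range => //; exact: g_inj.
move=> x; have [U [n [E [oU Ux hEO hF hind]]]] := frame_exists Fg eta_gen eta_surj gc finite_typeX tangentX x.
have hE i := (hEO i).1.
have EO i y u : U y -> ostk g y u -> ostk g y (E i u) by exact: (hEO i).2.
have U0 : U !=set0 by exists x.
have hspan := frame_span eta_gen eta_surj oU U0 hF.
apply: (simple_point_regular Fg eta_gen eta_surj gc finite_typeX charK oU U0 hE EO hF hind Ux) => P pP Pn PE u Pu.
apply: contrapT => /eqP u0.
have [|z [Uz mE z0]] := stable_point Fg gc finite_typeX oU Ux hE EO pP Pn PE; first by exists u.
case: (dvr_or_chain Fg gc finite_typeX normalO z0) => [[t dt]|chz].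
  exact: (dvr_not_stable Fg eta_gen eta_surj gc charK oU U0 hE EO hF hind Uz dt mE).
have [e [t [ez de Fe efe]]] := blow_divisor Fg gc finite_typeX charK z0.
have [p [p1 p2]] := blow_map Fg z.
(* The form df_1 ... df_n is the rational top form with respect to which both canonical divisors are
   computed. *)
have [|f [_ f0]] := @exists_det K n E (fun=> True); first by move=> a ha; apply: hind => v; exact: ha.
have top := frame_top_form Fg eta_gen eta_surj gc finite_typeX charK oU U0 hE hF f0.
have [QC disc] := terminalX K c g n (wedge f) Fg gc top.
pose cR : {rmorphism k -> sub_of (bring e)} := pull (hom_comp s p) e.
have cRE a : val (cR a) = c a.
  rewrite -(gc (bbase e)); exact: (p2 e (fun x => pull s x a)).
have kO v : range_subr c v -> bring e v by move=> [a _ <-]; rewrite -cRE; exact: sub_valP.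
have EOe i v : bring e v -> bring e (E i v).
  by apply: Fe; [exact: hE|move=> w; exact: EO|exact: mE].
have fre v : fracf (bring e) v by exact: bring_frac.
have [f' [d [bf df hd dsp]]] := dvr_basis de fre charK kO cRE (efe cR cRE) hE EOe hspan hind.
pose h := wedge f d.
have hD D : (forall i, is_self_derivation c (D i)) -> wedge f D = h * wedge (fun j => val (f' j)) D.
  by move=> kD; rewrite mulrC; apply: wedge_comp => i v; exact: dsp.
(* On the frame, the form is [h], its coefficient in the basis f' at [e], times the determinant [w],
   which lies in O_e since the frame preserves O_e. *)
have ef := hD E hE; set w := wedge (fun j => val (f' j)) E in ef.
have h0 : h != 0 by apply: contraNneq f0 => h0; apply/eqP; rewrite [LHS]ef h0 mul0r.
have Ow : bring e w by apply: det_mem => i j; rewrite mxE; apply: EOe; exact: sub_valP.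
have [u1 [m [iu1 Ou1 eh]]] := dvr_ordz de fre h0.
have [q [u2 [iu2 Ou2 ew]]] := dvr_ord de Ow df.
have := disc (blow g z) p (@gblow X K g z) (blow_scheme Fg gc finite_typeX (z := z))
  (blow_integral Fg eta_gen eta_surj z0) (blow_normal Fg (z := z))
  (blow_proper Fg gc finite_typeX charK p1 p2) (blow_birational Fg eta_gen eta_surj normalO z0 p1 p2)
  (blow_function_field Fg eta_gen eta_surj z0).
have gp (y : blow g z) a : gblow y (pull p y a) = g (p y) a.
  by have [r <-] := family_at a; apply: (etrans (p2 y r)); rewrite p1.
(* The canonical divisor upstairs has order m = ord h; the pullback of the one on [X] has order m +
   q, with q = ord w. Their difference is -q, so positivity is absurd. *)
move=> /(_ gp) disc'; have {disc'} : 0 < (m%:~R - (m + q%:Z)%:~R / 1%:R : rat).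
  apply: (disc' e).
    by split; [exact: dvr_codim1 de|rewrite p1 ez].
  exists 1%N, U, (wedge f E), m, (m + q%:Z); split=> //.
  - split=> //; first by rewrite p1 ez.
    exact: (frame_local_equation Fg gc hE EO hF f0 QC).
  - by exists f', h; split=> //; rewrite eh; exact: blow_ord_at.
  - rewrite ef eh ew.
    have -> : u1 * t ^ m * (u2 * t ^+ q) = (u1 * u2) * t ^ (m + q%:Z).
      by rewrite expfzDr; [rewrite -exprnP; ring|case: de].
    by apply: blow_ord_at => //; [exact: inuM|exact: srM].
rewrite divr1 intrD opprD addrA subrr add0r Num.Theory.oppr_gt0 => q0.
by have := Order.POrderTheory.le_lt_trans (Num.Theory.ler0n rat q) q0; rewrite Order.POrderTheory.ltxx.
Qed.
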